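(* Let $\varphi:\mathbb{R}\to\mathbb{R}$ be continuous and nondecreasing, let $\mu\ge0$ be an even Radon measure on $\mathbb{R}^N\setminus\{0\}$ with $\int_{|z|\le1}|z|^2\mu(\mathrm{d}z)+\int_{|z|>1}\mu(\mathrm{d}z)<\infty$, and let $u_0\in L^1(\mathbb{R}^N)\cap L^\infty(\mathbb{R}^N)$. Then the (unique) distributional solution $u\in L^1(Q_T)\cap L^\infty(Q_T)\cap C([0,T];L^1_{\mathrm{loc}}(\mathbb{R}^N))$ of $\partial_tu-\mathcal{L}^\mu[\varphi(u)]=0$ in $Q_T$, $u(\cdot,0)=u_0$ on $\mathbb{R}^N$, satisfies, for every $0<\tau\le T$, $$\int_{\mathbb{R}^N}|u(x,\tau)|^p\,\mathrm{d}x\le\int_{\mathbb{R}^N}|u_0(x)|^p\,\mathrm{d}x\qquad\text{for all }p\in[1,\infty),$$ and $\|u(\cdot,\tau)\|_{L^\infty(\mathbb{R}^N)}\le\|u_0\|_{L^\infty(\mathbb{R}^N)}$.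
   Context: $T>0$, $Q_T:=\mathbb{R}^N\times(0,T)$; $\mu$ even means $\mu(B)=\mu(-B)$ for all Borel $B$. The operator is $$\mathcal{L}^\mu[\phi](x)=\int_{\mathbb{R}^N\setminus\{0\}}\big(\phi(x+z)-\phi(x)-z\cdot D\phi(x)\mathbf{1}_{|z|\le1}\big)\mu(\mathrm{d}z).$$ Distributional solution: $u\in L^1_{\mathrm{loc}}(Q_T)$ such that, for all $\psi\in C_c^\infty(\mathbb{R}^N\times[0,T))$, $\iint_{Q_T}\big(u\,\partial_t\psi+\varphi(u)\mathcal{L}^\mu[\psi]\big)\mathrm{d}x\mathrm{d}t+\int_{\mathbb{R}^N}u_0(x)\psi(x,0)\,\mathrm{d}x=0$. Existence and uniqueness of a distributional solution in the class $L^1(Q_T)\cap L^\infty(Q_T)\cap C([0,T];L^1_{\mathrm{loc}}(\mathbb{R}^N))$ is known. *)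

(* Defs.v *)
From HB Require Import structures.
From mathcomp Require Import all_boot all_order all_algebra.
From mathcomp Require Import all_classical all_reals all_analysis.
From mathcomp Require Import measurable_realfun.
Set Implicit Arguments.
Unset Strict Implicit.
Unset Printing Implicit Defensive.
Import Order.TTheory GRing.Theory Num.Theory.
Import numFieldNormedType.Exports.
Local Open Scope classical_set_scope.
Local Open Scope ring_scope.

HB.instance Definition _ (R : realType) (n : nat) :=
  @isMeasurable.Build (sigma_display (@open 'rV[R]_n)) 'rV[R]_n <<s open >>
    (@sigma_algebra0 _ setT open) (@sigma_algebraC _ open)
    (@sigma_algebra_bigcup _ setT open).

Section lebesgue_rV.
Context {R : realType}.

Lemma measurable_rV d (T : measurableType d) (n : nat) (f : T -> 'rV[R]_n) :
  (forall i, measurable_fun setT (fun t => f t ord0 i)) ->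
  measurable_fun setT f.
Proof.
move=> mf; apply: (measurability (@open 'rV[R]_n)) => // _ [U oU <-].
rewrite setTI.
pose c (q : 'rV[rat]_n) : 'rV[R]_n := map_mx ratr q.
pose B (p : 'rV[rat]_n * rat) : set 'rV[R]_n :=
  if `[< ball (c p.1) (ratr p.2) `<=` U >]
  then ball (c p.1) (ratr p.2) else set0.
have -> : U = \bigcup_p B p.
  apply/seteqP; split=> [x Ux|x [p _]]; last first.
    by rewrite /B; case: asboolP => // BU /BU.
  have /nbhs_ballP[e /= e0 eU] : nbhs x U by exact: open_nbhs_nbhs.
  have [r] := rat_in_itvoo (divr_gt0 e0 (ltr0n R 2)).
  rewrite in_itv/= => /andP[r0 re].
  have q_ i : {q : rat | `|x ord0 i - ratr q| < ratr r :> R}.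
    apply: cid; have [q] : exists q, ratr q \in `](x ord0 i - ratr r), (x ord0 i + ratr r)[.
      by apply: rat_in_itvoo; rewrite ltrD2l gtrN.
    by rewrite in_itv/= => /andP[q1 q2]; exists q; rewrite ltr_distlC q1 q2.
  have xq : ball (c (\row_i sval (q_ i))) (ratr r) x.
    by split=> // i j; rewrite !mxE /ball/= distrC (ord1 i); exact: svalP (q_ j).
  exists (\row_i sval (q_ i), r) => //; rewrite /B /=; case: asboolP => // -[].
  move=> y qy; apply: eU; rewrite [e]splitr.
  apply: (@ball_triangle _ _ (c (\row_i sval (q_ i)))).
    by apply: ball_sym; exact: (le_ball (ltW re)).
  exact: (le_ball (ltW re)).
rewrite preimage_bigcup; apply: countable_bigcupT_measurable => // p.
rewrite /B; case: asboolP => _; last by rewrite preimage_set0.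
have [r0|r0] := ltP 0 (ratr p.2 : R); last first.
  rewrite (_ : _ @^-1` _ = set0)//; apply/seteqP; split=> // t [].
  by rewrite ltNge r0.
rewrite (_ : _ @^-1` _ = \bigcap_(i in [set: 'I_n])
    ((fun t => f t ord0 i) @^-1` ball (ratr (p.1 ord0 i) : R) (ratr p.2))).
  apply: fin_bigcap_measurable => // i _.
  rewrite -[X in measurable X]setTI; apply: mf => //.
  exact: measurable_ball.
apply/seteqP; split=> t /=.
  by move=> [_ h] i _; have := h ord0 i; rewrite mxE.
by move=> h; split=> // i j; rewrite ord1 mxE; exact: h.
Qed.

Definition rV_cons (n : nat) (p : R * 'rV[R]_n) : 'rV[R]_n.+1 :=
  row_mx p.1%:M p.2.

Lemma continuous_measurable_rV (n : nat) (f : 'rV[R]_n -> R) :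
  continuous f -> measurable_fun setT f.
Proof.
move=> cf; apply: (measurability _ (RGenOpens.measurableE R)).
move=> _ [_ [a [b ->]] <-]; rewrite setTI; apply: sub_sigma_algebra.
by apply: open_comp; [move=> x _; exact: cf|exact: interval_open].
Qed.

Lemma measurable_rV_cons (n : nat) : measurable_fun setT (@rV_cons n).
Proof.
apply: measurable_rV => i; rewrite /rV_cons /=.
case: (@splitP 1 n i) => j ij.
  rewrite (_ : (fun t => _) = fst); first exact: measurable_fst.
  apply/funext => -[x v] /=.
  rewrite (_ : i = lshift n j); last exact: val_inj.
  by apply: (etrans (row_mxEl _ _ _ _)); rewrite (ord1 j) mxE.
rewrite (_ : (fun t => _) = (fun v : 'rV[R]_n => v ord0 j) \o snd); last first.
  apply/funext => -[x v] /=.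
  rewrite (_ : i = rshift 1 j); last exact: val_inj.
  exact: row_mxEr.
apply: measurableT_comp => //.
apply: continuous_measurable_rV => x; exact: coord_continuous.
Qed.

Section step.
Variables (n : nat) (m : {sigma_finite_measure set 'rV[R]_n -> \bar R}).

Let mp : {measure set (measurableTypeR R * 'rV[R]_n)%type -> \bar R} :=
  (@lebesgue_measure R \x m)%E.

Definition lebesgue_rV_step : set 'rV[R]_n.+1 -> \bar R :=
  pushforward (@lebesgue_measure R \x m)%E (@rV_cons n).

Let mpush : {measure set 'rV[R]_n.+1 -> \bar R} :=
  measure_function_pushforward__canonical__measure_function_Measure
    mp (@measurable_rV_cons n).

HB.instance Definition _ := Measure.copy lebesgue_rV_step mpush.

Let step_sigma_finite : sigma_finite setT lebesgue_rV_step.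
Proof.
have [F [FT ndF Foo]] := (sigma_finiteP _ _).1 (sigma_finiteT (@lebesgue_measure R)).
have [G [GT ndG Goo]] := (sigma_finiteP _ _).1 (sigma_finiteT m).
pose uncons (v : 'rV[R]_n.+1) : R * 'rV[R]_n :=
  (v ord0 ord0, \row_j v ord0 (lift ord0 j)).
have consK : cancel (@rV_cons n) uncons.
  move=> [x v]; rewrite /uncons /rV_cons /=; congr pair.
    have <- : lshift n (ord0 : 'I_1) = (ord0 : 'I_n.+1) by exact: val_inj.
    by apply: (etrans (row_mxEl _ _ _ _)); rewrite mxE.
  apply/rowP => j; rewrite mxE.
  have <- : rshift 1 j = lift (ord0 : 'I_n.+1) j by exact: val_inj.
  exact: row_mxEr.
exists (fun k => uncons @^-1` (F k `*` G k)).
  apply/seteqP; split=> // v _.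
  have [i _ Fi] : (\bigcup_i F i) (uncons v).1 by rewrite -FT.
  have [j _ Gj] : (\bigcup_i G i) (uncons v).2 by rewrite -GT.
  exists (maxn i j) => //; split.
    by move: Fi; exact/subsetPset/ndF/leq_maxl.
  by move: Gj; exact/subsetPset/ndG/leq_maxr.
move=> k; have [mF Fk] := Foo k; have [mG Gk] := Goo k; split; last first.
  rewrite /lebesgue_rV_step /pushforward -comp_preimage.
  rewrite (_ : uncons \o _ = id); last by apply/funext => p; exact: consK.
  by rewrite /mp /= product_measure1E// lte_mul_pinfty// ge0_fin_numE.
rewrite -[X in measurable X]setTI.
suff : measurable_fun setT uncons by apply => //; exact: measurableX.
apply/measurable_fun_pairP; split.
  by apply: continuous_measurable_rV => x; exact: coord_continuous.
apply: measurable_rV => i.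
rewrite (_ : (fun v => _) = fun v : 'rV[R]_n.+1 => v ord0 (lift ord0 i)).
  by apply: continuous_measurable_rV => x; exact: coord_continuous.
by apply/funext => v; rewrite mxE.
Qed.

HB.instance Definition _ :=
  Measure_isSigmaFinite.Build _ _ _ lebesgue_rV_step step_sigma_finite.

End step.

End lebesgue_rV.

Fixpoint lebesgue_rV (R : realType) (n : nat) :
    {sigma_finite_measure set 'rV[R]_n -> \bar R} :=
  if n is n'.+1 then lebesgue_rV_step (lebesgue_rV R n')
  else dirac (0 : 'rV[R]_0).

Lemma lebesgue_rV_box (R : realType) (n : nat) (a b : 'I_n -> R) :
  (forall i, a i <= b i) ->
  lebesgue_rV R n [set v | forall i, v ord0 i \in `]a i, b i]] =
  (\prod_(i < n) (b i - a i))%:E.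
Proof.
elim: n a b => [|n IHn] a b ab.
  rewrite big_ord0 /= diracE (_ : _ \in _ = true)//.
  by apply/mem_set => -[].
rewrite big_ord_recl EFinM -IHn//= /lebesgue_rV_step /pushforward.
pose B := [set v : 'rV[R]_n |
  forall i, v ord0 i \in `]a (lift ord0 i), b (lift ord0 i)]].
have mB : measurable B.
  rewrite (_ : B = \bigcap_(i in [set: 'I_n]) ((fun v : 'rV[R]_n => v ord0 i)
      @^-1` `]a (lift ord0 i), b (lift ord0 i)])).
    apply: fin_bigcap_measurable => // i _; rewrite -[X in measurable X]setTI.
    apply: (continuous_measurable_rV (f := fun v : 'rV[R]_n => v ord0 i)) => //.
    by move=> x; exact: coord_continuous.
  by apply/seteqP; split=> [v Bv i _|v Bv i]; exact: Bv.
have hd (x : R) (v : 'rV[R]_n) : rV_cons (x, v) ord0 ord0 = x.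
  have <- : lshift n (ord0 : 'I_1) = (ord0 : 'I_n.+1) by exact: val_inj.
  by apply: (etrans (row_mxEl _ _ _ _)); rewrite mxE.
have tl (x : R) (v : 'rV[R]_n) j : rV_cons (x, v) ord0 (lift ord0 j) = v ord0 j.
  have <- : rshift 1 j = lift (ord0 : 'I_n.+1) j by exact: val_inj.
  exact: row_mxEr.
have -> : @rV_cons R n @^-1` [set v | forall i, v ord0 i \in `]a i, b i]] =
    `]a ord0, b ord0] `*` B.
  apply/seteqP; split=> [[x v] /= h|[x v] [/= h1 h2] i].
    by split=> [|j]; [rewrite /= -(hd x v); exact: h|rewrite -(tl x v); exact: h].
  have [j ->|->] := unliftP ord0 i; first by rewrite tl; exact: h2.
  by rewrite hd.
rewrite [LHS]product_measure1E//; congr (_ * _)%E.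
apply: (etrans (lebesgue_measure_itv _)); rewrite /= lte_fin lt_neqAle ab andbT.
by case: eqVneq => //= ->; rewrite subrr.
Qed.

Section definitions.
Context {R : realType} {N : nat}.
Implicit Types (phi : R -> R) (T : R) (f : 'rV[R]_N -> R).

Definition lebesgue_xt : {measure set ('rV[R]_N * measurableTypeR R) -> \bar R} :=
  (lebesgue_rV R N \x @lebesgue_measure R)%E.

Definition QT T : set ('rV[R]_N * R) := [set y | 0 < y.2 < T].

(* the norm that the library puts on 'rV is the sup norm *)
Definition enorm (z : 'rV[R]_N) : R := Num.sqrt (\sum_i z ord0 i ^+ 2).

Definition grad f (x : 'rV[R]_N) : 'rV[R]_N :=
  \row_i 'D_(delta_mx ord0 i) f x.

(* A measure on R^N \ {0} is represented by a measure on R^N of which only the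
   values on subsets of R^N \ {0} are used. *)
Definition radon_punctured (mu : {measure set 'rV[R]_N -> \bar R}) : Prop :=
  (forall K : set 'rV[R]_N, compact K -> K `<=` ~` [set 0] -> (mu K < +oo)%E) /\
  (forall B : set 'rV[R]_N, measurable B -> B `<=` ~` [set 0] ->
    mu B = ereal_sup
      [set mu K | K in [set K : set 'rV[R]_N | compact K /\ K `<=` B]]).

Definition even_punctured (mu : {measure set 'rV[R]_N -> \bar R}) : Prop :=
  forall B : set 'rV[R]_N, measurable B -> B `<=` ~` [set 0] -> mu (-%R @` B) = mu B.

Definition levy_integrable (mu : {measure set 'rV[R]_N -> \bar R}) : Prop :=
  ((\int[mu]_(z in [set z : 'rV[R]_N | (0 < enorm z <= 1)%R])
      (enorm z ^+ 2)%:E) +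
   (\int[mu]_(z in [set z : 'rV[R]_N | (1 < enorm z)%R]) 1) < +oo)%E.

Definition levy_op (mu : {measure set 'rV[R]_N -> \bar R}) f (x : 'rV[R]_N) : R :=
  \int[mu]_(z in ~` [set 0])
    (f (x + z) - f x
     - (\sum_i z ord0 i * grad f x ord0 i) * (enorm z <= 1)%R%:R).

(* C^oo: all iterated directional derivatives exist and are differentiable,
   hence continuous *)
Definition smooth (V W : normedModType R) (f : V -> W) : Prop :=
  forall (vs : seq V) (x : V), differentiable (foldr (fun v g => 'D_v g) f vs) x.

(* C_c^oo(R^N x [0,T)): its elements are the restrictions to t >= 0 of the
   smooth functions on R^N x R whose support is compact and lies in t < T; they
   need not vanish at t = 0. *)
Definition test_function T (psi : 'rV[R]_N * R -> R) : Prop :=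
  [/\ smooth psi, compact (closure [set y | psi y != 0]) &
      closure [set y | psi y != 0] `<=` [set y | y.2 < T]].

Definition L1loc_xt (D : set ('rV[R]_N * R)) (v : 'rV[R]_N * R -> R) : Prop :=
  measurable_fun D v /\
  forall K : set ('rV[R]_N * R), compact K -> K `<=` D -> (\int[lebesgue_xt]_(y in K) `|v y|%:E < +oo)%E.

Definition L1loc f : Prop :=
  measurable_fun setT f /\
  forall K : set 'rV[R]_N, compact K ->
    (\int[lebesgue_rV R N]_(x in K) `|f x|%:E < +oo)%E.

Definition continuous_L1loc T (u : 'rV[R]_N -> R -> R) : Prop :=
  (forall t, 0 <= t <= T -> L1loc (u ^~ t)) /\
  forall (K : set 'rV[R]_N) s, compact K -> 0 <= s <= T ->
    (\int[lebesgue_rV R N]_(x in K) `|u x t - u x s|%:E)%E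
      @[t --> within `[0, T] (nbhs s)] --> 0%E.

Definition distributional_solution phi (mu : {measure set 'rV[R]_N -> \bar R})
    T (u0 : 'rV[R]_N -> R) (u : 'rV[R]_N -> R -> R) : Prop :=
  L1loc_xt (QT T) (fun y => u y.1 y.2) /\
  forall psi, test_function T psi ->
    (\int[lebesgue_xt]_(y in QT T)
      (u y.1 y.2 * derive1 (fun t => psi (y.1, t)) y.2
       + phi (u y.1 y.2) * levy_op mu (fun x => psi (x, y.2)) y.1))
    + (\int[lebesgue_rV R N]_x (u0 x * psi (x, 0))) = 0.

End definitions.
Arguments lebesgue_xt R N : clear implicits.

(* Main.v *)
Require Import Defs.
From HB Require Import structures.
From mathcomp Require Import all_boot all_order all_algebra.
From mathcomp Require Import all_classical all_reals all_analysis.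
From mathcomp Require Import measurable_realfun ess_sup_inf hoelder ring lra.
Set Implicit Arguments.
Unset Strict Implicit.
Unset Printing Implicit Defensive.
Import Order.TTheory GRing.Theory Num.Theory.
Import numFieldNormedType.Exports.
Local Open Scope classical_set_scope.
Local Open Scope ring_scope.

(** Duality proof. For c > 0 we show that int (u(tau) - c)^+ <= int (u_0 - c)^+;
    applied also to -u, which solves the equation with - phi (- s), this bounds every
    int (|u(tau)| - c)^+, and L^p (by superposition of hinges) and L^oo follow.

    On a finite part E of {u(tau) > c} a mollified indicator of E is transported
    backwards in time by an explicit scheme for the dual equation
    d_t z + a lam (J z - z) = 0, where J is a symmetric Markov operator, a finite
    combination of translations approximating lam (lam - L)^-1, and a is a bounded
    regularisation of (phi u - phi c) / (u - c). The scheme keeps 0 <= z <= 1, and its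
    energy int lam (z - J z) z decreases by the time integral of
    int a (lam (z - J z))^2. Young's inequality therefore absorbs the three errors
    (regularisation of a, replacement of u by J u, mollification) into that
    dissipation, and the energy of the initial mollified indicator does not depend on
    lam. *)

(** Three obstacles shape the argument. [phi] is only continuous, so its chord slopes at c can be
    unbounded; [phi (u)] need not be integrable; [mu] may be infinite, so L is an unbounded
    operator. The first is met by a denominator bounded below by delta * c, whence c > 0; the second
    by cutting off the part of [phi (u) - phi 0] of size at most dp, after which the rest is
    controlled by |u|; the third by J, whose boundedness makes an explicit Euler scheme stable. J
    also acts on the mollified solution: J L rho is L1-close to lam (J rho - rho), so d_t J (rho *
    u) becomes lam (J - 1) (rho * phi (u)) up to a small error, and symmetry turns its pairing with
    z into one with the flux lam (z - J z), the quantity that the dissipation controls. The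
    parameters are nested: the mollifier of the indicator fixes the energy, the energy fixes its
    weight beta, beta fixes delta, these fix lam, and lam fixes dp and the accuracy of the mollifier
    of the equation; the resolvent error, J and the time step come last, because the CFL condition
    limits the time step by lam and delta. *)

(** * Invariance of Lebesgue measure under translation and reflection *)

Section lebesgue_line.
Context {R : realType}.
Let leb := @lebesgue_measure R.

Lemma measurable_shift_line (a : R) :
  measurable_fun [set: measurableTypeR R] (fun x : measurableTypeR R => (x + a : measurableTypeR R)).
Proof. exact: measurable_funD. Qed.

(** The image measure gives half-open intervals their length, and this determines Lebesgue
    measure. *)
Lemma lebesgue_measure_shift (a : R) (A : set (measurableTypeR R)) :
  measurable A -> leb ((fun x : R => x + a) @^-1` A) = leb A.
Proof.
move=> mA.
pose nu : {measure set (measurableTypeR R) -> \bar R} :=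
  measure_function_pushforward__canonical__measure_function_Measure
    leb (measurable_shift_line a).
rewrite -[LHS]/(nu A); apply/esym.
apply: (@lebesgue_measure_unique R nu) => // _ [[x y] _ <-] /=.
rewrite /pushforward.
rewrite (_ : _ @^-1` _ = `]x - a, y - a]%classic).
  rewrite !lebesgue_measure_itv /= !lte_fin ltrD2r.
  by case: ifPn => // _; rewrite -!EFinB; congr (_%:E); ring.
by apply/seteqP; split => z /=; rewrite !in_itv /= ltrBlDr lerBrDr.
Qed.

Lemma measurable_opp_line :
  measurable_fun [set: measurableTypeR R] (fun x : measurableTypeR R => (- x : measurableTypeR R)).
Proof. exact: oppr_measurable. Qed.

Lemma lebesgue_measure_opp (A : set (measurableTypeR R)) :
  measurable A -> leb ((fun x : R => - x) @^-1` A) = leb A.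
Proof.
move=> mA.
pose nu : {measure set (measurableTypeR R) -> \bar R} :=
  measure_function_pushforward__canonical__measure_function_Measure
    leb measurable_opp_line.
rewrite -[LHS]/(nu A); apply/esym.
apply: (@lebesgue_measure_unique R nu) => // _ [[x y] _ <-] /=.
rewrite /pushforward.
(* Reflection exchanges the open and the closed end; only the length matters. *)
rewrite (_ : _ @^-1` _ = `[- y, - x[%classic).
  rewrite !lebesgue_measure_itv /= !lte_fin ltrN2.
  by case: ifPn => // _; rewrite -!EFinB; congr (_%:E); ring.
by apply/seteqP; split => z /=; rewrite !in_itv /= andbC lerNl ltrNr.
Qed.

Local Open Scope ereal_scope.

Lemma ge0_integral_shift_line (a : R) (f : measurableTypeR R -> \bar R) :
  measurable_fun setT f -> (forall x, 0 <= f x) ->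
  \int[leb]_x f (x + a)%R = \int[leb]_x f x.
Proof.
move=> mf f0.
have := @ge0_integral_pushforward _ _ _ _ R _ (measurable_shift_line a) leb setT f
  measurableT mf (fun y _ => f0 y).
rewrite preimage_setT => <-.
by apply: eq_measure_integral => [|pf A mA _]; [exact: measurable_shift_line|exact: lebesgue_measure_shift].
Qed.

Lemma ge0_integral_opp_line (f : measurableTypeR R -> \bar R) :
  measurable_fun setT f -> (forall x, 0 <= f x) ->
  \int[leb]_x f (- x)%R = \int[leb]_x f x.
Proof.
move=> mf f0.
have := @ge0_integral_pushforward _ _ _ _ R _ measurable_opp_line leb setT f
  measurableT mf (fun y _ => f0 y).
rewrite preimage_setT => <-.
by apply: eq_measure_integral => [|pf A mA _]; [exact: measurable_opp_line|exact: lebesgue_measure_opp].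
Qed.
End lebesgue_line.

Section lebesgue_space.
Context {R : realType}.
Local Open Scope ereal_scope.

Lemma coord_measurable n (i : 'I_n) :
  measurable_fun setT (fun v : 'rV[R]_n => v ord0 i).
Proof. by apply: continuous_measurable_rV => x; exact: coord_continuous. Qed.

Lemma measurable_shift_rV n (z : 'rV[R]_n) :
  measurable_fun setT (fun x : 'rV[R]_n => (x + z)%R).
Proof.
apply: measurable_rV => i.
rewrite (_ : (fun _ => _) = (fun x : 'rV[R]_n => x ord0 i + z ord0 i)%R).
  by apply: measurable_funD => //; exact: coord_measurable.
by apply/funext => x; rewrite mxE.
Qed.

Lemma measurable_opp_rV n :
  measurable_fun setT (fun x : 'rV[R]_n => (- x)%R).
Proof.
apply: measurable_rV => i.
rewrite (_ : (fun _ => _) = (fun x : 'rV[R]_n => - x ord0 i)%R).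
  by apply: measurableT_comp => //; exact: coord_measurable.
by apply/funext => x; rewrite mxE.
Qed.

Lemma measurable_rV_cons_line n :
  measurable_fun [set: (measurableTypeR R * 'rV[R]_n)%type]
    (@rV_cons R n : (measurableTypeR R * 'rV[R]_n)%type -> 'rV[R]_n.+1).
Proof. exact: measurable_rV_cons. Qed.

(** The measure in dimension n + 1 is by construction the image under [rV_cons] of a product, so
    this is a change of variables followed by Tonelli. It drives the inductions on the dimension
    below. *)
Lemma ge0_integral_rV_step n (f : 'rV[R]_n.+1 -> \bar R) :
  measurable_fun setT f -> (forall x, 0 <= f x) ->
  \int[lebesgue_rV R n.+1]_x f x =
  \int[@lebesgue_measure R]_x \int[lebesgue_rV R n]_v f (rV_cons (x, v)).
Proof.
move=> mf f0.
pose mp : {measure set (measurableTypeR R * 'rV[R]_n)%type -> \bar R} :=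
  (@lebesgue_measure R \x lebesgue_rV R n)%E.
have := @ge0_integral_pushforward _ _ _ _ R _ (@measurable_rV_cons_line n)
  mp setT f measurableT mf (fun y _ => f0 y).
rewrite preimage_setT => pushE.
transitivity (\int[mp]_x (f \o @rV_cons R n) x).
  rewrite -pushE; apply: eq_measure_integral => [|pf A mA _] //.
  exact: measurable_rV_cons_line.
rewrite /mp fubini_tonelli1 //.
- by apply: measurableT_comp => //; exact: measurable_rV_cons_line.
- by move=> x /=.
Qed.

Lemma measurable_rV_cons1 n (f : 'rV[R]_n.+1 -> \bar R) x :
  measurable_fun setT f -> measurable_fun setT (fun v => f (rV_cons (x, v))).
Proof.
move=> mf; apply: measurableT_comp => //.
apply: (measurableT_comp (@measurable_rV_cons_line n)).
exact: measurable_pair1.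
Qed.

Lemma measurable_rV_int n (f : 'rV[R]_n.+1 -> \bar R) :
  measurable_fun setT f -> (forall x, 0 <= f x) ->
  measurable_fun [set: measurableTypeR R]
    (fun x => \int[lebesgue_rV R n]_v f (rV_cons (x, v))).
Proof.
move=> mf f0.
have := @measurable_fun_fubini_tonelli_F _ _ (measurableTypeR R) _ R
  (lebesgue_rV R n) (f \o @rV_cons R n).
apply; last by move=> x; exact: f0.
exact: (measurableT_comp mf (@measurable_rV_cons_line n)).
Qed.

Lemma rV_cons0 n (x : R) (v : 'rV[R]_n) : rV_cons (x, v) ord0 ord0 = x.
Proof.
have <- : lshift n (ord0 : 'I_1) = (ord0 : 'I_n.+1) by exact: val_inj.
by apply: (etrans (row_mxEl _ _ _ _)); rewrite mxE.
Qed.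

Lemma rV_consS n (x : R) (v : 'rV[R]_n) j :
  rV_cons (x, v) ord0 (lift ord0 j) = v ord0 j.
Proof.
have <- : rshift 1 j = lift (ord0 : 'I_n.+1) j by exact: val_inj.
exact: row_mxEr.
Qed.

Lemma rV_cons_add n (x a : R) (v z : 'rV[R]_n) :
  rV_cons (x + a, v + z)%R = (rV_cons (x, v) + rV_cons (a, z))%R.
Proof.
apply/rowP => i; rewrite [RHS]mxE.
have [j ->|->] := unliftP ord0 i; last by rewrite !rV_cons0.
by rewrite !rV_consS mxE.
Qed.

Lemma rV_cons_opp n (x : R) (v : 'rV[R]_n) :
  rV_cons (- x, - v)%R = (- rV_cons (x, v))%R.
Proof.
apply/rowP => i; rewrite [RHS]mxE.
have [j ->|->] := unliftP ord0 i; last by rewrite !rV_cons0.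
by rewrite !rV_consS mxE.
Qed.

Lemma rV_cons_split n (z : 'rV[R]_n.+1) :
  z = rV_cons (z ord0 ord0, (\row_j z ord0 (lift ord0 j))%R).
Proof.
apply/rowP => i.
have [j ->|->] := unliftP ord0 i; last by rewrite rV_cons0.
by rewrite rV_consS mxE.
Qed.

(** Induction on the dimension: Tonelli splits off the head coordinate, the tail is translated
    inside the integral by the induction hypothesis and the head by invariance on the line. *)
Lemma ge0_integral_shift n (z : 'rV[R]_n) (f : 'rV[R]_n -> \bar R) :
  measurable_fun setT f -> (forall x, 0 <= f x) ->
  \int[lebesgue_rV R n]_x f (x + z)%R = \int[lebesgue_rV R n]_x f x.
Proof.
elim: n z f => [|n IHn] z f mf f0.
  by apply: eq_integral => x _; congr f; apply/rowP => -[].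
have mfz : measurable_fun setT (fun x : 'rV[R]_n.+1 => f (x + z)%R).
  by apply: measurableT_comp => //; exact: measurable_shift_rV.
rewrite (ge0_integral_rV_step mfz)// (ge0_integral_rV_step mf)//.
set a := z ord0 ord0; set w := (\row_j z ord0 (lift ord0 j))%R.
pose F (x : measurableTypeR R) := \int[lebesgue_rV R n]_v f (rV_cons (x, v)).
transitivity (\int[@lebesgue_measure R]_x F (x + a)%R); last first.
  apply: ge0_integral_shift_line; first exact: measurable_rV_int.
  by move=> x; exact: integral_ge0.
apply: eq_integral => x _; rewrite /F.
rewrite -(IHn w (fun v => f (rV_cons (x + a, v)%R)))//; last exact: measurable_rV_cons1.
by apply: eq_integral => v _; rewrite {1}(rV_cons_split z) -rV_cons_add.
Qed.

Lemma ge0_integral_opp n (f : 'rV[R]_n -> \bar R) :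
  measurable_fun setT f -> (forall x, 0 <= f x) ->
  \int[lebesgue_rV R n]_x f (- x)%R = \int[lebesgue_rV R n]_x f x.
Proof.
elim: n f => [|n IHn] f mf f0.
  by apply: eq_integral => x _; congr f; apply/rowP => -[].
have mfz : measurable_fun setT (fun x : 'rV[R]_n.+1 => f (- x)%R).
  by apply: measurableT_comp => //; exact: measurable_opp_rV.
rewrite (ge0_integral_rV_step mfz)// (ge0_integral_rV_step mf)//.
pose F (x : measurableTypeR R) := \int[lebesgue_rV R n]_v f (rV_cons (x, v)).
transitivity (\int[@lebesgue_measure R]_x F (- x)%R); last first.
  apply: ge0_integral_opp_line; first exact: measurable_rV_int.
  by move=> x; exact: integral_ge0.
apply: eq_integral => x _; rewrite /F.
rewrite -(IHn (fun v => f (rV_cons (- x, v)%R)))//; last exact: measurable_rV_cons1.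
by apply: eq_integral => v _; rewrite -rV_cons_opp.
Qed.

End lebesgue_space.

(** * Bounded measurable and bounded integrable functions *)

Section bounded_integrable.
Context d (X : measurableType d) (R : realType) (m : {measure set X -> \bar R}).
Implicit Types f g : X -> R.

(** The bound holds at every point, not almost everywhere: products, translations and Markov
    operators all act pointwise and so preserve the class. *)
Definition bmf f := measurable_fun setT f /\ exists C, forall x, `|f x| <= C.
Definition L1b f := bmf f /\ m.-integrable setT (EFin \o f).

Lemma bmf_meas f : bmf f -> measurable_fun setT f. Proof. by case. Qed.

Lemma bmf_cst c : bmf (fun=> c).
Proof. by split; [exact: measurable_cst|exists `|c|]. Qed.

Lemma bmfD f g : bmf f -> bmf g -> bmf (fun x => f x + g x).
Proof.
move=> [mf [C fC]] [mg [D gD]]; split; first exact: measurable_funD.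
by exists (C + D) => x; rewrite (le_trans (ler_normD _ _))// lerD.
Qed.

Lemma bmfN f : bmf f -> bmf (fun x => - f x).
Proof.
move=> [mf [C fC]]; split; first exact: measurableT_comp.
by exists C => x; rewrite normrN.
Qed.

Lemma bmfB f g : bmf f -> bmf g -> bmf (fun x => f x - g x).
Proof. by move=> bf bg; apply: bmfD => //; exact: bmfN. Qed.

Lemma bmfM f g : bmf f -> bmf g -> bmf (fun x => f x * g x).
Proof.
move=> [mf [C fC]] [mg [D gD]]; split; first exact: measurable_funM.
by exists (C * D) => x; rewrite normrM ler_pM.
Qed.

Lemma bmfZ c f : bmf f -> bmf (fun x => c * f x).
Proof. by move=> bf; apply: bmfM => //; exact: bmf_cst. Qed.

Lemma bmf_norm f : bmf f -> bmf (fun x => `|f x|).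
Proof.
move=> [mf [C fC]]; split; first exact: measurableT_comp.
by exists C => x; rewrite normr_id.
Qed.

Lemma L1b_bmf f : L1b f -> bmf f. Proof. by case. Qed.
Lemma L1b_int f : L1b f -> m.-integrable setT (EFin \o f). Proof. by case. Qed.

Lemma L1bD f g : L1b f -> L1b g -> L1b (fun x => f x + g x).
Proof.
move=> [bf jf] [bg jg]; split; first exact: bmfD.
by rewrite (_ : _ \o _ = (EFin \o f) \+ (EFin \o g))%E //; exact: integrableD.
Qed.

Lemma L1b_le f g : bmf f -> L1b g -> (forall x, `|f x| <= `|g x|) -> L1b f.
Proof.
move=> bf [bg jg] fg; split=> //.
apply: le_integrable jg => //; first by case: bf => mf _; exact/measurable_EFinP.
by move=> x _ /=; rewrite lee_fin.
Qed.

Lemma L1bZ c f : L1b f -> L1b (fun x => c * f x).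
Proof.
move=> [bf jf]; split; first exact: bmfZ.
rewrite (_ : _ \o _ = fun x => (c%:E * (EFin \o f) x)%E) //.
exact: integrableZl.
Qed.

Lemma L1bM f g : bmf f -> L1b g -> L1b (fun x => f x * g x).
Proof.
move=> [mf [C fC]] Lg.
apply: (@L1b_le _ (fun x => C * g x)).
- by apply: bmfM; [split=> //; exists C|exact: L1b_bmf].
- exact: L1bZ.
- move=> x; rewrite !normrM ler_wpM2r//.
  by rewrite (le_trans (fC x))// ler_norm.
Qed.

Lemma L1bMr f g : L1b f -> bmf g -> L1b (fun x => f x * g x).
Proof.
move=> Lf bg; rewrite (_ : (fun _ => _) = fun x => g x * f x); first exact: L1bM.
by apply/funext => x; rewrite mulrC.
Qed.

Lemma L1bN f : L1b f -> L1b (fun x => - f x).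
Proof.
move=> Lf; rewrite (_ : (fun _ => _) = fun x => -1 * f x); first exact: L1bZ.
by apply/funext => x; rewrite mulN1r.
Qed.

Lemma L1bB f g : L1b f -> L1b g -> L1b (fun x => f x - g x).
Proof. by move=> Lf Lg; apply: L1bD => //; exact: L1bN. Qed.

Lemma L1b_norm f : L1b f -> L1b (fun x => `|f x|).
Proof.
move=> Lf; apply: (L1b_le _ Lf); first by apply: bmf_norm; exact: L1b_bmf.
by move=> x; rewrite normr_id.
Qed.

Lemma RintD f g : L1b f -> L1b g ->
  \int[m]_x (f x + g x) = \int[m]_x f x + \int[m]_x g x.
Proof. by move=> [_ jf] [_ jg]; exact: RintegralD. Qed.

Lemma RintZ c f : L1b f -> \int[m]_x (c * f x) = c * \int[m]_x f x.
Proof. by move=> [_ jf]; exact: RintegralZl. Qed.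

Lemma RintB f g : L1b f -> L1b g ->
  \int[m]_x (f x - g x) = \int[m]_x f x - \int[m]_x g x.
Proof. by move=> [_ jf] [_ jg]; exact: RintegralB. Qed.

Lemma le_Rint f g : L1b f -> L1b g -> (forall x, f x <= g x) ->
  \int[m]_x f x <= \int[m]_x g x.
Proof. by move=> [_ jf] [_ jg] fg; apply: le_Rintegral. Qed.

Lemma Rint_ge0 f : (forall x, 0 <= f x) -> 0 <= \int[m]_x f x.
Proof. by move=> f0; exact: Rintegral_ge0. Qed.

Lemma eq_Rint f g : f =1 g -> \int[m]_x f x = \int[m]_x g x.
Proof. by move=> /funext ->. Qed.

Lemma Rint_norm f : L1b f -> `|\int[m]_x f x| <= \int[m]_x `|f x|.
Proof. by move=> [_ jf]; exact: le_normr_Rintegral. Qed.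

End bounded_integrable.

(** * Symmetric Markov operators and the explicit dual scheme *)

Section markov.
Context d (X : measurableType d) (R : realType) (m : {measure set X -> \bar R}).
Implicit Types f g : X -> R.
Local Notation I f := (\int[m]_x f x).

(** The operator acts on functions rather than on classes, and is linear and positive on all of
    them, so that its inequalities hold at every point. Symmetry pairs an integrable function with a
    bounded one: the dual variable is integrable, while the solution side enters only as a bounded
    function. *)
Record markov_op (J : (X -> R) -> X -> R) : Prop := Markov {
  mk_lin : forall a f g, J (fun x => a * f x + g x) = fun x => a * J f x + J g x ;
  mk_ge0 : forall f, (forall x, 0 <= f x) -> forall x, 0 <= J f x ;
  mk_cst : forall c, J (fun=> c) = fun=> c ;
  mk_meas : forall f, measurable_fun setT f -> measurable_fun setT (J f) ;
  mk_int : forall f, L1b m f -> L1b m (J f) /\ I (J f) = I f ;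
  mk_sym : forall f g, L1b m f -> bmf g ->
    \int[m]_x (J f x * g x) = \int[m]_x (f x * J g x) }.

Section theory.
Variables (J : (X -> R) -> X -> R) (MJ : markov_op J).

Lemma mkD f g : J (fun x => f x + g x) = fun x => J f x + J g x.
Proof.
have := mk_lin MJ 1 f g; under eq_fun do rewrite mul1r.
by move=> ->; apply/funext => x; rewrite mul1r.
Qed.

Lemma mkZ c f : J (fun x => c * f x) = fun x => c * J f x.
Proof.
have := mk_lin MJ c f (fun=> 0); under eq_fun do rewrite addr0.
by move=> ->; rewrite (mk_cst MJ); apply/funext => x; rewrite addr0.
Qed.

Lemma mkN f : J (fun x => - f x) = fun x => - J f x.
Proof.
have := mkZ (-1) f; under eq_fun do rewrite mulN1r.
by move=> ->; apply/funext => x; rewrite mulN1r.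
Qed.

Lemma mkB f g : J (fun x => f x - g x) = fun x => J f x - J g x.
Proof. by rewrite mkD mkN. Qed.

Lemma mk_le f g : (forall x, f x <= g x) -> forall x, J f x <= J g x.
Proof.
move=> fg x; rewrite -subr_ge0.
by have := mk_ge0 MJ (f := fun x => g x - f x); rewrite mkB; apply => y; rewrite subr_ge0.
Qed.

Lemma mk_norm f x : `|J f x| <= J (fun x => `|f x|) x.
Proof.
rewrite ler_norml; apply/andP; split.
  have := mk_le (f := fun x => - `|f x|) (g := f); rewrite mkN => h; apply: h => y.
  by rewrite lerNl -normrN ler_norm.
by apply: mk_le => y; exact: ler_norm.
Qed.

Lemma mk_bound f C : (forall x, `|f x| <= C) -> forall x, `|J f x| <= C.
Proof.
move=> fC x; rewrite (le_trans (mk_norm _ _))//.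
by have := mk_le fC x; rewrite (mk_cst MJ).
Qed.

Lemma mk_bmf f : bmf f -> bmf (J f).
Proof.
move=> [mf [C fC]]; split; first exact: mk_meas.
by exists C; exact: mk_bound.
Qed.

Lemma mk_L1 f : L1b m f -> I (fun x => `|J f x|) <= I (fun x => `|f x|).
Proof.
move=> Lf; have [LJ <-] := mk_int MJ (L1b_norm Lf).
apply: le_Rint => //; last exact: mk_norm.
by apply: L1b_norm; have [] := mk_int MJ Lf.
Qed.

(** Jensen's inequality, from J ((f - t)^2) >= 0 at x with the constant t = J f x. *)
Lemma mk_sqr f x : J f x ^+ 2 <= J (fun y => f y ^+ 2) x.
Proof.
pose t := J f x.
have := mk_ge0 MJ (f := fun y => f y ^+ 2 + (- (2 * t) * f y + t ^+ 2)).
rewrite mkD mkD mkZ (mk_cst MJ) => /(_ _ x).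
have h y : 0 <= f y ^+ 2 + (- (2 * t) * f y + t ^+ 2).
  by rewrite (_ : _ + _ = (f y - t) ^+ 2) ?sqr_ge0//; ring.
move=> /(_ h); rewrite -/t; set q := J _ x => h2; rewrite -subr_ge0.
by apply: le_trans h2 _; rewrite le_eqVlt; apply/orP; left; apply/eqP; ring.
Qed.

Lemma L1b_sqr f : L1b m f -> L1b m (fun x => f x ^+ 2).
Proof.
move=> Lf; rewrite (_ : (fun _ => _) = fun x => f x * f x).
  exact: L1bMr Lf (L1b_bmf Lf).
by apply/funext => x; rewrite expr2.
Qed.

(** Pointwise |J f| |f| <= (J (f^2) + f^2) / 2 by [mk_sqr]; as J preserves the integral, both halves
    contribute equally. *)
Lemma mk_form f : L1b m f ->
  `| \int[m]_x (J f x * f x) | <= \int[m]_x (f x ^+ 2).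
Proof.
move=> Lf; have [LJ IJ] := mk_int MJ Lf.
have [LJ2 IJ2] := mk_int MJ (L1b_sqr Lf).
rewrite (le_trans (Rint_norm _))//; first exact: L1bMr LJ (L1b_bmf Lf).
have -> : \int[m]_x (f x ^+ 2) =
    \int[m]_x (2^-1 * (J (fun y => f y ^+ 2) x + f x ^+ 2)).
  rewrite RintZ; last by apply: L1bD => //; exact: L1b_sqr.
  by rewrite RintD// ?IJ2; [field|exact: L1b_sqr].
apply: le_Rint.
- by apply: L1b_norm; exact: L1bMr LJ (L1b_bmf Lf).
- by apply: L1bZ; apply: L1bD => //; exact: L1b_sqr.
- move=> x; rewrite normrM; have := mk_sqr f x.
  rewrite -(real_normK (num_real (J f x))) -(real_normK (num_real (f x))).
  have := sqr_ge0 (`|J f x| - `|f x|); set a := `|_|; set b := `|f x|; set q := J _ x.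
  by move=> h1 h2; nra.
Qed.

Variable lam : R.
Hypothesis lam0 : 0 < lam.

(** The quadratic form of the symmetric operator lam (1 - J). By [mk_form] it lies between 0 and 2
    lam times the squared L2 norm. *)
Definition energy f := lam * \int[m]_x ((f x - J f x) * f x).

Lemma energyE f : L1b m f ->
  energy f = lam * (\int[m]_x (f x ^+ 2) - \int[m]_x (J f x * f x)).
Proof.
move=> Lf; have [LJ IJ] := mk_int MJ Lf.
rewrite -RintB; [|exact: L1b_sqr|exact: L1bMr LJ (L1b_bmf Lf)].
by congr (_ * _); apply: eq_Rint => x; ring.
Qed.

Lemma energy_ge0 f : L1b m f -> 0 <= energy f.
Proof.
move=> Lf; rewrite energyE// mulr_ge0 ?(ltW lam0)// subr_ge0.
by rewrite (le_trans _ (mk_form Lf))// ler_norm.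
Qed.

Lemma energy_le f : L1b m f -> energy f <= 2 * lam * \int[m]_x (f x ^+ 2).
Proof.
move=> Lf; rewrite energyE// (mulrC 2) -mulrA ler_pM2l// mulr_natl mulr2n lerD2l.
by rewrite lerNl (le_trans _ (lerNnormlW (mk_form Lf)))// lerN2.
Qed.

Lemma energyB f q : L1b m f -> L1b m q ->
  energy (fun x => f x - q x) =
  energy f - 2 * (lam * \int[m]_x (q x * (f x - J f x))) + energy q.
Proof.
move=> Lf Lq; have [LJf _] := mk_int MJ Lf; have [LJq _] := mk_int MJ Lq.
have sym : \int[m]_x (J q x * f x) = \int[m]_x (q x * J f x).
  exact: (mk_sym MJ) Lq (L1b_bmf Lf).
have Lff := L1bMr Lf (L1b_bmf Lf).
have Ljff := L1bMr LJf (L1b_bmf Lf).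
have Lqf := L1bMr Lq (L1b_bmf Lf).
have Lqjf := L1bMr Lq (L1b_bmf LJf).
have Ljqf := L1bMr LJq (L1b_bmf Lf).
have Lqq := L1bMr Lq (L1b_bmf Lq).
have Ljqq := L1bMr LJq (L1b_bmf Lq).
rewrite /energy mkB.
have B1 : L1b m (fun x => f x * f x - J f x * f x) by exact: L1bB.
have B2 : L1b m (fun x => J q x * f x - q x * f x) by exact: L1bB.
have B3 : L1b m (fun x => q x * J f x - q x * f x) by exact: L1bB.
have B4 : L1b m (fun x => q x * q x - J q x * q x) by exact: L1bB.
have B12 := L1bD B1 B2; have B123 := L1bD B12 B3.
have -> : \int[m]_x ((f x - q x - (J f x - J q x)) * (f x - q x)) =
   \int[m]_x (f x * f x - J f x * f x) + \int[m]_x (J q x * f x - q x * f x)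
   + \int[m]_x (q x * J f x - q x * f x) + \int[m]_x (q x * q x - J q x * q x).
  by rewrite -!RintD//; apply: eq_Rint => x; ring.
have -> : \int[m]_x ((f x - J f x) * f x) = \int[m]_x (f x * f x - J f x * f x).
  by apply: eq_Rint => x; ring.
have -> : \int[m]_x ((q x - J q x) * q x) = \int[m]_x (q x * q x - J q x * q x).
  by apply: eq_Rint => x; ring.
have -> : \int[m]_x (q x * (f x - J f x)) = \int[m]_x (q x * f x - q x * J f x).
  by apply: eq_Rint => x; ring.
by rewrite !RintB// sym; ring.
Qed.

Variables (A h : R).
Hypotheses (A0 : 0 <= A) (h0 : 0 < h) (cfl : 2 * (h * A * lam) <= 1).

Section step.
Variables (z ab : X -> R).
Hypotheses (Lz : L1b m z) (z01 : forall x, 0 <= z x <= 1).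
Hypotheses (mab : measurable_fun setT ab) (abA : forall x, 0 <= ab x <= A).

Definition flux x := lam * (z x - J z x).
(** One explicit Euler step of length h, backwards in time, for d_t z + a lam (J z - z) = 0, with
    [ab] in the role of a. *)
Definition backstep x := z x - h * ab x * flux x.

Let Jz01 x : 0 <= J z x <= 1.
Proof.
apply/andP; split; first by apply: (mk_ge0 MJ) => y; case/andP: (z01 y).
have := mk_le (f := z) (g := fun=> 1); rewrite (mk_cst MJ) => h1; apply: h1 => y.
by case/andP: (z01 y).
Qed.

Let bab : bmf ab.
Proof.
by split=> //; exists A => x; have /andP[a0 aA] := abA x; rewrite ger0_norm.
Qed.

Lemma flux_L1b : L1b m flux.
Proof. by apply: L1bZ; apply: L1bB => //; have [] := mk_int MJ Lz. Qed.

Lemma flux_le x : `|flux x| <= lam.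
Proof.
rewrite /flux normrM gtr0_norm// ler_piMr ?(ltW lam0)//.
have /andP[? ?] := z01 x; have /andP[? ?] := Jz01 x.
by rewrite ler_norml; apply/andP; split; lra.
Qed.

Lemma flux_I : \int[m]_x `|flux x| <= 2 * lam * \int[m]_x z x.
Proof.
have [LJz IJz] := mk_int MJ Lz.
apply: (@le_trans _ _ (\int[m]_x (lam * (z x + J z x)))).
  apply: le_Rint; first exact/L1b_norm/flux_L1b.
    by apply: L1bZ; exact: L1bD.
  move=> x; rewrite /flux normrM gtr0_norm// ler_pM2l//.
  have /andP[? ?] := z01 x; have /andP[? ?] := Jz01 x.
  by rewrite ler_norml; apply/andP; split; lra.
rewrite RintZ ?RintD// ?IJz; last exact: L1bD.
by rewrite le_eqVlt; apply/orP; left; apply/eqP; ring.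
Qed.

Lemma backstep_L1b : L1b m backstep.
Proof.
apply: L1bB => //; apply: L1bM; last exact: flux_L1b.
exact: bmfZ.
Qed.

Let hal x : 0 <= h * ab x * lam <= 1.
Proof.
have /andP[a0 aA] := abA x; rewrite !mulr_ge0 ?(ltW h0) ?(ltW lam0)//=.
apply: le_trans (_ : h * A * lam <= 1).
  by rewrite ler_wpM2r ?(ltW lam0)// ler_wpM2l// ltW.
have : 0 <= h * A * lam by rewrite !mulr_ge0 ?(ltW h0) ?(ltW lam0).
by move: cfl; lra.
Qed.

(** Under the CFL condition the weights lie in [0, 1], so the step is a convex combination of z x
    and J z x; this keeps the values in [0, 1]. *)
Let backstepE x : backstep x = (1 - h * ab x * lam) * z x + h * ab x * lam * J z x.
Proof. by rewrite /backstep /flux; ring. Qed.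

Lemma backstep01 x : 0 <= backstep x <= 1.
Proof.
rewrite backstepE; have := hal x; set t := h * ab x * lam => /andP[t0 t1].
have /andP[? ?] := z01 x; have /andP[? ?] := Jz01 x.
by apply/andP; split; nra.
Qed.

(** The coefficient stands in front of lam (J z - z), so the mass is not conserved; it grows at most
    by the factor 1 + h A lam. Over n steps this is bounded by the exponential of n h A lam,
    whatever the number of steps for a given total time n h. *)
Lemma backstep_I : \int[m]_x backstep x <= (1 + h * A * lam) * \int[m]_x z x.
Proof.
have [LJz IJz] := mk_int MJ Lz.
apply: (@le_trans _ _ (\int[m]_x (z x + (h * A * lam) * J z x))).
  apply: le_Rint; [exact: backstep_L1b|by apply: L1bD => //; exact: L1bZ|].
  move=> x; rewrite backstepE; have /andP[t0 t1] := hal x.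
  have /andP[? ?] := z01 x; have /andP[? ?] := Jz01 x.
  have : h * ab x * lam <= h * A * lam.
    by have /andP[a0 aA] := abA x; rewrite ler_wpM2r ?(ltW lam0)// ler_wpM2l// ltW.
  by move: t0 t1; set t := h * ab x * lam; set s := h * A * lam => *; nra.
by rewrite RintD ?RintZ ?IJz ?mulrDl ?mul1r//; exact: L1bZ.
Qed.

Lemma flux_sqr_L1b : L1b m (fun x => ab x * flux x ^+ 2).
Proof. by apply: L1bM => //; apply: L1b_sqr; exact: flux_L1b. Qed.

(** Let D be the integral of ab flux^2. In the energy of z - q with q = h ab flux the mixed term is
    -2 h D, and the quadratic term is at most 2 lam times the integral of q^2, hence at most h D by
    the CFL condition. A loss of h D remains. *)
Lemma backstep_energy :
  energy backstep + h * \int[m]_x (ab x * flux x ^+ 2) <= energy z.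
Proof.
have Lq : L1b m (fun x => h * ab x * flux x).
  by apply: L1bM; [exact: bmfZ|exact: flux_L1b].
rewrite /backstep (energyB Lz Lq).
have -> : lam * \int[m]_x (h * ab x * flux x * (z x - J z x)) =
    h * \int[m]_x (ab x * flux x ^+ 2).
  rewrite -RintZ; last first.
    by apply: L1bMr Lq (L1b_bmf (L1bB Lz _)); have [] := mk_int MJ Lz.
  rewrite -RintZ; last exact: flux_sqr_L1b.
  by apply: eq_Rint => x; rewrite /flux; ring.
have q2 : energy (fun x => h * ab x * flux x) <=
    h * \int[m]_x (ab x * flux x ^+ 2).
  apply: (le_trans (energy_le Lq)).
  rewrite -RintZ; last exact: L1b_sqr.
  rewrite -RintZ; last exact: flux_sqr_L1b.
  apply: le_Rint.
  - by apply: L1bZ; exact: L1b_sqr.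
  - by apply: L1bZ; exact: flux_sqr_L1b.
  - move=> x.
    have -> : 2 * lam * (h * ab x * flux x) ^+ 2 =
       (2 * (h * ab x * lam)) * (h * (ab x * flux x ^+ 2)) by ring.
    have /andP[a0 aA] := abA x.
    apply: ler_piMl.
      by apply: mulr_ge0; [exact: ltW|apply: mulr_ge0 => //; exact: sqr_ge0].
    apply: le_trans cfl; rewrite ler_pM2l// ler_wpM2r ?(ltW lam0)//.
    by rewrite ler_wpM2l// ltW.
by move: q2; set e := energy z; set a := energy _; set b := _ * \int[m]_x _; lra.
Qed.

End step.

Section discrete.
Variables (c bt kp et : R) (ab W r F : nat -> X -> R) (U : nat -> X -> R).
Hypotheses (kp0 : 0 <= kp) (et0 : 0 <= et) (bt0 : 0 <= bt).
Hypothesis mab : forall k, measurable_fun setT (ab k).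
Hypothesis abA : forall k x, 0 <= ab k x <= A.
Hypothesis bU : forall k, bmf (U k).
Hypothesis bW : forall k, bmf (W k).
Hypothesis br : forall k, bmf (r k).
Hypothesis rE : forall k x, `|r k x| <= h * et.
Hypothesis LF : forall k, L1b m (F k).
Hypothesis US : forall k x, U k.+1 x - U k x = lam * (J (W k) x - W k x) + r k x.
Hypothesis key : forall k x y, `|y| <= lam ->
  - y * W k x + h * ab k x * (U k x - c) * y <=
  bt * (h * (ab k x * y ^+ 2)) + F k x + h * kp * `|y|.

(** Symmetry moves lam (J - 1) from W onto z, where it becomes minus the flux; trading z for its
    backstep adds h ab (U - c) flux. The hypothesis [key], with y the flux, bounds the sum of the
    two by bt h ab flux^2 plus errors, and the integral of that first term is covered by the energy
    lost in the step. *)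
Lemma discrete_step k z : L1b m z -> (forall x, 0 <= z x <= 1) ->
  \int[m]_x ((U k.+1 x - c) * z x) + bt * energy (backstep z (ab k)) <=
  \int[m]_x ((U k x - c) * backstep z (ab k) x) + bt * energy z
  + \int[m]_x F k x + h * (2 * lam * kp + et) * \int[m]_x z x.
Proof.
move=> Lz z01.
have Lb := backstep_L1b Lz (mab k) (abA k).
have Lf := flux_L1b Lz.
have [LJz _] := mk_int MJ Lz.
have bUc j : bmf (fun x => U j x - c) by apply: bmfB => //; exact: bmf_cst.
have bab : bmf (ab k).
  by split=> //; exists A => x; have /andP[a0 aA] := abA k x; rewrite ger0_norm.
have LW : L1b m (fun x => W k x * flux z x) by exact: L1bM.
have LU j : L1b m (fun x => (U j x - c) * z x) by exact: L1bM.
have LaU : L1b m (fun x => h * ab k x * (U k x - c) * flux z x).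
  by apply: L1bM => //; apply: bmfM => //; exact: bmfZ.
have Lr : L1b m (fun x => r k x * z x) by exact: L1bM.
have Lf2 := flux_sqr_L1b Lz (mab k) (abA k).
have symW : \int[m]_x (lam * (J (W k) x - W k x) * z x) =
    \int[m]_x (- flux z x * W k x).
  have e1 : \int[m]_x (J z x * W k x) = \int[m]_x (z x * J (W k) x).
    exact: (mk_sym MJ).
  have LzW : L1b m (fun x => z x * W k x) by exact: L1bMr.
  have LJzW : L1b m (fun x => J z x * W k x) by exact: L1bMr.
  have LzJW : L1b m (fun x => z x * J (W k) x) by apply: L1bMr => //; exact: mk_bmf.
  transitivity (\int[m]_x (lam * (z x * J (W k) x - z x * W k x))).
    by apply: eq_Rint => x; ring.
  transitivity (\int[m]_x (lam * (J z x * W k x - z x * W k x))).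
    by rewrite !RintZ ?RintB ?e1//; exact: L1bB.
  by apply: eq_Rint => x; rewrite /flux; ring.
have E : \int[m]_x ((U k.+1 x - c) * z x) =
   \int[m]_x ((U k x - c) * backstep z (ab k) x)
   + \int[m]_x (- flux z x * W k x + h * ab k x * (U k x - c) * flux z x)
   + \int[m]_x (r k x * z x).
  have LfW : L1b m (fun x => - flux z x * W k x).
    by apply: L1bMr => //; exact: L1bN.
  have LJW : L1b m (fun x => lam * (J (W k) x - W k x) * z x).
    by apply: L1bM => //; apply: bmfZ; apply: bmfB => //; exact: mk_bmf.
  have LUb : L1b m (fun x => (U k x - c) * backstep z (ab k) x) by exact: L1bM.
  rewrite RintD// -symW -RintD// addrC addrA -RintD// -RintD//; last 2 first.
    exact: L1bD.
    by apply: L1bD.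
  apply: eq_Rint => x; rewrite /backstep.
  have -> : U k.+1 x = U k x + (lam * (J (W k) x - W k x) + r k x).
    by rewrite -US; ring.
  by ring.
rewrite E.
have I1 : \int[m]_x (- flux z x * W k x + h * ab k x * (U k x - c) * flux z x)
   <= bt * (h * \int[m]_x (ab k x * flux z x ^+ 2)) + \int[m]_x F k x
      + h * kp * (2 * lam * \int[m]_x z x).
  apply: (@le_trans _ _ (\int[m]_x (bt * (h * (ab k x * flux z x ^+ 2)) + F k x
      + h * kp * `|flux z x|))).
    apply: le_Rint.
    - by apply: L1bD => //; apply: L1bMr => //; exact: L1bN.
    - apply: L1bD; first by apply: L1bD => //; apply: L1bZ; exact: L1bZ.
      by apply: L1bZ; exact: L1b_norm.
    - by move=> x; apply: key; exact: flux_le.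
  have La : L1b m (fun x => h * (ab k x * flux z x ^+ 2)) by exact: L1bZ.
  have Lbt : L1b m (fun x => bt * (h * (ab k x * flux z x ^+ 2))) by exact: L1bZ.
  have Ln : L1b m (fun x => `|flux z x|) by exact: L1b_norm.
  have Lk : L1b m (fun x => h * kp * `|flux z x|) by exact: L1bZ.
  have Ls := L1bD Lbt (LF k).
  rewrite RintD// RintD// RintZ// RintZ// RintZ//.
  by rewrite lerD2l ler_wpM2l ?mulr_ge0 ?(ltW h0)//; exact: flux_I.
have I2 : \int[m]_x (r k x * z x) <= h * et * \int[m]_x z x.
  rewrite -RintZ//; apply: le_Rint => //; first exact: L1bZ.
  move=> x; have /andP[z0 z1] := z01 x; rewrite ler_wpM2r//.
  by rewrite (le_trans (ler_norm _)).
have I3 := backstep_energy Lz (mab k) (abA k).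
have := ler_wpM2l bt0 I3; rewrite mulrDr; move: I1 I2.
set q1 := \int[m]_x _; set q2 := \int[m]_x F k x; set q3 := \int[m]_x _.
set q4 := \int[m]_x z x; set q5 := \int[m]_x (_ * backstep _ _ _).
set q6 := bt * energy (backstep _ _); set q7 := bt * (h * _); set q8 := bt * energy z.
set q9 := \int[m]_x _.
move=> J1 J2 J3; rewrite -subr_ge0.
have -> : q5 + q8 + q2 + h * (2 * lam * kp + et) * q4 - (q5 + q1 + q9 + q6) =
  (q7 + q2 + h * kp * (2 * lam * q4) - q1) + (h * et * q4 - q9) + (q8 - (q6 + q7)).
  by ring.
by apply: addr_ge0; [apply: addr_ge0|]; rewrite subr_ge0.
Qed.

Lemma discrete_core n z : L1b m z -> (forall x, 0 <= z x <= 1) ->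
  exists z0, [/\ L1b m z0, forall x, 0 <= z0 x <= 1 &
  \int[m]_x ((U n x - c) * z x) <=
  \int[m]_x ((U 0%N x - c) * z0 x) + bt * energy z
  + \sum_(k < n) \int[m]_x F k x
  + n%:R * h * (2 * lam * kp + et) * (1 + h * A * lam) ^+ n * \int[m]_x z x].
Proof.
move=> Lz z01.
(* The energy of [z0] is kept on the left so that the induction closes; being nonnegative, it is
   dropped at the end. *)
suff [z0 [L0 z001 H]] : exists z0, [/\ L1b m z0, forall x, 0 <= z0 x <= 1 &
  \int[m]_x ((U n x - c) * z x) + bt * energy z0 <=
  \int[m]_x ((U 0%N x - c) * z0 x) + bt * energy z
  + \sum_(k < n) \int[m]_x F k x
  + n%:R * h * (2 * lam * kp + et) * (1 + h * A * lam) ^+ n * \int[m]_x z x].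
  exists z0; split=> //; apply: le_trans H; rewrite lerDl mulr_ge0//.
  exact: energy_ge0.
have hAl0 : 0 <= h * A * lam by rewrite !mulr_ge0 ?(ltW h0) ?(ltW lam0).
have K0 : 0 <= 2 * lam * kp + et by rewrite addr_ge0// !mulr_ge0// ltW.
elim: n z Lz z01 => [|n IHn] z Lz z01.
  by exists z; split=> //; rewrite big_ord0 !mul0r !addr0.
have Lb := backstep_L1b Lz (mab n) (abA n).
have b01 := backstep01 z01 (abA n).
have [z0 [L0 z001 H]] := IHn _ Lb b01.
exists z0; split=> //; rewrite big_ord_recr /=.
have S := discrete_step n Lz z01.
have B := backstep_I Lz z01 (mab n) (abA n).
have z_ge0 : 0 <= \int[m]_x z x by apply: Rint_ge0 => x; case/andP: (z01 x).
(* The induction hypothesis measures the error by the mass of the backstep; one more factor 1 + h A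
   lam leads back to the mass of z. *)
have B' : n%:R * h * (2 * lam * kp + et) * (1 + h * A * lam) ^+ n *
    \int[m]_x backstep z (ab n) x <=
  n%:R * h * (2 * lam * kp + et) * (1 + h * A * lam) ^+ n.+1 * \int[m]_x z x.
  rewrite exprSr mulrA -[leRHS]mulrA; apply: ler_wpM2l => //.
  rewrite !mulr_ge0// ?(ltW h0)// exprn_ge0//.
  exact: addr_ge0.
have B'' : h * (2 * lam * kp + et) * \int[m]_x z x <=
   h * (2 * lam * kp + et) * (1 + h * A * lam) ^+ n.+1 * \int[m]_x z x.
  rewrite ler_wpM2r// ler_peMr// ?mulr_ge0 ?(ltW h0)//.
  by rewrite exprn_ege1// lerDl.
move: H S B' B''.
rewrite -[n.+1%:R]natr1.
set K := 2 * lam * kp + et; set P := (1 + _) ^+ n; set P' := (1 + _) ^+ n.+1.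
set q1 := \int[m]_x (_ * backstep _ _ _); set q2 := bt * energy z0.
set q3 := \int[m]_x (_ * z0 _); set q4 := bt * energy (backstep _ _).
set q5 := \sum_(k < n) _; set q6 := \int[m]_x backstep _ _ _.
set q7 := \int[m]_x ((U n.+1 _ - c) * _); set q8 := bt * energy z.
set q9 := \int[m]_x F n x; set q10 := \int[m]_x z x.
move=> H S B' B''; rewrite -subr_ge0.
have -> : q3 + q8 + (q5 + q9) + (n%:R + 1) * h * K * P' * q10 - (q7 + q2) =
  (q3 + q4 + q5 + n%:R * h * K * P * q6 - (q1 + q2)) +
  (q1 + q8 + q9 + h * K * q10 - (q7 + q4)) +
  (n%:R * h * K * P' * q10 - n%:R * h * K * P * q6) +
  (h * K * P' * q10 - h * K * q10) by ring.
by apply: addr_ge0; [apply: addr_ge0; [apply: addr_ge0|]|]; rewrite subr_ge0.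
Qed.

End discrete.

End theory.

End markov.

(** * Smooth functions built from exp (-1/t) *)

Section flat.
Context {R : realType}.
Implicit Types (p : {poly R}) (t : R).

(** Indexed by polynomials because the family is then closed under differentiation: p becomes (p -
    p') X^2. *)
Definition flat p t : R := if 0 < t then p.[t^-1] * expR (- t^-1) else 0.

Lemma flat_eq0 p t : t <= 0 -> flat p t = 0.
Proof. by rewrite /flat ltNge => ->. Qed.

(** Coefficient by coefficient from s^i <= i! exp s. *)
Lemma poly_expRN_bound p :
  exists2 C : R, 0 <= C & forall s, 0 <= s -> `|p.[s]| * expR (- s) <= C.
Proof.
exists (\sum_(i < size p) `|p`_i| * (i`!)%:R).
  by apply: sumr_ge0 => i _; rewrite mulr_ge0.
move=> s s0; rewrite horner_coef.
apply: (@le_trans _ _ (\sum_(i < size p) `|p`_i| * s ^+ i * expR (- s))).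
  rewrite -mulr_suml ler_wpM2r ?expR_ge0// (le_trans (ler_norm_sum _ _ _))//.
  by apply: ler_sum => i _; rewrite normrM (ger0_norm (exprn_ge0 _ _)).
apply: ler_sum => i _; rewrite -mulrA ler_wpM2l// expRN ler_pdivrMr ?expR_gt0//.
case: (nat_of_ord i) => [|n]; first by rewrite expr0 fact0 mul1r -expR0 ler_expR.
have := @expR_ge1Dxn R s n s0.
have f0 : (0 : R) < (n.+1)`!%:R by rewrite ltr0n fact_gt0.
rewrite -(ler_pM2l f0) mulrDr mulr1 mulrCA mulfV ?gt_eqF// mulr1; apply: le_trans.
by rewrite lerDr ltW.
Qed.

(** The previous bound for p X^2, read at s = 1/t. Quadratic decay is what yields derivative 0 at
    the origin. *)
Lemma flat_quad p : exists2 C : R, 0 <= C & forall t, `|flat p t| <= C * t ^+ 2.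
Proof.
have [C C0 pC] := poly_expRN_bound (p * 'X^2).
exists C => // t; rewrite /flat; case: ifPn => [t0|_]; last first.
  by rewrite normr0 mulr_ge0// sqr_ge0.
have := pC t^-1; rewrite invr_ge0 (ltW t0) => /(_ isT).
have t1 : 0 <= t^-1 by rewrite invr_ge0 ltW.
rewrite hornerM hornerXn normrM normrX (ger0_norm t1) normrM (ger0_norm (expR_ge0 _)) mulrAC exprVn.
by rewrite ler_pdivrMr ?exprn_gt0.
Qed.

Lemma is_derive_flat p t :
  is_derive t 1 (flat p) (flat ((p - p^`()) * 'X^2) t).
Proof.
have [t0|t0|<-] := ltgtP 0 t.
- apply: (@near_eq_is_derive _ _ _ (fun t => p.[t^-1] * expR (- t^-1))).
    near=> s; rewrite /flat ifT//.
    near: s; exact: lt_nbhsr.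
  have dV : is_derive t 1 (fun t : R => t^-1) (- t ^- 2).
    have := @is_deriveV R id t 1 1 (lt0r_neq0 t0) (is_derive_id _ _).
    by move=> h; apply: is_derive_eq h _; rewrite scaler1.
  have d1 : is_derive t 1 (horner p \o (fun t : R => t^-1)) (p^`().[t^-1] * - t ^- 2).
    exact: is_derive1_comp.
  have dN : is_derive t 1 (fun t : R => - t^-1) (t ^- 2).
    by apply: is_derive_eq (is_deriveN dV) _; rewrite opprK.
  have d2 : is_derive t 1 (expR \o (fun t : R => - t^-1)) (expR (- t^-1) * t ^- 2).
    exact: is_derive1_comp.
  have := is_deriveM d1 d2; rewrite /flat t0 => h; apply: is_derive_eq h _.
  rewrite hornerM hornerD hornerN hornerXn /= /GRing.scale /= exprVn; ring.
- apply: (@near_eq_is_derive _ _ _ (cst 0)).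
    near=> s; rewrite /flat ifF//; apply/negbTE; rewrite -leNgt ltW//.
    near: s; exact: lt_nbhsl.
  by rewrite /flat ifF; [exact: is_derive_cst|apply/negbTE; rewrite -leNgt ltW].
- have [C C0 fC] := flat_quad p.
  have H : (fun h : R => h^-1 *: ((flat p \o shift 0) (h *: 1) - flat p 0)) @ 0^' --> (0 : R).
    apply: (@cvg_trans _ ((fun h : R => h^-1 *: flat p h) @ 0^')).
      apply: near_eq_cvg; near=> h.
      by rewrite /= addr0 [_ *: 1]mulr1 (flat_eq0 _ (lexx 0)) subr0.
    apply/cvgr0Pnorm_le => e e0.
    near=> h.
    rewrite normrZ (le_trans (ler_wpM2l _ (fC h)))//.
    have h0 : 0 < `|h| by rewrite normr_gt0; near: h; exact: nbhs_dnbhs_neq.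
    rewrite normfV -(real_normK (num_real h)) mulrCA expr2 mulKf ?gt_eqF//.
    have hC : `|h| <= e / (C + 1).
      near: h; apply: dnbhs0_le; rewrite divr_gt0//; lra.
    rewrite (le_trans (ler_wpM2l C0 hC))// mulrCA ler_piMr ?(ltW e0)//.
    by rewrite ler_pdivrMr; lra.
  apply: DeriveDef; first by apply/cvg_ex; exists 0.
  by rewrite /derive (cvg_lim _ H)// /flat ltxx.
Unshelve. all: by end_near.
Qed.

Lemma differentiable_flat p t : differentiable (flat p) t.
Proof. by apply/derivable1_diffP; have [] := is_derive_flat p t. Qed.

Lemma flat_gt0 t : (0 < flat 1 t) = (0 < t).
Proof.
by rewrite /flat; case: ifPn => t0; rewrite ?ltxx// hornerC mul1r expR_gt0.
Qed.

Lemma flat1_ge0 t : 0 <= flat 1 t.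
Proof.
by rewrite /flat; case: ifPn => t0//; rewrite hornerC mul1r expR_ge0.
Qed.

End flat.

Section smooth_class.
Context {R : realType} {V : normedModType R}.

Definition affine_fun (l : V -> R) := (forall x, differentiable l x) /\
  forall v, exists c, forall x, 'D_v l x = c.

(** A syntactic class of differentiable functions that is closed under ['D_v]; smoothness of its
    members then follows by induction on the list of directions. [flat] occurs with every polynomial
    because differentiation changes the polynomial. *)
Inductive smc : (V -> R) -> Prop :=
| smc_cst c : smc (fun=> c)
| smc_flat p l : affine_fun l -> smc (fun x => flat p (l x))
| smc_add f g : smc f -> smc g -> smc (fun x => f x + g x)
| smc_mul f g : smc f -> smc g -> smc (fun x => f x * g x)
| smc_inv f : smc f -> (forall x, f x != 0) -> smc (fun x => (f x)^-1).

Lemma smc_opp f : smc f -> smc (fun x => - f x).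
Proof.
move=> sf; rewrite (_ : (fun _ => _) = fun x => (-1) * f x).
  by apply: smc_mul => //; exact: smc_cst.
by apply/funext => x; rewrite mulN1r.
Qed.

Lemma smc_differentiable f : smc f -> forall x, differentiable f x.
Proof.
elim=> {f} [c|p l [dl _]|f g _ df _ dg|f g _ df _ dg|f _ df f0] x.
- exact: differentiable_cst.
- apply: (@differentiable_comp _ _ _ _ l (flat p)) => //.
  exact: differentiable_flat.
- exact: differentiableD.
- exact: differentiableM.
- exact: differentiableV.
Qed.

Lemma derive_flat_comp p (l : V -> R) x v : differentiable l x ->
  'D_v (fun y => flat p (l y)) x = flat ((p - p^`()) * 'X^2) (l x) * 'D_v l x.
Proof.
move=> dl; have df := differentiable_flat p (l x).
rewrite deriveE; last exact: (@differentiable_comp _ _ _ _ l (flat p)).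
rewrite (_ : (fun y => _) = flat p \o l)// diff_comp// /= diff1E//.
have [_ <-] := is_derive_flat p (l x).
by rewrite -deriveE// /GRing.scale /= mulrC derive1E.
Qed.

Lemma smc_derive f v : smc f -> smc ('D_v f).
Proof.
elim=> {f} [c|p l [dl cl]|f g sf Df sg Dg|f g sf Df sg Dg|f sf Df f0].
- rewrite (_ : 'D_v _ = fun=> 0); first exact: smc_cst.
  by apply/funext => x; exact: derive_cst.
- have [c lc] := cl v.
  rewrite (_ : 'D_v _ = fun x => flat ((p - p^`()) * 'X^2) (l x) * c).
    by apply: smc_mul; [exact: smc_flat|exact: smc_cst].
  by apply/funext => x; rewrite derive_flat_comp// lc.
- rewrite (_ : 'D_v _ = fun x => 'D_v f x + 'D_v g x); first exact: smc_add.
  by apply/funext => x; apply: deriveD; apply: diff_derivable; exact: smc_differentiable.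
- rewrite (_ : 'D_v _ = fun x => f x * 'D_v g x + g x * 'D_v f x).
    by apply: smc_add; exact: smc_mul.
  by apply/funext => x; apply: deriveM; apply: diff_derivable; exact: smc_differentiable.
- rewrite (_ : 'D_v _ = fun x => - ((f x)^-1 * (f x)^-1) * 'D_v f x).
    by apply: smc_mul => //; apply: smc_opp; apply: smc_mul; exact: smc_inv.
  apply/funext => x; rewrite deriveV//; last exact/diff_derivable/smc_differentiable.
  by rewrite /GRing.scale /= expr2 invfM.
Qed.

Lemma smc_smooth f : smc f -> smooth f.
Proof.
move=> sf vs x; apply: smc_differentiable.
by elim: vs => //= v vs IH; exact: smc_derive.
Qed.

Lemma smc_continuous f : smc f -> continuous f.
Proof. by move=> sf x; apply: differentiable_continuous; exact: smc_differentiable. Qed.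

Lemma smc_prod n (F : 'I_n -> V -> R) : (forall i, smc (F i)) ->
  smc (fun x => \prod_i F i x).
Proof.
elim: n F => [|n IHn] F sF.
  by under eq_fun do rewrite big_ord0; exact: smc_cst.
under eq_fun do rewrite big_ord_recl; apply: smc_mul => //.
by apply: IHn => i; exact: sF.
Qed.

End smooth_class.

(** * Sup-norm cubes and Taylor bounds along segments *)

Section cubes.
Context {R : realType} {N : nat}.
Implicit Types (x z : 'rV[R]_N).

Lemma rV_norm_le x r : 0 <= r -> (`|x| <= r) = [forall i, `|x ord0 i| <= r].
Proof.
move=> r0; apply/idP/forallP => [xr i|xr].
  rewrite (le_trans _ xr)// [leRHS]/Num.Def.normr /= mx_normrE.
  by apply/bigmax_geP; right => /=; exists (ord0, i).
rewrite [leLHS]/Num.Def.normr /= mx_normrE; apply/bigmax_leP; split=> // -[j i] _ /=.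
by rewrite (ord1 j).
Qed.

Lemma coord_norm_le x i : `|x ord0 i| <= `|x|.
Proof. by have := lexx `|x|; rewrite rV_norm_le// => /forallP. Qed.

Definition cube (r : R) : set 'rV[R]_N := [set x | `|x| <= r].

Lemma cube_compact r : compact (cube r).
Proof.
have [r0|r0] := ltP r 0.
  rewrite (_ : cube r = set0); first exact: compact0.
  by apply/seteqP; split=> // x /= /le_lt_trans/(_ r0); rewrite ltNge normr_ge0.
rewrite (_ : cube r = [set v | forall i, `[- r, r]%classic (v ord0 i)]).
  by apply: (@rV_compact _ _ (fun=> `[- r, r]%classic)) => _; exact: segment_compact.
apply/seteqP; split=> x; rewrite /cube /mkset rV_norm_le//.
  by move/forallP => h i; rewrite in_itv/= -ler_norml.
by move=> h; apply/forallP => i; have := h i; rewrite in_itv/= -ler_norml.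
Qed.

Lemma norm_measurable : measurable_fun setT (fun x : 'rV[R]_N => `|x|).
Proof. by apply: continuous_measurable_rV; exact: norm_continuous. Qed.

Lemma cube_measurable r : measurable (cube r).
Proof.
rewrite (_ : cube r = (fun x : 'rV[R]_N => `|x|) @^-1` `]-oo, r]); last first.
  by apply/seteqP; split=> x /=; rewrite in_itv.
by rewrite -[X in measurable X]setTI; exact: norm_measurable.
Qed.

Lemma cube_finite r : (lebesgue_rV R N (cube r) < +oo)%E.
Proof.
have h (i : 'I_N) : - (`|r| + 1) <= `|r| + 1 by have := normr_ge0 r; lra.
pose B := [set v : 'rV[R]_N | forall i : 'I_N,
  v ord0 i \in `](- (`|r| + 1)), (`|r| + 1)]].
have mB : measurable B.
  rewrite (_ : B = \bigcap_(i in [set: 'I_N]) ((fun v : 'rV[R]_N => v ord0 i)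
      @^-1` `](- (`|r| + 1)), (`|r| + 1)])).
    apply: fin_bigcap_measurable => // i _; rewrite -[X in measurable X]setTI.
    exact: coord_measurable.
  by apply/seteqP; split=> [v Bv i _|v Bv i]; exact: Bv.
apply: (@le_lt_trans _ _ (lebesgue_rV R N B)).
  apply: le_measure; rewrite ?inE//; first exact: cube_measurable.
  move=> x /= xr i; have := le_trans (coord_norm_le x i) xr.
  rewrite ler_norml => /andP[h1 h2]; rewrite in_itv /=.
  move: h1 h2 (ler_norm r); clear; set y := x _ _; set n := `|r| => h1 h2 h3.
  by apply/andP; split; lra.
by rewrite /B (lebesgue_rV_box h) ltry.
Qed.

End cubes.

Section lines.
Context {R : realType} {N : nat}.
Implicit Types (f g : 'rV[R]_N -> R) (x z : 'rV[R]_N).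

Lemma is_derive_line f x z (s : R) : (forall y, differentiable f y) ->
  is_derive s 1 (fun s => f (x + s *: z)) ('D_z f (x + s *: z)).
Proof.
move=> df.
pose L : R -> 'rV[R]_N := cst x + ( *:%R ^~ z).
have dl : is_diff s L (0 + ( *:%R ^~ z)) by exact: is_diffD.
have ds : differentiable L s by exact: ex_diff.
have dc : differentiable (f \o L) s by exact: differentiable_comp.
apply: DeriveDef; first exact/derivable1_diffP.
rewrite [LHS](deriveE _ dc) diff_comp//= (deriveE _ (df _)).
by rewrite diff_val; congr ('d f _ _); rewrite -[RHS]scale1r -[RHS]add0r.
Qed.

Lemma derive_rV f x z : differentiable f x ->
  'D_z f x = \sum_i z ord0 i * 'D_(delta_mx ord0 i) f x.
Proof.
move=> df; rewrite (deriveE _ df) {1}(row_sum_delta z) linear_sum.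
by apply: eq_bigr => i _; rewrite linearZ /= -deriveE.
Qed.

Lemma derive_rV_bound f x z C : differentiable f x ->
  (forall i, `|'D_(delta_mx ord0 i) f x| <= C) -> `|'D_z f x| <= N%:R * C * `|z|.
Proof.
move=> df dC; rewrite derive_rV// (le_trans (ler_norm_sum _ _ _))//.
apply: (@le_trans _ _ (\sum_(i < N) (`|z| * C))).
  by apply: ler_sum => i _; rewrite normrM ler_pM// coord_norm_le.
rewrite sumr_const card_ord -mulr_natl le_eqVlt; apply/orP; left; apply/eqP; ring.
Qed.

Lemma derive_out f r v : (forall x, r < `|x| -> f x = 0) ->
  forall x, r < `|x| -> 'D_v f x = 0.
Proof.
move=> f0 x rx.
rewrite -(@derive_cst _ _ _ (0 : R) x v).
apply: near_eq_derive.
have : \forall y \near x, r < `|y|.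
  have := @norm_continuous _ _ x; move/cvgr_gt; exact.
by apply: filterS => y; exact: f0.
Qed.

Lemma smc_bound f r : smc f -> (forall x, r < `|x| -> f x = 0) ->
  exists2 C, 0 <= C & forall x, `|f x| <= C.
Proof.
move=> sf f0.
have cf := smc_continuous sf.
have [c0|/set0P c0] := eqVneq (cube r : set 'rV[R]_N) set0.
  exists 0 => // x; rewrite f0 ?normr0// ltNge; apply/negP => xr.
  by have : cube r x by []; rewrite c0.
have [|c _ cM] := @EVT_max_rV R N (fun x => `|f x|) _ c0 (@cube_compact _ _ r).
  apply: continuous_subspaceT => x; apply: continuous_comp; first exact: cf.
  exact: norm_continuous.
exists `|f c| => // x; have [xr|xr] := leP `|x| r; first by apply: cM; rewrite inE.
by rewrite f0// normr0.
Qed.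

End lines.

Section taylor.
Context {R : realType} {N : nat}.
Variables (f : 'rV[R]_N -> R) (r : R).
Hypotheses (sf : smc f) (f0 : forall x, r < `|x| -> f x = 0).

Let df := smc_differentiable sf.
Let e i : 'rV[R]_N := delta_mx ord0 i.

Lemma grad_bound : exists2 C, 0 <= C & forall x z, `|'D_z f x| <= C * `|z|.
Proof.
have H i : exists C, 0 <= C /\ forall x, `|'D_(e i) f x| <= C.
  have [C C0 fC] := smc_bound (smc_derive (e i) sf) (@derive_out _ _ _ _ (e i) f0).
  by exists C.
have [C HC] := choice H.
exists (N%:R * \sum_i C i) => [|x z].
  by rewrite mulr_ge0// sumr_ge0// => i _; have [] := HC i.
apply: derive_rV_bound => // i; have [C0 HCi] := HC i.
rewrite (le_trans (HCi x))// (bigD1 i)//= lerDl sumr_ge0// => j _.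
by have [] := HC j.
Qed.

End taylor.

Section taylor2.
Context {R : realType} {N : nat}.
Variables (f : 'rV[R]_N -> R) (r : R).
Hypotheses (sf : smc f) (f0 : forall x, r < `|x| -> f x = 0).

Let df := smc_differentiable sf.
Let e i : 'rV[R]_N := delta_mx ord0 i.

(** One factor |z| comes from expanding the inner derivative along the basis, the other from
    [grad_bound] applied to each partial derivative. *)
Lemma hess_bound : exists2 C, 0 <= C &
  forall x z, `|'D_z ('D_z f) x| <= C * `|z| ^+ 2.
Proof.
have H i : exists C, 0 <= C /\ forall x z, `|'D_z ('D_(e i) f) x| <= C * `|z|.
  have [C C0 fC] := grad_bound (smc_derive (e i) sf) (@derive_out _ _ _ _ (e i) f0).
  by exists C.
have [C HC] := choice H.
exists (\sum_i C i) => [|x z].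
  by rewrite sumr_ge0// => i _; have [] := HC i.
have -> : 'D_z f = \sum_i (z ord0 i *: 'D_(e i) f).
  apply/funext => y; rewrite fct_sumE derive_rV//.
have ddf i y v : derivable ('D_(e i) f) y v.
  by apply/diff_derivable/smc_differentiable/smc_derive.
rewrite derive_sum; last by move=> i; exact: derivableZ.
rewrite (le_trans (ler_norm_sum _ _ _))// mulr_suml; apply: ler_sum => i _.
rewrite deriveZ// normrZ expr2 mulrCA; have [C0 HCi] := HC i.
by rewrite ler_pM// coord_norm_le.
Qed.

Lemma line_diff (x z : 'rV[R]_N) :
  exists2 s : R, 0 < s < 1 & f (x + z) - f x = 'D_z f (x + s *: z).
Proof.
have [||s] := @MVT R (fun s => f (x + s *: z)) (fun s => 'D_z f (x + s *: z)) 0 1 ltr01.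
- by move=> s _; exact: is_derive_line.
- apply: continuous_subspaceT => s; apply: differentiable_continuous.
  by apply/derivable1_diffP; have [] := is_derive_line x z s df.
rewrite in_itv/= scale1r scale0r addr0 subr0 mulr1 => s01 E.
by exists s.
Qed.

Lemma lip_bound : exists2 C, 0 <= C &
  forall x z, `|f (x + z) - f x| <= C * `|z|.
Proof.
have [C C0 fC] := grad_bound sf f0; exists C => // x z.
by have [s _ ->] := line_diff x z.
Qed.

End taylor2.

Section taylor3.
Context {R : realType} {N : nat}.
Variables (f : 'rV[R]_N -> R) (r : R).
Hypotheses (sf : smc f) (f0 : forall x, r < `|x| -> f x = 0).

(** The mean value theorem twice: the increment of f is its derivative at x + s z, which differs
    from the derivative at x by s times a second derivative. *)
Lemma taylor_bound : exists2 C, 0 <= C &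
  forall x z, `|f (x + z) - f x - 'D_z f x| <= C * `|z| ^+ 2.
Proof.
have [C C0 fC] := hess_bound sf f0; exists C => // x z.
have [s /andP[s0 s1] ->] := line_diff sf x z.
have [t /andP[t0 t1] ->] := line_diff (smc_derive z sf) x (s *: z).
have dD y : differentiable ('D_z f) y by exact/smc_differentiable/smc_derive.
rewrite (deriveE _ (dD _)) linearZ -(deriveE _ (dD _)) normrZ gtr0_norm//.
by rewrite (le_trans _ (fC (x + t *: (s *: z)) z))// ler_piMl// ltW.
Qed.

(** Sum of the Taylor bounds for z and -z, whose first-order terms cancel. It makes the symmetric
    Levy integral converge without a compensator. *)
Lemma second_diff_bound : exists2 C, 0 <= C &
  forall x z, `|f (x + z) + f (x - z) - 2 * f x| <= C * `|z| ^+ 2.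
Proof.
have [C C0 fC] := taylor_bound; exists (2 * C) => [|x z]; first by rewrite mulr_ge0.
have df := smc_differentiable sf x.
have h1 := fC x z; have h2 := fC x (- z).
have e : 'D_(- z) f x = - 'D_z f x.
  by rewrite (deriveE _ df) linearN /= -(deriveE _ df).
rewrite (_ : _ - _ = (f (x + z) - f x - 'D_z f x) + (f (x - z) - f x - 'D_(- z) f x)).
  rewrite (le_trans (ler_normD _ _))// -mulrA mulr_natl mulr2n lerD//.
  by rewrite -[X in C * X ^+ 2]normrN.
by rewrite e; ring.
Qed.

End taylor3.

(** * Translations and second differences in L1 *)

Section shift_integral.
Context {R : realType} {N : nat}.
Local Notation m := (lebesgue_rV R N).
Implicit Types (f : 'rV[R]_N -> R) (z : 'rV[R]_N).

Lemma integral_shift (g : 'rV[R]_N -> \bar R) z : measurable_fun setT g ->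
  (\int[m]_x g (x + z)%R = \int[m]_x g x)%E.
Proof.
move=> mg; rewrite [LHS]integralE [RHS]integralE; congr (_ - _)%E.
  by apply: etrans (ge0_integral_shift z (measurable_funepos mg) _); [apply: eq_integral => x _; rewrite !funeposE|move=> x; exact: funepos_ge0].
by apply: etrans (ge0_integral_shift z (measurable_funeneg mg) _); [apply: eq_integral => x _; rewrite !funenegE|move=> x; exact: funeneg_ge0].
Qed.

Lemma integral_opp (g : 'rV[R]_N -> \bar R) : measurable_fun setT g ->
  (\int[m]_x g (- x)%R = \int[m]_x g x)%E.
Proof.
move=> mg; rewrite [LHS]integralE [RHS]integralE; congr (_ - _)%E.
  by apply: etrans (ge0_integral_opp (measurable_funepos mg) _); [apply: eq_integral => x _; rewrite !funeposE|move=> x; exact: funepos_ge0].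
by apply: etrans (ge0_integral_opp (measurable_funeneg mg) _); [apply: eq_integral => x _; rewrite !funenegE|move=> x; exact: funeneg_ge0].
Qed.

Lemma Rint_shift f z : measurable_fun setT f ->
  \int[m]_x f (x + z) = \int[m]_x f x.
Proof.
move=> mf; congr fine; apply: (@integral_shift (EFin \o f)).
exact/measurable_EFinP.
Qed.

Lemma Rint_opp f : measurable_fun setT f ->
  \int[m]_x f (- x) = \int[m]_x f x.
Proof.
move=> mf; congr fine; apply: (@integral_opp (EFin \o f)).
exact/measurable_EFinP.
Qed.

Lemma bmf_shift f z : bmf f -> bmf (fun x : 'rV[R]_N => f (x + z)).
Proof.
move=> [mf [C fC]]; split; last by exists C.
by apply: measurableT_comp => //; exact: measurable_shift_rV.
Qed.

Lemma bmf_opp f : bmf f -> bmf (fun x : 'rV[R]_N => f (- x)).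
Proof.
move=> [mf [C fC]]; split; last by exists C.
by apply: measurableT_comp => //; exact: measurable_opp_rV.
Qed.

Lemma L1b_shift f z : L1b m f -> L1b m (fun x : 'rV[R]_N => f (x + z)).
Proof.
move=> [bf /integrableP[mf jf]]; split; first exact: bmf_shift.
apply/integrableP; split; first by apply/measurable_EFinP; case: (bmf_shift z bf).
by rewrite (integral_shift z (g := fun x : 'rV[R]_N => `|(f x)%:E|%E))//; exact: measurableT_comp.
Qed.

Lemma L1b_opp f : L1b m f -> L1b m (fun x : 'rV[R]_N => f (- x)).
Proof.
move=> [bf /integrableP[mf jf]]; split; first exact: bmf_opp.
apply/integrableP; split; first by apply/measurable_EFinP; case: (bmf_opp bf).
by rewrite (integral_opp (g := fun x : 'rV[R]_N => `|(f x)%:E|%E))//; exact: measurableT_comp.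
Qed.

Lemma L1b_supp f C r : measurable_fun setT f -> (forall x, `|f x| <= C) ->
  (forall x, r < `|x| -> f x = 0) ->
  L1b m f /\ \int[m]_x `|f x| <= C * fine (m (cube r)).
Proof.
move=> mf fC f0.
have C0 : 0 <= C by rewrite (le_trans _ (fC 0)).
have mC := @cube_measurable R N r.
have fE x : `|f x| <= C * \1_(cube r) x.
  have [xr|xr] := leP `|x| r; last by rewrite f0// normr0 mulr_ge0.
  by rewrite indicE mem_set// mulr1.
have jC : m.-integrable setT (fun x => (C * \1_(cube r) x)%:E).
  rewrite (_ : (fun _ => _) = fun x => (C%:E * (\1_(cube r) x)%:E)%E)//.
  apply: integrableZl => //; apply/integrableP; split.
    by apply/measurable_EFinP; exact: measurable_indic.
  under eq_integral do rewrite gee0_abs ?lee_fin//.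
  by rewrite integral_indic// setIT cube_finite.
have Lf : L1b m f.
  split; first by split=> //; exists C.
  apply: le_integrable jC => //; first exact/measurable_EFinP.
  by move=> x _ /=; rewrite lee_fin (le_trans (fE x))// ler_norm.
split=> //.
have -> : C * fine (m (cube r)) = \int[m]_x (C * \1_(cube r) x).
  rewrite /Rintegral; under eq_integral do rewrite EFinM.
  rewrite ge0_integralZl//; last first.
    by apply/measurable_EFinP; exact: measurable_indic.
  by rewrite integral_indic// setIT fineM// ge0_fin_numE ?cube_finite.
by apply: le_Rintegral => //; exact: (L1b_int (L1b_norm Lf)).
Qed.

End shift_integral.

Section kernels.
Context {R : realType} {N : nat}.
Local Notation m := (lebesgue_rV R N).
Implicit Types (f : 'rV[R]_N -> R) (x y z : 'rV[R]_N).

Definition sdiff f z x := f (x + z) + f (x - z) - 2 * f x.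

(** What the discretisation of the generator uses of a kernel, in the sup norm and in L1 alike. One
    constant serves all bounds, so that a single J can be chosen for all kernels sharing it. *)
Definition kernel_const f (C : R) : Prop :=
  [/\ forall x, `|f x| <= C, \int[m]_x `|f x| <= C,
      forall x y z, `|f (x + z) - f (x + y)| <= C * `|z - y| &
      forall y z, \int[m]_x `|f (x + z) - f (x + y)| <= C * `|z - y|] /\
  (forall x z, `|sdiff f z x| <= C * Num.min 1 (`|z| ^+ 2)) /\
  (forall z, \int[m]_x `|sdiff f z x| <= C * Num.min 1 (`|z| ^+ 2)).

Lemma L1b_sdiff f z : L1b m f -> L1b m (sdiff f z).
Proof.
move=> Lf; apply: L1bB; last exact: L1bZ.
by apply: L1bD; exact: L1b_shift.
Qed.

Lemma sdiff_L1 f z : L1b m f -> \int[m]_x `|sdiff f z x| <= 4 * \int[m]_x `|f x|.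
Proof.
move=> Lf.
have L1 := L1b_norm (L1b_shift z Lf).
have L2 := L1b_norm (L1b_shift (- z) Lf).
have L3 := L1b_norm Lf; have L3' := L1bZ 2 L3.
have L12 := L1bD L1 L2.
apply: (@le_trans _ _ (\int[m]_x (`|f (x + z)| + `|f (x - z)| + 2 * `|f x|))).
  apply: le_Rint; first exact/L1b_norm/L1b_sdiff.
    exact: L1bD.
  move=> x; rewrite /sdiff (le_trans (ler_normB _ _))// lerD ?ler_normD//.
  by rewrite normrM (ger0_norm (ler0n _ 2)).
have mf : measurable_fun setT (fun x => `|f x|) by case: L3 => -[].
rewrite RintD// RintD// RintZ//.
rewrite (Rint_shift z (f := fun x => `|f x|))// (Rint_shift (- z) (f := fun x => `|f x|))//.
by rewrite le_eqVlt; apply/orP; left; apply/eqP; ring.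
Qed.

(** For |z| <= 1 the differences of f live in a cube enlarged by 1, so pointwise bounds give L1
    bounds; for |z| > 1 translation invariance bounds them by a multiple of the L1 norm of f. *)
Lemma smc_kernel f r : smc f -> (forall x, r < `|x| -> f x = 0) ->
  L1b m f /\ exists C, kernel_const f C.
Proof.
move=> sf f0.
have mf : measurable_fun setT f by apply: continuous_measurable_rV; exact: smc_continuous.
have [C0 C00 fC0] := smc_bound sf f0.
have [C1 C10 fC1] := lip_bound sf f0.
have [C2 C20 fC2] := second_diff_bound sf f0.
have [Lf If] := L1b_supp mf fC0 f0.
split=> //.
set M := fine (m (cube (r + 1))).
have M0 : 0 <= M by rewrite fine_ge0.
have I0 : 0 <= \int[m]_x `|f x| by exact: Rint_ge0.
set I := \int[m]_x `|f x| in I0 *.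
have out v x : `|v| <= 1 -> r + 1 < `|x| -> f (x + v) = 0.
  move=> v1 xr; apply: f0; have := ler_normD (x + v) (- v).
  by rewrite addrK normrN; lra.
have lip z : \int[m]_x `|f (x + z) - f x| <= (C1 * M + 2 * I) * `|z|.
  have Lz := L1b_shift z Lf.
  have [z1|z1] := leP `|z| 1.
    have [] := @L1b_supp R N (fun x : 'rV[R]_N => f (x + z) - f x) (C1 * `|z|) (r + 1) => //.
    - by case: (L1bB Lz Lf) => -[].
    - move=> x xr; rewrite out// f0 ?subr0//.
      by apply: le_lt_trans xr; rewrite lerDl.
    move=> _ /le_trans; apply; rewrite -/M mulrAC ler_wpM2r// lerDl.
    by rewrite mulr_ge0.
  apply: (@le_trans _ _ (2 * I)); last first.
    rewrite -[leLHS]mulr1; apply: ler_pM => //; [exact: mulr_ge0| |exact: ltW].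
    by rewrite lerDr; exact: mulr_ge0.
  apply: (@le_trans _ _ (\int[m]_x (`|f (x + z)| + `|f x|))).
    apply: le_Rint; first exact/L1b_norm/L1bB.
      by apply: L1bD; exact: L1b_norm.
    by move=> x; exact: ler_normB.
  rewrite RintD ?(Rint_shift z (f := fun x => `|f x|))//; try exact: L1b_norm.
    by rewrite mulr_natl mulr2n.
  by case: (L1b_norm Lf) => -[].
have sd z : \int[m]_x `|sdiff f z x| <= (C2 * M + 4 * I) * Num.min 1 (`|z| ^+ 2).
  have [z1|z1] := leP `|z| 1.
    rewrite min_r; last by rewrite exprn_ile1.
    have [] := @L1b_supp R N (sdiff f z) (C2 * `|z| ^+ 2) (r + 1) => //.
    - by case: (L1b_sdiff z Lf) => -[].
    - by move=> x; exact: fC2.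
    - move=> x xr; rewrite /sdiff !out// ?normrN// f0 ?mulr0 ?addr0 ?subr0//.
      by apply: le_lt_trans xr; rewrite lerDl.
    move=> _ /le_trans; apply; rewrite -/M mulrAC ler_wpM2r ?sqr_ge0// lerDl.
    by rewrite mulr_ge0.
  rewrite min_l; last by rewrite exprn_ege1// ltW.
  rewrite mulr1 (le_trans (sdiff_L1 z Lf))// lerDr.
  exact: mulr_ge0.
exists (C0 + I + (C1 + C1 * M + 2 * I) + (C2 + 4 * C0 + C2 * M + 4 * I)).
have P1 : 0 <= C1 * M by exact: mulr_ge0.
have P2 : 0 <= C2 * M by exact: mulr_ge0.
set D := _ + _.
have DC0 : C0 <= D by rewrite /D; lra.
have DI : I <= D by rewrite /D; lra.
have DC1 : C1 <= D by rewrite /D; lra.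
have DC2 : C2 + 4 * C0 <= D by rewrite /D; lra.
have D1 : C1 * M + 2 * I <= D by rewrite /D; lra.
have D2 : C2 * M + 4 * I <= D by rewrite /D; lra.
have m0 z : 0 <= Num.min 1 (`|z| ^+ 2) by rewrite le_min ler01 sqr_ge0.
split; [split|split].
- by move=> x; exact: le_trans DC0.
- exact: DI.
- move=> x y z; have -> : x + z = (x + y) + (z - y) by rewrite addrACA subrr addr0.
  by rewrite (le_trans (fC1 _ _))// ler_wpM2r.
- move=> y z; apply: (@le_trans _ _ (\int[m]_x `|f (x + (z - y)) - f x|)).
    have mg : measurable_fun setT (fun x : 'rV[R]_N => `|f (x + (z - y)) - f x|).
      by case: (L1b_norm (L1bB (L1b_shift (z - y) Lf) Lf)) => -[].
    rewrite -[leRHS](Rint_shift y mg) le_eqVlt; apply/orP; left; apply/eqP.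
    apply: eq_Rint => x; congr (`|f _ - _|).
    by rewrite -addrA [y + _]addrC subrK.
  by rewrite (le_trans (lip _))// ler_wpM2r.
- move=> x z; have [z1|z1] := leP `|z| 1.
    rewrite min_r; last by rewrite exprn_ile1.
    rewrite (le_trans (fC2 _ _))// ler_wpM2r ?sqr_ge0// (le_trans _ DC2)// lerDl.
    by rewrite mulr_ge0.
  rewrite min_l; last by rewrite exprn_ege1// ltW.
  rewrite mulr1 (le_trans _ DC2)// /sdiff.
  have := fC0 x; have := fC0 (x + z); have := fC0 (x - z).
  rewrite !ler_norml => /andP[? ?] /andP[? ?] /andP[? ?].
  by apply/andP; split; lra.
- by move=> z; rewrite (le_trans (sd _))// ler_wpM2r.
Qed.

End kernels.

(** * Auxiliary facts on integrals and a countable dense set *)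

Section l1_tools.
Context d (X : measurableType d) (R : realType) (m : {measure set X -> \bar R}).
Implicit Types f g : X -> R.

Lemma measurable_sumr (I : Type) (s : seq I) (F : I -> X -> R) :
  (forall i, measurable_fun setT (F i)) ->
  measurable_fun setT (fun x => \sum_(i <- s) F i x).
Proof.
move=> mF; elim: s => [|i s IH]; under eq_fun do rewrite ?big_nil ?big_cons.
  exact: measurable_cst.
exact: measurable_funD.
Qed.

Lemma L1bE f : L1b m f ->
  (\int[m]_x `|f x|%:E = (\int[m]_x `|f x|)%:E)%E.
Proof.
move=> /L1b_norm [_ jf]; rewrite /Rintegral fineK//.
exact: (integrable_fin_num _ jf).
Qed.

Lemma L1b_of f c : bmf f -> (\int[m]_x `|f x|%:E <= c%:E)%E ->
  L1b m f /\ \int[m]_x `|f x| <= c.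
Proof.
move=> bf fc.
have Lf : L1b m f.
  split=> //; apply/integrableP; split; first by apply/measurable_EFinP; case: bf.
  by rewrite (le_lt_trans fc)// ltry.
by split=> //; rewrite -lee_fin -L1bE.
Qed.

(** Dominated convergence with majorant |K|. Points where K vanishes are exempt, which admits cubes
    shrinking to the origin when K is the Levy weight. *)
Lemma integrable_setI_cvg0 (K : X -> R) (A : nat -> set X) :
  m.-integrable setT (EFin \o K) -> (forall n, measurable (A n)) ->
  (forall x, K x = 0 \/ \forall n \near \oo, ~ A n x) ->
  forall e, 0 < e -> exists n, (\int[m]_(x in A n) `|K x|%:E < e%:E)%E.
Proof.
move=> jK mA H e e0.
have mK : measurable_fun setT K by apply/measurable_EFinP; case/integrableP: jK.
have [] := @dominated_convergence _ _ _ m setT measurableT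
    (fun n x => (`|K x| * \1_(A n) x)%:E) (cst 0%E) (fun x => `|K x|%:E).
- move=> n; apply/measurable_EFinP; apply: measurable_funM.
    exact: measurableT_comp.
  exact: measurable_indic.
- exact: measurable_cst.
- apply: aeW => x _; have [K0|An] := H x.
    by rewrite K0 normr0; under eq_fun do rewrite mul0r; exact: cvg_cst.
  apply: cvg_near_cst; apply: filterS An => n nA.
  by rewrite indicE memNset// mulr0.
- rewrite (_ : (fun _ => _) = abse \o (EFin \o K)); first exact: integrable_abse.
  by apply/funext => x.
- apply: aeW => x n _; rewrite gee0_abs ?lee_fin ?mulr_ge0//.
  by rewrite ler_piMr// indicE; case: (_ \in _).
move=> _ _; rewrite integral0 => /fine_cvgP[] /= [k _ _] /cvgr_lt/(_ e e0) [n _ nE].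
have := nE n (leqnn n) => /=.
have E : (\int[m]_x (`|K x| * \1_(A n) x)%:E = \int[m]_(x in A n) `|K x|%:E)%E.
  rewrite [RHS]integral_mkcond; apply: eq_integral => x _.
  by rewrite patchE indicE; case: ifPn => _; rewrite ?mulr1 ?mulr0.
rewrite E => h; exists n; rewrite -[ltLHS]fineK ?lte_fin//.
rewrite ge0_fin_numE ?integral_ge0//.
apply: (@le_lt_trans _ _ (\int[m]_x `|(EFin \o K) x|)%E); last by case/integrableP: jK.
by apply: ge0_subset_integral => //=; do 2 apply: measurableT_comp => //.
Qed.

End l1_tools.

Section parametric.
Context d1 d2 (X : measurableType d1) (Y : measurableType d2) (R : realType).
Variable m : {sigma_finite_measure set Y -> \bar R}.

(** No integrability is asked: the integrals of the positive and negative parts are measurable by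
    Tonelli, and [fine] gives their difference a value everywhere. *)
Lemma measurable_Rint (F : X * Y -> R) : measurable_fun setT F ->
  measurable_fun setT (fun x => \int[m]_y F (x, y)).
Proof.
move=> mF; apply: (measurableT_comp (f := fine)) => //.
have mE : measurable_fun setT (EFin \o F) by exact/measurable_EFinP.
rewrite (_ : (fun _ => _) = fun x =>
   (\int[m]_y (EFin \o F)^\+ (x, y) - \int[m]_y (EFin \o F)^\- (x, y))%E).
  apply: emeasurable_funB.
    apply: (measurable_fun_fubini_tonelli_F (m2 := m)) => //.
    exact: measurable_funepos.
  apply: (measurable_fun_fubini_tonelli_F (m2 := m)) => //.
  exact: measurable_funeneg.
apply/funext => x; rewrite integralE; congr (_ - _)%E.
  by apply: eq_integral => y _; rewrite !funeposE.
by apply: eq_integral => y _; rewrite !funenegE.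
Qed.

End parametric.

Section rational_points.
Context {R : realType} {N : nat}.

(** An enumeration of the rational points; codes that decode to nothing get the default value 0. *)
Definition ratpt (j : nat) : 'rV[R]_N :=
  if @unpickle 'rV[rat]_N j is Some q then map_mx ratr q else 0.

Lemma ratpt_dense (z : 'rV[R]_N) (e : R) : 0 < e -> exists j, `|z - ratpt j| < e.
Proof.
move=> e0.
have q_ i : {q : rat | `|z ord0 i - ratr q| < e / 2}.
  apply: cid; have [q] : exists q, ratr q \in `](z ord0 i - e / 2), (z ord0 i + e / 2)[.
    by apply: rat_in_itvoo; rewrite ltrD2l gtrN// divr_gt0.
  by rewrite in_itv/= => /andP[q1 q2]; exists q; rewrite ltr_distlC q1 q2.
pose q : 'rV[rat]_N := \row_i sval (q_ i).
exists (pickle q); rewrite /ratpt pickleK.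
apply: (@le_lt_trans _ _ (e / 2)); last by rewrite ltr_pdivrMr// ltr_pMr// ltr1n.
rewrite rV_norm_le ?divr_ge0 ?ltW//; apply/forallP => i; rewrite !mxE.
by rewrite ltW//; exact: svalP (q_ i).
Qed.

End rational_points.

(** * The Levy measure and its symmetric generator *)

Section levy.
Context {R : realType} {N : nat}.
Variable mu : {measure set 'rV[R]_N -> \bar R}.
Hypotheses (mu_even : even_punctured mu) (mu_levy : levy_integrable mu).
Implicit Types z : 'rV[R]_N.

(** The Levy weight in the sup norm; the passage from the Euclidean norm costs a factor N, paid in
    [levy_op_gen]. *)
Definition lw z : R := Num.min 1 (`|z| ^+ 2).
Local Notation D := (~` [set (0 : 'rV[R]_N)]).

Lemma lw_ge0 z : 0 <= lw z. Proof. by rewrite /lw le_min ler01 sqr_ge0. Qed.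

Lemma lw0 : lw 0 = 0.
Proof. by rewrite /lw normr0 expr0n /= min_r. Qed.

Lemma lw_measurable : measurable_fun setT lw.
Proof.
apply: measurable_minr; first exact: measurable_cst.
apply: measurable_funX; exact: norm_measurable.
Qed.

Lemma measurable_D : measurable D.
Proof.
apply: measurableC; rewrite (_ : [set 0] = cube 0); first exact: cube_measurable.
by apply/seteqP; split=> x /=; rewrite /cube /= normr_le0 => /eqP.
Qed.

Lemma enorm_sqr z : enorm z ^+ 2 = \sum_i z ord0 i ^+ 2.
Proof. by rewrite sqr_sqrtr// sumr_ge0// => i _; exact: sqr_ge0. Qed.

Lemma enorm_ge0 z : 0 <= enorm z. Proof. exact: sqrtr_ge0. Qed.

Lemma norm_le_enorm z : `|z| <= enorm z.
Proof.
rewrite rV_norm_le ?enorm_ge0//; apply/forallP => i.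
rewrite -(@ler_pXn2r _ 2) ?nnegrE ?enorm_ge0// enorm_sqr real_normK ?num_real//.
by rewrite (bigD1 i)//= lerDl sumr_ge0// => j _; exact: sqr_ge0.
Qed.

Lemma enorm_le z : enorm z ^+ 2 <= N%:R * `|z| ^+ 2.
Proof.
rewrite enorm_sqr -[N in N%:R]card_ord mulr_natl -sumr_const.
apply: ler_sum => i _; rewrite -real_normK ?num_real//.
by rewrite ler_pXn2r ?nnegrE// coord_norm_le.
Qed.

Lemma enorm_measurable : measurable_fun setT (@enorm R N).
Proof.
rewrite (_ : @enorm R N = Num.sqrt \o (fun z => \sum_i z ord0 i ^+ 2))//.
apply: measurableT_comp; first exact: (continuous_measurable_fun (@sqrt_continuous R)).
apply: measurable_sumr => i; apply: measurable_funX; exact: coord_measurable.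
Qed.

Lemma enorm_set_measurable (P : R -> bool) :
  measurable_fun setT P -> measurable [set z : 'rV[R]_N | P (enorm z)].
Proof.
move=> mP; have := measurableT_comp mP enorm_measurable => /(_ measurableT [set true]).
by rewrite setTI; apply.
Qed.


Lemma enorm_opp z : enorm (- z) = enorm z.
Proof. by congr Num.sqrt; apply: eq_bigr => i _; rewrite mxE sqrrN. Qed.

Lemma enorm_gt0 z : D z -> 0 < enorm z.
Proof.
move=> z0; apply: lt_le_trans (norm_le_enorm z); rewrite normr_gt0.
exact/eqP.
Qed.

Lemma levy_lw : (\int[mu]_(z in D) (lw z)%:E < +oo)%E.
Proof.
pose A := [set z : 'rV[R]_N | (0 < enorm z <= 1)%R].
pose B := [set z : 'rV[R]_N | (1 < enorm z)%R].
have mA : measurable A.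
  apply: (enorm_set_measurable (P := fun t => (0 < t <= 1)%R)).
  by apply: measurable_and; [exact: measurable_fun_ltr|exact: measurable_fun_ler].
have mB : measurable B.
  apply: (enorm_set_measurable (P := fun t => (1 < t)%R)).
  exact: measurable_fun_ltr.
have mlw E : measurable_fun E (fun z => (lw z)%:E).
  by apply: measurable_funTS; apply/measurable_EFinP; exact: lw_measurable.
have DAB : D `<=` A `|` B.
  move=> z /enorm_gt0 z0; rewrite /A /B /=.
  by have [z1|z1] := leP (enorm z) 1; [left; rewrite z0|right].
have lw0' z : (0 <= (lw z)%:E)%E by rewrite lee_fin lw_ge0.
apply: (@le_lt_trans _ _ (\int[mu]_(z in A `|` B) (lw z)%:E)%E).
  by apply: ge0_subset_integral => //; [exact: measurable_D|exact: measurableU].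
rewrite ge0_integral_setU//; last first.
  apply/disj_setPS => z [/= /andP[_ h]]; rewrite /B /= => /lt_le_trans/(_ h).
  by rewrite ltxx.
apply: le_lt_trans mu_levy; apply: leeD; apply: ge0_le_integral => //.
- apply: measurable_funTS; apply/measurable_EFinP; apply: measurable_funX.
  exact: enorm_measurable.
- move=> z _; rewrite lee_fin (@le_trans _ _ (`|z| ^+ 2))//.
    by rewrite /lw ge_min lexx orbT.
  by rewrite ler_pXn2r ?nnegrE ?enorm_ge0// norm_le_enorm.
- by move=> z _; rewrite lee_fin /lw ge_min lexx.
Qed.

(** Chebyshev's inequality: for |z| > r the weight is at least min (1, r^2). *)
Lemma levy_tail (r : R) : 0 < r ->
  (mu (D `&` [set z : 'rV[R]_N | (r < `|z|)%R]) < +oo)%E.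
Proof.
move=> r0; set B := _ `&` _.
have mB : measurable B.
  apply: measurableI; first exact: measurable_D.
  rewrite (_ : mkset _ = ~` cube r); first by apply: measurableC; exact: cube_measurable.
  by apply/seteqP; split=> z /=; rewrite /cube /= ltNge => /negP.
pose c := Num.min 1 (r ^+ 2).
have c0 : 0 < c by rewrite lt_min ltr01 exprn_gt0.
have H : (c%:E * mu B <= \int[mu]_(z in D) (lw z)%:E)%E.
  rewrite -integral_cst//.
  apply: (@le_trans _ _ (\int[mu]_(z in B) (lw z)%:E)%E).
    apply: ge0_le_integral => //.
    - by move=> z _; rewrite lee_fin ltW.
    - by apply: measurable_funTS; apply/measurable_EFinP; exact: lw_measurable.
    - move=> z [_ /= rz]; rewrite lee_fin /c /lw.
      rewrite le_min ge_min lexx/= ge_min ler_pXn2r ?nnegrE ?(ltW r0)//.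
      by rewrite (ltW rz) orbT.
  apply: ge0_subset_integral => //.
  - exact: measurable_D.
  - by apply: measurable_funTS; apply/measurable_EFinP; exact: lw_measurable.
  - by move=> z _; rewrite lee_fin lw_ge0.
  - by move=> z [].
have := le_lt_trans H levy_lw.
case: (mu B) => [x _|h|//]; first exact: ltry.
by move: h; rewrite gt0_muley ?lte_fin// ltxx.
Qed.

(** The restriction of [mu] to the complement of 0, made sigma-finite for the sake of Fubini: the
    sets {0} and |z| > 1/(n + 1) exhaust the space, the former being null for the restriction and
    the latter of finite mass. *)
Lemma punctured_measure : exists nu : {sigma_finite_measure set 'rV[R]_N -> \bar R},
  forall A, measurable A -> nu A = mu (A `&` D).
Proof.
pose nu0 : {measure set 'rV[R]_N -> \bar R} := mrestr mu measurable_D.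
have sf : sigma_finite setT nu0.
  exists (fun n => [set 0] `|` [set z : 'rV[R]_N | (n.+1%:R^-1 < `|z|)%R]).
    apply/seteqP; split=> // z _.
    have [->|z0] := eqVneq z 0; first by exists 0%N => //; left.
    have z1 : 0 < `|z| by rewrite normr_gt0.
    exists (Num.truncn `|z|^-1) => //; right => /=.
    rewrite -[ltRHS]invrK ltf_pV2 ?posrE ?invr_gt0 ?ltr0n//.
    exact: truncnS_gt.
  move=> n; have mF : measurable ([set 0] `|` [set z : 'rV[R]_N | (n.+1%:R^-1 < `|z|)%R]).
    apply: measurableU.
      rewrite -[X in measurable X]setCK; by apply: measurableC; exact: measurable_D.
    rewrite (_ : mkset _ = ~` cube n.+1%:R^-1).
      by apply: measurableC; exact: cube_measurable.
    by apply/seteqP; split=> z /=; rewrite /cube /= ltNge => /negP.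
  split=> //; rewrite /nu0 /= /mrestr setIUl.
  rewrite (_ : [set 0] `&` D = set0) ?set0U; last by rewrite setICr.
  by rewrite setIC; apply: levy_tail; rewrite invr_gt0.
pose nu : {sigma_finite_measure set 'rV[R]_N -> \bar R} :=
  HB.pack_for {sigma_finite_measure set 'rV[R]_N -> \bar R} (Measure.sort nu0)
    (Measure_isSigmaFinite.Build _ _ _ nu0 sf).
by exists nu.
Qed.

End levy.

Section levy_weight.
Context {R : realType} {N : nat}.
Variable nu : {sigma_finite_measure set 'rV[R]_N -> \bar R}.
Hypothesis ilw : nu.-integrable setT (EFin \o @lw R N).
Implicit Types z : 'rV[R]_N.

Lemma integrable_le_lw (g : 'rV[R]_N -> R) C : measurable_fun setT g ->
  (forall z, `|g z| <= C * lw z) -> nu.-integrable setT (EFin \o g).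
Proof.
move=> mg gC.
apply: (@le_integrable _ _ _ _ _ measurableT _ (EFin \o (fun z => C * lw z))).
- exact/measurable_EFinP.
- by move=> z _ /=; rewrite lee_fin (le_trans (gC z))// ler_norm.
- rewrite (_ : _ \o _ = fun z => (C%:E * (EFin \o @lw R N) z)%E)//.
  by apply: integrableZl => //; exact: ilw.
Qed.

(** The generator in symmetric form: for kernels it converges absolutely without a gradient term. *)
Definition gen (f : 'rV[R]_N -> R) (x : 'rV[R]_N) := \int[nu]_z (2^-1 * sdiff f z x).

Lemma measurable_sdiff (f : 'rV[R]_N -> R) : measurable_fun setT f ->
  measurable_fun [set: 'rV[R]_N * 'rV[R]_N] (fun p => sdiff f p.2 p.1).
Proof.
move=> mf.
have mp : measurable_fun [set: 'rV[R]_N * 'rV[R]_N] (fun p => p.1 + p.2 : 'rV[R]_N).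
  apply: measurable_rV => i.
  rewrite (_ : (fun _ => _) = fun p : 'rV[R]_N * 'rV[R]_N => p.1 ord0 i + p.2 ord0 i).
    apply: measurable_funD.
      exact: (measurableT_comp (coord_measurable i) measurable_fst).
    exact: (measurableT_comp (coord_measurable i) measurable_snd).
  by apply/funext => p; rewrite mxE.
have mn : measurable_fun [set: 'rV[R]_N * 'rV[R]_N] (fun p => p.1 - p.2 : 'rV[R]_N).
  apply: measurable_rV => i.
  rewrite (_ : (fun _ => _) = fun p : 'rV[R]_N * 'rV[R]_N => p.1 ord0 i - p.2 ord0 i).
    apply: measurable_funB.
      exact: (measurableT_comp (coord_measurable i) measurable_fst).
    exact: (measurableT_comp (coord_measurable i) measurable_snd).
  by apply/funext => p; rewrite !mxE.
rewrite /sdiff; apply: measurable_funB.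
  by apply: measurable_funD; exact: measurableT_comp.
apply: measurable_funM; first exact: measurable_cst.
exact: (measurableT_comp mf measurable_fst).
Qed.

Lemma measurable_sdiff_x (f : 'rV[R]_N -> R) x : measurable_fun setT f ->
  measurable_fun setT (fun z => sdiff f z x).
Proof.
move=> /measurable_sdiff mf.
exact: (measurableT_comp mf (measurable_pair1 x)).
Qed.

Lemma measurable_gen f : measurable_fun setT f -> measurable_fun setT (gen f).
Proof.
move=> mf; apply: (measurable_Rint nu (F := fun p => 2^-1 * sdiff f p.2 p.1)).
by apply: measurable_funM; [exact: measurable_cst|exact: measurable_sdiff].
Qed.

Lemma integrable_sdiff f C x : measurable_fun setT f -> kernel_const f C ->
  nu.-integrable setT (EFin \o (fun z => 2^-1 * sdiff f z x)).
Proof.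
move=> mf [_ [fC _]]; apply: (@integrable_le_lw _ (2^-1 * C)).
  by apply: measurable_funM; [exact: measurable_cst|exact: measurable_sdiff_x].
by move=> z; rewrite normrM gtr0_norm ?invr_gt0// -mulrA ler_pM2l ?invr_gt0//.
Qed.

End levy_weight.

Section levy_symmetric.
Context {R : realType} {N : nat}.
Variable mu : {measure set 'rV[R]_N -> \bar R}.
Hypotheses (mu_even : even_punctured mu) (mu_levy : levy_integrable mu).
Variable nu : {sigma_finite_measure set 'rV[R]_N -> \bar R}.
Local Notation D := (~` [set (0 : 'rV[R]_N)]).
Hypothesis nuE : forall A, measurable A -> nu A = mu (A `&` D).
Implicit Types z : 'rV[R]_N.
Let mD : measurable D := @measurable_D R N.

Lemma nu0 : nu [set 0] = 0%E.
Proof.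
rewrite nuE ?setICr//.
by rewrite -[X in measurable X]setCK; apply: measurableC.
Qed.

Lemma integral_nu (g : 'rV[R]_N -> \bar R) : measurable_fun setT g ->
  (\int[nu]_z g z = \int[mu]_(z in D) g z)%E.
Proof.
move=> mg; have m0 : measurable [set (0 : 'rV[R]_N)].
  by rewrite -[X in measurable X]setCK; apply: measurableC.
have H (h : 'rV[R]_N -> \bar R) : measurable_fun setT h -> (forall z, (0 <= h z)%E) ->
    (\int[nu]_z h z = \int[mu]_(z in D) h z)%E.
  move=> mh h0; rewrite (ge0_negligible_integral (N := [set (0 : 'rV[R]_N)]))//; last exact: nu0.
  rewrite setTD; apply: eq_measure_integral => A mA AD.
  by apply: etrans (nuE _) _ => //; congr (mu _); exact/setIidl.
rewrite integralE [RHS]integralE !H//.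
  exact: measurable_funeneg.
exact: measurable_funepos.
Qed.

Lemma Rintegral_nu (g : 'rV[R]_N -> R) : measurable_fun setT g ->
  \int[nu]_z g z = \int[mu]_(z in D) g z.
Proof. by move=> mg; congr fine; apply: integral_nu; exact/measurable_EFinP. Qed.

Lemma integral_nu_opp (g : 'rV[R]_N -> \bar R) : measurable_fun setT g ->
  (\int[nu]_z g (- z)%R = \int[nu]_z g z)%E.
Proof.
move=> mg.
have H (h : 'rV[R]_N -> \bar R) : measurable_fun setT h -> (forall z, (0 <= h z)%E) ->
    (\int[nu]_z h (- z)%R = \int[nu]_z h z)%E.
  move=> mh h0.
  have := @ge0_integral_pushforward _ _ _ _ R _ (@measurable_opp_rV R N) nu setT h
    measurableT mh (fun y _ => h0 y).
  rewrite preimage_setT => <-.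
  apply: eq_measure_integral => [|pf A mA _]; first exact: measurable_opp_rV.
  rewrite /= /pushforward nuE; last first.
    by rewrite -[X in measurable X]setTI; exact: measurable_opp_rV.
  rewrite nuE//.
  (* Evenness of [mu] is stated for sets that avoid 0, so it is applied to the intersection with
     [D]. *)
  have mAD : measurable (A `&` D) by exact: measurableI.
  rewrite -(mu_even mAD); last by move=> z [].
  congr (mu _); apply/seteqP; split=> z /=.
    move=> [Az z0]; exists (- z); rewrite ?opprK//; split=> //.
    by move=> /eqP; rewrite oppr_eq0 => /eqP.
  move=> [y [Ay y0] <-]; rewrite opprK; split=> //.
  by move=> /eqP; rewrite oppr_eq0 => /eqP.
rewrite integralE [RHS]integralE; congr (_ - _)%E.
  rewrite -(H (fun z => g^\+%E z))//; last exact: measurable_funepos.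
  by apply: eq_integral => z _; rewrite !funeposE.
rewrite -(H (fun z => g^\-%E z))//; last exact: measurable_funeneg.
by apply: eq_integral => z _; rewrite !funenegE.
Qed.

Lemma integrable_lw : nu.-integrable setT (EFin \o @lw R N).
Proof.
apply/integrableP; split; first by apply/measurable_EFinP; exact: lw_measurable.
rewrite integral_nu; last first.
  by do 2 apply: measurableT_comp => //; exact: lw_measurable.
by under eq_integral do rewrite /= ger0_norm ?lw_ge0//; exact: levy_lw.
Qed.

(** The integrand is averaged over z and -z, which have equal integrals by evenness; the gradient
    term with its cutoff is odd and cancels. *)
Lemma levy_op_gen (f : 'rV[R]_N -> R) r : smc f -> (forall x, r < `|x| -> f x = 0) ->
  forall x, levy_op mu f x = gen nu f x.
Proof.
move=> sf f0 x.
have cf := smc_continuous sf.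
have mf : measurable_fun setT f by exact: continuous_measurable_rV.
have df := smc_differentiable sf.
have [Lf [C0 KC]] := smc_kernel sf f0.
have [C C_ge0 fC] := taylor_bound sf f0.
have [M M0 fM] := smc_bound sf f0.
pose A z := f (x + z) - f x - (\sum_i z ord0 i * grad f x ord0 i) * (enorm z <= 1)%R%:R.
have gradE z : \sum_i z ord0 i * grad f x ord0 i = 'D_z f x.
  by rewrite derive_rV//; apply: eq_bigr => i _; rewrite mxE.
have mshift : measurable_fun setT (fun z => f (x + z)).
  rewrite (_ : (fun _ => _) = f \o (fun z => z + x)).
    by apply: measurableT_comp => //; exact: measurable_shift_rV.
  by apply/funext => z /=; rewrite addrC.
have mA : measurable_fun setT A.
  apply: measurable_funB; first by apply: measurable_funB => //; exact: measurable_cst.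
  apply: measurable_funM.
    apply: measurable_sumr => i; apply: measurable_funM; first exact: coord_measurable.
    exact: measurable_cst.
  rewrite (_ : (fun _ => _) = \1_[set z : 'rV[R]_N | (enorm z <= 1)%R]).
    apply: measurable_indic; apply: (enorm_set_measurable (P := fun t => t <= 1)).
    exact: measurable_fun_ler.
  by apply/funext => z; rewrite indicE; congr (_%:R); rewrite mem_setE.
have AC z : `|A z| <= (C + 2 * M * N%:R) * lw z.
  rewrite /A gradE; have [z1|z1] := leP (enorm z) 1.
    have z1' : `|z| <= 1 by exact: le_trans (norm_le_enorm z) _.
    rewrite mulr1 /lw min_r ?exprn_ile1//.
    rewrite (le_trans (fC _ _))// ler_wpM2r ?sqr_ge0// lerDl.
    by rewrite !mulr_ge0.
  rewrite mulr0 subr0.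
  (* Where the Euclidean norm exceeds 1 the sup norm may be below 1, but N |z|^2 exceeds 1, so N
     times the weight is still at least 1. *)
  have h1 : 1 <= N%:R * lw z.
    rewrite /lw; have := enorm_le z; have : 1 < enorm z ^+ 2 by rewrite exprn_egt1.
    case: (leP 1 (`|z| ^+ 2)) => h h1 h2; last by rewrite ltW// (lt_le_trans h1).
    rewrite mulr1 ler1n lt0n; apply/eqP => N0.
    have N00 : N%:R = 0 :> R by rewrite N0.
    by move: h2; rewrite N00 mul0r => /(lt_le_trans h1); rewrite ltNge ler01.
  rewrite (le_trans (ler_normB _ _))// (@le_trans _ _ (2 * M))//.
    by rewrite mulr_natl mulr2n lerD.
  have h2 : 2 * M <= 2 * M * N%:R * lw z.
    by rewrite -[leLHS]mulr1 -[leRHS]mulrA ler_wpM2l// mulr_ge0.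
  have h3 : 0 <= C * lw z by rewrite mulr_ge0// lw_ge0.
  by rewrite [leRHS]mulrDl; apply: le_trans h2 _; rewrite lerDr.
have iA := integrable_le_lw integrable_lw mA AC.
have mAN : measurable_fun setT (fun z => A (- z)).
  by apply: measurableT_comp => //; exact: measurable_opp_rV.
have iAN : nu.-integrable setT (EFin \o (fun z => A (- z))).
  apply: (integrable_le_lw integrable_lw (C := C + 2 * M * N%:R)) => // z.
  by rewrite (le_trans (AC _))// /lw normrN.
rewrite /levy_op -(Rintegral_nu mA) /gen.
have AN : \int[nu]_z A (- z) = \int[nu]_z A z.
  by congr fine; apply: (@integral_nu_opp (EFin \o A)); exact/measurable_EFinP.
transitivity (2^-1 * (\int[nu]_z A z + \int[nu]_z A (- z))).
  by rewrite AN; set q := \int[_]_z _; field.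
rewrite -RintegralD// -RintegralZl//; last exact: (integrableD measurableT iA iAN).
apply: eq_Rintegral => z _; congr (_ * _).
rewrite /A !gradE enorm_opp.
have -> : 'D_(- z) f x = - 'D_z f x.
  by rewrite (deriveE _ (df _)) linearN /= -(deriveE _ (df _)).
by rewrite /sdiff; ring.
Qed.

End levy_symmetric.

(** * Approximation of the generator by finitely many jumps *)

Section discretization.
Context {R : realType} {N : nat}.
Local Notation m := (lebesgue_rV R N).
Variable nu : {sigma_finite_measure set 'rV[R]_N -> \bar R}.
Hypothesis ilw : nu.-integrable setT (EFin \o @lw R N).
Hypothesis ntail : forall r : R, 0 < r -> (nu (~` cube r) < +oo)%E.
Implicit Types (x z : 'rV[R]_N) (f : 'rV[R]_N -> R).

Definition dgen (s : seq (R * 'rV[R]_N)) f x := \sum_(p <- s) p.1 * sdiff f p.2 x.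

Lemma sdiff_close f C y z : L1b m f -> kernel_const f C ->
  (forall x, `|sdiff f z x - sdiff f y x| <= 2 * C * `|z - y|) /\
  \int[m]_x `|sdiff f z x - sdiff f y x| <= 2 * C * `|z - y|.
Proof.
move=> Lf [[_ _ K1 K2] _].
have E x : sdiff f z x - sdiff f y x =
    (f (x + z) - f (x + y)) + (f (x - z) - f (x - y)) by rewrite /sdiff; ring.
have nE : `|- z - - y| = `|z - y| by rewrite -opprD normrN.
split=> [x|].
  rewrite E (le_trans (ler_normD _ _))//.
  have := K1 x y z; have := K1 x (- y) (- z); rewrite nE => h1 h2.
  by rewrite -mulrA mulr_natl mulr2n lerD.
have La : L1b m (fun x => `|f (x + z) - f (x + y)|).
  by apply/L1b_norm/L1bB; exact: L1b_shift.
have Lb : L1b m (fun x => `|f (x - z) - f (x - y)|).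
  by apply/L1b_norm/L1bB; exact: L1b_shift.
apply: (@le_trans _ _ (\int[m]_x (`|f (x + z) - f (x + y)| + `|f (x - z) - f (x - y)|))).
  apply: le_Rint; last by move=> x; rewrite E ler_normD.
    by apply/L1b_norm/L1bB; exact: L1b_sdiff.
  exact: L1bD.
rewrite RintD//; have := K2 y z; have := K2 (- y) (- z); rewrite nE => h1 h2.
by rewrite -mulrA mulr_natl mulr2n lerD.
Qed.

Section step.
Variables (q : nat -> 'rV[R]_N) (c : nat -> set 'rV[R]_N) (n : nat) (r e : R).
Hypotheses (mc : forall j, measurable (c j)) (tc : trivIset setT c).
Hypothesis cB : forall j, c j `<=` ~` cube r.
Hypothesis cq : forall j z, c j z -> `|z - q j| <= e.
Hypotheses (r0 : 0 < r) (e0 : 0 <= e).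

Let E := \bigcup_(j < n) c j.
Let mE : measurable E.
Proof. by apply: bigcup_measurable => j _; exact: mc. Qed.

Let nc j : (nu (c j) < +oo)%E.
Proof.
apply: le_lt_trans (ntail r0); apply: le_measure; rewrite ?inE//.
by apply: measurableC; exact: cube_measurable.
Qed.

(** Each point q j carries the mass of its cell, halved as in [gen]. *)
Definition wts : seq (R * 'rV[R]_N) :=
  [seq (2^-1 * fine (nu (c j)), q j) | j <- index_iota 0 n].

Lemma wts_ge0 p : p \in wts -> 0 <= p.1.
Proof. by case/mapP => j _ ->; rewrite /= mulr_ge0 ?invr_ge0// fine_ge0. Qed.

(** The integrand of [gen] frozen at q j on each cell and set to 0 off the cells; its integral in z
    is [dgen wts f x]. *)
Definition step f z x := \sum_(j < n) \1_(c j) z * (2^-1 * sdiff f (q j) x).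

Lemma step_in f z x (j : 'I_n) : c j z -> step f z x = 2^-1 * sdiff f (q j) x.
Proof.
move=> cjz; rewrite /step (bigD1 j)//= big1 ?addr0 => [|i ij].
  by rewrite indicE mem_set// mul1r.
rewrite indicE memNset ?mul0r// => ciz.
have := trivIsetP.1 tc i j Logic.I Logic.I.
move=> h; have {}h : c i `&` c j = set0.
  by apply: h; apply: contra ij => /eqP h; apply/eqP/val_inj.
by have : (c i `&` c j) z by []; rewrite h.
Qed.

Lemma step_out f z x : ~ E z -> step f z x = 0.
Proof.
move=> nE; rewrite /step big1// => j _; rewrite indicE memNset ?mul0r// => cjz.
by apply: nE; exists j => //=.
Qed.

Lemma integrable_indic_c (a : R) j :
  nu.-integrable setT (EFin \o (fun z => \1_(c j) z * a)).
Proof.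
rewrite (_ : _ \o _ = fun z => (a%:E * (\1_(c j) z)%:E)%E); last first.
  by apply/funext => z; rewrite /= mulrC EFinM.
apply: integrableZl => //; apply/integrableP; split.
  by apply/measurable_EFinP; exact: measurable_indic.
under eq_integral do rewrite gee0_abs ?lee_fin//.
by rewrite integral_indic// setIT; exact: nc.
Qed.

Lemma step_int f x : nu.-integrable setT (EFin \o (fun z => step f z x)) /\
  \int[nu]_z step f z x = dgen wts f x.
Proof.
rewrite /step /dgen /wts big_map big_mkord.
have H (k : nat) : nu.-integrable setT (EFin \o (fun z =>
      \sum_(j < k) \1_(c j) z * (2^-1 * sdiff f (q j) x))) /\
    \int[nu]_z (\sum_(j < k) \1_(c j) z * (2^-1 * sdiff f (q j) x)) =
    \sum_(j < k) 2^-1 * fine (nu (c j)) * sdiff f (q j) x.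
  elim: k => [|k [IH1 IH2]].
    rewrite big_ord0; have -> : (fun z => \sum_(j < 0) \1_(c j) z *
        (2^-1 * sdiff f (q j) x)) = cst 0.
      by apply/funext => z; rewrite big_ord0.
    by split; [exact: integrable0|rewrite Rintegral_cst// mul0r].
  have IH := integrable_indic_c (2^-1 * sdiff f (q k) x) k.
  have -> : (fun z => \sum_(j < k.+1) \1_(c j) z * (2^-1 * sdiff f (q j) x)) =
      (fun z => \sum_(j < k) \1_(c j) z * (2^-1 * sdiff f (q j) x) +
       \1_(c k) z * (2^-1 * sdiff f (q k) x)).
    by apply/funext => z; rewrite big_ord_recr.
  split; first exact: (integrableD measurableT IH1 IH).
  rewrite RintegralD// IH2 big_ord_recr /=; congr (_ + _).
  have ii : nu.-integrable setT (EFin \o (\1_(c k) : _ -> R)).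
    have := integrable_indic_c 1 k; apply: eq_integrable => // z _ /=.
    by rewrite mulr1.
  rewrite RintegralZr// mulrA (mulrC _ 2^-1); congr (_ * _ * _).
  by rewrite /Rintegral integral_indic// setIT.
exact: H.
Qed.

(** The error of freezing, up to the kernel constant: e on the cells, where second differences are
    Lipschitz in z, and the Levy weight elsewhere. *)
Definition dominator z : R := e * \1_E z + lw z * \1_(~` E) z.

Lemma dominator_ge0 z : 0 <= dominator z.
Proof. by rewrite addr_ge0// mulr_ge0// ?lw_ge0. Qed.

Lemma dominator_measurable : measurable_fun setT dominator.
Proof.
apply: measurable_funD; apply: measurable_funM.
- exact: measurable_cst.
- exact: measurable_indic.
- exact: lw_measurable.
- by apply: measurable_indic; exact: measurableC.
Qed.

Lemma step_error f C z : L1b m f -> kernel_const f C ->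
  (forall x, `|2^-1 * sdiff f z x - step f z x| <= C * dominator z) /\
  (\int[m]_x `|2^-1 * sdiff f z x - step f z x| <= C * dominator z).
Proof.
move=> Lf KC.
have C0 : 0 <= C by case: KC => -[K _ _ _] _; exact: le_trans (K 0).
have [Ez|nEz] := pselect (E z).
  have dE : dominator z = e.
    by rewrite /dominator !indicE mem_set// memNset ?mulr1 ?mulr0 ?addr0// => /(_ Ez).
  case: (Ez) => j /= jn cjz; have [h1 h2] := sdiff_close (q j) z Lf KC.
  have zq : 2 * C * `|z - q j| <= 2 * C * e.
    by apply: ler_wpM2l; [rewrite mulr_ge0|exact: (@cq j)].
  have e2 : C * e * 2 = 2 * C * e by ring.
  have sE x : 2^-1 * sdiff f z x - step f z x = 2^-1 * (sdiff f z x - sdiff f (q j) x).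
    by rewrite (@step_in f z x (Ordinal jn) cjz) [RHS]mulrBr.
  rewrite dE; split=> [x|].
    rewrite sE normrM gtr0_norm ?invr_gt0// mulrC ler_pdivrMr//.
    by rewrite (le_trans (h1 x))// (le_trans zq)// e2.
  under eq_Rint do rewrite sE normrM gtr0_norm ?invr_gt0//.
  rewrite RintZ; last by apply/L1b_norm/L1bB; exact: L1b_sdiff.
  rewrite mulrC ler_pdivrMr//.
  by rewrite (le_trans h2)// (le_trans zq)// e2.
have dE : dominator z = lw z.
  by rewrite /dominator !indicE memNset// mem_set// mulr1 mulr0 add0r.
case: KC => _ [h1 h2].
have lwC : 0 <= C * lw z by rewrite mulr_ge0// lw_ge0.
have sE x : 2^-1 * sdiff f z x - step f z x = 2^-1 * sdiff f z x.
  by rewrite step_out// subr0.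
rewrite dE; split=> [x|].
  rewrite sE normrM gtr0_norm ?invr_gt0// mulrC ler_pdivrMr//.
  by rewrite (le_trans (h1 x z))// ler_peMr// ler1n.
under eq_Rint do rewrite sE normrM gtr0_norm ?invr_gt0//.
rewrite RintZ; last by apply/L1b_norm; exact: L1b_sdiff.
rewrite mulrC ler_pdivrMr//.
by rewrite (le_trans (h2 z))// ler_peMr// ler1n.
Qed.

(** The bounds of [step_error] are integrated in z, for the L1 estimate after exchanging the
    integrals by Tonelli. Integrability of [gen nu f] is a by-product, as [dgen wts f] is
    integrable. *)
Lemma gen_error f C eta : L1b m f -> kernel_const f C ->
  (\int[nu]_z (dominator z)%:E <= eta%:E)%E ->
  [/\ L1b m (gen nu f), \int[m]_x `|gen nu f x - dgen wts f x| <= C * eta &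
     forall x, `|gen nu f x - dgen wts f x| <= C * eta].
Proof.
move=> Lf KC deta.
have C0 : 0 <= C by case: KC => -[K _ _ _] _; exact: le_trans (K 0).
have mf : measurable_fun setT f by case: Lf => -[].
have isd x := integrable_sdiff ilw x mf KC.
have msd := measurable_sdiff mf.
pose G (p : 'rV[R]_N * 'rV[R]_N) := 2^-1 * sdiff f p.2 p.1 - step f p.2 p.1.
have mG : measurable_fun setT G.
  apply: measurable_funB; first by apply: measurable_funM => //; exact: measurable_cst.
  rewrite /step; apply: measurable_sumr => j; apply: measurable_funM.
    exact: (measurableT_comp (measurable_indic (mc j)) measurable_snd).
  apply: measurable_funM; first exact: measurable_cst.
  exact: (measurableT_comp (bmf_meas (L1b_bmf (L1b_sdiff (q j) Lf))) measurable_fst).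
have iG x : nu.-integrable setT (EFin \o (fun z => G (x, z))).
  by have [h _] := step_int f x; exact: (integrableB measurableT (isd x) h).
have diffE x : gen nu f x - dgen wts f x = \int[nu]_z G (x, z).
  by have [h <-] := step_int f x; rewrite /gen -RintegralB.
have ub x : (`|gen nu f x - dgen wts f x|%:E <= \int[nu]_z `|G (x, z)|%:E)%E.
  rewrite diffE EFin_normr_Rintegral//.
  exact: (le_trans (le_abse_integral nu measurableT (measurable_int _ (iG x)))).
have dom : (\int[nu]_z (C * dominator z)%:E <= (C * eta)%:E)%E.
  under eq_integral do rewrite EFinM.
  rewrite ge0_integralZl//.
  - by rewrite EFinM lee_pmul// ?integral_ge0// => z _; rewrite ?lee_fin ?dominator_ge0.
  - by apply/measurable_EFinP; exact: dominator_measurable.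
  - by move=> z _; rewrite lee_fin dominator_ge0.
have mdom : measurable_fun setT (fun z => (C * dominator z)%:E).
  apply/measurable_EFinP; apply: measurable_funM; first exact: measurable_cst.
  exact: dominator_measurable.
have ptw x : `|gen nu f x - dgen wts f x| <= C * eta.
  rewrite -lee_fin (le_trans (ub x))// (le_trans _ dom)//.
  apply: ge0_le_integral => //.
  - apply/measurable_EFinP; apply: measurableT_comp => //.
    exact: (measurableT_comp mG (measurable_pair1 x)).
  - move=> z _; rewrite lee_fin; have [h _] := step_error z Lf KC; exact: h.
have Ld : L1b m (dgen wts f).
  rewrite /dgen; elim: wts => [|p s IH].
    rewrite (_ : (fun _ => _) = fun x => 0 * f x); first exact: L1bZ.
    by apply/funext => x; rewrite big_nil mul0r.
  rewrite (_ : (fun _ => _) = fun x => p.1 * sdiff f p.2 x +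
      \sum_(p <- s) p.1 * sdiff f p.2 x).
    by apply: L1bD => //; apply: L1bZ; exact: L1b_sdiff.
  by apply/funext => x; rewrite big_cons.
have bD : bmf (fun x => gen nu f x - dgen wts f x).
  split; last by exists (C * eta).
  apply: measurable_funB; first exact: measurable_gen.
  by case: Ld => -[].
have [LD ID] : L1b m (fun x => gen nu f x - dgen wts f x) /\
    \int[m]_x `|gen nu f x - dgen wts f x| <= C * eta.
  apply: L1b_of => //.
  apply: (@le_trans _ _ (\int[m]_x \int[nu]_z `|G (x, z)|%:E)%E).
    apply: ge0_le_integral => //.
    - by apply/measurable_EFinP; apply: measurableT_comp => //; case: bD.
    - apply: (measurable_fun_fubini_tonelli_F (m2 := nu) (fun p => `|G p|%:E)) => //.
      by apply/measurable_EFinP; exact: measurableT_comp.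
  have mGE : measurable_fun setT (fun p => `|G p|%:E).
    by apply/measurable_EFinP; exact: measurableT_comp.
  rewrite -(fubini_tonelli1 (m1 := m) (m2 := nu) (fun p => `|G p|%:E))//.
  rewrite (fubini_tonelli2 (m1 := m) (m2 := nu) (fun p => `|G p|%:E))//.
  apply: le_trans dom; apply: ge0_le_integral => //.
  - by move=> z _; exact: integral_ge0.
  - exact: (measurable_fun_fubini_tonelli_G (m1 := m) (fun p => `|G p|%:E)).
  - move=> z _; rewrite /fubini_G.
    have Lg : L1b m (fun x => G (x, z)).
      apply: L1bB; first by apply: L1bZ; exact: L1b_sdiff.
      have [[j jn cjz]|nE] := pselect (E z).
        rewrite (_ : (fun _ => _) = fun x => 2^-1 * sdiff f (q j) x).
          by apply: L1bZ; exact: L1b_sdiff.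
        by apply/funext => x; exact: (@step_in f z x (Ordinal jn) cjz).
      rewrite (_ : (fun _ => _) = fun x => 0 * f x); first exact: L1bZ.
      by apply/funext => x; rewrite /= step_out// mul0r.
    by rewrite L1bE// lee_fin; have [_ h] := step_error z Lf KC; exact: h.
split=> //.
rewrite (_ : gen nu f = fun x => (gen nu f x - dgen wts f x) + dgen wts f x).
  exact: L1bD.
by apply/funext => x; rewrite subrK.
Qed.

End step.

(** The family s is chosen before f, so it serves all kernels at once. The three thirds of eta pay
    for small jumps, for freezing and for the omitted cells. *)
Lemma discretize eta : 0 < eta -> exists s : seq (R * 'rV[R]_N),
  (forall p, p \in s -> 0 <= p.1) /\
  forall f C, L1b m f -> kernel_const f C ->
  [/\ L1b m (gen nu f), \int[m]_x `|gen nu f x - dgen s f x| <= C * eta &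
     forall x, `|gen nu f x - dgen s f x| <= C * eta].
Proof.
move=> eta0.
have eta3 : 0 < eta / 3 by rewrite divr_gt0.
have mcube r : measurable (cube r : set 'rV[R]_N) by exact: cube_measurable.
(* Small jumps: the Levy weight has a small integral near the origin. *)
have [k hk] : exists k, (\int[nu]_(z in cube (k.+1%:R^-1)) `|lw z|%:E < (eta / 3)%:E)%E.
  apply: (integrable_setI_cvg0 ilw (A := fun k => cube (k.+1%:R^-1)) _ _ eta3) => //.
  move=> z; have [->|z0] := eqVneq z 0; first by left; exact: lw0.
  right; have z1 : 0 < `|z| by rewrite normr_gt0.
  have := near_infty_natSinv_lt (PosNum z1); apply: filterS => n /= nz.
  by rewrite /cube /= => /le_lt_trans/(_ nz); rewrite ltxx.
set r : R := k.+1%:R^-1 in hk.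
have r0 : 0 < r by rewrite invr_gt0.
pose B : set 'rV[R]_N := ~` cube r.
have mB : measurable B by exact: measurableC.
have nB : (nu B < +oo)%E by exact: ntail.
pose b := fine (nu B).
have b0 : 0 <= b by exact: fine_ge0.
have bE : nu B = b%:E by rewrite fineK// ge0_fin_numE.
(* Away from the origin the mass b is finite, so freezing at distance e costs at most e b; b + 1
   avoids a division by 0. *)
pose e := eta / 3 / (b + 1).
have e0 : 0 < e by apply: divr_gt0 => //; exact: ltr_wpDl.
pose bl j := B `&` [set z | `|z - ratpt j| <= e].
have mbl j : measurable (bl j).
  apply: measurableI => //.
  rewrite (_ : mkset _ = (fun z => z - ratpt j) @^-1` cube e)//.
  by rewrite -[X in measurable X]setTI; apply: measurable_shift_rV.
(* Balls around the rational points cover [B]; made disjoint, they are the cells. *)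
pose c := seqDU bl.
have mc j : measurable (c j) by apply: measurableD => //; exact: bigsetU_measurable.
have cbl j : c j `<=` bl j by exact: subDsetl.
have tc : trivIset setT c by exact: trivIset_seqDU.
have cB j : c j `<=` ~` cube r by move=> z /cbl [].
have cq j z : c j z -> `|z - ratpt j| <= e by move=> /cbl [].
have cU : \bigcup_j c j = B.
  rewrite -seqDU_bigcup_eq; apply/seteqP; split=> [z [j _ []]//|z Bz].
  by have [j jz] := ratpt_dense z e0; exists j => //; split=> //; exact: ltW.
pose En n := \bigcup_(j < n) c j.
have mE n : measurable (En n) by apply: bigcup_measurable => j _; exact: mc.
have [n hn] : exists n, (\int[nu]_(z in B `\` En n) `|lw z|%:E < (eta / 3)%:E)%E.
  apply: (integrable_setI_cvg0 ilw (A := fun n => B `\` En n) _ _ eta3).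
    by move=> n; exact: measurableD.
  move=> z; right; have [Bz|nBz] := pselect (B z); last by near=> n; move=> [].
  have : (\bigcup_j c j) z by rewrite cU.
  move=> [j _ cjz]; near=> n => -[_]; apply; exists j => //=.
  by near: n; exact: nbhs_infty_gt.
exists (wts ratpt c n); split; first by move=> p; exact: wts_ge0.
move=> f C Lf KC; apply: (gen_error (r := r) (e := e)) => //; first exact: ltW.
have EB : En n `<=` B by rewrite -cU => z [j _ cjz]; exists j.
rewrite /dominator -/(En n).
have mlw : measurable_fun setT (fun z : 'rV[R]_N => (lw z)%:E).
  by apply/measurable_EFinP; exact: lw_measurable.
have lw0' z : (0 <= (lw z)%:E :> \bar R)%E by rewrite lee_fin lw_ge0.
under eq_integral do rewrite EFinD.
rewrite ge0_integralD//; last first.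
- apply/measurable_EFinP; apply: measurable_funM; first exact: lw_measurable.
  by apply: measurable_indic; exact: measurableC.
- by move=> z _; rewrite lee_fin mulr_ge0// lw_ge0.
- by apply/measurable_EFinP; apply: measurable_funM => //; exact: measurable_indic.
- by move=> z _; rewrite lee_fin mulr_ge0// ltW.
have -> : eta%:E = ((eta / 3)%:E + ((eta / 3)%:E + (eta / 3)%:E))%E.
  by rewrite -!EFinD; congr (_%:E); field.
apply: leeD.
  under eq_integral do rewrite EFinM.
  rewrite ge0_integralZl//; last 2 first.
  - by apply/measurable_EFinP; exact: measurable_indic.
  - by rewrite lee_fin ltW.
  rewrite integral_indic// setIT.
  apply: (@le_trans _ _ (e%:E * nu B)%E).
    by rewrite lee_pmul2l ?lte_fin//; apply: le_measure; rewrite ?inE.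
  rewrite bE -EFinM lee_fin /e mulrAC ler_pdivrMr ?ltr_wpDl//.
  by rewrite ler_wpM2l ?(ltW eta3)// lerDl.
have absE A : (\int[nu]_(z in A) `|lw z|%:E = \int[nu]_(z in A) (lw z)%:E)%E.
  by apply: eq_integral => z _; rewrite ger0_norm// lw_ge0.
rewrite !absE in hk hn.
have -> : (\int[nu]_z (lw z * \1_(~` En n) z)%:E = \int[nu]_(z in ~` En n) (lw z)%:E)%E.
  rewrite [RHS]integral_mkcond; apply: eq_integral => z _.
  by rewrite patchE indicE; case: ifPn => _; rewrite ?mulr1 ?mulr0.
have -> : ~` En n = cube r `|` (B `\` En n).
  apply/seteqP; split=> [z nz|z [zr /EB|[]//]]; last by [].
  by have [zr|zr] := pselect (cube r z); [left|right].
rewrite ge0_integral_setU//.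
- by apply: leeD; exact: ltW.
- exact: measurableD.
- exact: measurable_funTS.
- apply/disj_setPS => z [/= zr [+ _]]; exact.
Unshelve. all: by end_near.
Qed.

End discretization.

(** * The approximate resolvent as a finite combination of translations *)

Section resolvent.
Context {R : realType} {N : nat}.
Local Notation m := (lebesgue_rV R N).
Implicit Types (x z : 'rV[R]_N) (f g h : 'rV[R]_N -> R).

(** Such operators pass under convolutions and time integrals by mere linearity, without Fubini; for
    this the resolvent is approximated by a finite iteration. *)
Definition finshift (J : ('rV[R]_N -> R) -> 'rV[R]_N -> R) :=
  exists w : seq (R * 'rV[R]_N), forall f x, J f x = \sum_(p <- w) p.1 * f (x + p.2).

Section jump.
Variable s : seq (R * 'rV[R]_N).
Hypothesis s0 : forall p, p \in s -> 0 <= p.1.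

Definition jump f x := \sum_(p <- s) p.1 * (f (x + p.2) + f (x - p.2)).
Definition rate : R := \sum_(p <- s) 2 * p.1.

Lemma rate_ge0 : 0 <= rate.
Proof. by rewrite /rate big_seq sumr_ge0// => p /s0 p0; rewrite mulr_ge0. Qed.

Lemma dgen_jump f x : dgen s f x = jump f x - rate * f x.
Proof.
rewrite /dgen /jump /rate mulr_suml -sumrB; apply: eq_bigr => p _.
by rewrite /sdiff; ring.
Qed.

Lemma jump_lin a f g : jump (fun x => a * f x + g x) = fun x => a * jump f x + jump g x.
Proof.
apply/funext => x; rewrite /jump mulr_sumr -big_split; apply: eq_bigr => p _ /=; ring.
Qed.

Lemma jump_ge0 f : (forall x, 0 <= f x) -> forall x, 0 <= jump f x.
Proof.
move=> f0 x; rewrite /jump big_seq sumr_ge0// => p /s0 p0.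
by rewrite mulr_ge0// addr_ge0.
Qed.

Lemma jump_cst c : jump (fun=> c) = fun=> rate * c.
Proof.
by apply/funext => x; rewrite /jump /rate mulr_suml; apply: eq_bigr => p _; ring.
Qed.

Lemma jump_meas f : measurable_fun setT f -> measurable_fun setT (jump f).
Proof.
move=> mf; apply: measurable_sumr => p; apply: measurable_funM.
  exact: measurable_cst.
by apply: measurable_funD; apply: measurableT_comp => //; exact: measurable_shift_rV.
Qed.

Lemma jump_bmf f : bmf f -> bmf (jump f).
Proof.
move=> bf; rewrite /jump; elim: s => [|p t IH].
  by under eq_fun do rewrite big_nil; exact: bmf_cst.
under eq_fun do rewrite big_cons; apply: bmfD => //; apply: bmfZ.
by apply: bmfD; exact: bmf_shift.
Qed.

Lemma jump_int f : L1b m f ->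
  L1b m (jump f) /\ \int[m]_x jump f x = rate * \int[m]_x f x.
Proof.
move=> Lf; have mf : measurable_fun setT f by case: Lf => -[].
rewrite /jump /rate; elim: s => [|p t [IH1 IH2]].
  have -> : (fun x => \sum_(p <- [::]) p.1 * (f (x + p.2) + f (x - p.2))) = cst 0.
    by apply/funext => x; rewrite big_nil.
  rewrite big_nil mul0r Rintegral_cst// mul0r; split=> //.
  rewrite (_ : cst 0 = fun x => 0 * f x); first exact: L1bZ.
  by apply/funext => x; rewrite mul0r.
have -> : (fun x => \sum_(q <- p :: t) q.1 * (f (x + q.2) + f (x - q.2))) =
   fun x => p.1 * (f (x + p.2) + f (x - p.2)) +
     \sum_(q <- t) q.1 * (f (x + q.2) + f (x - q.2)).
  by apply/funext => x; rewrite big_cons.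
have L1 := L1b_shift p.2 Lf; have L2 := L1b_shift (- p.2) Lf.
have L12 := L1bD L1 L2; have L3 := L1bZ p.1 L12.
split; first exact: L1bD.
rewrite RintD// IH2 RintZ// RintD// !Rint_shift// big_cons; ring.
Qed.

Lemma jump_sym f g : L1b m f -> bmf g ->
  \int[m]_x (jump f x * g x) = \int[m]_x (f x * jump g x).
Proof.
move=> Lf bg.
have sh z : \int[m]_x (f (x + z) * g x) = \int[m]_x (f x * g (x - z)).
  have Lg : L1b m (fun x => f (x + z) * g x) by apply: L1bMr => //; exact: L1b_shift.
  rewrite -(Rint_shift (- z)); last by case: Lg => -[].
  by apply: eq_Rint => x; rewrite subrK.
rewrite /jump; elim: s => [|p t IH].
  by under eq_Rint do rewrite big_nil mul0r; under [RHS]eq_Rint do rewrite big_nil mulr0.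
have Lt : L1b m (fun x => \sum_(q <- t) q.1 * (f (x + q.2) + f (x - q.2))).
  elim: t {IH} => [|q t IH].
    rewrite (_ : (fun _ => _) = fun x => 0 * f x); first exact: L1bZ.
    by apply/funext => x; rewrite big_nil mul0r.
  rewrite (_ : (fun _ => _) = fun x => q.1 * (f (x + q.2) + f (x - q.2)) +
     \sum_(q <- t) q.1 * (f (x + q.2) + f (x - q.2))).
    by apply: L1bD => //; apply: L1bZ; apply: L1bD; exact: L1b_shift.
  by apply/funext => x; rewrite big_cons.
have bt : bmf (fun x => \sum_(q <- t) q.1 * (g (x + q.2) + g (x - q.2))).
  elim: t {IH Lt} => [|q t IH].
    by under eq_fun do rewrite big_nil; exact: bmf_cst.
  under eq_fun do rewrite big_cons; apply: bmfD => //; apply: bmfZ.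
  by apply: bmfD; exact: bmf_shift.
have A1 z : L1b m (fun x => f (x + z) * g x) by apply: L1bMr => //; exact: L1b_shift.
have A2 z : L1b m (fun x => f x * g (x + z)) by apply: L1bMr => //; exact: bmf_shift.
have B1 : L1b m (fun x => (\sum_(q <- t) q.1 * (f (x + q.2) + f (x - q.2))) * g x).
  exact: L1bMr.
have B2 : L1b m (fun x => f x * \sum_(q <- t) q.1 * (g (x + q.2) + g (x - q.2))).
  exact: L1bMr.
transitivity (p.1 * (\int[m]_x (f (x + p.2) * g x) + \int[m]_x (f (x - p.2) * g x))
  + \int[m]_x ((\sum_(q <- t) q.1 * (f (x + q.2) + f (x - q.2))) * g x)).
  have A12 := L1bD (A1 p.2) (A1 (- p.2)).
  rewrite -RintD// -RintZ// -RintD//; last exact: L1bZ.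
  by apply: eq_Rint => x; rewrite big_cons; ring.
rewrite IH !sh opprK.
have A12 := L1bD (A2 (- p.2)) (A2 p.2).
rewrite -RintD// -RintZ// -RintD//; last exact: L1bZ.
by apply: eq_Rint => x; rewrite big_cons; ring.
Qed.

Variable lam : R.
Hypothesis lam0 : 0 < lam.

(** Fixed-point iteration, started at f, for (lam + rate) g = lam f + jump g. The solution of this
    equation is the resolvent lam (lam - dgen)^-1 f. *)
Fixpoint neumann k f x : R :=
  if k is k'.+1 then (lam + rate)^-1 * (lam * f x + jump (neumann k' f) x) else f x.

Let lM0 : 0 < lam + rate. Proof. by rewrite ltr_wpDr// rate_ge0. Qed.

Lemma jumpZ a f : jump (fun x => a * f x) = fun x => a * jump f x.
Proof.
have := jump_lin a f (fun=> 0); under eq_fun do rewrite addr0.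
by move=> ->; apply/funext => x; rewrite jump_cst mulr0 addr0.
Qed.

Lemma jumpB f g : jump (fun x => f x - g x) = fun x => jump f x - jump g x.
Proof.
have := jump_lin (-1) g f; under eq_fun do rewrite mulN1r addrC.
by move=> ->; apply/funext => x; rewrite mulN1r addrC.
Qed.

Lemma neumann_jump k f : neumann k (jump f) = jump (neumann k f).
Proof.
elim: k => [//|k IH]; apply/funext => x /=; rewrite IH.
transitivity (jump (fun x => (lam + rate)^-1 * (lam * f x + jump (neumann k f) x)) x) => //.
by rewrite jumpZ jump_lin.
Qed.

Lemma neumann_markov k : markov_op m (neumann k).
Proof.
elim: k => [|k IH].
  by split=> // [a f g|f Lf].
have jint f : L1b m f -> L1b m (jump (neumann k f)).
  by move=> Lf; have [] := jump_int (mk_int IH Lf).1.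
split=> /= [a f g|f f0 x|c|f mf|f Lf|f g Lf bg].
- apply/funext => x; rewrite (mk_lin IH) jump_lin; ring.
- rewrite mulr_ge0 ?invr_ge0 ?(ltW lM0)// addr_ge0 ?mulr_ge0 ?(ltW lam0)//.
  by apply: jump_ge0; exact: (mk_ge0 IH).
- apply/funext => x; rewrite (mk_cst IH) jump_cst -mulrDl mulrA mulVf ?mul1r//.
  exact: lt0r_neq0.
- apply: measurable_funM; first exact: measurable_cst.
  apply: measurable_funD; last by apply: jump_meas; exact: (mk_meas IH).
  by apply: measurable_funM => //; exact: measurable_cst.
- have [L1 E1] := mk_int IH Lf; have [L2 E2] := jump_int L1.
  have L3 := L1bZ lam Lf; have L4 := L1bD L3 L2.
  split; first exact: L1bZ.
  rewrite RintZ// RintD// RintZ// E2 E1 -mulrDl mulrA mulVf ?mul1r//.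
  exact: lt0r_neq0.
- have L1 := jint f Lf.
  have bJg : bmf (jump (neumann k g)) by apply: jump_bmf; exact: mk_bmf IH _ bg.
  have M1 : L1b m (fun x => f x * g x) by exact: L1bMr.
  have M2 : L1b m (fun x => jump (neumann k f) x * g x) by exact: L1bMr.
  have M3 : L1b m (fun x => f x * jump (neumann k g) x) by exact: L1bMr.
  have M1' := L1bZ lam M1; have M12 := L1bD M1' M2; have M13 := L1bD M1' M3.
  have E : \int[m]_x (jump (neumann k f) x * g x) = \int[m]_x (f x * jump (neumann k g) x).
    rewrite jump_sym//; last exact: (mk_int IH Lf).1.
    by rewrite (mk_sym IH)// ?neumann_jump//; exact: jump_bmf.
  transitivity ((lam + rate)^-1 * (lam * \int[m]_x (f x * g x) +
      \int[m]_x (jump (neumann k f) x * g x))).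
    rewrite -RintZ// -RintD// -RintZ//; apply: eq_Rint => x; ring.
  rewrite E -RintZ// -RintD// -RintZ//; apply: eq_Rint => x; ring.
Qed.

Lemma neumann_finshift k : finshift (neumann k).
Proof.
elim: k => [|k [w IH]].
  by exists [:: (1, 0)] => f x; rewrite big_seq1 mul1r addr0.
exists ((lam / (lam + rate), 0) :: flatten [seq [seq ((lam + rate)^-1 * p.1 * q.1, p.2 + q.2) | q <- w]
   ++ [seq ((lam + rate)^-1 * p.1 * q.1, - p.2 + q.2) | q <- w] | p <- s]) => f x /=.
rewrite big_cons /= addr0 mulrDr; congr (_ + _).
  by rewrite mulrA (mulrC _ lam).
rewrite big_flatten big_map /= /jump mulr_sumr; apply: eq_bigr => p _.
rewrite big_cat !big_map /= !IH mulrA mulrDr !mulr_sumr; congr (_ + _).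
  by apply: eq_bigr => q _; rewrite addrA mulrA.
by apply: eq_bigr => q _; rewrite addrA mulrA.
Qed.

(** Geometric convergence: [jump] has L1 norm at most [rate], so an iteration contracts by rate /
    (lam + rate). *)
Lemma neumann_diff k f : L1b m f ->
  \int[m]_x `|neumann k.+1 f x - neumann k f x| <=
  (rate / (lam + rate)) ^+ k * (2 * \int[m]_x `|f x|).
Proof.
move=> Lf; have LJ j : L1b m (neumann j f) by have [] := mk_int (neumann_markov j) Lf.
have Lf' := L1b_norm Lf.
elim: k => [|k IH].
  rewrite expr0 mul1r.
  have LJ1 := L1b_norm (LJ 1%N).
  apply: (@le_trans _ _ (\int[m]_x (`|neumann 1 f x| + `|f x|))).
    apply: le_Rint; first by apply: L1b_norm; apply: L1bB => //; exact: (LJ 1%N).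
      exact: L1bD.
    by move=> x; exact: ler_normB.
  rewrite RintD// mulr_natl mulr2n lerD2r.
  exact: (mk_L1 (neumann_markov 1) Lf).
have Ld : L1b m (fun x => neumann k.+1 f x - neumann k f x).
  by apply: L1bB; exact: LJ.
have E x : neumann k.+2 f x - neumann k.+1 f x =
    (lam + rate)^-1 * jump (fun x => neumann k.+1 f x - neumann k f x) x.
  by rewrite jumpB /=; ring.
have Lj := (jump_int Ld).1; have Ln := L1b_norm Ld.
under eq_Rint do rewrite E normrM (gtr0_norm (_ : 0 < (lam + rate)^-1)) ?invr_gt0//.
rewrite RintZ; last exact: L1b_norm.
set q := rate / (lam + rate) in IH *.
rewrite exprS -[leRHS]mulrA {1}/q (mulrC rate) -mulrA ler_pM2l ?invr_gt0//.
apply: (@le_trans _ _ (rate * \int[m]_x `|neumann k.+1 f x - neumann k f x|)).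
  have [L1 <-] := jump_int Ln.
  apply: le_Rint => //; first exact: L1b_norm.
  move=> x; rewrite /jump (le_trans (ler_norm_sum _ _ _))// big_seq [leRHS]big_seq.
  apply: ler_sum => p /s0 p0; rewrite normrM ger0_norm// ler_wpM2l//.
  exact: ler_normD.
by rewrite ler_wpM2l// rate_ge0.
Qed.

(** As [neumann] and [jump] commute, the defect of the resolvent equation is, up to sign, exactly
    lam + rate times the increment of the iteration. *)
Lemma neumann_resid k f : L1b m f ->
  \int[m]_x `|lam * (neumann k f x - f x) - neumann k (dgen s f) x| <=
  (lam + rate) * ((rate / (lam + rate)) ^+ k * (2 * \int[m]_x `|f x|)).
Proof.
move=> Lf; have LJ j : L1b m (neumann j f) by have [] := mk_int (neumann_markov j) Lf.
have E x : lam * (neumann k f x - f x) - neumann k (dgen s f) x =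
    - ((lam + rate) * (neumann k.+1 f x - neumann k f x)).
  have -> : dgen s f = fun x => jump f x - rate * f x.
    by apply/funext => y; exact: dgen_jump.
  rewrite (mkB (neumann_markov k)) (mkZ (neumann_markov k)) neumann_jump /=.
  have : lam + rate != 0 by exact: lt0r_neq0.
  by move=> h; field.
under eq_Rint do rewrite E normrN normrM (gtr0_norm lM0).
rewrite RintZ; last by apply: L1b_norm; apply: L1bB; exact: LJ.
by rewrite ler_pM2l//; exact: neumann_diff.
Qed.

End jump.

Variable nu : {sigma_finite_measure set 'rV[R]_N -> \bar R}.
Hypothesis ilw : nu.-integrable setT (EFin \o @lw R N).
Hypothesis ntail : forall r : R, 0 < r -> (nu (~` cube r) < +oo)%E.

(** J is the same for all kernels with constant C. One half of eta pays for stopping the iteration,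
    the other for replacing the generator by a finite sum, since J is an L1 contraction. *)
Lemma resolvent_approx lam eta C : 0 < lam -> 0 < eta -> 0 <= C ->
  exists J, [/\ markov_op m J, finshift J & forall f, L1b m f -> kernel_const f C ->
    \int[m]_x `|lam * (J f x - f x) - J (gen nu f) x| <= eta].
Proof.
move=> lam0 eta0 C0.
have e0 : 0 < eta / 2 / (C + 1) by rewrite !divr_gt0// ltr_wpDl.
have [s [s0 H]] := discretize ilw ntail e0.
have M0 := rate_ge0 s0; set M := rate s in M0 *.
have lM0 : 0 < lam + M by rewrite ltr_wpDr.
pose q := M / (lam + M).
have q0 : 0 <= q by rewrite divr_ge0// ltW.
have q1 : `|q| < 1 by rewrite ger0_norm// ltr_pdivrMr// mul1r ltrDr.
have K0 : 0 < (lam + M) * (2 * (C + 1)) by rewrite !mulr_gt0// ltr_wpDl.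
have [k hk] : exists k, q ^+ k * ((lam + M) * (2 * (C + 1))) < eta / 2.
  have /cvgr0Pnorm_lt/(_ (eta / 2 / ((lam + M) * (2 * (C + 1))))) := @cvg_expr _ _ q1.
  rewrite divr_gt0 ?divr_gt0// => /(_ isT) [k _ /(_ k (leqnn k))] /=.
  rewrite ger0_norm ?exprn_ge0// ltr_pdivlMr// => h; by exists k.
exists (neumann s lam k); have MJ := neumann_markov s0 lam0 k.
split=> //; first exact: neumann_finshift.
move=> f Lf KC; have [Lg Hg _] := H f C Lf KC.
have Ld : L1b m (dgen s f).
  rewrite (_ : dgen s f = fun x => jump s f x - rate s * f x).
    by apply: L1bB; [have [] := jump_int s Lf|exact: L1bZ].
  by apply/funext => x; exact: dgen_jump.
have [LJf _] := mk_int MJ Lf.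
have LJd := (mk_int MJ Ld).1; have LJg := (mk_int MJ Lg).1.
have L1 : L1b m (fun x => lam * (neumann s lam k f x - f x) - neumann s lam k (dgen s f) x).
  by apply: L1bB => //; apply: L1bZ; exact: L1bB.
have L2 : L1b m (fun x => dgen s f x - gen nu f x) by exact: L1bB.
have L3 := (mk_int MJ L2).1.
apply: (@le_trans _ _ (\int[m]_x (`|lam * (neumann s lam k f x - f x)
     - neumann s lam k (dgen s f) x| + `|neumann s lam k (fun x => dgen s f x - gen nu f x) x|))).
  apply: le_Rint.
  - by apply: L1b_norm; apply: L1bB => //; apply: L1bZ; exact: L1bB.
  - by apply: L1bD; exact: L1b_norm.
  - move=> x; rewrite (mkB MJ); apply: le_trans (ler_normD _ _).
    by rewrite le_eqVlt; apply/orP; left; apply/eqP; congr (`|_|); ring.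
rewrite RintD; [|exact: L1b_norm|exact: L1b_norm].
rewrite (splitr eta) lerD//.
  rewrite (le_trans (neumann_resid s0 lam0 k Lf))// -/M -/q mulrCA.
  rewrite (le_trans _ (ltW hk))// ler_wpM2l ?exprn_ge0// ler_wpM2l ?(ltW lM0)//.
  rewrite ler_wpM2l//; case: KC => -[_ K _ _] _; rewrite (le_trans K)// lerDl//.
rewrite (le_trans (mk_L1 MJ L2))//.
under eq_Rint do rewrite distrC.
apply: (le_trans Hg); rewrite mulrA ler_pdivrMr ?ltr_wpDl// mulrC.
by rewrite ler_wpM2l ?divr_ge0 ?(ltW eta0)// lerDl.
Qed.

End resolvent.

(** * Convolution with an integrable kernel *)

Section convolution.
Context {R : realType} {N : nat}.
Local Notation m := (lebesgue_rV R N).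
Implicit Types (x y z : 'rV[R]_N) (f g h k : 'rV[R]_N -> R).

Definition cvl k f x := \int[m]_y (k (x - y) * f y).

Lemma L1b_refl k x : L1b m k -> L1b m (fun y => k (x - y)).
Proof.
move=> /L1b_opp /(@L1b_shift _ _ _ (- x)); congr L1b.
by apply/funext => y; rewrite opprB.
Qed.

Lemma Rint_refl k x : measurable_fun setT k ->
  \int[m]_y k (x - y) = \int[m]_y k y.
Proof.
move=> mk; rewrite -[RHS](Rint_opp mk) -[RHS](Rint_shift (- x)).
  by apply: eq_Rint => y; rewrite opprB.
by apply: measurableT_comp => //; exact: measurable_opp_rV.
Qed.

Lemma measurable_sub : measurable_fun [set: 'rV[R]_N * 'rV[R]_N] (fun p => p.1 - p.2 : 'rV[R]_N).
Proof.
apply: measurable_rV => i.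
rewrite (_ : (fun _ => _) = fun p : 'rV[R]_N * 'rV[R]_N => p.1 ord0 i - p.2 ord0 i).
  apply: measurable_funB.
    exact: (measurableT_comp (coord_measurable i) measurable_fst).
  exact: (measurableT_comp (coord_measurable i) measurable_snd).
by apply/funext => p; rewrite !mxE.
Qed.

Section basic.
Variable k : 'rV[R]_N -> R.
Hypothesis Lk : L1b m k.

Let mk : measurable_fun setT k. Proof. by case: Lk => -[]. Qed.

Lemma cvl_L1b f x : bmf f -> L1b m (fun y => k (x - y) * f y).
Proof. by move=> bf; apply: L1bMr => //; exact: L1b_refl. Qed.

Lemma cvl_bound f C x : bmf f -> (forall y, `|f y| <= C) ->
  `|cvl k f x| <= C * \int[m]_y `|k y|.
Proof.
move=> bf fC; rewrite (le_trans (Rint_norm (cvl_L1b x bf)))//.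
have Lr := L1b_norm (L1b_refl x Lk).
have mnk : measurable_fun setT (fun y => `|k y|) by exact: measurableT_comp.
rewrite -(Rint_refl x mnk) -RintZ//; apply: le_Rint.
- by apply/L1b_norm; exact: cvl_L1b.
- exact: L1bZ.
- by move=> y; rewrite normrM mulrC ler_wpM2r.
Qed.

Lemma cvl_meas f : measurable_fun setT f -> measurable_fun setT (cvl k f).
Proof.
move=> mf.
have := @measurable_Rint _ _ 'rV[R]_N 'rV[R]_N R m (fun p => k (p.1 - p.2) * f p.2).
apply.
apply: measurable_funM; first exact: (measurableT_comp mk measurable_sub).
exact: (measurableT_comp mf measurable_snd).
Qed.

Lemma cvl_bmf f : bmf f -> bmf (cvl k f).
Proof.
move=> bf; split; first by apply: cvl_meas; case: bf.
by case: (bf) => _ [C fC]; exists (C * \int[m]_y `|k y|) => x; exact: cvl_bound.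
Qed.

Lemma cvlD f g x : bmf f -> bmf g ->
  cvl k (fun y => f y + g y) x = cvl k f x + cvl k g x.
Proof.
move=> bf bg; rewrite /cvl -RintD; [|exact: cvl_L1b|exact: cvl_L1b].
by apply: eq_Rint => y; rewrite mulrDr.
Qed.

Lemma cvlZ c f x : bmf f -> cvl k (fun y => c * f y) x = c * cvl k f x.
Proof.
move=> bf; rewrite /cvl -RintZ; last exact: cvl_L1b.
by apply: eq_Rint => y; rewrite mulrCA.
Qed.

Lemma cvlB f g x : bmf f -> bmf g ->
  cvl k (fun y => f y - g y) x = cvl k f x - cvl k g x.
Proof.
move=> bf bg; rewrite /cvl -RintB; [|exact: cvl_L1b|exact: cvl_L1b].
by apply: eq_Rint => y; rewrite mulrBr.
Qed.

Lemma cvl_cst c x : cvl k (fun=> c) x = c * \int[m]_y k y.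
Proof.
rewrite /cvl -(Rint_refl x mk) -RintZ; last exact: L1b_refl.
by apply: eq_Rint => y; rewrite mulrC.
Qed.

Lemma cvl_L1 f : L1b m f -> L1b m (cvl k f) /\
  \int[m]_x `|cvl k f x| <= \int[m]_x `|k x| * \int[m]_x `|f x|.
Proof.
move=> Lf; have bf := L1b_bmf Lf; have mf := bmf_meas bf.
apply: L1b_of; first exact: cvl_bmf.
pose G (p : 'rV[R]_N * 'rV[R]_N) := (`|k (p.1 - p.2)| * `|f p.2|)%:E.
have mG : measurable_fun setT G.
  apply/measurable_EFinP; apply: measurable_funM; apply: measurableT_comp => //.
    exact: (measurableT_comp mk measurable_sub).
  exact: (measurableT_comp mf measurable_snd).
apply: (@le_trans _ _ (\int[m]_x \int[m]_y G (x, y))%E).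
  apply: ge0_le_integral => //.
  - by apply/measurable_EFinP; apply: measurableT_comp => //; exact: cvl_meas.
  - by apply: (measurable_fun_fubini_tonelli_F (m2 := m) G) => // p; rewrite lee_fin mulr_ge0.
  - move=> x _; have Lx := cvl_L1b x bf.
    have := Rint_norm Lx; rewrite -lee_fin -(L1bE Lx) => /le_trans; apply.
    by apply: ge0_le_integral => //;
      [apply/measurable_EFinP; apply: measurableT_comp => //; case: Lx => -[]|
       exact: (measurableT_comp mG (measurable_pair1 x))|
       move=> y _; rewrite lee_fin normrM].
have G0 p : (0 <= G p)%E by rewrite lee_fin mulr_ge0.
rewrite -(fubini_tonelli1 (m1 := m) (m2 := m) G)//.
rewrite (fubini_tonelli2 (m1 := m) (m2 := m) G)// /fubini_G.
rewrite EFinM -(L1bE Lf) -ge0_integralZl//; last 2 first.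
- by apply/measurable_EFinP; apply: measurableT_comp.
- by rewrite lee_fin Rint_ge0.
rewrite le_eqVlt; apply/orP; left; apply/eqP; apply: eq_integral => y _.
have Ls : L1b m (fun x => k (x - y)) by exact: L1b_shift.
rewrite /G /=; under eq_integral do rewrite mulrC EFinM.
rewrite ge0_integralZl//; last first.
  by apply/measurable_EFinP; apply: measurableT_comp => //; case: Ls => -[].
rewrite (L1bE Ls) muleC; congr (_%:E * _)%E.
by apply: (Rint_shift (- y) (f := fun x => `|k x|)); exact: measurableT_comp.
Qed.

Lemma finshift_cvl J f x : finshift J -> bmf f ->
  J (cvl k f) x = cvl (J k) f x.
Proof.
move=> [w Jw] bf; rewrite Jw /cvl.
under [RHS]eq_Rint do rewrite Jw.
elim: w {Jw} => [|p w IH].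
  rewrite big_nil; under eq_Rint do rewrite big_nil mul0r.
  by rewrite Rintegral_cst// mul0r.
rewrite big_cons IH.
have L1 : L1b m (fun y => k (x + p.2 - y) * f y) by exact: cvl_L1b.
have L1' := L1bZ p.1 L1.
have Lw : L1b m (fun y => \sum_(q <- w) q.1 * k (x - y + q.2)).
  elim: w {IH} => [|q w IH].
    rewrite (_ : (fun _ => _) = fun x => 0 * k x); first exact: L1bZ.
    by apply/funext => y; rewrite big_nil mul0r.
  under eq_fun do rewrite big_cons; apply: L1bD => //; apply: L1bZ.
  rewrite (_ : (fun _ => _) = fun y => k ((x + q.2) - y)); first exact: L1b_refl.
  by apply/funext => y; rewrite addrAC.
have L2 : L1b m (fun y => (\sum_(q <- w) q.1 * k (x - y + q.2)) * f y).
  exact: L1bMr.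
rewrite -RintZ// -RintD//; apply: eq_Rint => y.
by rewrite big_cons mulrDl mulrA (addrAC x).
Qed.

End basic.

Lemma cvl_kZ c k f x : L1b m k -> bmf f ->
  cvl (fun y => c * k y) f x = c * cvl k f x.
Proof.
move=> L1 bf; rewrite /cvl -RintZ; last exact: cvl_L1b.
by apply: eq_Rint => y; rewrite mulrA.
Qed.

Lemma cvl_kB k1 k2 f x : L1b m k1 -> L1b m k2 -> bmf f ->
  cvl (fun y => k1 y - k2 y) f x = cvl k1 f x - cvl k2 f x.
Proof.
move=> L1 L2 bf; rewrite /cvl -RintB; [|exact: cvl_L1b|exact: cvl_L1b].
by apply: eq_Rint => y; rewrite mulrBl.
Qed.

(** Fubini: the double integral converges absolutely because f is bounded while k and g are
    integrable. Evenness of k exchanges the two variables. *)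
Lemma cvl_sym k f g : L1b m k -> (forall x, k (- x) = k x) -> bmf f -> L1b m g ->
  \int[m]_x (cvl k f x * g x) = \int[m]_x (f x * cvl k g x).
Proof.
move=> Lk ke bf Lg; have bg := L1b_bmf Lg.
have mk := bmf_meas (L1b_bmf Lk); have mf := bmf_meas bf; have mg := bmf_meas bg.
pose G (p : 'rV[R]_N * 'rV[R]_N) := k (p.1 - p.2) * f p.2 * g p.1.
have mG : measurable_fun setT G.
  apply: measurable_funM; last exact: (measurableT_comp mg measurable_fst).
  apply: measurable_funM; first exact: (measurableT_comp mk measurable_sub).
  exact: (measurableT_comp mf measurable_snd).
have [C fC] : exists C, forall x, `|f x| <= C by case: bf.
have C0 : 0 <= C by exact: le_trans (fC 0).
have LGx x : L1b m (fun y => G (x, y)).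
  rewrite (_ : (fun _ => _) = fun y => g x * (k (x - y) * f y)).
    by apply: L1bZ; exact: cvl_L1b.
  by apply/funext => y; rewrite /G /= mulrC.
have jG : (m \x m)%E.-integrable setT (EFin \o G).
  apply/(integrable12ltyP m m); first exact/measurable_EFinP.
  apply: (@le_lt_trans _ _ (\int[m]_x (C * (\int[m]_y `|k y|) * `|g x|)%:E)%E).
    apply: ge0_le_integral => //.
    - by move=> x _; exact: integral_ge0.
    - apply: (measurable_fun_fubini_tonelli_F (m2 := m) (fun p => `|(EFin \o G) p|%E)) => //.
      by apply: measurableT_comp => //; exact/measurable_EFinP.
    - apply/measurable_EFinP; apply: measurable_funM; first exact: measurable_cst.
      exact: measurableT_comp.
    - move=> x _ /=; rewrite (L1bE (LGx x)) lee_fin.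
      have Lr := L1b_norm (L1b_refl x Lk).
      rewrite -(Rint_refl x (k := fun y => `|k y|)); last exact: measurableT_comp.
      rewrite mulrAC -RintZ//; apply: le_Rint.
      + exact: L1b_norm.
      + exact: L1bZ.
      + move=> y; rewrite /G /= !normrM mulrAC -mulrA [leRHS]mulrC ler_wpM2l//.
        by rewrite mulrC ler_wpM2r.
  have Lgg := L1bZ (C * \int[m]_y `|k y|) (L1b_norm Lg).
  have := L1bE Lgg; under eq_integral do rewrite ger0_norm ?mulr_ge0 ?Rint_ge0//.
  by move=> ->; rewrite ltry.
have E := Fubini jG.
transitivity (\int[m]_x \int[m]_y G (x, y)).
  apply: eq_Rint => x; rewrite /cvl mulrC -RintZ; last exact: cvl_L1b.
  by apply: eq_Rint => y; rewrite /G /= mulrC.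
transitivity (\int[m]_y \int[m]_x G (x, y)).
  rewrite /Rintegral; congr fine.
  have finx x : (\int[m]_y (G (x, y))%:E)%E \is a fin_num.
    exact: (integrable_fin_num _ (L1b_int (LGx x))).
  under eq_integral do rewrite fineK//.
  rewrite E; apply: eq_integral => y _ /=.
  have LGy : L1b m (fun x => G (x, y)).
    rewrite (_ : (fun _ => _) = fun x => f y * (k (x - y) * g x)).
      by apply: L1bZ; apply: L1bMr => //; exact: L1b_shift.
    by apply/funext => x; rewrite /G /=; ring.
  by rewrite fineK//; exact: (integrable_fin_num _ (L1b_int LGy)).
apply: eq_Rint => y; rewrite /cvl -RintZ; last exact: cvl_L1b.
by apply: eq_Rint => x; rewrite /G /= -(ke (y - x)) opprB; ring.
Qed.

End convolution.

(** * Convergence of mollified functions in L1 *)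

Section mollification.
Context {R : realType} {N : nat}.
Local Notation m := (lebesgue_rV R N).
Implicit Types (x y z : 'rV[R]_N) (f g h k : 'rV[R]_N -> R) (A : set 'rV[R]_N).

Record mollifier (rho : nat -> 'rV[R]_N -> R) : Prop := Mollifier {
  mo_L1 : forall n, L1b m (rho n) ;
  mo_ge0 : forall n x, 0 <= rho n x ;
  mo_mass : forall n, \int[m]_x rho n x = 1 ;
  mo_supp : forall n x, n.+1%:R^-1 < `|x| -> rho n x = 0 ;
  mo_even : forall n x, rho n (- x) = rho n x }.

Variable rho : nat -> 'rV[R]_N -> R.
Hypothesis Mr : mollifier rho.

Lemma mo_norm n : \int[m]_x `|rho n x| = 1.
Proof. by rewrite -(mo_mass Mr n); apply: eq_Rint => x; rewrite ger0_norm// mo_ge0. Qed.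

Lemma moll_L1 n f : L1b m f -> L1b m (cvl (rho n) f) /\
  \int[m]_x `|cvl (rho n) f x| <= \int[m]_x `|f x|.
Proof. by move=> Lf; have := cvl_L1 (mo_L1 Mr n) Lf; rewrite mo_norm mul1r. Qed.

Lemma moll_bound n f C : bmf f -> (forall x, `|f x| <= C) ->
  forall x, `|cvl (rho n) f x| <= C.
Proof.
by move=> bf fC x; have := cvl_bound (mo_L1 Mr n) x bf fC; rewrite mo_norm mulr1.
Qed.

Lemma moll_ge0 n f : bmf f -> (forall x, 0 <= f x) -> forall x, 0 <= cvl (rho n) f x.
Proof. by move=> bf f0 x; apply: Rint_ge0 => y; rewrite mulr_ge0// mo_ge0. Qed.

Lemma moll_le n f g : bmf f -> bmf g -> (forall x, f x <= g x) ->
  forall x, cvl (rho n) f x <= cvl (rho n) g x.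
Proof.
move=> bf bg fg x; rewrite -subr_ge0 -(cvlB (mo_L1 Mr n))//.
by apply: moll_ge0 => [|y]; [exact: bmfB|rewrite subr_ge0].
Qed.

Lemma moll_cst n c x : cvl (rho n) (fun=> c) x = c.
Proof. by rewrite (cvl_cst (mo_L1 Mr n)) mo_mass// mulr1. Qed.

(** Symmetry of the convolution, paired with the constant 1. *)
Lemma moll_int n f : L1b m f -> \int[m]_x cvl (rho n) f x = \int[m]_x f x.
Proof.
move=> Lf.
have := cvl_sym (mo_L1 Mr n) (mo_even Mr n) (bmf_cst _ 1) Lf.
under eq_Rint do rewrite moll_cst mul1r.
under [RHS]eq_Rint do rewrite mul1r.
by move=> ->.
Qed.

Definition moll_cvg f := forall e, 0 < e -> exists n0, forall n, (n0 <= n)%N ->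
  \int[m]_x `|cvl (rho n) f x - f x| <= e.

Let Ld n f : L1b m f -> L1b m (fun x => cvl (rho n) f x - f x).
Proof. by move=> Lf; apply: L1bB => //; have [] := moll_L1 n Lf. Qed.

Lemma moll_cvg_close f : L1b m f ->
  (forall e, 0 < e -> exists g, [/\ L1b m g, moll_cvg g & \int[m]_x `|f x - g x| <= e]) ->
  moll_cvg f.
Proof.
move=> Lf H e e0; have e3 : 0 < e / 3 by rewrite divr_gt0.
have [g [Lg Cg fg]] := H _ e3; have [n0 hn0] := Cg _ e3.
exists n0 => n /hn0 hn.
have Lfg := L1bB Lf Lg; have [Lc Ic] := moll_L1 n Lfg.
have L1 := L1b_norm Lc; have L2 := L1b_norm (Ld n Lg); have L3 := L1b_norm Lfg.
have L12 := L1bD L1 L2.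
apply: (@le_trans _ _ (\int[m]_x (`|cvl (rho n) (fun x => f x - g x) x| +
   `|cvl (rho n) g x - g x| + `|f x - g x|))).
  apply: le_Rint; [exact/L1b_norm/Ld|exact: L1bD|move=> x].
  rewrite (cvlB (mo_L1 Mr n))//; [|exact: L1b_bmf Lf|exact: L1b_bmf Lg].
  rewrite (_ : cvl _ f x - f x = cvl (rho n) f x - cvl (rho n) g x +
    (cvl (rho n) g x - g x) - (f x - g x)); last by ring.
  by rewrite (le_trans (ler_normB _ _))// lerD2r ler_normD.
rewrite RintD// RintD//.
have -> : e = e / 3 + e / 3 + e / 3 by field.
by rewrite lerD// lerD// (le_trans Ic).
Qed.

Lemma moll_cvgB f g : L1b m f -> L1b m g -> moll_cvg f -> moll_cvg g ->
  moll_cvg (fun x => f x - g x).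
Proof.
move=> Lf Lg Cf Cg e e0; have e2 : 0 < e / 2 by rewrite divr_gt0.
have [n1 h1] := Cf _ e2; have [n2 h2] := Cg _ e2.
exists (maxn n1 n2) => n; rewrite geq_max => /andP[/h1 k1 /h2 k2].
have L1 := L1b_norm (Ld n Lf); have L2 := L1b_norm (Ld n Lg).
apply: (@le_trans _ _ (\int[m]_x (`|cvl (rho n) f x - f x| + `|cvl (rho n) g x - g x|))).
  apply: le_Rint; [exact/L1b_norm/Ld/L1bB|exact: L1bD|move=> x].
  rewrite (cvlB (mo_L1 Mr n))//; [|exact: L1b_bmf Lf|exact: L1b_bmf Lg].
  rewrite (_ : _ - _ - _ = (cvl (rho n) f x - f x) - (cvl (rho n) g x - g x)); last by ring.
  exact: ler_normB.
by rewrite RintD// [e]splitr lerD.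
Qed.

Lemma moll_cvgZ c f : L1b m f -> moll_cvg f -> moll_cvg (fun x => c * f x).
Proof.
move=> Lf Cf e e0.
have [n0 h0] := Cf (e / (`|c| + 1)) (divr_gt0 e0 (ltr_wpDl (normr_ge0 c) ltr01)).
exists n0 => n /h0 hn.
under eq_Rint => x do rewrite (cvlZ (mo_L1 Mr n) _ _ (L1b_bmf Lf)) -mulrBr normrM.
rewrite RintZ; last exact/L1b_norm/Ld.
rewrite (le_trans (ler_wpM2l _ hn))// mulrCA ler_piMr ?(ltW e0)//.
by rewrite ler_pdivrMr ?mul1r ?lerDl// ltr_wpDl.
Qed.

Lemma moll_cvgD f g : L1b m f -> L1b m g -> moll_cvg f -> moll_cvg g ->
  moll_cvg (fun x => f x + g x).
Proof.
move=> Lf Lg Cf Cg.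
have := moll_cvgB Lf (L1bZ (-1) Lg) Cf (moll_cvgZ (-1) Lg Cg).
by congr moll_cvg; apply/funext => x; rewrite mulN1r opprK.
Qed.

Definition fin_meas A := measurable A /\ (m A < +oo)%E.

Lemma indic_L1b A : fin_meas A -> L1b m \1_A /\ \int[m]_x `|\1_A x : R| = fine (m A).
Proof.
move=> [mA fA].
have bA : bmf (\1_A : 'rV[R]_N -> R).
  split; first exact: measurable_indic.
  by exists 1 => x; rewrite ger0_norm// indicE; case: (_ \in _).
have E : (\int[m]_x `|\1_A x|%:E = m A)%E.
  under eq_integral do rewrite ger0_norm//.
  by rewrite integral_indic// setIT.
have fm : m A = (fine (m A))%:E by rewrite fineK// ge0_fin_numE.
have [L1 _] : L1b m \1_A /\ \int[m]_x `|\1_A x : R| <= fine (m A).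
  by apply: L1b_of => //; rewrite E -fm.
by split=> //; apply: EFin_inj; rewrite -L1bE// E.
Qed.

Lemma Rint_indic A : fin_meas A -> \int[m]_x (\1_A x : R) = fine (m A).
Proof.
by move=> fA; have [_ <-] := indic_L1b fA; apply: eq_Rint => x; rewrite ger0_norm.
Qed.

(** At a point of an open set the mollified indicator is eventually 1, so its deficit inside A tends
    to 0 in L1 by dominated convergence. The integral is preserved, hence the mass that leaks out of
    A equals this deficit and the total error is twice the deficit. *)
Lemma moll_cvg_open A : open A -> fin_meas A -> moll_cvg \1_A.
Proof.
move=> oA fA e e0; have [LA _] := indic_L1b fA; have bA := L1b_bmf LA.
have mA : measurable A by case: fA.
pose g n x := cvl (rho n) \1_A x.
have g01 n x : 0 <= g n x <= 1.
  apply/andP; split; first by apply: moll_ge0 => // y; rewrite indicE.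
  by rewrite -(moll_cst n 1 x); apply: moll_le => //; exact: bmf_cst.
have Lg n : L1b m (g n) by have [] := moll_L1 n LA.
have gA x : A x -> \forall n \near \oo, g n x = 1.
  move=> Ax; have /nbhs_ballP[r /= r0 rA] : nbhs x A by exact: open_nbhs_nbhs.
  near=> n; rewrite /g /cvl.
  transitivity (\int[m]_y rho n (x - y)).
    apply: eq_Rint => y; have [yr|yr] := ltP `|x - y| r.
      by rewrite indicE mem_set ?mulr1//; apply: rA; rewrite -ball_normE.
    rewrite (mo_supp Mr) ?mul0r// (lt_le_trans _ yr)//.
    by near: n; exact: near_infty_natSinv_lt (PosNum r0).
  by rewrite Rint_refl ?mo_mass//; case: (mo_L1 Mr n) => -[].
pose d n x := \1_A x * (1 - g n x).
have Ld' n : L1b m (d n).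
  by apply: L1bMr => //; apply: bmfB; [exact: bmf_cst|exact: L1b_bmf (Lg n)].
have [] := @dominated_convergence _ _ _ m setT measurableT
    (fun n x => (d n x)%:E) (cst 0%E) (fun x => (\1_A x)%:E).
- by move=> n; apply/measurable_EFinP; case: (Ld' n) => -[].
- exact: measurable_cst.
- apply: aeW => x _; apply: cvg_near_cst; rewrite /d indicE.
  have [Ax|nAx] := boolP (x \in A); last by near=> n; rewrite mul0r.
  have := gA x (set_mem Ax); apply: filterS => n ->.
  by rewrite subrr mulr0.
- exact: L1b_int LA.
- apply: aeW => x n _; rewrite gee0_abs ?lee_fin.
    by rewrite /d ler_piMr//; have /andP[h _] := g01 n x; rewrite gerBl.
  by rewrite /d mulr_ge0// subr_ge0; case/andP: (g01 n x).
move=> _ _; rewrite integral0 => /fine_cvgP[] _ /cvgr_lt/(_ (e / 2)).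
rewrite divr_gt0// => /(_ isT) [n0 _ hn0]; exists n0 => n /hn0 /= hn.
have -> : \int[m]_x `|cvl (rho n) \1_A x - \1_A x| =
   \int[m]_x (2 * d n x + (g n x - \1_A x)).
  apply: eq_Rint => x; rewrite -/(g n x) /d indicE; have /andP[h0 h1] := g01 n x.
  case: (x \in A) => /=; last by rewrite mul0r mulr0 add0r !subr0 ger0_norm.
  by rewrite mul1r ler0_norm ?subr_le0//; ring.
have L2 := L1bZ 2 (Ld' n); have L3 := L1bB (Lg n) LA.
rewrite RintD// RintZ// RintB// (moll_int n LA) subrr addr0.
rewrite mulrC -ler_pdivlMr// ltW//.
Unshelve. all: by end_near.
Qed.

Definition obox (r : R) : set 'rV[R]_N := [set x | `|x| < r].

Lemma obox_open r : open (obox r).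
Proof.
rewrite (_ : obox r = (fun x : 'rV[R]_N => `|x|) @^-1` `]-oo, r[).
  by apply: open_comp; [move=> x _; exact: norm_continuous|exact: interval_open].
by apply/seteqP; split=> x; rewrite /obox /= in_itv.
Qed.

Lemma obox_fin r : fin_meas (obox r).
Proof.
have mo : measurable (obox r) by apply: sub_sigma_algebra; exact: obox_open.
split=> //; apply: le_lt_trans (@cube_finite R N r).
apply: le_measure; rewrite ?inE//; first exact: cube_measurable.
by move=> x /ltW.
Qed.

Lemma fin_measI A r : measurable A -> fin_meas (A `&` obox r).
Proof.
have [mo fo] := obox_fin r; move=> mA; split; first exact: measurableI.
by apply: le_lt_trans fo; apply: le_measure; rewrite ?inE//; exact: measurableI.
Qed.

Lemma L1_indic_cvg A (F : nat -> set 'rV[R]_N) : fin_meas A ->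
  (forall n, measurable (F n)) -> (forall n, F n `<=` A) ->
  (forall x, A x -> \forall n \near \oo, F n x) ->
  forall e, 0 < e -> exists n, \int[m]_x `|\1_A x - \1_(F n) x : R| <= e.
Proof.
move=> fA mF FA AF e e0; have [LA _] := indic_L1b fA; have mA : measurable A by case: fA.
have [] := @integrable_setI_cvg0 _ _ _ m _ (fun n => A `\` F n) (L1b_int LA) _ _ e e0.
- by move=> n; exact: measurableD.
- move=> x; have [Ax|nAx] := pselect (A x); last by left; rewrite indicE memNset.
  by right; have := AF x Ax; apply: filterS => n Fn [].
move=> n hn; exists n.
have fF : fin_meas (F n).
  split=> //; case: fA => _; apply: le_lt_trans; apply: le_measure; rewrite ?inE//.
have [LF _] := indic_L1b fF.
rewrite -lee_fin -L1bE; last exact: L1bB.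
apply: le_trans (ltW hn); rewrite [leRHS]integral_mkcond le_eqVlt.
apply/orP; left; apply/eqP; apply: eq_integral => x _.
rewrite patchE !indicE; have [Fx|nFx] := pselect (F n x).
  rewrite (mem_set Fx) (mem_set (FA n x Fx)) subrr normr0.
  by rewrite memNset// => -[].
rewrite (memNset nFx) subr0; have [Ax|nAx] := pselect (A x).
  by rewrite (mem_set Ax) ifT// inE; split.
by rewrite (memNset nAx) normr0 ifF//; apply/negbTE/negP => /set_mem [].
Qed.

(** Dynkin's lemma, starting from the open sets. The bounded box keeps measures finite under
    complements and countable unions. *)
Lemma moll_cvg_box A r : measurable A -> moll_cvg \1_(A `&` obox r).
Proof.
move: A; have LO := (indic_L1b (obox_fin r)).1.
have CO : moll_cvg \1_(obox r) by apply: moll_cvg_open; [exact: obox_open|exact: obox_fin].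
have H := @dynkin_induction _ 'rV[R]_N open (fun A => moll_cvg \1_(A `&` obox r)).
apply: H => //.
- by move=> A B; exact: openI.
- by rewrite setTI.
- move=> A oA; apply: moll_cvg_open; first by apply: openI => //; exact: obox_open.
  by apply: fin_measI; exact: sub_sigma_algebra.
- move=> S mS CS.
  have LS := (indic_L1b (fin_measI r mS)).1.
  have := moll_cvgB LO LS CO CS; congr moll_cvg; apply/funext => x.
  rewrite !indicE !in_setI in_setC.
  by case: (_ \in S); case: (_ \in obox r); rewrite /= ?subr0 ?subrr.
move=> F mF tF CF.
have mU : measurable (\bigcup_k F k) by exact: bigcup_measurable.
have fU := fin_measI r mU; have [LU _] := indic_L1b fU.
pose G n := \bigcup_(k < n) F k.
have mG n : measurable (G n) by apply: bigcup_measurable.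
have CG n : moll_cvg \1_(G n `&` obox r).
  elim: n => [|n IH].
    rewrite /G bigcup0// set0I => e e0; exists 0%N => n _.
    under eq_Rint => x.
      rewrite (_ : \1_set0 = fun=> 0 : R); last by apply/funext => y; rewrite indicE in_set0.
      rewrite moll_cst subrr normr0; over.
    by rewrite Rintegral_cst// mul0r ltW.
  have := moll_cvgD (indic_L1b (fin_measI r (mG n))).1 (indic_L1b (fin_measI r (mF n))).1 IH (CF n).
  congr moll_cvg; apply/funext => x; rewrite !indicE !in_setI.
  have -> : (x \in G n.+1) = (x \in G n) || (x \in F n).
    apply/idP/idP => [/set_mem[k /= kn Fk]|/orP[/set_mem[k /= kn Fk]|/set_mem Fn]].
    - move: kn; rewrite ltnS leq_eqVlt => /predU1P[kE|kn].
        by apply/orP; right; rewrite -kE; exact: mem_set.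
      by apply/orP; left; apply: mem_set; exists k.
    - by apply: mem_set; exists k => //=; exact: ltnW.
    - by apply: mem_set; exists n => /=.
  have [/set_mem[k /= kn Fk]|] := boolP (x \in G n); last by case: (_ \in F n) => /=; rewrite add0r.
  rewrite [x \in F n]memNset ?addr0// => Fn.
  have := trivIsetP.1 tF k n Logic.I Logic.I; rewrite ltn_eqF// => /(_ isT) h.
  by have : (F k `&` F n) x by []; rewrite h.
apply: moll_cvg_close => // e e0.
have [|||n hn] := @L1_indic_cvg _ (fun n => G n `&` obox r) fU _ _ _ e e0 => //.
- by move=> n; apply: measurableI => //; case: (obox_fin r).
- by move=> n x [[k _ Fk] ox]; split=> //; exists k.
- move=> x [[k _ Fk] ox]; near=> n; split=> //; exists k => //=.
  by near: n; exact: nbhs_infty_gt.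
exists \1_(G n `&` obox r); split=> //.
by have [] := indic_L1b (fin_measI r (mG n)).
Unshelve. all: by end_near.
Qed.

Lemma moll_cvg_indic A : fin_meas A -> moll_cvg \1_A.
Proof.
move=> fA; have [LA _] := indic_L1b fA; have mA : measurable A by case: fA.
apply: moll_cvg_close => // e e0.
have [|||n hn] := @L1_indic_cvg _ (fun n => A `&` obox n%:R) fA _ _ _ e e0 => //.
- by move=> n; have [] := fin_measI n%:R mA.
- move=> x Ax; near=> n; split=> //; rewrite /obox /=.
  by near: n; exact: nbhs_infty_gtr.
exists \1_(A `&` obox n%:R); split=> //; last exact: moll_cvg_box.
by have [] := indic_L1b (fin_measI n%:R mA).
Unshelve. all: by end_near.
Qed.

Import HBSimple.

(** Density of simple functions. Their level sets have finite measure by Chebyshev except possibly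
    that of the value 0, which is treated apart. *)
Lemma moll_cvg_L1 f : L1b m f -> moll_cvg f.
Proof.
move=> Lf; apply: moll_cvg_close => // e e0.
have [g [ig _ /fine_cvgP[_ /cvgr_lt/(_ e e0) [n _ hn]]]] :=
  approximation_sfun_integrable measurableT (L1b_int Lf).
have {}hn := hn n (leqnn n); rewrite /= in hn.
have Lg : L1b m (g n).
  split; last exact: ig.
  split; first exact: measurable_funP.
  have [B hB] := simple_bounded (g n).
  exists (`|B| + 1) => x; apply: (hB.2) => //.
  by rewrite (le_lt_trans (ler_norm _))// ltrDl.
exists (g n); split=> //.
  rewrite (_ : (g n : _ -> R) = fun x => \sum_(r \in range (g n)) r * \1_(g n @^-1` [set r]) x); last first.
    by apply/funext => x; rewrite [LHS]fimfunE.
  have fr : finite_set (range (g n)) by exact: fimfunP.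
  rewrite (_ : (fun _ => _) = fun x => \sum_(r <- finmap.enum_fset (fset_set (range (g n))))
      r * \1_(g n @^-1` [set r]) x); last first.
    by apply/funext => x; rewrite fsbig_finite.
  have T r : L1b m (fun x => r * \1_(g n @^-1` [set r]) x) /\ moll_cvg (fun x => r * \1_(g n @^-1` [set r]) x).
    have ms : measurable (g n @^-1` [set r]) by exact: measurable_sfunP.
    have [->|r0] := eqVneq r 0.
      have -> : (fun x => 0 * \1_(g n @^-1` [set 0]) x) = fun x => 0 * f x.
        by apply/funext => x; rewrite !mul0r.
      split; first exact: L1bZ.
      move=> e' e'0; exists 0%N => k _.
      under eq_Rint => x do rewrite (cvlZ (mo_L1 Mr k) _ _ (L1b_bmf Lf)) !mul0r subrr normr0.
      by rewrite Rintegral_cst// mul0r ltW.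
    have fs : fin_meas (g n @^-1` [set r]).
      split=> //.
      have r1 : 0 < `|r| by rewrite normr_gt0.
      have : (`|r|%:E * m (g n @^-1` [set r]) <= \int[m]_x `|g n x|%:E)%E.
        rewrite -integral_cst//.
        apply: (@le_trans _ _ (\int[m]_(x in g n @^-1` [set r]) `|g n x|%:E)%E).
          apply: ge0_le_integral => //.
          - by move=> x _; rewrite lee_fin ltW.
          - by apply: measurable_funTS; apply/measurable_EFinP; apply: measurableT_comp.
          - by move=> x /= ->.
        apply: ge0_subset_integral => //.
        by apply/measurable_EFinP; apply: measurableT_comp.
      rewrite L1bE//; case: (m _) => [x _|h|//]; first exact: ltry.
      by move: h; rewrite gt0_muley ?lte_fin// leye_eq.
    have [L1 _] := indic_L1b fs.
    by split; [exact: L1bZ|apply: moll_cvgZ => //; exact: moll_cvg_indic].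
  elim: (finmap.enum_fset (fset_set (range (g n)))) => [|r s IH].
    under eq_fun do rewrite big_nil.
    have [_] := T 0; congr moll_cvg; apply/funext => x; rewrite mul0r.
    by [].
  under eq_fun do rewrite big_cons.
  have [L1 C1] := T r; apply: moll_cvgD => //.
  elim: s {IH} => [|r' s IH].
    under eq_fun do rewrite big_nil; have [h _] := T 0; move: h.
    by congr L1b; apply/funext => x; rewrite mul0r.
  under eq_fun do rewrite big_cons; apply: L1bD => //.
  by have [] := T r'.
exact: ltW.
Qed.

End mollification.

(** * Smooth bumps, the mollifier and the time cutoffs *)

Section affine.
Context {R : realType} {V : normedModType R}.

Lemma affine_lin (L : {linear V -> R}) (a c : R) : continuous L ->
  affine_fun (fun x : V => c + a * L x).
Proof.
move=> cL.
have dL x : differentiable L x by exact: linear_differentiable.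
have daL x : differentiable (a \*: (L : V -> R)) x by exact: differentiableZ.
have dc x : differentiable (cst c : V -> R) x by exact: differentiable_cst.
split=> [x|v]; first exact: (differentiableD (dc x) (daL x)).
exists (a * L v) => x.
have -> : (fun x : V => c + a * L x) = (cst c : V -> R) + (a \*: (L : V -> R)) by [].
rewrite deriveD; [|exact: diff_derivable|exact: diff_derivable].
rewrite derive_cst add0r deriveZ; last exact: diff_derivable.
by rewrite (deriveE _ (dL x)) diff_lin.
Qed.

End affine.

Section affine_examples.
Context {R : realType} {N : nat}.

Lemma affine_coord (i : 'I_N) (a c : R) : affine_fun (fun x : 'rV[R]_N => c + a * x ord0 i).
Proof.
have @f : {linear 'rV[R]_N -> R}.
  by exists (fun x : 'rV[R]_N => x ord0 i); do 2![eexists]; do ?[constructor];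
     rewrite ?mxE// => ? *; rewrite ?mxE//; move=> ?; rewrite !mxE.
have := @affine_lin _ _ f a c; apply => x; exact: coord_continuous.
Qed.

Lemma affine_coord1 (i : 'I_N) (a c : R) :
  affine_fun (fun p : 'rV[R]_N * R => c + a * p.1 ord0 i).
Proof.
have @f : {linear ('rV[R]_N * R)%type -> R}.
  by exists (fun p : 'rV[R]_N * R => p.1 ord0 i); do 2![eexists]; do ?[constructor];
     rewrite ?mxE// => ? *; rewrite ?mxE//; move=> ?; rewrite !mxE.
have := @affine_lin _ _ f a c; apply => p.
apply: (@continuous_comp _ _ _ fst (fun v : 'rV[R]_N => v ord0 i)).
  exact: cvg_fst.
exact: coord_continuous.
Qed.

Lemma affine_time (a c : R) : affine_fun (fun p : 'rV[R]_N * R => c + a * p.2).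
Proof.
have @f : {linear ('rV[R]_N * R)%type -> R}.
  by exists (fun p : 'rV[R]_N * R => p.2); do 2![eexists]; do ?[constructor].
have := @affine_lin _ _ f a c; apply => p; exact: cvg_snd.
Qed.

Lemma affine_line (a c : R) : affine_fun (fun t : R => c + a * t).
Proof.
have @f : {linear R -> R}.
  by exists (fun t : R => t); do 2![eexists]; do ?[constructor].
have := @affine_lin _ _ f a c; apply => p; exact: cvg_id.
Qed.

Lemma smc_ext (V : normedModType R) (f g : V -> R) : f =1 g -> smc f -> smc g.
Proof. by move=> /funext ->. Qed.

Definition bump1 (t : R) : R := flat 1 (1 + t) * flat 1 (1 - t).

Lemma smc_bump1 (V : normedModType R) (l : V -> R) a :
  (forall b d, affine_fun (fun x => d + b * l x)) -> forall c,
  smc (fun x => bump1 (c + a * l x)).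
Proof.
move=> al c; apply: smc_mul.
  apply: (@smc_ext _ (fun x => flat 1 ((1 + c) + a * l x))).
    by move=> x; rewrite addrA.
  exact: smc_flat.
apply: (@smc_ext _ (fun x => flat 1 ((1 - c) + - a * l x))).
  by move=> x; congr flat; ring.
exact: smc_flat.
Qed.

Lemma bump1_ge0 (t : R) : 0 <= bump1 t.
Proof. by rewrite mulr_ge0// flat1_ge0. Qed.

Lemma bump1_out (t : R) : 1 <= `|t| -> bump1 t = 0.
Proof.
rewrite ler_normr => /orP[h|h]; rewrite /bump1.
  by rewrite [X in _ * X]flat_eq0 ?mulr0// subr_le0.
by rewrite flat_eq0 ?mul0r// -[t]opprK subr_le0.
Qed.

Lemma bump1_gt0 (t : R) : `|t| < 1 -> 0 < bump1 t.
Proof.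
by rewrite ltr_norml => /andP[h1 h2]; rewrite mulr_gt0// flat_gt0; lra.
Qed.

Lemma bump1N t : bump1 (- t) = bump1 t.
Proof. by rewrite /bump1 opprK mulrC. Qed.

(** The usual smooth step from 0 on t <= 0 to 1 on t >= 1; the denominator is positive because t and
    1 - t are never both nonpositive. *)
Definition sigmo (t : R) : R := flat 1 t * (flat 1 t + flat 1 (1 - t))^-1.

Lemma sigmo_den (t : R) : 0 < flat 1 t + flat 1 (1 - t).
Proof.
have [t0|t0] := ltP 0 t; first by rewrite ltr_pwDl ?flat1_ge0// flat_gt0.
by rewrite ltr_wpDl ?flat1_ge0// flat_gt0; lra.
Qed.

Lemma sigmo_0 (t : R) : t <= 0 -> sigmo t = 0.
Proof. by move=> t0; rewrite /sigmo flat_eq0// mul0r. Qed.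

Lemma sigmo_1 (t : R) : 1 <= t -> sigmo t = 1.
Proof.
move=> t1; rewrite /sigmo [X in _ + X]flat_eq0 ?subr_le0// addr0 mulfV//.
by apply: lt0r_neq0; rewrite flat_gt0 (lt_le_trans ltr01).
Qed.

Lemma sigmo_01 t : 0 <= sigmo t <= 1.
Proof.
rewrite /sigmo divr_ge0 ?flat1_ge0//=; last exact: ltW (sigmo_den t).
by rewrite ler_pdivrMr ?sigmo_den// mul1r lerDl flat1_ge0.
Qed.

Lemma smc_sigmo (V : normedModType R) (l : V -> R) a :
  (forall b d, affine_fun (fun x => d + b * l x)) -> forall c,
  smc (fun x => sigmo (c + a * l x)).
Proof.
move=> al c.
have S1 : smc (fun x => flat 1 (c + a * l x)) by exact: smc_flat.
apply: smc_mul => //; apply: smc_inv.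
  apply: smc_add => //.
  apply: (@smc_ext _ (fun x => flat 1 ((1 - c) + - a * l x))).
    by move=> x; congr flat; ring.
  exact: smc_flat.
by move=> x; exact: lt0r_neq0 (sigmo_den _).
Qed.

End affine_examples.

Section standard_mollifier.
Context {R : realType} {N : nat}.
Local Notation m := (lebesgue_rV R N).
Implicit Types x y : 'rV[R]_N.

Definition prebump n x : R := \prod_i bump1 (n.+1%:R * x ord0 i).
Definition rho n x : R := (\int[m]_y prebump n y)^-1 * prebump n x.

Lemma smc_prebump n : smc (prebump n).
Proof.
apply: smc_prod => i.
apply: (@smc_ext _ _ (fun x : 'rV[R]_N => bump1 (0 + n.+1%:R * x ord0 i))).
  by move=> x; rewrite add0r.
by apply: smc_bump1 => b d; exact: affine_coord.
Qed.

Lemma prebump_out n x : n.+1%:R^-1 < `|x| -> prebump n x = 0.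
Proof.
move=> nx; have : ~~ (`|x| <= n.+1%:R^-1) by rewrite -ltNge.
rewrite rV_norm_le ?invr_ge0// => /forallPn[i]; rewrite -ltNge => h.
rewrite /prebump (bigD1 i)//= bump1_out ?mul0r//.
rewrite normrM ger0_norm// mulrC -ler_pdivrMr//.
by rewrite mul1r ltW.
Qed.

Lemma prebump_ge0 n x : 0 <= prebump n x.
Proof. by apply: prodr_ge0 => i _; exact: bump1_ge0. Qed.

Lemma prebump_L1b n : L1b m (prebump n).
Proof. by have [] := smc_kernel (smc_prebump n) (@prebump_out n). Qed.

(** If the integral were 0, the set of positivity would be null; but it contains the box of points
    with coordinates in ]0, a] with a = 1/(2 (n + 1)), of measure a^N. *)
Lemma prebump_mass n : 0 < \int[m]_y prebump n y.
Proof.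
have L := prebump_L1b n.
rewrite lt_neqAle Rint_ge0 ?andbT; last exact: prebump_ge0.
apply/eqP => I0.
pose a : R := (2 * n.+1%:R)^-1.
have a0 : 0 < a by rewrite invr_gt0 mulr_gt0.
pose B := [set v : 'rV[R]_N | forall i : 'I_N, v ord0 i \in `]0, a]].
have mB : measurable B.
  rewrite (_ : B = \bigcap_(i in [set: 'I_N]) ((fun v : 'rV[R]_N => v ord0 i)
      @^-1` `]0, a])).
    apply: fin_bigcap_measurable => // i _; rewrite -[X in measurable X]setTI.
    exact: coord_measurable.
  by apply/seteqP; split=> [v Bv i _|v Bv i]; exact: Bv.
have B0 : m B = (a ^+ N)%:E.
  rewrite /B (@lebesgue_rV_box R N (fun=> 0) (fun=> a)) => [|_]; last exact: ltW.
  by rewrite prodr_const card_ord subr0.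
have : (\int[m]_x `|prebump n x|%:E = 0)%E.
  rewrite (L1bE L) (_ : \int[m]_x `|prebump n x| = 0)// I0.
  by apply: eq_Rint => x; rewrite ger0_norm// prebump_ge0.
have mp : measurable_fun setT (EFin \o prebump n) by apply/measurable_EFinP; case: L => -[].
move=> /(ae_eq_integral_abs m measurableT mp) ae0.
have : m.-negligible B.
  apply: negligibleS ae0 => x Bx /= h.
  have := h Logic.I; apply/eqP; rewrite eqe gt_eqF//.
  apply: prodr_gt0 => i _; apply: bump1_gt0.
  have := Bx i; rewrite in_itv/= => /andP[x0 xa].
  rewrite normrM !gtr0_norm//; apply: (@le_lt_trans _ _ (n.+1%:R * a)).
    by rewrite ler_pM2l.
  rewrite /a invfM mulrCA mulfV// mulr1.
  by rewrite invf_lt1// ltr1n.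
move=> /(measure_negligible mB) hB; have := etrans (esym B0) hB.
by move/eqP; rewrite eqe gt_eqF// exprn_gt0.
Qed.

Lemma smc_rho n : smc (rho n).
Proof. by apply: smc_mul; [exact: smc_cst|exact: smc_prebump]. Qed.

Lemma rho_out n x : n.+1%:R^-1 < `|x| -> rho n x = 0.
Proof. by move=> nx; rewrite /rho prebump_out// mulr0. Qed.

Lemma rhoN n x : rho n (- x) = rho n x.
Proof.
by congr (_ * _); apply: eq_bigr => i _; rewrite mxE mulrN bump1N.
Qed.

Lemma rho_mollifier : mollifier rho.
Proof.
split=> [n|n x|n|n x|n x].
- by have [] := smc_kernel (smc_rho n) (@rho_out n).
- by rewrite mulr_ge0 ?prebump_ge0// invr_ge0 ltW// prebump_mass.
- rewrite /rho RintZ; last exact: prebump_L1b.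
  by rewrite mulVf// gt_eqF// prebump_mass.
- exact: rho_out.
- exact: rhoN.
Qed.

(** Equal to 1 on [-1, s] and to 0 from s + e on. The second factor cuts off negative times, since
    test functions have compact support in R^N x R. *)
Definition cutoff (s e t : R) := sigmo ((s + e) / e + - e^-1 * t) * sigmo (2 + 1 * t).

Lemma cutoff_1 s e t : 0 < e -> -1 <= t -> t <= s -> cutoff s e t = 1.
Proof.
move=> e0 t1 ts; rewrite /cutoff !sigmo_1 ?mulr1//; first by lra.
by rewrite mulNr (mulrC e^-1) -mulrBl ler_pdivlMr//; lra.
Qed.

Lemma cutoff_out s e t : 0 < e -> s + e <= t \/ t <= -2 -> cutoff s e t = 0.
Proof.
move=> e0 [h|h]; last by rewrite /cutoff [X in _ * X]sigmo_0 ?mulr0//; lra.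
rewrite /cutoff sigmo_0 ?mul0r// mulNr (mulrC e^-1) -mulrBl.
by rewrite ler_pdivrMr// mul0r subr_le0.
Qed.

Lemma cutoff_01 s e t : 0 <= cutoff s e t <= 1.
Proof.
rewrite /cutoff; have /andP[? ?] := sigmo_01 ((s + e) / e + - e^-1 * t).
have /andP[? ?] := sigmo_01 (2 + 1 * t); rewrite mulr_ge0//=.
by rewrite -[leRHS]mulr1 ler_pM.
Qed.

Lemma smc_cutoff s e : smc (cutoff s e).
Proof.
by apply: smc_mul; apply: (@smc_sigmo R R id) => b d; exact: affine_line.
Qed.

Lemma test_function_rho T n x s e : 0 < e -> s + e < T ->
  test_function T (fun p : 'rV[R]_N * R => rho n (x - p.1) * cutoff s e p.2).
Proof.
move=> e0 sT; set psi := (fun _ => _).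
pose K : set ('rV[R]_N * R) := ((fun z => x - z) @` cube n.+1%:R^-1) `*` `[-2, s + e].
have cK : compact K.
  apply: compact_setX; last exact: segment_compact.
  apply: continuous_compact; last exact: cube_compact.
  apply: continuous_subspaceT => z; apply: (@continuousB _ _ _ (cst x) id z).
    exact: cst_continuous.
  exact: cvg_id.
have hK : closed K.
  by apply: compact_closed => //; exact: norm_hausdorff.
have sK : [set y | psi y != 0] `<=` K.
  move=> [y t] /= h; split=> /=.
    exists (x - y); last by rewrite subKr.
    rewrite /cube /=; rewrite leNgt; apply/negP => xy; move: h.
    by rewrite /psi /= rho_out// mul0r eqxx.
  rewrite in_itv/= !leNgt -negb_or; apply/negP => /orP ht; move: h.
  rewrite /psi /= cutoff_out ?mulr0 ?eqxx//.
  by case: ht => /ltW; [right|left].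
have clK : closure [set y | psi y != 0] `<=` K.
  by have := closure_subset sK; rewrite -(closure_id K).1.
split.
- apply: smc_smooth; apply: smc_mul.
    apply: smc_mul; first exact: smc_cst.
    apply: smc_prod => i.
    apply: (@smc_ext _ _ (fun p : 'rV[R]_N * R => bump1 (n.+1%:R * x ord0 i + (- n.+1%:R) * p.1 ord0 i))).
      by move=> p; rewrite !mxE mulrBr mulNr.
    by apply: (smc_bump1 (l := fun p : 'rV[R]_N * R => p.1 ord0 i)) => b d; exact: affine_coord1.
  by apply: smc_mul; apply: (smc_sigmo (l := fun p : 'rV[R]_N * R => p.2)) => b d; exact: affine_time.
- exact: (subclosed_compact (@closed_closure _ _) cK clK).
- move=> y /clK [_ /=]; rewrite in_itv/= => /andP[_] /le_lt_trans; exact.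
Qed.

End standard_mollifier.

(** * From the weak equation in time to the integrated equation *)

Section interval_integrals.
Context {R : realType}.
Local Notation leb := (@lebesgue_measure R).
Implicit Types (f g : measurableTypeR R -> R).

Lemma leb_itvoo_fin (a b : R) : (leb `]a, b[%classic < +oo)%E.
Proof.
by rewrite lebesgue_measure_itv /=; case: ifP => _; rewrite ?ltry// -EFinB ltry.
Qed.

Lemma leb_itvoc_fin (a b : R) : (leb `]a, b]%classic < +oo)%E.
Proof.
by rewrite lebesgue_measure_itv /=; case: ifP => _; rewrite ?ltry// -EFinB ltry.
Qed.

Lemma integrable_itv f C (a b : R) : measurable_fun setT f -> (forall x, `|f x| <= C) ->
  leb.-integrable `]a, b[ (EFin \o f).
Proof.
move=> mf fC; apply: measurable_bounded_integrable => //.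
- exact: leb_itvoo_fin.
- exact: measurable_funTS.
- exists C; split; first exact: num_real.
  by move=> M CM x _; exact: le_trans (fC x) (ltW CM).
Qed.

Lemma Rint_itv_le f C (a b : R) : a <= b -> measurable_fun setT f ->
  (forall x, x \in `]a, b[ -> `|f x| <= C) -> 0 <= C ->
  `|\int[leb]_(x in `]a, b[) f x| <= C * (b - a).
Proof.
move=> ab mf fC C0.
(* Extension by 0 turns a bound on the interval into a bound everywhere. *)
pose g x := if x \in `]a, b[ then f x else 0.
have gC x : `|g x| <= C by rewrite /g; case: ifP => [/fC//|_]; rewrite normr0.
have mg : measurable_fun setT g.
  apply: measurable_fun_ifT => //.
  rewrite (_ : (fun _ => _) = fun x : R => (a < x) && (x < b)).
    by apply: measurable_and; exact: measurable_fun_ltr.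
  by apply/funext => x; rewrite in_itv.
have -> : \int[leb]_(x in `]a, b[) f x = \int[leb]_(x in `]a, b[) g x.
  by apply: eq_Rintegral => x; rewrite inE /g => /= ->.
have ig := integrable_itv a b mg gC.
rewrite (le_trans (le_normr_Rintegral _ ig))//.
apply: (@le_trans _ _ (\int[leb]_(x in `]a, b[) C)).
  have mn : measurable_fun setT (fun x => `|g x|) by exact: measurableT_comp.
  have mc : measurable_fun [set: measurableTypeR R] (fun=> C : R) by exact: measurable_cst.
  have i1 := integrable_itv a b mc (C := `|C|) (fun=> lexx _).
  have i2 : leb.-integrable `]a, b[ (EFin \o (fun x => `|g x|)).
    by apply: (integrable_itv (C := C) a b mn) => x; rewrite normr_id.
  by apply: le_Rintegral.
have E : fine (leb `]a, b[%classic) = b - a.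
  rewrite lebesgue_measure_itv /= lte_fin; case: ltP => [_|ba]; first by rewrite -EFinB.
  by apply/esym/eqP; rewrite subr_eq0 eq_le ba ab.
by rewrite Rintegral_cst// -E.
Qed.

Lemma Rint_itv_split f C (a b c : R) : a <= b -> b <= c -> measurable_fun setT f ->
  (forall x, `|f x| <= C) ->
  \int[leb]_(x in `]a, c[) f x = \int[leb]_(x in `]a, b[) f x + \int[leb]_(x in `]b, c[) f x.
Proof.
move=> ab bc mf fC.
have E (p q : R) : \int[leb]_(x in `]p, q[) f x = \int[leb]_(x in `]p, q]) f x.
  by apply: Rintegral_itv_bndo_bndc; exact: integrable_itv mf fC.
rewrite !E; have [abE|ab'] := eqVneq a b.
  by rewrite abE set_itvxx// Rintegral_set0 add0r.
rewrite -Rintegral_setU//=.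
- rewrite -itv_bndbnd_setU//; by rewrite bnd_simp.
- have : leb.-integrable `]a, c] (EFin \o f).
    apply: measurable_bounded_integrable => //.
    + exact: leb_itvoc_fin.
    + exact: measurable_funTS.
    + exists C; split; first exact: num_real.
      by move=> M CM x _; exact: le_trans (fC x) (ltW CM).
  by rewrite -itv_bndbnd_setU// bnd_simp.
- apply/disj_setPS => x [/=]; rewrite !in_itv/= => /andP[_ xb] /andP[bx _].
  by have := le_lt_trans xb bx; rewrite ltxx.
Qed.

End interval_integrals.

Section cutoff_derivative.
Context {R : realType}.
Implicit Types t : R.

Lemma smc_sigmo1 : smc (@sigmo R).
Proof.
apply: (@smc_ext _ _ (fun t : R => sigmo (0 + 1 * t))).
  by move=> t; rewrite add0r mul1r.
by apply: (@smc_sigmo R R id) => b d; exact: affine_line.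
Qed.

Lemma sigmo_derivable t : derivable (@sigmo R) t 1.
Proof. by apply: diff_derivable; exact: smc_differentiable smc_sigmo1 _. Qed.

Lemma sigmo_sym t : sigmo (1 - t) = 1 - sigmo t.
Proof.
have d0 : flat 1 t + flat 1 (1 - t) != 0 by apply: lt0r_neq0; exact: sigmo_den.
by rewrite /sigmo subKr (addrC (flat 1 (1 - t))); field.
Qed.

Lemma dsig_le0 t : t <= 0 -> derive1 (@sigmo R) t = 0.
Proof.
move=> t0; rewrite derive1E.
have S1 : smc (fun x : R => flat 1 (0 + 1 * x)).
  by apply: smc_flat; exact: affine_line.
have S2 : smc (fun x : R => flat 1 (1 + - 1 * x)) by apply: smc_flat; exact: affine_line.
have Si : smc (fun x : R => (flat 1 x + flat 1 (1 - x))^-1).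
  apply: smc_inv; last by move=> x; exact: lt0r_neq0 (sigmo_den _).
  by apply: (smc_ext _ (smc_add S1 S2)) => x; rewrite add0r mul1r mulN1r.
have d1 : derivable (flat (1 : {poly R})) t 1.
  by have [] := is_derive_flat 1 t.
have d2 : derivable (fun x : R => (flat 1 x + flat 1 (1 - x))^-1) t 1.
  by apply: diff_derivable; exact: smc_differentiable.
rewrite (_ : @sigmo R = (flat 1 * (fun x : R => (flat 1 x + flat 1 (1 - x))^-1)))//.
rewrite deriveM// flat_eq0// scale0r add0r.
have [_ ->] := is_derive_flat (1 : {poly R}) t.
by apply/eqP; rewrite scaler_eq0; apply/orP; right; rewrite flat_eq0.
Qed.

Lemma dsig_ge1 t : 1 <= t -> derive1 (@sigmo R) t = 0.
Proof.
move=> t1; have t0 : 1 - t <= 0 by rewrite subr_le0.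
have E : @sigmo R = cst 1 - (@sigmo R \o (fun t => 1 - t)).
  by apply/funext => x; rewrite -[LHS](subKr 1) -sigmo_sym.
have ds : is_derive t 1 (fun t : R => 1 - t) (- 1).
  have := is_deriveB (is_derive_cst (1 : R) t 1) (is_derive_id t 1).
  by move=> h; apply: is_derive_eq h _; rewrite sub0r.
have dc : is_derive t 1 (@sigmo R \o (fun t => 1 - t)) (derive1 (@sigmo R) (1 - t) * - 1).
  apply: is_derive1_comp; apply: DeriveDef; first exact: sigmo_derivable.
  by rewrite derive1E.
have [dc1 dc2] := dc.
have dcst : derivable (cst (1 : R) : R -> R) t 1 by exact: derivable_cst.
rewrite derive1E E deriveB// derive_cst sub0r dc2.
by rewrite dsig_le0// mul0r oppr0.
Qed.

Lemma dsig_cont : continuous (derive1 (@sigmo R)).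
Proof.
rewrite (_ : derive1 _ = 'D_1 (@sigmo R)); last by apply/funext => t; rewrite derive1E.
have h : smc ('D_(1 : R) (@sigmo R)) by apply: smc_derive smc_sigmo1.
exact: smc_continuous h.
Qed.

Lemma dsig_bound : exists2 C : R, 0 <= C & forall t, `|derive1 (@sigmo R) t| <= C.
Proof.
have [|c c01 hc] := @EVT_max R (fun t => `|derive1 (@sigmo R) t|) 0 1 ler01.
  apply: continuous_subspaceT => t; apply: continuous_comp; first exact: dsig_cont.
  exact: norm_continuous.
exists `|derive1 (@sigmo R) c| => // t.
have [t0|t0] := leP t 0; first by rewrite dsig_le0// normr0.
have [t1|t1] := leP 1 t; first by rewrite dsig_ge1// normr0.
by apply: hc; rewrite in_itv/= !ltW.
Qed.

Lemma cutoff_derivable (s e : R) t : derivable (cutoff s e) t 1.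
Proof. by apply: diff_derivable; exact: smc_differentiable (smc_cutoff _ _) _. Qed.

(** For t > -1 the second factor of the cutoff is locally the constant 1. *)
Lemma dcutoff (s e : R) t : -1 < t ->
  derive1 (cutoff s e) t = derive1 (@sigmo R) ((s + e) / e + - e^-1 * t) * - e^-1.
Proof.
move=> t1; rewrite derive1E.
pose l (x : R) := (s + e) / e + - e^-1 * x.
have dl : is_derive t 1 l (- e^-1).
  have d1 : is_derive t 1 (fun x : R => - e^-1 * x) (- e^-1).
    have := is_deriveZ (- e^-1) (is_derive_id t 1).
    by move=> h; apply: is_derive_eq h _; rewrite /GRing.scale /= mulr1.
  have := is_deriveD (is_derive_cst ((s + e) / e) t 1) d1.
  by move=> h; apply: is_derive_eq h _; rewrite add0r.
have dc : is_derive t 1 (@sigmo R \o l) (derive1 (@sigmo R) (l t) * - e^-1).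
  apply: is_derive1_comp; apply: DeriveDef; first exact: sigmo_derivable.
  by rewrite derive1E.
have [_ <-] := dc; apply: near_eq_derive; near=> x.
rewrite /cutoff /= -/(l x) [X in _ * X]sigmo_1 ?mulr1//.
have : -1 < x by near: x; exact: lt_nbhsr.
by lra.
Unshelve. all: by end_near.
Qed.

Lemma dcutoff_cont (s e : R) : continuous (derive1 (cutoff s e)).
Proof.
rewrite (_ : derive1 _ = 'D_1 (cutoff s e)); last by apply/funext => t; rewrite derive1E.
have h : smc ('D_(1 : R) (cutoff s e)) by apply: smc_derive (smc_cutoff s e).
exact: smc_continuous h.
Qed.

End cutoff_derivative.

Section time_limit.
Context {R : realType}.
Local Notation leb := (@lebesgue_measure R).
Variables (T : R) (V G : measurableTypeR R -> R) (V0 MV MG : R).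
Hypotheses (T0 : 0 < T) (mV : measurable_fun setT V) (mG : measurable_fun setT G).
Hypotheses (VM : forall t, `|V t| <= MV) (GM : forall t, `|G t| <= MG).
Hypothesis cV : forall s : R, 0 <= s <= T -> forall g : R, 0 < g ->
  exists2 d : R, 0 < d & forall t : R, 0 <= t <= T -> `|t - s| < d -> `|V t - V s| <= g.
Hypothesis weak : forall s e : R, 0 <= s -> 0 < e -> s + e < T ->
  \int[leb]_(t in `]0, T[) (V t * derive1 (cutoff s e) t + G t * cutoff s e t) + V0 = 0.

Let MG0 : 0 <= MG. Proof. exact: le_trans (GM 0). Qed.
Let MV0 : 0 <= MV. Proof. exact: le_trans (VM 0). Qed.

Let mcutoff s e : measurable_fun [set: measurableTypeR R] (cutoff s e).
Proof. exact: continuous_measurable_fun (smc_continuous (smc_cutoff s e)). Qed.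

Let mdcutoff s e : measurable_fun [set: measurableTypeR R] (derive1 (cutoff s e)).
Proof. exact: continuous_measurable_fun (@dcutoff_cont R s e). Qed.

Lemma dcutoff_mass s e : 0 <= s -> 0 < e -> \int[leb]_(t in `]s, s + e[) derive1 (cutoff s e) t = -1.
Proof.
move=> s0 e0; have se : s < s + e by rewrite ltrDl.
have := @continuous_FTC2 R (derive1 (cutoff s e)) (cutoff s e) s (s + e) se.
have -> : cutoff s e (s + e) = 0 by apply: cutoff_out => //; left.
rewrite (_ : cutoff s e s = 1); last by apply: cutoff_1 => //; lra.
move=> h; have {}h : (\int[leb]_(x in `[s, (s + e)%R]) (derive1 (cutoff s e) x)%:E = (0 - 1)%R%:E)%E.
  apply: h => //.
    by apply: continuous_subspaceT => x; exact: dcutoff_cont.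
  have ce : continuous (cutoff s e) by exact: smc_continuous (smc_cutoff s e).
  split.
  - by move=> x _; exact: cutoff_derivable.
  - by apply: cvg_at_right_filter; exact: ce.
  - by apply: cvg_at_left_filter; exact: ce.
rewrite /Rintegral.
have -> : (\int[leb]_(t in `]s, (s + e)%R[) (derive1 (cutoff s e) t)%:E =
    \int[leb]_(x in `[s, (s + e)%R]) (derive1 (cutoff s e) x)%:E)%E.
  rewrite integral_itv_bndo_bndc ?integral_itv_obnd_cbnd//;
    by apply: measurable_funTS; apply: measurableT_comp => //; exact: mdcutoff.
by rewrite h /= sub0r.
Qed.

(** As e tends to 0, the derivative of the cutoff acts as minus a unit mass at s, approached from
    the right: on ]s, s + e[ it has integral -1 and total variation at most C, and V is continuous.
    The term with G exceeds its integral up to s by at most MG e. *)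
Lemma time_limit_lt s : 0 <= s -> s < T -> V s = V0 + \int[leb]_(r in `]0, s[) G r.
Proof.
move=> s0 sT.
have [C C0 hC] := @dsig_bound R.
apply/eqP; rewrite -subr_eq0 -normr_le0; apply/ler_addgt0Pr => g g0; rewrite add0r.
have g1 : 0 < g / 2 / (C + 1) by rewrite !divr_gt0// ltr_wpDl.
have sT' : 0 <= s <= T by rewrite s0 ltW.
have [d d0 hd] := cV sT' g1.
(* The three bounds secure the continuity estimate on ]s, s + e[, room below T, and a small integral
   of G. *)
pose e := Num.min (d / 2) (Num.min ((T - s) / 2) (g / 2 / (MG + 1))).
have g2 : 0 < g / 2 / (MG + 1) by rewrite !divr_gt0// ltr_wpDl.
have Ts : 0 < T - s by rewrite subr_gt0.
have e0 : 0 < e by rewrite !lt_min g2 !divr_gt0.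
have ed : e < d.
  by apply: (@le_lt_trans _ _ (d / 2)); [rewrite ge_min lexx|lra].
have esT : s + e < T.
  have : e <= (T - s) / 2 by rewrite ge_min; apply/orP; right; rewrite ge_min lexx.
  by lra.
have eg : e <= g / 2 / (MG + 1).
  by rewrite ge_min; apply/orP; right; rewrite ge_min lexx orbT.
have W := weak s0 e0 esT.
pose E := cutoff s e; pose E' := derive1 (cutoff s e).
have detaE t : -1 < t -> `|E' t| <= C / e.
  move=> t1; rewrite /E' dcutoff// normrM normrN (gtr0_norm (_ : 0 < e^-1)) ?invr_gt0//.
  by rewrite ler_wpM2r// invr_ge0 ltW.
have deta0 t : -1 < t -> t <= s \/ s + e <= t -> E' t = 0.
  move=> t1 ht; rewrite /E' dcutoff// mulNr (mulrC e^-1) -mulrBl.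
  case: ht => h; [rewrite dsig_ge1 ?mul0r//|rewrite dsig_le0 ?mul0r//].
    by rewrite ler_pdivlMr//; lra.
  by rewrite ler_pdivrMr//; lra.
have E01 t : `|E t| <= 1.
  by have /andP[h0 h1] := cutoff_01 s e t; rewrite ger0_norm.
have A1 : \int[leb]_(t in `]0, T[) (V t * E' t) = \int[leb]_(t in `]s, s + e[) (V t * E' t).
  rewrite [LHS]Rintegral_mkcond [RHS]Rintegral_mkcond; apply: eq_Rintegral => t _.
  rewrite !patchE !mem_setE !in_itv/=.
  have [st|st] := leP t s.
    case: ifP => [/andP[t0 tT]|_]; last by [].
    by rewrite deta0 ?mulr0//; [lra|left].
  have [te|te] := leP (s + e) t.
    case: ifP => [/andP[t0 tT]|_]; last by [].
    by rewrite deta0 ?mulr0//; [lra|right].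
  by rewrite ifT// (le_lt_trans s0 st) (lt_trans te esT).
(* The bound C / e on the derivative is known for t > -1; [clip] satisfies it everywhere and agrees
   with the derivative at nonnegative times. *)
pose clip (t : measurableTypeR R) : R := if (-1 < t) then E' t else 0.
have mclip : measurable_fun setT clip.
  apply: measurable_fun_ifT => //; last exact: mdcutoff.
  have : measurable_fun setT (fun t : measurableTypeR R => (-1 < t)%R) by exact: measurable_fun_ltr.
  by [].
have clipE t : 0 <= t -> clip t = E' t by move=> t0; rewrite /clip ifT//; lra.
have Ce : 0 <= C / e by rewrite divr_ge0// ltW.
have clipC t : `|clip t| <= C / e.
  by rewrite /clip; case: ifP => [/detaE//|_]; rewrite normr0.
have mVc : measurable_fun setT (fun t => V t * clip t) by exact: measurable_funM mV mclip.
have VcC t : `|V t * clip t| <= MV * (C / e) by rewrite normrM ler_pM.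
have mGE : measurable_fun setT (fun t => G t * E t) by apply: measurable_funM => //; exact: mcutoff.
have GEC t : `|G t * E t| <= MG by rewrite normrM -[MG]mulr1 ler_pM.
have cl (p q : R) (f : measurableTypeR R -> R) : 0 <= p ->
   \int[leb]_(t in `]p, q[) (f t * clip t) = \int[leb]_(t in `]p, q[) (f t * E' t).
  move=> p0; apply: eq_Rintegral => t; rewrite inE /= in_itv/= => /andP[pt _].
  by rewrite clipE// (le_trans p0)// ltW.
have W1 : \int[leb]_(t in `]s, s + e[) (V t * E' t) + \int[leb]_(t in `]0, T[) (G t * E t)
    + V0 = 0.
  rewrite -A1 -cl// -RintegralD//.
  - rewrite -[RHS]W; congr (_ + _); apply: eq_Rintegral => t; rewrite inE /= in_itv/=.
    by move=> /andP[t0 _]; rewrite clipE// ltW.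
  - exact: integrable_itv mVc VcC.
  - exact: integrable_itv mGE GEC.
have A2 : \int[leb]_(t in `]0, T[) (G t * E t) =
   \int[leb]_(t in `]0, s[) G t + \int[leb]_(t in `]s, s + e[) (G t * E t).
  rewrite (@Rint_itv_split R _ MG 0 s T)//; last exact: ltW.
  rewrite (@Rint_itv_split R _ MG s (s + e) T)//; [|by rewrite lerDl ltW|exact: ltW].
  congr (_ + _).
    apply: eq_Rintegral => t; rewrite inE /= in_itv/= => /andP[t0 ts].
    by rewrite /E cutoff_1 ?mulr1//; [lra|exact: ltW].
  rewrite [X in _ + X](_ : _ = 0) ?addr0//.
  rewrite -[RHS](_ : \int[leb]_(t in `]s + e, T[) (0 : R) = 0).
    apply: eq_Rintegral => t; rewrite inE /= in_itv/= => /andP[t0 ts].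
    by rewrite /E cutoff_out ?mulr0//; left; exact: ltW.
  by rewrite Rintegral_cst// mul0r.
(* The derivative has integral -1 on this interval, so V s can be absorbed into the integral. *)
have A3 : V s + \int[leb]_(t in `]s, s + e[) (V t * E' t) =
    \int[leb]_(t in `]s, s + e[) ((V t - V s) * clip t).
  have h1 : V s = - \int[leb]_(t in `]s, s + e[) (V s * clip t).
    rewrite (cl _ _ (fun=> V s))// RintegralZl//; first by rewrite dcutoff_mass// mulrN1 opprK.
    have := @integrable_itv R clip (C / e) s (s + e) mclip clipC.
    apply: eq_integrable => // t; rewrite inE /= in_itv/= => /andP[t0 _].
    by rewrite clipE// (le_trans s0)// ltW.
  have mVs : measurable_fun setT (fun t => V s * clip t) by apply: measurable_funM => //; exact: measurable_cst.
  have VsC t : `|V s * clip t| <= MV * (C / e) by rewrite normrM ler_pM.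
  rewrite {1}h1 addrC -(cl _ _ V)// -RintegralB//.
  - by apply: eq_Rintegral => t _; rewrite mulrBl.
  - exact: integrable_itv mVc VcC.
  - exact: integrable_itv mVs VsC.
have -> : V s - (V0 + \int[leb]_(r in `]0, s[) G r) =
   \int[leb]_(t in `]s, s + e[) ((V t - V s) * clip t) +
   \int[leb]_(t in `]s, s + e[) (G t * E t).
  move: W1; rewrite -A3 A2; set a := \int[leb]_(t in _) _; set b := \int[leb]_(t in _) _.
  by set c := \int[leb]_(t in _) _ => h; lra.
have se : s <= s + e by rewrite lerDl ltW.
rewrite (le_trans (ler_normD _ _))// [g]splitr lerD//.
  apply: le_trans (_ : (g / 2 / (C + 1)) * (C / e) * (s + e - s) <= _).
    apply: Rint_itv_le => //.
    - by apply: measurable_funM => //; apply: measurable_funB => //; exact: measurable_cst.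
    - move=> t; rewrite in_itv/= => /andP[st te].
      rewrite normrM ler_pM//; apply: hd.
        by rewrite (le_trans s0 (ltW st))/= ltW// (lt_trans te).
      by rewrite ger0_norm ?subr_ge0 ?ltW//; lra.
    - by rewrite mulr_ge0// ltW.
  have -> : g / 2 / (C + 1) * (C / e) * (s + e - s) = g / 2 * (C / (C + 1)).
    by field; rewrite !gt_eqF// ltr_wpDl.
  rewrite ler_piMr ?divr_ge0 ?(ltW g0)//.
  by rewrite ler_pdivrMr ?ltr_wpDl// mul1r lerDl.
apply: le_trans (_ : MG * (s + e - s) <= _).
  by apply: Rint_itv_le => // t _; exact: GEC.
rewrite (addrC s) addrK (le_trans (ler_wpM2l MG0 eg))// mulrCA ler_piMr ?divr_ge0 ?(ltW g0)//.
by rewrite ler_pdivrMr ?ltr_wpDl// mul1r lerDl.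
Qed.

(** The cutoffs must end before T, so the identity at T is the limit of those at T - e, by
    continuity of V. *)
Lemma time_limit t : 0 <= t <= T -> V t = V0 + \int[leb]_(r in `]0, t[) G r.
Proof.
move=> /andP[t0]; rewrite le_eqVlt => /predU1P[->|]; last exact: time_limit_lt.
apply/eqP; rewrite -subr_eq0 -normr_le0; apply/ler_addgt0Pr => g g0; rewrite add0r.
have g2 : 0 < g / 2 by rewrite divr_gt0.
have TT : 0 <= T <= T by rewrite lexx ltW.
have [d d0 hd] := cV TT g2.
have g1 : 0 < g / 2 / (MG + 1) by rewrite !divr_gt0// ltr_wpDl.
pose e := Num.min (d / 2) (Num.min (T / 2) (g / 2 / (MG + 1))).
have e0 : 0 < e by rewrite !lt_min g1 !divr_gt0.
have ed : e < d.
  by apply: (@le_lt_trans _ _ (d / 2)); [rewrite ge_min lexx|lra].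
have eT : e <= T / 2 by rewrite ge_min; apply/orP; right; rewrite ge_min lexx.
have eg : e <= g / 2 / (MG + 1).
  by rewrite ge_min; apply/orP; right; rewrite ge_min lexx orbT.
pose s := T - e.
have s0 : 0 <= s by rewrite /s; lra.
have sT : s < T by rewrite /s; lra.
rewrite (@Rint_itv_split R _ MG 0 s T)//; last exact: ltW.
have := time_limit_lt s0 sT; set I := \int[leb]_(x in _) _; set I' := \int[leb]_(x in _) _ => h.
have -> : V T - (V0 + (I + I')) = - (V s - V T) - I' by rewrite h; ring.
rewrite (le_trans (ler_normB _ _))// normrN [g]splitr lerD//.
  apply: hd; first by rewrite s0 ltW.
  by rewrite /s addrAC subrr add0r normrN gtr0_norm.
apply: le_trans (_ : MG * (T - s) <= _).
  by apply: Rint_itv_le => //; exact: ltW.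
rewrite /s subKr (le_trans (ler_wpM2l MG0 eg))// mulrCA ler_piMr ?divr_ge0 ?(ltW g0)//.
by rewrite ler_pdivrMr ?ltr_wpDl// mul1r lerDl.
Qed.

End time_limit.

(** * Truncation, and Fubini on the strip *)

Section clamp.
Context {R : realType}.
Implicit Types M a b : R.

(** Truncating the solution and the datum changes them only on null sets and makes their bounds hold
    at every point. *)
Definition clamp M a := Num.max (- M) (Num.min M a).

Lemma clamp_le M a : 0 <= M -> `|clamp M a| <= M.
Proof.
move=> M0; rewrite ler_norml /clamp le_max lexx /= ge_max ge_min lexx andbT.
by rewrite (le_trans _ M0)// oppr_le0.
Qed.

Lemma clamp_id M a : `|a| <= M -> clamp M a = a.
Proof.
by rewrite ler_norml => /andP[a1 a2]; rewrite /clamp (min_idPr a2) (max_idPr a1).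
Qed.

Lemma clamp_dist M a b : 0 <= M -> `|clamp M a - clamp M b| <= `|a - b|.
Proof.
wlog ab : a b / a <= b.
  move=> H M0; have [ab|/ltW ab] := leP a b; first exact: H.
  by rewrite distrC (distrC a); exact: H.
move=> M0; rewrite distrC (distrC a) (ger0_norm (_ : 0 <= b - a)) ?subr_ge0//.
rewrite /clamp /Num.max /Num.min; case: ifPn; case: ifPn; case: ifPn; case: ifPn;
  rewrite -?leNgt => h1 h2 h3 h4; rewrite ger0_norm; lra.
Qed.

Lemma clamp0 M : 0 <= M -> clamp M 0 = 0.
Proof. by move=> M0; rewrite clamp_id ?normr0. Qed.

Lemma clamp_norm M a : 0 <= M -> `|clamp M a| <= `|a|.
Proof. by move=> M0; have := clamp_dist a 0 M0; rewrite clamp0// !subr0. Qed.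

Lemma measurable_clamp M d (X : measurableType d) (f : X -> R) :
  measurable_fun setT f -> measurable_fun setT (fun x => clamp M (f x)).
Proof.
move=> mf; apply: measurable_maxr; first exact: measurable_cst.
by apply: measurable_minr => //; exact: measurable_cst.
Qed.

End clamp.

Lemma Lfun_meas d (X : measurableType d) (R : realType) (m : {measure set X -> \bar R}) p
  (f : X -> R) : f \in Lfun m p -> measurable_fun setT f.
Proof. by rewrite inE => /andP[/[!inE]]. Qed.

Lemma Lfun_bounded d (X : measurableType d) (R : realType) (m : {measure set X -> \bar R})
  (f : X -> R) : f \in Lfun m +oo%E -> exists2 M, 0 <= M & \forall x \ae m, `|f x| <= M.
Proof.
rewrite inE => /andP[_ /[!inE]] /=; rewrite /finite_norm unlock /=.
(* The case treated at once is that of the zero measure, where every property holds almost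
   everywhere. *)
case: ifPn => [_ h|m0 _]; last first.
  exists 0 => //; exists setT; split => //.
  by apply/eqP; rewrite eq_le measure_ge0 andbT leNgt.
have ge := @ess_sup_ge _ _ _ m (abse \o (EFin \o f)).
have [M [M0 hM]] : exists M, 0 <= M /\ (ess_sup m (abse \o (EFin \o f)) <= M%:E)%E.
  move: h; case: (ess_sup m _) => [r _| |_] //.
    by exists (Num.max 0 r); rewrite le_max lexx /= lee_fin le_max lexx orbT.
  by exists 0; rewrite lexx leNye.
exists M => //; apply: filterS ge => x /= h1.
by rewrite -lee_fin (le_trans h1).
Qed.

Section strip.
Context {R : realType} {N : nat}.
Local Notation m := (lebesgue_rV R N).
Local Notation leb := (@lebesgue_measure R).
Local Notation XT := ('rV[R]_N * measurableTypeR R)%type.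
Variable T : R.

Lemma QTE : @QT R N T = setT `*` `]0, T[%classic.
Proof. by apply/seteqP; split=> [[y t]|[y t] [_]]; rewrite /QT /= in_itv. Qed.

Lemma measurable_QT : measurable (QT T : set XT).
Proof. by rewrite QTE; apply: measurableX => //; exact: measurable_itv. Qed.

(** Fubini for a bounded function times a kernel in space and a weight in time. The weight is
    bounded for 0 < t < T only, hence the restriction to the strip. *)
Lemma strip_integral (b : XT -> R) (B C : R) (k : 'rV[R]_N -> R) (w : measurableTypeR R -> R) :
  measurable_fun setT b -> (forall p, `|b p| <= B) -> L1b m k ->
  measurable_fun setT w -> (forall t, 0 < t < T -> `|w t| <= C) -> 0 <= C ->
  (lebesgue_xt R N).-integrable (QT T) (EFin \o (fun p => b p * k p.1 * w p.2)) /\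
  \int[lebesgue_xt R N]_(p in QT T) (b p * k p.1 * w p.2) =
  \int[leb]_(t in `]0, T[) (w t * \int[m]_y (b (y, t) * k y)).
Proof.
move=> mb bB Lk mw wC C0.
have B0 : 0 <= B by exact: le_trans (bB (0, 0)).
have mk : measurable_fun setT k by case: Lk => -[].
pose F (p : XT) := b p * k p.1 * w p.2.
have mF : measurable_fun setT F.
  apply: measurable_funM; first apply: measurable_funM => //.
    by apply: measurableT_comp => //; exact: measurable_fst.
  by apply: measurableT_comp => //; exact: measurable_snd.
pose F' := F \_ (QT T).
have mF' : measurable_fun setT F'.
  by apply/(measurable_restrictT _ measurable_QT); exact: measurable_funTS.
have bd t y : `|F' (y, t)| <= (B * C * \1_(`]0, T[%classic) t) * `|k y|.
  rewrite /F' patchE; case: ifPn => [|_]; last by rewrite normr0 !mulr_ge0.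
  rewrite inE /QT /= => tT; rewrite indicE mem_set ?mulr1; last by rewrite /= in_itv.
  rewrite /F !normrM /= mulrAC ler_wpM2r// ler_pM//; exact: wC.
have iF : (lebesgue_xt R N).-integrable setT (EFin \o F').
  apply/(integrable21ltyP m leb); first exact/measurable_EFinP.
  have S : (\int[leb]_(t in `]0%R, T[) (B * C * \int[m]_y `|k y|)%R%:E < +oo)%E.
    rewrite integral_cst//= ; apply: lte_mul_pinfty; [|by []|].
    - by rewrite lee_fin !mulr_ge0// Rint_ge0.
    - exact: leb_itvoo_fin.
  apply: le_lt_trans S.
    rewrite [leRHS]integral_mkcond /=; apply: ge0_le_integral => //.
    - by move=> t _; apply: integral_ge0 => y _.
    - by apply: (@measurable_fun_fubini_tonelli_G _ _ _ _ R m (fun p => `|F' p|%:E)%E) => //;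
        apply/measurable_EFinP; apply: measurableT_comp.
    - by apply/(measurable_restrictT _ (measurable_itv _)); exact: measurable_cst.
    move=> t _; apply: (@le_trans _ _ (\int[m]_y (B * C * \1_(`]0, T[%classic) t * `|k y|)%:E)%E).
      apply: ge0_le_integral => //.
      - by apply/measurable_EFinP; apply: measurableT_comp => //; apply: measurableT_comp mF' _;
          exact: measurable_pair2.
      - by apply/measurable_EFinP; apply: measurable_funM => //; exact: measurableT_comp.
      - by move=> y _; rewrite lee_fin.
    under eq_integral do rewrite EFinM.
    rewrite ge0_integralZl//; last first.
    - by rewrite lee_fin !mulr_ge0.
    - by apply/measurable_EFinP; exact: measurableT_comp.
    rewrite L1bE// patchE -EFinM indicE.
    by case: ifPn => _; rewrite ?mulr1 ?mulr0 ?mul0r.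
split.
  apply/(integrable_mkcond _ measurable_QT).
  rewrite (_ : _ \_ _ = EFin \o F')//.
  by apply/funext => p; rewrite /F' /= !patchE; case: ifP.
rewrite Rintegral_mkcond [RHS]Rintegral_mkcond; congr fine.
rewrite -/F -[LHS](integral21_prod_meas1 iF).
apply: eq_integral => t _.
rewrite patchE; case: ifPn => [|] tT.
  rewrite -RintZ; last first.
    have bt : bmf (fun y => b (y, t)).
      split; last by exists B.
      by apply: measurableT_comp mb _; exact: measurable_pair2.
    exact: L1bM.
  have LH : L1b m (fun y => w t * (b (y, t) * k y)).
    have bt : bmf (fun y => b (y, t)).
      split; last by exists B.
      by apply: measurableT_comp mb _; exact: measurable_pair2.
    by apply: L1bZ; exact: L1bM.
  rewrite /Rintegral fineK; last by apply: integrable_fin_num => //; exact: L1b_int.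
  apply: eq_integral => y _; congr EFin.
  rewrite /F' patchE mem_set; last by move: tT; rewrite inE /= in_itv.
  by rewrite /F mulrC mulrA.
rewrite /fubini_G integral0_eq// => y _ /=; rewrite /F' patchE memNset//.
by move=> h; move/negP: tT; apply; rewrite inE /= in_itv.
Qed.

End strip.

(** * The mollified equation *)

Section regular.
Context {R : realType} {N : nat}.
Local Notation m := (lebesgue_rV R N).
Local Notation leb := (@lebesgue_measure R).
Local Notation XT := ('rV[R]_N * measurableTypeR R)%type.
Variables (nu : {sigma_finite_measure set 'rV[R]_N -> \bar R}).

(** The mollified solution as the equation integrated in time predicts it. The generator falls on
    the mollifier, so no regularity of [phi (v)] is involved. *)
Definition mild (phi : R -> R) (v : XT -> R) (u0 : 'rV[R]_N -> R) n t x : R :=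
  cvl (rho n) u0 x +
  \int[leb]_(s in `]0, t[) cvl (gen nu (rho n)) (fun y => phi (v (y, s))) x.

(* Only the mollified equation is recorded: testing with rho n (x - y) and a time
   cutoff turns the distributional formulation into this identity at every point x
   and every time. *)
Record evolution phi tau M (v : XT -> R) (u0 w : 'rV[R]_N -> R) : Prop := Evolution {
  ev_meas : measurable_fun setT v ;
  ev_bound : forall p, `|v p| <= M ;
  ev_int : (lebesgue_xt R N).-integrable setT (EFin \o v) ;
  ev_u0 : L1b m u0 ;
  ev_w : measurable_fun setT w ;
  ev_wM : forall x, `|w x| <= M ;
  ev_mid : forall n t x, 0 < t < tau -> cvl (rho n) (fun y => v (y, t)) x = mild phi v u0 n t x ;
  ev_end : forall n x, cvl (rho n) w x = mild phi v u0 n tau x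
}.

End regular.

Section levy_mollifier.
Context {R : realType} {N : nat}.
Local Notation m := (lebesgue_rV R N).
Variable mu : {measure set 'rV[R]_N -> \bar R}.
Hypotheses (mu_even : even_punctured mu) (mu_levy : levy_integrable mu).
Variable nu : {sigma_finite_measure set 'rV[R]_N -> \bar R}.
Hypothesis nuE : forall A, measurable A -> nu A = mu (A `&` ~` [set 0]).

Lemma rho_kernel n : exists2 C, 0 <= C & kernel_const (@rho R N n) C.
Proof.
have [_ [C KC]] := smc_kernel (smc_rho n) (@rho_out R N n).
by exists C => //; case: KC => [[h _ _ _] _]; rewrite (le_trans _ (h 0)).
Qed.

Lemma nu_tail (r : R) : 0 < r -> (nu (~` cube r) < +oo)%E.
Proof.
move=> r0; rewrite nuE; last by apply: measurableC; exact: cube_measurable.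
apply: le_lt_trans (levy_tail mu_levy r0); apply: le_measure.
- by rewrite inE; apply: measurableI; [apply: measurableC; exact: cube_measurable|exact: measurable_D].
- rewrite inE; apply: measurableI; first exact: measurable_D.
  rewrite (_ : [set _ | _] = ~` cube r); first by apply: measurableC; exact: cube_measurable.
  by apply/seteqP; split=> z /=; rewrite /cube /= ltNge => /negP.
- move=> z [h1 h2]; split => //=; rewrite ltNge; apply/negP; exact: h1.
Qed.

(** Integrability comes with the discretisation at any accuracy; 1 is taken. *)
Lemma gen_rho_L1b n : L1b m (gen nu (rho n)).
Proof.
have ilw := integrable_lw mu_levy nuE.
have [C _ KC] := rho_kernel n.
have [s [_ hs]] := discretize ilw nu_tail (ltr01 : 0 < (1 : R)).
by have [] := hs _ _ (mo_L1 (@rho_mollifier R N) n) KC.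
Qed.

(** Second differences are invariant under the reflection of y into x - y, so the generator can be
    applied to the mollifier before reflecting. *)
Lemma levy_op_rho n x c y :
  levy_op mu (fun y => rho n (x - y) * c) y = c * gen nu (rho n) (x - y).
Proof.
have ilw := integrable_lw mu_levy nuE.
have [C _ KC] := rho_kernel n.
have mr : measurable_fun setT (@rho R N n) by case: (mo_L1 (@rho_mollifier R N) n) => -[].
rewrite (levy_op_gen mu_even mu_levy nuE (r := `|x| + n.+1%:R^-1)); last 2 first.
- apply: smc_mul; last exact: smc_cst.
  apply: smc_mul; first exact: smc_cst.
  apply: smc_prod => i.
  apply: (@smc_ext _ _ (fun y : 'rV[R]_N => bump1 (n.+1%:R * x ord0 i + (- n.+1%:R) * y ord0 i))).
    by move=> p; rewrite !mxE mulrBr mulNr.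
  by apply: (smc_bump1 (l := fun y : 'rV[R]_N => y ord0 i)) => b d; exact: affine_coord.
- move=> z hz; rewrite rho_out ?mul0r//.
  rewrite distrC; apply: lt_le_trans (lerB_dist _ _); by rewrite ltrBrDl.
have I := integrable_sdiff ilw (x - y) mr KC.
rewrite /gen -(RintegralZl c measurableT I).
apply: eq_Rintegral => z _; rewrite /sdiff.
have -> : x - (y + z) = x - y - z by rewrite opprD addrA.
have -> : x - (y - z) = x - y + z by rewrite opprB addrA addrAC.
by ring.
Qed.

End levy_mollifier.

(** * From the distributional solution to the mollified equation *)

Section solution.
Context {R : realType} {N : nat}.
Local Notation m := (lebesgue_rV R N).
Local Notation leb := (@lebesgue_measure R).
Local Notation XT := ('rV[R]_N * measurableTypeR R)%type.
Variables (T : R) (phi : R -> R) (mu : {measure set 'rV[R]_N -> \bar R}).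
Variables (u0 : 'rV[R]_N -> R) (u : 'rV[R]_N -> R -> R).
Hypotheses (T_gt0 : 0 < T) (phi_cont : continuous phi).
Hypotheses (mu_even : even_punctured mu) (mu_levy : levy_integrable mu).
Hypotheses (u0_L1 : u0 \in Lfun m 1%E) (u0_Loo : u0 \in Lfun m +oo%E).
Hypothesis u_L1 : (fun y => u y.1 y.2) \_ (QT T) \in Lfun (lebesgue_xt R N) 1%E.
Hypothesis u_Loo : (fun y => u y.1 y.2) \_ (QT T) \in Lfun (lebesgue_xt R N) +oo%E.
Hypotheses (u_cont : continuous_L1loc T u).
Hypothesis u_sol : distributional_solution phi mu T u0 u.
Variable nu : {sigma_finite_measure set 'rV[R]_N -> \bar R}.
Hypothesis nuE : forall A, measurable A -> nu A = mu (A `&` ~` [set 0]).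

Let w : XT -> R := (fun y => u y.1 y.2) \_ (QT T).

Variable M : R.
Hypotheses (M0 : 0 <= M) (wM : \forall p \ae lebesgue_xt R N, `|w p| <= M).
Hypothesis u0M : \forall x \ae m, `|u0 x| <= M.

(** The solution on the strip, its trace at one time and the datum are truncated separately: an
    almost everywhere bound on the strip says nothing about a single time, and the trace at 0 is not
    [u0] by definition. *)
Definition clip_xt (p : XT) := clamp M (w p).
Definition clip_at t y := clamp M (u y t).
Definition clip_0 y := clamp M (u0 y).

Let mw : measurable_fun setT w. Proof. exact: Lfun_meas u_L1. Qed.

Let mv : measurable_fun setT clip_xt. Proof. exact: measurable_clamp. Qed.

Let vM p : `|clip_xt p| <= M. Proof. exact: clamp_le. Qed.

Let v_at t y : 0 < t < T -> clip_xt (y, t) = clip_at t y.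
Proof. by move=> tT; rewrite /clip_xt /w patchE mem_set. Qed.

Let v_int : (lebesgue_xt R N).-integrable setT (EFin \o clip_xt).
Proof.
have /Lfun1_integrable iw := u_L1.
apply: le_integrable iw => //; first exact/measurable_EFinP.
by move=> p _ /=; rewrite lee_fin clamp_norm.
Qed.

Let u0_L1b : L1b m clip_0.
Proof.
have /Lfun1_integrable iw := u0_L1.
have mu0 : measurable_fun setT clip_0 by apply: measurable_clamp; exact: Lfun_meas u0_L1.
split; first by split=> //; exists M => x; exact: clamp_le.
apply: le_integrable iw => //; first exact/measurable_EFinP.
by move=> p _ /=; rewrite lee_fin clamp_norm.
Qed.

Let u0E : \forall x \ae m, u0 x = clip_0 x.
Proof. by apply: filterS u0M => x h; rewrite /clip_0 clamp_id. Qed.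

Let vE : \forall p \ae lebesgue_xt R N, w p = clip_xt p.
Proof. by apply: filterS wM => x h; rewrite /clip_xt clamp_id. Qed.

Let mclip t : 0 <= t <= T -> measurable_fun setT (clip_at t).
Proof. by move=> tT; apply: measurable_clamp; have [+ _] := u_cont.1 t tT. Qed.

Lemma phi_bound : exists2 B, 0 <= B & forall a, `|a| <= M -> `|phi a| <= B.
Proof.
have MM : - M <= M by rewrite (le_trans _ M0)// oppr_le0.
have [|c _ hc] := @EVT_max R (fun t => `|phi t|) (- M) M MM.
  apply: continuous_subspaceT => t; apply: continuous_comp; first exact: phi_cont.
  exact: norm_continuous.
by exists `|phi c| => // a; rewrite ler_norml => aM; apply: hc; rewrite in_itv.
Qed.

Let mphi : measurable_fun setT (fun p => phi (clip_xt p)).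
Proof. apply: measurableT_comp => //; exact: continuous_measurable_fun. Qed.

Lemma clip_at_dist (K : set 'rV[R]_N) s t : 0 <= s <= T -> 0 <= t <= T -> measurable K ->
  (\int[m]_(y in K) `|clip_at t y - clip_at s y|%:E <= \int[m]_(y in K) `|u y t - u y s|%:E)%E.
Proof.
move=> sT tT mK; apply: ge0_le_integral => //.
- by apply/measurable_EFinP; apply: measurableT_comp => //; apply: measurable_funB;
    apply: measurable_funTS; exact: mclip.
- apply/measurable_EFinP; apply: measurableT_comp => //; apply: measurable_funB;
    apply: measurable_funTS.
    by have [+ _] := u_cont.1 t tT.
  by have [+ _] := u_cont.1 s sT.
- by move=> y _; rewrite lee_fin; exact: clamp_dist.
Qed.

Lemma u_near (K : set 'rV[R]_N) s g : compact K -> 0 <= s <= T -> 0 < g ->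
  exists2 d : R, 0 < d & forall t, 0 <= t <= T -> `|t - s| < d ->
    (\int[m]_(x in K) `|u x t - u x s|%:E <= g%:E)%E.
Proof.
move=> cK sT g0; have h := u_cont.2 K s cK sT.
have O : nbhs (0 : \bar R)%E [set y | (y < g%:E)%E].
  by apply: open_nbhs_nbhs; split; [exact: open_ereal_lt_ereal|rewrite /= lte_fin].
have := h _ O; rewrite nbhs_filterE /= => -[d /= d0 hd]; exists d => // t tT ts.
by apply: ltW; apply: hd => //=; rewrite ?in_itv//= distrC.
Qed.

Section mollified.
Variables (n : nat) (x : 'rV[R]_N).

(** At 0 and T, where the function on the strip is merely extended by 0, the traces of u are used;
    this makes V continuous on [0, T]. *)
Let V (t : measurableTypeR R) : R :=
  if t == 0 then cvl (rho n) (clip_at 0) x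
  else if t == T then cvl (rho n) (clip_at T) x
  else cvl (rho n) (fun y => clip_xt (y, t)) x.
Let G (t : measurableTypeR R) : R := cvl (gen nu (rho n)) (fun y => phi (clip_xt (y, t))) x.

Let rL := mo_L1 (@rho_mollifier R N) n.
Let gL := gen_rho_L1b mu_levy nuE n.

Let VE t : 0 <= t <= T -> V t = cvl (rho n) (clip_at t) x.
Proof.
move=> /andP[t0 tT]; rewrite /V; case: eqVneq => [->//|tn0]; case: eqVneq => [->//|tnT].
congr cvl; apply/funext => y; apply: v_at.
by rewrite !lt_neqAle t0 tT tnT eq_sym tn0.
Qed.

Let mslice (f : XT -> R) k : measurable_fun setT f -> measurable_fun setT k ->
  measurable_fun [set: measurableTypeR R] (fun t => cvl k (fun y => f (y, t)) x).
Proof.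
move=> mf mk; apply: (measurable_Rint m (F := fun p : measurableTypeR R * 'rV[R]_N => k (x - p.2) * f (p.2, p.1))).
apply: measurable_funM.
  apply: measurableT_comp => //; apply: (measurableT_comp (f := fun y : 'rV[R]_N => x - y)) => //.
  apply: measurable_rV => i.
  rewrite (_ : (fun _ => _) = (fun y : 'rV[R]_N => x ord0 i - y ord0 i)).
    by apply: measurable_funB; [exact: measurable_cst|exact: coord_measurable].
  by apply/funext => y; rewrite !mxE.
apply: measurableT_comp => //; apply/measurable_fun_pairP; split.
  exact: measurable_snd.
exact: measurable_fst.
Qed.

Let mV : measurable_fun setT V.
Proof.
have mr : measurable_fun setT (@rho R N n) by case: rL => -[].
apply: measurable_fun_ifT; [exact: measurable_fun_eqr| |apply: measurable_fun_ifT].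
- exact: measurable_cst.
- exact: measurable_fun_eqr.
- exact: measurable_cst.
- exact: mslice.
Qed.

Let mG : measurable_fun setT G.
Proof. by apply: (mslice (f := fun p => phi (clip_xt p))) => //; case: gL => -[]. Qed.

Let bclip t : 0 <= t <= T -> bmf (clip_at t).
Proof. by move=> tT; split; [exact: mclip|exists M => y; exact: clamp_le]. Qed.

Let bv t : bmf (fun y => clip_xt (y, t)).
Proof.
split; last by exists M.
by apply: measurableT_comp mv _; exact: measurable_pair2.
Qed.

Let VM t : `|V t| <= M.
Proof.
rewrite /V; case: ifP => _; [|case: ifP => _]; apply: (moll_bound (@rho_mollifier R N)) => //.
- by apply: bclip; rewrite lexx ltW.
- by move=> y; exact: clamp_le.
- by apply: bclip; rewrite lexx ltW.
- by move=> y; exact: clamp_le.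
Qed.

Let GM : exists C, forall t, `|G t| <= C.
Proof.
have [B B0 hB] := phi_bound.
exists (B * \int[m]_y `|gen nu (rho n) y|) => t; apply: cvl_bound => //.
- split; last by exists B => y; exact: hB.
  by apply: measurableT_comp mphi _; exact: measurable_pair2.
- by move=> y; exact: hB.
Qed.

(** The mollifier centred at x is supported in a cube, so continuity in L1 on compact sets
    suffices. *)
Let cV s : 0 <= s <= T -> forall g : R, 0 < g ->
  exists2 d : R, 0 < d & forall t : R, 0 <= t <= T -> `|t - s| < d -> `|V t - V s| <= g.
Proof.
move=> sT g g0.
have [C C0 [[rC _ _ _] _]] := @rho_kernel R N n.
have g1 : 0 < g / (C + 1) by rewrite divr_gt0// ltr_wpDl.
pose K := @cube R N (`|x| + n.+1%:R^-1).
have mK : measurable K by exact: cube_measurable.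
have [d d0 hd] := u_near (@cube_compact R N (`|x| + n.+1%:R^-1)) sT g1.
exists d => // t tT ts; rewrite !VE//.
have bt := bclip tT; have bs := bclip sT.
rewrite -cvlB//.
have LL : L1b m (fun y => rho n (x - y) * (clip_at t y - clip_at s y)).
  by apply: cvl_L1b => //; exact: bmfB.
apply: le_trans (Rint_norm LL) _; rewrite -lee_fin -L1bE//.
apply: (@le_trans _ _ (C%:E * \int[m]_(y in K) `|clip_at t y - clip_at s y|%:E)%E); last first.
  apply: (@le_trans _ _ (C%:E * (g / (C + 1))%:E)%E).
    by rewrite lee_wpmul2l ?lee_fin//; apply: le_trans (hd _ tT ts); exact: clip_at_dist.
  rewrite -EFinM lee_fin mulrCA ler_piMr ?(ltW g0)// ler_pdivrMr ?ltr_wpDl// mul1r lerDl//.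
have md : measurable_fun setT (fun y => clip_at t y - clip_at s y).
  by apply: measurable_funB; exact: mclip.
rewrite -ge0_integralZl//; last first.
  by apply/measurable_EFinP; apply: measurableT_comp => //; exact: measurable_funTS.
rewrite [leRHS]integral_mkcond; apply: ge0_le_integral => //.
- by apply/measurable_EFinP; apply: measurableT_comp => //; case: LL => -[].
- apply/(measurable_restrictT _ mK); apply: measurable_funTS.
  under eq_fun do rewrite -EFinM.
  apply/measurable_EFinP; apply: measurable_funM; first exact: measurable_cst.
  exact: measurableT_comp.
move=> y _; rewrite patchE; case: ifPn => [_|yK].
  by rewrite -EFinM lee_fin normrM ler_wpM2r.
rewrite rho_out ?mul0r ?normr0//.
move: yK; rewrite notin_setE /K /cube /= => /negP; rewrite -ltNge => h.
by rewrite distrC; apply: lt_le_trans (lerB_dist _ _); rewrite ltrBrDl.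
Qed.

Let itv_bd (f : measurableTypeR R -> R) C : measurable_fun setT f ->
  (forall t, 0 < t < T -> `|f t| <= C) -> leb.-integrable `]0, T[ (EFin \o f).
Proof.
move=> mf fC; apply: measurable_bounded_integrable => //.
- exact: leb_itvoo_fin.
- exact: measurable_funTS.
- exists C; split; first exact: num_real.
  by move=> B CB t; rewrite /= in_itv /= => /fC h; exact: le_trans h (ltW CB).
Qed.

(** The test function is the mollifier centred at x times the time cutoff. [levy_op_rho] puts the
    operator on the mollifier, and truncation changes the integrands on null sets only. *)
Let weak s e : 0 <= s -> 0 < e -> s + e < T ->
  \int[leb]_(t in `]0, T[) (V t * derive1 (cutoff s e) t + G t * cutoff s e t)
  + cvl (rho n) clip_0 x = 0.
Proof.
move=> s0 e0 sT.
have [_ /(_ _ (test_function_rho n x e0 sT))] := u_sol.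
have [C C0 dC] := @dsig_bound R.
have [B B0 hB] := phi_bound.
have mt : measurable_fun [set: measurableTypeR R] (cutoff s e).
  exact: continuous_measurable_fun (smc_continuous (smc_cutoff s e)).
have md : measurable_fun [set: measurableTypeR R] (derive1 (cutoff s e)).
  exact: continuous_measurable_fun (@dcutoff_cont R s e).
have dcC t : 0 < t < T -> `|derive1 (cutoff s e) t| <= C / e.
  move=> /andP[t0 _]; rewrite dcutoff; last by lra.
  rewrite normrM normrN (gtr0_norm (_ : 0 < e^-1)) ?invr_gt0//.
  by rewrite ler_wpM2r// invr_ge0 ltW.
have cC t : 0 < t < T -> `|cutoff s e t| <= 1.
  by move=> _; have /andP[h0 h1] := cutoff_01 s e t; rewrite ger0_norm.
have Ce : 0 <= C / e by rewrite divr_ge0// ltW.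
have [i1 e1] := strip_integral mv vM (L1b_refl x rL) md dcC Ce.
have [i2 e2] := strip_integral mphi (fun p => hB _ (vM p)) (L1b_refl x gL) mt cC ler01.
have -> : \int[m]_y (u0 y * (rho n (x - y) * cutoff s e 0)) = cvl (rho n) clip_0 x.
  congr fine; apply: ae_eq_integral => //.
  - apply/measurable_EFinP; apply: measurable_funM; first exact: Lfun_meas u0_L1.
    apply: measurable_funM; last exact: measurable_cst.
    by case: (L1b_refl x rL) => -[].
  - apply/measurable_EFinP; apply: measurable_funM; first by case: (L1b_refl x rL) => -[].
    by case: u0_L1b => -[].
  apply: filterS u0E => y h _; rewrite {1}h cutoff_1 ?mulr1//; first by rewrite mulrC.
move=> H; rewrite -[RHS]H {H}; congr (_ + _).
transitivity (\int[lebesgue_xt R N]_(p in QT T) (clip_xt p * rho n (x - p.1) * derive1 (cutoff s e) p.2 +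
   phi (clip_xt p) * gen nu (rho n) (x - p.1) * cutoff s e p.2)).
  apply: esym; have -> := RintegralD (@measurable_QT R N T) i1 i2.
  rewrite e1 e2.
  have -> : \int[leb]_(t in `]0, T[) (derive1 (cutoff s e) t * \int[m]_y (clip_xt (y, t) * rho n (x - y))) =
      \int[leb]_(t in `]0, T[) (V t * derive1 (cutoff s e) t).
    apply: eq_Rintegral => t; rewrite inE /= in_itv /= => tT.
    rewrite VE; last by case/andP: tT => /ltW -> /ltW ->.
    by rewrite mulrC; congr (_ * _); apply: eq_Rint => y; rewrite mulrC v_at.
  have -> : \int[leb]_(t in `]0, T[) (cutoff s e t * \int[m]_y (phi (clip_xt (y, t)) * gen nu (rho n) (x - y))) =
      \int[leb]_(t in `]0, T[) (G t * cutoff s e t).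
    apply: eq_Rintegral => t _.
    by rewrite mulrC; congr (_ * _); apply: eq_Rint => y; rewrite mulrC.
  rewrite RintegralD//.
  - apply: (itv_bd _ (C := M * (C / e))); first exact: measurable_funM.
    by move=> t tT; rewrite normrM ler_pM// dcC.
  - have [D hD] := GM.
    apply: (itv_bd _ (C := D)); first exact: measurable_funM.
    by move=> t tT; rewrite normrM -[D]mulr1 ler_pM// cC.
transitivity (\int[lebesgue_xt R N]_(p in QT T) (w p * rho n (x - p.1) * derive1 (cutoff s e) p.2 +
   phi (w p) * gen nu (rho n) (x - p.1) * cutoff s e p.2)).
  have mQ := @measurable_QT R N T.
  have mb (a b : XT -> R) : measurable_fun setT a -> measurable_fun setT b ->
    measurable_fun (QT T) (EFin \o (fun p : XT => a p * rho n (x - p.1) * derive1 (cutoff s e) p.2 +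
      b p * gen nu (rho n) (x - p.1) * cutoff s e p.2)).
    move=> ma mb'; apply: measurable_funTS; apply/measurable_EFinP.
    have L1 k : L1b m k -> measurable_fun setT (fun p : XT => k (x - p.1)).
      move=> Lk; rewrite (_ : (fun _ => _) = (fun y => k (x - y)) \o fst)//; apply: measurableT_comp.
        by case: (L1b_refl x Lk) => -[].
      exact: measurable_fst.
    apply: measurable_funD; apply: measurable_funM; try (apply: measurable_funM => //; exact: L1).
      by apply: measurableT_comp md _; exact: measurable_snd.
    by apply: measurableT_comp mt _; exact: measurable_snd.
  congr fine; apply: ae_eq_integral => //.
  - by apply: (mb clip_xt (fun p => phi (clip_xt p))).
  - apply: (mb w (fun p => phi (w p))) => //.
    by apply: measurableT_comp mw; exact: continuous_measurable_fun.
  - by apply: filterS vE => p -> _.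
apply: eq_Rintegral => -[y t]; rewrite inE /QT /= => tT.
rewrite /w patchE mem_set//= (levy_op_rho mu_even mu_levy nuE) derive1Ml; last exact: cutoff_derivable.
by ring.
Qed.

Lemma clip_mild t : 0 <= t <= T ->
  cvl (rho n) (clip_at t) x = mild nu phi clip_xt clip_0 n t x.
Proof.
move=> tT; have [D hD] := GM; rewrite -VE//.
exact: (time_limit T_gt0 mV mG VM hD cV weak).
Qed.

End mollified.

Lemma clip_evolution tau : 0 < tau <= T ->
  evolution nu phi tau M clip_xt clip_0 (clip_at tau).
Proof.
move=> /andP[t0 tT]; have t0T : 0 <= tau <= T by rewrite ltW.
split=> //.
- exact: mclip.
- by move=> x; exact: clamp_le.
- move=> n t x /andP[t1 t2]; have tT' : 0 < t < T by rewrite t1 (lt_le_trans t2).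
  rewrite -clip_mild; last by rewrite !ltW//; case/andP: tT'.
  by congr cvl; apply/funext => y; exact: v_at.
- by move=> n x; exact: clip_mild.
Qed.

(** By Tonelli the solution equals its truncation at almost every time, and a nonempty open interval
    is not a null set. *)
Lemma good_time (a b : R) : 0 <= a -> a < b -> b <= T -> exists2 t, a < t < b &
  (\int[m]_y `|u y t - clip_at t y|%:E = 0)%E.
Proof.
move=> a0 ab bT.
pose f (p : XT) : \bar R := `|w p - clip_xt p|%:E.
have f0 p : (0 <= f p)%E by rewrite lee_fin.
have mf : measurable_fun setT f.
  by apply/measurable_EFinP; apply: measurableT_comp => //; exact: measurable_funB.
have If : (\int[leb]_t \int[m]_y f (y, t) = 0)%E.
  rewrite -[LHS](@fubini_tonelli2 _ _ _ _ R m leb f mf f0).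
  rewrite (ge0_ae_eq_integral (g := cst 0%E))//; first by rewrite integral0.
  by apply: filterS vE => p h _; rewrite /f h subrr normr0.
have mI : measurable_fun setT (fun t => \int[m]_y f (y, t))%E.
  exact: (@measurable_fun_fubini_tonelli_G _ _ _ _ R m f mf f0).
have [Z [mZ Z0 hZ]] : leb.-negligible [set t | ~ (\int[m]_y f (y, t) = 0)%E].
  have [H _] := @ae_eq_integral_abs _ _ _ leb setT measurableT _ mI.
  have := H _; rewrite /ae_eq => {}H.
  have /H : (\int[leb]_t `|\int[m]_y f (y, t)| = 0)%E.
    rewrite -[RHS]If; apply: eq_integral => t _; rewrite gee0_abs//.
    by apply: integral_ge0.
  by apply: negligibleS => t /= h hh; apply: h; exact: hh.
apply: contrapT => H.
have sub : `]a, b[%classic `<=` Z.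
  move=> t; rewrite /= in_itv /= => tab; apply: hZ => /= h; apply: H; exists t => //.
  rewrite -[RHS]h; apply: eq_integral => y _; rewrite /f.
  have tT : 0 < t < T.
    by case/andP: tab => h1 h2; rewrite (le_lt_trans a0 h1) (lt_le_trans h2 bT).
  by rewrite /w patchE mem_set//= v_at.
have : (leb `]a, b[%classic <= leb Z)%E by apply: le_measure => //; rewrite inE.
rewrite Z0 lebesgue_measure_itv /= lte_fin ab -EFinB lee_fin; lra.
Qed.

(** At a prescribed time the bound is a limit along good times t close to s: u and its truncation
    are both continuous in time in L1 of every cube. *)
Lemma clip_at_ae s : 0 <= s <= T -> \forall y \ae m, u y s = clip_at s y.
Proof.
move=> sT; have mu_ t : 0 <= t <= T -> measurable_fun setT (u ^~ t).
  by move=> tT; have [+ _] := u_cont.1 t tT.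
have md r t : 0 <= r <= T -> 0 <= t <= T -> measurable_fun setT (fun y => `|u y r - u y t|).
  by move=> rT tT; apply: measurableT_comp => //; apply: measurable_funB; exact: mu_.
have mc r t : 0 <= r <= T -> 0 <= t <= T -> measurable_fun setT (fun y => `|clip_at r y - clip_at t y|).
  by move=> rT tT; apply: measurableT_comp => //; apply: measurable_funB; exact: mclip.
have me t : 0 <= t <= T -> measurable_fun setT (fun y => `|u y t - clip_at t y|).
  by move=> tT; apply: measurableT_comp => //; apply: measurable_funB; [exact: mu_|exact: mclip].
have D0 k : (\int[m]_(y in @cube R N k) `|(u y s - clip_at s y)%:E| = 0)%E.
  have mK : measurable (@cube R N k) by exact: cube_measurable.
  apply/eqP; rewrite eq_le integral_ge0// andbT.
  apply/lee_addgt0Pr => g g0; rewrite add0e.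
  have g2 : 0 < g / 2 by rewrite divr_gt0.
  have cK := @cube_compact R N k.
  have [d d0 hd] := u_near cK sT g2.
  have /andP[s0 s1] := sT.
  pose a := Num.max 0 (s - d); pose b := Num.min T (s + d).
  have a0 : 0 <= a by rewrite le_max lexx.
  have bT : b <= T by rewrite ge_min lexx.
  have ab : a < b.
    by rewrite lt_min !gt_max T_gt0 /=; apply/andP; split; [|apply/andP; split]; lra.
  have [t /andP[at_ tb] ht] := good_time a0 ab bT.
  have tT : 0 <= t <= T by rewrite (le_trans a0 (ltW at_)) (le_trans (ltW tb) bT).
  have ts : `|t - s| < d.
    move: at_ tb; rewrite gt_max lt_min => /andP[_ h1] /andP[_ h2].
    by rewrite ltr_distlC; apply/andP; split; lra.
  have h1 := hd _ tT ts.
  have h2 := le_trans (clip_at_dist sT tT mK) h1.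
  apply: (@le_trans _ _ (\int[m]_(y in cube k) (`|u y t - u y s|%:E + `|clip_at t y - clip_at s y|%:E
     + `|u y t - clip_at t y|%:E))%E).
    apply: ge0_le_integral => //.
    - by apply/measurable_EFinP; apply: measurable_funTS; exact: me.
    - by apply: emeasurable_funD; [apply: emeasurable_funD|];
        apply/measurable_EFinP; apply: measurable_funTS; [exact: md|exact: mc|exact: me].
    move=> y _; rewrite -!EFinD lee_fin.
    have -> : u y s - clip_at s y = - (u y t - u y s) + (clip_at t y - clip_at s y) + (u y t - clip_at t y).
      by ring.
    rewrite (le_trans (ler_normD _ _))// lerD2r.
    by rewrite (le_trans (ler_normD _ _))// normrN.
  rewrite ge0_integralD//; last 2 first.
  - by apply: emeasurable_funD; apply/measurable_EFinP; apply: measurable_funTS; [exact: md|exact: mc].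
  - by apply/measurable_EFinP; apply: measurable_funTS; exact: me.
  rewrite ge0_integralD//; last 2 first.
  - by apply/measurable_EFinP; apply: measurable_funTS; exact: md.
  - by apply/measurable_EFinP; apply: measurable_funTS; exact: mc.
  have h3 : (\int[m]_(y in cube k) `|u y t - clip_at t y|%:E <= 0)%E.
    rewrite -ht; apply: ge0_subset_integral => //.
    by apply/measurable_EFinP; exact: me.
  rewrite [g]splitr EFinD -[leRHS]adde0; apply: leeD => //; exact: leeD.
  by move=> y _; rewrite -EFinD lee_fin addr_ge0.
have : \forall y \ae m, forall k : nat, @cube R N k%:R y -> (u y s - clip_at s y)%:E = 0%E.
  apply: ae_foralln => k.
  have mK : measurable (@cube R N k%:R) by exact: cube_measurable.
  have mf : measurable_fun (@cube R N k%:R) (fun y => (u y s - clip_at s y)%:E).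
    by apply/measurable_EFinP; apply: measurable_funTS; apply: measurable_funB; [exact: mu_|exact: mclip].
  exact: (@ae_eq_integral_abs _ _ _ m _ mK _ mf).1 (D0 _).
apply: filterS => y h; apply/eqP; rewrite -subr_eq0 -eqe; apply/eqP.
apply: (h (Num.truncn `|y|).+1); rewrite /cube /=; apply: ltW; exact: truncnS_gt.
Qed.

End solution.

(** * Estimates for J and the mollifiers, uniform in lam *)

Section l1_norm.
Context d (X : measurableType d) (R : realType) (m : {measure set X -> \bar R}).
Implicit Types f g : X -> R.

Lemma Rint_normD f g : L1b m f -> L1b m g ->
  \int[m]_x `|f x + g x| <= \int[m]_x `|f x| + \int[m]_x `|g x|.
Proof.
move=> Lf Lg; rewrite -(RintD (L1b_norm Lf) (L1b_norm Lg)); apply: le_Rint.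
- exact/L1b_norm/L1bD.
- exact: L1bD (L1b_norm Lf) (L1b_norm Lg).
- by move=> x; exact: ler_normD.
Qed.

Lemma Rint_normZ c f : L1b m f -> \int[m]_x `|c * f x| = `|c| * \int[m]_x `|f x|.
Proof. by move=> Lf; rewrite -(RintZ _ (L1b_norm Lf)); apply: eq_Rint => x; rewrite normrM. Qed.

Lemma Rint_normC f g : \int[m]_x `|f x - g x| = \int[m]_x `|g x - f x|.
Proof. by apply: eq_Rint => x; exact: distrC. Qed.

Lemma Rint_norm_ge0 f : 0 <= \int[m]_x `|f x|. Proof. exact: Rint_ge0. Qed.

Lemma Rint_holder f g C : L1b m f -> bmf g -> (forall x, `|g x| <= C) ->
  `|\int[m]_x (g x * f x)| <= C * \int[m]_x `|f x|.
Proof.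
move=> Lf bg gC; have L := L1bM bg Lf; rewrite (le_trans (Rint_norm L))//.
rewrite -RintZ; last exact: L1b_norm.
apply: le_Rint; [exact: L1b_norm|exact/L1bZ/L1b_norm|].
by move=> x; rewrite normrM ler_wpM2r.
Qed.

End l1_norm.

Lemma telescope4 (V : zmodType) (a b c d e : V) : (a - b) + (b - c) + ((c - d) + (d - e)) = a - e.
Proof. by rewrite !addrA !subrK. Qed.

Lemma regroup2 (R : realDomainType) (p q r : R) : (p + q) + (r + q) <= p + 2 * q + r.
Proof. lra. Qed.

Section space_estimates.
Context {R : realType} {N : nat}.
Local Notation m := (lebesgue_rV R N).
Variable nu : {sigma_finite_measure set 'rV[R]_N -> \bar R}.
Hypothesis gL : forall k, L1b m (gen nu (rho k)).
Variables (J : ('rV[R]_N -> R) -> 'rV[R]_N -> R) (lam eta : R).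
Hypotheses (MJ : markov_op m J) (FJ : finshift J) (lam0 : 0 < lam) (eta0 : 0 <= eta).

Let Mr := @rho_mollifier R N.
Let rL k := mo_L1 Mr k.
Let JL f : L1b m f -> L1b m (J f). Proof. by move=> Lf; have [] := mk_int MJ Lf. Qed.

Definition gmass k := \int[m]_x `|gen nu (rho k) x|.

Lemma gmass_ge0 k : 0 <= gmass k. Proof. exact: Rint_ge0. Qed.

Section one_mollifier.
Variable k : nat.
Hypothesis Jk : \int[m]_x `|lam * (J (rho k) x - rho k x) - J (gen nu (rho k)) x| <= eta.

Let dL : L1b m (fun x => J (rho k) x - rho k x). Proof. by apply: L1bB => //; exact: JL. Qed.

(** lam (J rho - rho) is within eta of J L rho, and J is an L1 contraction, so the left side stays
    bounded as lam grows. The later factors 1/lam come from here. *)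
Lemma resolvent_kernel : lam * \int[m]_x `|J (rho k) x - rho k x| <= gmass k + eta.
Proof.
have L1 := L1bZ lam dL; have L2 := JL (gL k).
rewrite -[X in X * _ <= _](gtr0_norm lam0) -Rint_normZ//.
have -> : \int[m]_x `|lam * (J (rho k) x - rho k x)| =
  \int[m]_x `|(lam * (J (rho k) x - rho k x) - J (gen nu (rho k)) x) + J (gen nu (rho k)) x|.
  by apply: eq_Rint => x; rewrite subrK.
rewrite (le_trans (Rint_normD _ _))//; first exact: L1bB.
by rewrite addrC lerD// mk_L1.
Qed.

Lemma moll_flux f x : bmf f ->
  J (cvl (rho k) f) x - cvl (rho k) f x = cvl (fun y => J (rho k) y - rho k y) f x.
Proof. by move=> bf; rewrite (finshift_cvl (rL k)) ?cvl_kB//; exact: JL. Qed.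

Lemma moll_flux_L1 f : L1b m f ->
  lam * \int[m]_x `|J (cvl (rho k) f) x - cvl (rho k) f x| <= (gmass k + eta) * \int[m]_x `|f x|.
Proof.
move=> Lf; have [_ h] := cvl_L1 dL Lf.
have -> : \int[m]_x `|J (cvl (rho k) f) x - cvl (rho k) f x| =
    \int[m]_x `|cvl (fun y => J (rho k) y - rho k y) f x|.
  by apply: eq_Rint => x; rewrite moll_flux//; exact: L1b_bmf Lf.
apply: le_trans (ler_wpM2l (ltW lam0) h) _; rewrite mulrA ler_wpM2r ?Rint_norm_ge0//.
exact: resolvent_kernel.
Qed.

Lemma moll_flux_bound f C x : bmf f -> (forall y, `|f y| <= C) ->
  lam * `|J (cvl (rho k) f) x - cvl (rho k) f x| <= (gmass k + eta) * C.
Proof.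
move=> bf fC; rewrite moll_flux//.
have C0 : 0 <= C by exact: le_trans (fC 0).
apply: le_trans (ler_wpM2l (ltW lam0) (cvl_bound dL x bf fC)) _.
by rewrite mulrCA mulrC ler_wpM2r// resolvent_kernel.
Qed.

(** With z the mollified indicator, lam |z - J z| is at most gmass + eta at every point, and z has
    mass m (A); no lam is left. *)
Lemma moll_energy A : fin_meas A ->
  energy m J lam (cvl (rho k) \1_A) <= (gmass k + eta) * fine (m A).
Proof.
move=> fA; have [LA _] := indic_L1b fA; have bA := L1b_bmf LA.
have [Lz _] := moll_L1 Mr k LA.
have z0 x : 0 <= cvl (rho k) \1_A x.
  by apply: (moll_ge0 Mr) => // y; rewrite indicE; case: (_ \in _).
rewrite /energy -RintZ; last by apply: L1bMr (L1b_bmf Lz); apply: L1bB => //; exact: JL.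
apply: (@le_trans _ _ (\int[m]_x ((gmass k + eta) * cvl (rho k) \1_A x))).
  apply: le_Rint.
  - by apply: L1bZ; apply: L1bMr (L1b_bmf Lz); apply: L1bB => //; exact: JL.
  - exact: L1bZ.
  - move=> x; rewrite mulrA ler_wpM2r//.
    have h : forall y, `|(\1_A : 'rV[R]_N -> R) y| <= 1.
      by move=> y; rewrite indicE; case: (_ \in _); rewrite ?normr1 ?normr0.
    have := moll_flux_bound x bA h; rewrite mulr1; apply: le_trans.
    by rewrite ler_wpM2l ?(ltW lam0)// distrC ler_norm.
by rewrite RintZ// (moll_int Mr)// Rint_indic.
Qed.

(** J is compared with the identity on rho_k * f, where k stays fixed while lam grows; rho_e * f is
    linked to it by L1 contraction. Thus the coefficient of 1/lam does not involve e. *)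
Lemma resolvent_moll_L1 e f : L1b m f ->
  \int[m]_x `|J (cvl (rho e) f) x - f x| <=
  \int[m]_x `|cvl (rho e) f x - f x| + 2 * \int[m]_x `|cvl (rho k) f x - f x|
  + lam^-1 * (gmass k + eta) * \int[m]_x `|f x|.
Proof.
move=> Lf; have [Le _] := moll_L1 Mr e Lf; have [Lk _] := moll_L1 Mr k Lf.
have J1 := JL Le; have J2 := JL Lk; have J3 := JL Lf.
pose a1 x := J (cvl (rho e) f) x - J f x.
pose a2 x := J f x - J (cvl (rho k) f) x.
pose a3 x := J (cvl (rho k) f) x - cvl (rho k) f x.
pose a4 x := cvl (rho k) f x - f x.
have L1 : L1b m a1 by exact: L1bB. have L2 : L1b m a2 by exact: L1bB.
have L3 : L1b m a3 by exact: L1bB. have L4 : L1b m a4 by exact: L1bB.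
have -> : \int[m]_x `|J (cvl (rho e) f) x - f x| = \int[m]_x `|(a1 x + a2 x) + (a3 x + a4 x)|.
  by apply: eq_Rint => x; rewrite /a1 /a2 /a3 /a4 telescope4.
have L12 := L1bD L1 L2; have L34 := L1bD L3 L4.
apply: le_trans (Rint_normD L12 L34) _.
apply: le_trans (lerD (Rint_normD L1 L2) (Rint_normD L3 L4)) _.
have h1 : \int[m]_x `|a1 x| <= \int[m]_x `|cvl (rho e) f x - f x|.
  have := mk_L1 MJ (L1bB Le Lf); rewrite (mkB MJ); exact.
have h2 : \int[m]_x `|a2 x| <= \int[m]_x `|cvl (rho k) f x - f x|.
  by have := mk_L1 MJ (L1bB Lf Lk); rewrite (mkB MJ) [leRHS]Rint_normC.
have h3 : \int[m]_x `|a3 x| <= lam^-1 * (gmass k + eta) * \int[m]_x `|f x|.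
  by rewrite -mulrA ler_pdivlMl//; exact: moll_flux_L1.
have h4 : \int[m]_x `|a4 x| <= \int[m]_x `|cvl (rho k) f x - f x| by exact: lexx.
exact: le_trans (lerD (lerD h1 h2) (lerD h3 h4)) (regroup2 _ _ _).
Qed.

(** Symmetry moves J and rho_e from f onto the mollified indicator; three L1 errors remain, due to
    J, to rho_e and to rho_k. *)
Lemma resolvent_pairing e A f M : fin_meas A -> bmf f -> (forall x, `|f x| <= M) ->
  \int[m]_x (f x * \1_A x) - M * (lam^-1 * (gmass k + eta) * fine (m A) +
    \int[m]_x `|cvl (rho e) (cvl (rho k) \1_A) x - cvl (rho k) \1_A x|
    + \int[m]_x `|cvl (rho k) \1_A x - \1_A x|) <=
  \int[m]_x (J (cvl (rho e) f) x * cvl (rho k) \1_A x).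
Proof.
move=> fA bf fM; have [LA IA] := indic_L1b fA.
have [Lz _] := moll_L1 Mr k LA; set z := cvl (rho k) \1_A in Lz *.
have LJz := JL Lz; have [LRJ _] := moll_L1 Mr e LJz; have [LR _] := moll_L1 Mr e Lz.
have bR : bmf (cvl (rho e) f) by apply: cvl_bmf.
have -> : \int[m]_x (J (cvl (rho e) f) x * z x) = \int[m]_x (f x * cvl (rho e) (J z) x).
  rewrite -cvl_sym//; last by move=> x; exact: rhoN.
  transitivity (\int[m]_x (z x * J (cvl (rho e) f) x)).
    by apply: eq_Rint => x; rewrite mulrC.
  by rewrite -mk_sym//; apply: eq_Rint => x; rewrite mulrC.
pose D x := \1_A x - cvl (rho e) (J z) x.
have LD : L1b m D by exact: L1bB.
rewrite lerBlDl -lerBlDr -RintB; [|exact: L1bM|exact: L1bM].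
have -> : \int[m]_x (f x * \1_A x - f x * cvl (rho e) (J z) x) = \int[m]_x (f x * D x).
  by apply: eq_Rint => x; rewrite mulrBr.
apply: le_trans (ler_norm _) _; apply: le_trans (Rint_holder LD bf fM) _.
have M0 : 0 <= M by exact: le_trans (fM 0).
rewrite ler_wpM2l//.
pose a1 x := cvl (rho e) (fun y => J z y - z y) x.
have LJd : L1b m (fun y => J z y - z y) by exact: L1bB.
have [L1 N1] := moll_L1 Mr e LJd.
have L2 := L1bB LR Lz; have L3 := L1bB Lz LA.
have -> : \int[m]_x `|D x| = \int[m]_x `|(a1 x + (cvl (rho e) z x - z x)) + (z x - \1_A x)|.
  apply: eq_Rint => x; rewrite -normrN; congr `|_|; rewrite /D /a1.
  by rewrite (cvlB (rL e) x (L1b_bmf LJz) (L1b_bmf Lz)); ring.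
apply: le_trans (Rint_normD (L1bD L1 L2) L3) _; rewrite lerD2r.
apply: le_trans (Rint_normD L1 L2) _; rewrite lerD2r.
apply: le_trans N1 _; rewrite -mulrA ler_pdivlMl//.
by apply: le_trans (moll_flux_L1 LA) _; rewrite IA.
Qed.

End one_mollifier.

(** Positivity and preservation of constants give J (rho * f) - c <= J (rho * (f - c)^+) pointwise;
    the right side is nonnegative and has the integral of (f - c)^+. *)
Lemma initial_pairing e f c z : L1b m f -> 0 < c -> L1b m z -> (forall x, 0 <= z x <= 1) ->
  \int[m]_x ((J (cvl (rho e) f) x - c) * z x) <= \int[m]_x Num.max 0 (f x - c).
Proof.
move=> Lf c0 Lz z01; have bf := L1b_bmf Lf.
have Lp : L1b m (fun x => Num.max 0 (f x - c)).
  have mp : measurable_fun setT (fun x => Num.max 0 (f x - c)).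
    apply: measurable_maxr; first exact: measurable_cst.
    by apply: measurable_funB; [case: bf|exact: measurable_cst].
  have h x : `|Num.max 0 (f x - c)| <= `|f x|.
    rewrite ger0_norm ?le_max ?lexx// ge_max normr_ge0/=.
    by rewrite (le_trans _ (ler_norm _))// lerBlDr lerDl ltW.
  apply: (L1b_le _ Lf h); split => //.
  by have [_ [C fC]] := bf; exists C => x; exact: le_trans (h x) (fC x).
have [Lq _] := moll_L1 Mr e Lp; have [LJ IJ] := mk_int MJ Lq.
rewrite -(moll_int Mr e Lp) -IJ.
have bR := L1b_bmf (JL (moll_L1 Mr e Lf).1).
apply: le_Rint => //.
  by apply: L1bM => //; apply: bmfB => //; exact: bmf_cst.
move=> x; have /andP[z0 z1] := z01 x.
have q0 : 0 <= J (cvl (rho e) (fun x => Num.max 0 (f x - c))) x.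
  apply: (mk_ge0 MJ) => y; apply: (moll_ge0 Mr); first exact: L1b_bmf Lp.
  by move=> t; rewrite le_max lexx.
have h : J (cvl (rho e) f) x - c <= J (cvl (rho e) (fun x => Num.max 0 (f x - c))) x.
  rewrite -[c in leLHS](congr1 (fun g => g x) (mk_cst MJ c)).
  rewrite -[X in X x]/(fun x => _) -(congr1 (fun g => g x) (mkB MJ _ _)) /=.
  apply: (mk_le MJ) => y; rewrite -[c in leLHS](moll_cst Mr e c y) -cvlB//; last exact: bmf_cst.
  apply: (moll_le Mr); [by apply: bmfB => //; exact: bmf_cst|exact: L1b_bmf Lp|].
  by move=> t; rewrite le_max lexx orbT.
have [s0|s0] := leP 0 (J (cvl (rho e) f) x - c).
  by apply: le_trans h; rewrite ler_piMr.
by apply: le_trans q0; rewrite mulr_le0_ge0// ltW.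
Qed.

End space_estimates.

(** * Time slabs and iterated integrals *)

Section slabs.
Context {R : realType} {N : nat}.
Local Notation m := (lebesgue_rV R N).
Local Notation leb := (@lebesgue_measure R).
Local Notation XT := ('rV[R]_N * measurableTypeR R)%type.
Implicit Types (b F : XT -> R).

Lemma slice_bmf b C t : measurable_fun setT b -> (forall p, `|b p| <= C) ->
  bmf (fun y => b (y, t)).
Proof.
by move=> mb bC; split; [apply: measurableT_comp mb _; exact: measurable_pair2|exists C].
Qed.

Lemma slice_time b x : measurable_fun setT b -> measurable_fun [set: measurableTypeR R] (fun t => b (x, t)).
Proof. by move=> mb; apply: measurableT_comp mb _; exact: measurable_pair1. Qed.

Lemma measurable_cvl_xt k b : measurable_fun setT k -> measurable_fun setT b ->
  measurable_fun [set: XT] (fun p => cvl k (fun y => b (y, p.2)) p.1).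
Proof.
move=> mk mb; apply: (measurable_Rint m (F := fun q : XT * 'rV[R]_N => k (q.1.1 - q.2) * b (q.2, q.1.2))).
have m11 : measurable_fun [set: XT * 'rV[R]_N] (fun q => q.1.1).
  by apply: measurableT_comp => //; exact: measurable_fst.
have m12 : measurable_fun [set: XT * 'rV[R]_N] (fun q => q.1.2).
  by apply: measurableT_comp; [exact: measurable_snd|exact: measurable_fst].
apply: measurable_funM.
  apply: measurableT_comp => //.
  rewrite (_ : (fun _ => _) = (fun p : 'rV[R]_N * 'rV[R]_N => p.1 - p.2) \o
     (fun q : XT * 'rV[R]_N => (q.1.1, q.2)))//.
  apply: measurableT_comp; first exact: measurable_sub.
  by apply/measurable_fun_pairP; split => //; exact: measurable_snd.
apply: measurableT_comp => //; apply/measurable_fun_pairP; split => //.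
exact: measurable_snd.
Qed.

Lemma measurable_finshift_xt J b : finshift J -> measurable_fun setT b ->
  measurable_fun [set: XT] (fun p => J (fun y => b (y, p.2)) p.1).
Proof.
move=> [s Js] mb; under eq_fun do rewrite Js.
apply: measurable_sumr => q; apply: measurable_funM; first exact: measurable_cst.
have mS : measurable_fun [set: XT] (fun p : XT => p.1 + q.2).
  rewrite (_ : (fun _ => _) = (fun y : 'rV[R]_N => y + q.2) \o fst)//.
  by apply: measurableT_comp; [exact: measurable_shift_rV|exact: measurable_fst].
apply: measurableT_comp => //; apply/measurable_fun_pairP; split => //.
exact: measurable_snd.
Qed.

Lemma measurable_Rint_itv b (t1 t2 : R) : measurable_fun setT b ->
  measurable_fun [set: 'rV[R]_N] (fun x => \int[leb]_(s in `]t1, t2[) b (x, s)).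
Proof.
move=> mb; under eq_fun do rewrite Rintegral_mkcond.
pose D : set XT := setT `*` `]t1, t2[%classic.
have mD : measurable D by apply: measurableX => //; exact: measurable_itv.
rewrite (_ : (fun _ => _) = fun x => \int[leb]_s (b \_ D) (x, s)).
  by apply: (measurable_Rint leb); apply/(measurable_restrictT _ mD); exact: measurable_funTS.
apply/funext => x; apply: eq_Rint => s; rewrite !patchE.
by congr (if _ then _ else _); apply/idP/idP; rewrite !inE /D /=; [|case].
Qed.

Lemma itv_bmf b C (t1 t2 : R) : measurable_fun setT b -> (forall p, `|b p| <= C) -> t1 <= t2 ->
  bmf (fun x : 'rV[R]_N => \int[leb]_(s in `]t1, t2[) b (x, s)).
Proof.
move=> mb bC t12; split; first exact: measurable_Rint_itv.
exists (C * (t2 - t1)) => x; apply: Rint_itv_le => //; first exact: slice_time.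
exact: le_trans (bC (0, 0)).
Qed.

Lemma finshift_itv J b C (t1 t2 : R) x : finshift J -> measurable_fun setT b -> (forall p, `|b p| <= C) ->
  J (fun y => \int[leb]_(s in `]t1, t2[) b (y, s)) x =
  \int[leb]_(s in `]t1, t2[) J (fun y => b (y, s)) x.
Proof.
move=> [s Js] mb bC; rewrite Js; under [RHS]eq_Rintegral do rewrite Js.
elim: s {Js} => [|q s IH].
  by rewrite big_nil; under eq_Rintegral do rewrite big_nil; rewrite Rintegral_cst// mul0r.
rewrite big_cons IH; under [RHS]eq_Rintegral do rewrite big_cons.
have i1 := integrable_itv t1 t2 (slice_time (x + q.2) mb) (fun t => bC (x + q.2, t)).
rewrite -RintegralZl// -RintegralD//.
  apply: (integrable_itv (C := `|q.1| * C)).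
    by apply: measurable_funM; [exact: measurable_cst|exact: slice_time].
  by move=> t; rewrite normrM ler_wpM2l.
have ms : measurable_fun [set: measurableTypeR R] (fun t => \sum_(p <- s) p.1 * b (x + p.2, t)).
  apply: measurable_sumr => p; apply: measurable_funM; first exact: measurable_cst.
  exact: slice_time.
have C0 : 0 <= C by exact: le_trans (bC (0, 0)).
apply: (integrable_itv (C := \sum_(p <- s) `|p.1| * C) _ _ ms) => t.
rewrite (le_trans (ler_norm_sum _ _ _))//; apply: ler_sum => p _.
by rewrite normrM ler_wpM2l.
Qed.

Section slab_sum.
Variables (F : XT -> R) (K om h : R).
Hypotheses (mF : measurable_fun setT F) (F0 : forall p, 0 <= F p) (FK : forall p, F p <= K).
Hypotheses (h0 : 0 <= h) (IF : (\int[leb]_s \int[m]_x (F (x, s))%:E <= om%:E)%E).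

Let FKn p : `|F p| <= K. Proof. by rewrite ger0_norm. Qed.

Let slab_le (t1 t2 : R) : (\int[m]_x (\int[leb]_(s in `]t1, t2[) F (x, s))%:E <= om%:E)%E.
Proof.
apply: le_trans IF.
have -> : (\int[leb]_s \int[m]_x (F (x, s))%:E = \int[m]_x \int[leb]_s (F (x, s))%:E)%E.
  have F0E p : (0 <= (F p)%:E)%E by rewrite lee_fin.
  have mFE : measurable_fun setT (fun p => (F p)%:E) by exact/measurable_EFinP.
  exact: esym (@fubini_tonelli _ _ _ _ R m leb _ mFE F0E).
have mEF : measurable_fun [set: XT] (fun p => (F p)%:E) by exact/measurable_EFinP.
apply: ge0_le_integral => //.
- by move=> x _; rewrite lee_fin; apply: Rintegral_ge0.
- by apply/measurable_EFinP; exact: measurable_Rint_itv.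
- apply: (@measurable_fun_fubini_tonelli_F _ _ _ _ R leb (fun p => (F p)%:E)) => //.
move=> x _; have i1 := integrable_itv t1 t2 (slice_time x mF) (fun t => FKn (x, t)).
rewrite /Rintegral fineK; last exact: integrable_fin_num.
apply: ge0_subset_integral => //.
  by apply/measurable_EFinP; exact: slice_time.
by move=> s _; rewrite lee_fin.
Qed.

Lemma slab_L1b (t1 t2 : R) : t1 <= t2 ->
  L1b m (fun x => \int[leb]_(s in `]t1, t2[) F (x, s)) /\
  \int[m]_x \int[leb]_(s in `]t1, t2[) F (x, s) <= om.
Proof.
move=> t12; have b := itv_bmf mF FKn t12.
have S0 x : 0 <= \int[leb]_(s in `]t1, t2[) F (x, s) by exact: Rintegral_ge0.
have [|L le] := L1b_of (m := m) (c := om) b.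
  by under eq_integral => x _ do rewrite ger0_norm//; exact: slab_le.
split=> //; apply: le_trans le; rewrite le_eqVlt; apply/orP; left; apply/eqP.
by apply: eq_Rint => x; rewrite ger0_norm.
Qed.

(** Adjacent slabs glue to one interval, dominated by all times; bounding each slab separately would
    lose a factor n. *)
Lemma slab_sum n :
  \sum_(k < n) \int[m]_x \int[leb]_(s in `]k%:R * h, k.+1%:R * h[) F (x, s) <= om.
Proof.
suff -> : \sum_(k < n) \int[m]_x \int[leb]_(s in `]k%:R * h, k.+1%:R * h[) F (x, s) =
    \int[m]_x \int[leb]_(s in `]0, n%:R * h[) F (x, s).
  by have [] := @slab_L1b 0 (n%:R * h) (mulr_ge0 (ler0n _ _) h0).
elim: n => [|n IH].
  rewrite big_ord0 mul0r -[RHS](_ : \int[m]_x (0 : R) = _).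
    by rewrite /Rintegral integral0.
  by apply: eq_Rint => x; rewrite set_itv_ge ?Rintegral_set0// bnd_simp ltxx.
have kh : n%:R * h <= n.+1%:R * h by rewrite ler_wpM2r// ler_nat.
have [L1 _] := @slab_L1b 0 (n%:R * h) (mulr_ge0 (ler0n _ _) h0).
have [L2 _] := slab_L1b kh.
rewrite big_ord_recr /= IH -RintD//; apply: eq_Rint => x.
have n0 : 0 <= n%:R * h by rewrite mulr_ge0.
by rewrite -(Rint_itv_split n0 kh (slice_time x mF) (fun t => FKn (x, t))).
Qed.

End slab_sum.

Section strip_integrals.
Implicit Types (f g : XT -> R).
Local Notation xt := (lebesgue_xt R N).

Lemma xt_iterated f : measurable_fun setT f -> (forall p, 0 <= f p) ->
  (\int[xt]_p (f p)%:E = \int[leb]_s \int[m]_x (f (x, s))%:E)%E.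
Proof.
move=> mf f0; have F0 p : (0 <= (f p)%:E)%E by rewrite lee_fin.
have mF : measurable_fun setT (fun p => (f p)%:E) by exact/measurable_EFinP.
exact: (@fubini_tonelli2 _ _ _ _ R m leb _ mF F0).
Qed.

Lemma xt_slices f g : measurable_fun setT f -> measurable_fun setT g ->
  (forall p, 0 <= f p) -> (forall p, 0 <= g p) ->
  (forall s, (\int[m]_x (f (x, s))%:E <= \int[m]_x (g (x, s))%:E)%E) ->
  (\int[xt]_p (f p)%:E <= \int[xt]_p (g p)%:E)%E.
Proof.
move=> mf mg f0 g0 fg; rewrite !xt_iterated//; apply: ge0_le_integral => //.
- by move=> s _; apply: integral_ge0 => x _; rewrite lee_fin.
- apply: (@measurable_fun_fubini_tonelli_G _ _ _ _ R m (fun p => (f p)%:E)).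
    exact/measurable_EFinP.
  by move=> p; rewrite lee_fin.
- apply: (@measurable_fun_fubini_tonelli_G _ _ _ _ R m (fun p => (g p)%:E)).
    exact/measurable_EFinP.
  by move=> p; rewrite lee_fin.
Qed.

Lemma xt_le f g (a c x y : R) : measurable_fun setT f -> measurable_fun setT g ->
  (forall p, 0 <= f p) -> (forall p, 0 <= g p) -> 0 <= a -> 0 <= c ->
  (\int[xt]_p (f p)%:E <= x%:E)%E -> (\int[xt]_p (g p)%:E <= y%:E)%E ->
  (\int[xt]_p (a * f p + c * g p)%:E <= (a * x + c * y)%:E)%E.
Proof.
move=> mf mg f0 g0 a0 c0 fx gy.
have m1 : measurable_fun setT (fun p => (f p)%:E) by exact/measurable_EFinP.
have m2 : measurable_fun setT (fun p => (g p)%:E) by exact/measurable_EFinP.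
under eq_integral do rewrite EFinD !EFinM.
rewrite ge0_integralD//; last 4 first.
- by move=> p _; rewrite -EFinM lee_fin mulr_ge0.
- exact: measurable_funeM.
- by move=> p _; rewrite -EFinM lee_fin mulr_ge0.
- exact: measurable_funeM.
rewrite !ge0_integralZl//; last 2 first.
- by move=> p _; rewrite lee_fin.
- by move=> p _; rewrite lee_fin.
rewrite EFinD !EFinM; apply: leeD; exact: lee_wpmul2l.
Qed.

End strip_integrals.
End slabs.

(** * The pointwise inequality for the regularised chord slope *)

Section scalar.
Context {R : realType}.
Variables (phi : R -> R) (c delta B M : R).
Hypotheses (phi_cont : continuous phi) (phi_ndecr : {homo phi : a b / a <= b}).
Hypotheses (c0 : 0 < c) (d0 : 0 < delta) (d1 : delta <= 1).
Hypotheses (hB : forall a, `|a| <= M -> `|phi a| <= B) (hBc : `|phi c| <= B).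

(* The chord slope |phi s - phi c| / |s - c|, regularised so that it stays bounded
   as s tends to c although phi is only continuous. *)
Definition slope s := `|phi s - phi c| / (`|s - c| + delta * `|s|).

Let B0 : 0 <= B. Proof. exact: le_trans hBc. Qed.

(** From c <= |s - c| + |s| and delta <= 1: when s is close to c, the term delta |s| takes over. *)
Lemma slope_den s : delta * c <= `|s - c| + delta * `|s|.
Proof.
have h : c <= `|s - c| + `|s|.
  rewrite distrC -[leLHS](gtr0_norm c0) -[X in `|X| <= _](subrK s).
  exact: ler_normD.
apply: le_trans (ler_wpM2l (ltW d0) h) _; rewrite mulrDr lerD2r.
by rewrite ler_piMl.
Qed.

Let den0 s : 0 < `|s - c| + delta * `|s|.
Proof. by apply: lt_le_trans (slope_den s); rewrite mulr_gt0. Qed.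

Lemma slope_ge0 s : 0 <= slope s.
Proof. by rewrite divr_ge0// ltW. Qed.

Let psiB s : `|s| <= M -> `|phi s - phi c| <= 2 * B.
Proof.
move=> sM; rewrite (le_trans (ler_normB _ _))// mulr_natl mulr2n lerD//; exact: hB.
Qed.

Lemma slope_le s : `|s| <= M -> slope s <= 2 * B / (delta * c).
Proof.
move=> sM; rewrite /slope ler_pM ?invr_ge0 ?(ltW (den0 s))//; first exact: psiB.
by rewrite lef_pV2 ?posrE ?mulr_gt0//; exact: slope_den.
Qed.

(** The regularisation leaves the defect slope * delta |s| in slope * (s - c) = phi s - phi c. The
    factor [slope] is kept in it, since Young's inequality will be used with this weight. *)
Lemma slope_err s : `|s| <= M ->
  `|slope s * (s - c) - (phi s - phi c)| = slope s * (delta * `|s|) /\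
  slope s * (delta * `|s|) <= 2 * B.
Proof.
move=> sM; split; last first.
  apply: le_trans (psiB sM); rewrite /slope mulrAC ler_pdivrMr// ler_wpM2l//.
  by rewrite lerDr.
have dn : `|s - c| + delta * `|s| != 0 by rewrite gt_eqF.
have E : slope s * (s - c) - (phi s - phi c) = - Num.sg (s - c) * (slope s * (delta * `|s|)).
  (* Monotonicity of [phi] enters here: both differences have compatible signs. *)
  have -> : phi s - phi c = Num.sg (s - c) * `|phi s - phi c|.
    have [sc|sc|->] := ltgtP s c; last by rewrite !subrr sgr0 mul0r.
      rewrite ltr0_sg ?subr_lt0// ler0_norm ?subr_le0; last exact/phi_ndecr/ltW.
      by rewrite mulN1r opprK.
    rewrite gtr0_sg ?subr_gt0// ger0_norm ?subr_ge0 ?mul1r//; exact/phi_ndecr/ltW.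
  rewrite {1}[s - c in LHS]numEsg /slope.
  by field.
rewrite E normrM normrN; have [->|sc] := eqVneq s c.
  have -> : slope c = 0 by rewrite /slope subrr normr0 mul0r.
  by rewrite !mul0r normr0 mulr0.
by rewrite normr_sg subr_eq0 sc mul1r ger0_norm// mulr_ge0 ?slope_ge0 ?mulr_ge0 ?(ltW d0)//.
Qed.

Lemma young (y t beta : R) : 0 < beta -> y * t <= beta / 2 * y ^+ 2 + t ^+ 2 / (2 * beta).
Proof.
move=> b0; rewrite -subr_ge0.
have -> : beta / 2 * y ^+ 2 + t ^+ 2 / (2 * beta) - y * t = (beta * y - t) ^+ 2 / (2 * beta).
  by field; rewrite gt_eqF.
by rewrite divr_ge0 ?sqr_ge0// mulr_ge0// ltW.
Qed.

(** Here s is a value of the solution, Us its smoothed version, Uk that version at the start of the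
    time slab, p the mollified [phi (v) - phi c] and q the mollification error of the excess. The
    left side splits into five products with y. Those with Us - s and with the defect of the slope
    carry the weight [slope] and cost beta / 2 of the dissipation each; the time shift and the error
    f are charged to |y|, and q to the bound lam of |y|. *)
Lemma slope_key (A beta lam s Us Uk y p q e f : R) : 0 < beta -> `|s| <= M -> slope s <= A ->
  `|Us| <= M -> `|Uk - Us| <= e -> `|y| <= lam -> `|phi s - phi c - p - q| <= f -> 
  y * (slope s * (Uk - c) - p) <=
  beta * (slope s * y ^+ 2) + (B / beta * delta * `|s| + M * A / beta * `|Us - s| + lam * `|q|)
  + (A * e + f) * `|y|.
Proof.
move=> b0 sM sA UM Ue yl pf.
have [e1 e2] := slope_err sM; have a0 := slope_ge0 s.
set a := slope s in e1 e2 a0 sA *.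
set t := slope s * (s - c) - (phi s - phi c) in e1.
have -> : y * (a * (Uk - c) - p) = y * (a * (Uk - Us)) + a * (y * (Us - s)) + y * t
    + y * (phi s - phi c - p - q) + y * q by rewrite /t /a; ring.
have h1 : y * (a * (Uk - Us)) <= A * e * `|y|.
  rewrite (le_trans (ler_norm _))// normrM mulrC ler_wpM2r// normrM (ger0_norm a0).
  by rewrite ler_pM.
have h2 : a * (y * (Us - s)) <= beta / 2 * (a * y ^+ 2) + M * A / beta * `|Us - s|.
  have := ler_wpM2l a0 (young y (Us - s) b0); move/le_trans; apply.
  rewrite mulrDr mulrCA lerD2l.
  have D : `|Us - s| <= 2 * M.
    by rewrite (le_trans (ler_normB _ _))// mulr_natl mulr2n lerD.
  have -> : a * ((Us - s) ^+ 2 / (2 * beta)) = (a * `|Us - s| / (2 * beta)) * `|Us - s|.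
    by rewrite -(real_normK (num_real (Us - s))); field; rewrite gt_eqF.
  rewrite ler_wpM2r// ler_pdivrMr ?mulr_gt0//.
  apply: (@le_trans _ _ (A * (2 * M))); first by rewrite ler_pM.
  by rewrite le_eqVlt; apply/orP; left; apply/eqP; field; rewrite gt_eqF.
have h3 : y * t <= beta / 2 * (a * y ^+ 2) + B / beta * delta * `|s|.
  rewrite (le_trans (ler_norm _))// normrM e1 mulrCA.
  have := ler_wpM2l a0 (young `|y| (delta * `|s|) b0); move/le_trans; apply.
  rewrite mulrDr mulrCA (real_normK (num_real y)) lerD2l.
  have -> : a * ((delta * `|s|) ^+ 2 / (2 * beta)) = (a * (delta * `|s|)) * (delta * `|s| / (2 * beta)).
    by ring.
  have ds : 0 <= delta * `|s| / (2 * beta) by rewrite divr_ge0// mulr_ge0// ltW.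
  apply: le_trans (ler_wpM2r ds e2) _.
  by rewrite le_eqVlt; apply/orP; left; apply/eqP; field; rewrite gt_eqF.
have h4 : y * (phi s - phi c - p - q) <= f * `|y|.
  by rewrite (le_trans (ler_norm _))// normrM mulrC ler_wpM2r.
have h5 : y * q <= lam * `|q|.
  by rewrite (le_trans (ler_norm _))// normrM ler_wpM2r.
have -> : beta * (a * y ^+ 2) = beta / 2 * (a * y ^+ 2) + beta / 2 * (a * y ^+ 2) by field.
lra.
Qed.

Lemma slope_continuous : continuous slope.
Proof.
move=> s; apply: cvgM.
  apply: cvg_norm.
  by apply: cvgB; [exact: phi_cont|exact: cvg_cst].
apply: cvgV; first by rewrite gt_eqF.
apply: cvgD.
  apply: cvg_norm.
  by apply: cvgB; [exact: cvg_id|exact: cvg_cst].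
by apply: cvgMr; apply: cvg_norm; exact: cvg_id.
Qed.

End scalar.

Lemma chain_bounds (R : realDomainType) (P cE I En S Q W err Mx om X : R) :
  P - cE <= I + En + S + Q -> W - err <= P -> I <= Mx -> S <= om -> En <= X ->
  W - cE <= Mx + err + X + om + Q.
Proof. lra. Qed.

(** * The estimate with all parameters explicit *)

Section core.
Context {R : realType} {N : nat}.
Local Notation m := (lebesgue_rV R N).
Local Notation leb := (@lebesgue_measure R).
Local Notation XT := ('rV[R]_N * measurableTypeR R)%type.
Variable nu : {sigma_finite_measure set 'rV[R]_N -> \bar R}.
Hypothesis gL : forall k, L1b m (gen nu (rho k)).
Variables (J : ('rV[R]_N -> R) -> 'rV[R]_N -> R) (lam eta : R).
Hypotheses (MJ : markov_op m J) (FJ : finshift J) (lam0 : 0 < lam) (eta0 : 0 <= eta).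
Variables (phi : R -> R) (c delta B M tau : R).
Hypotheses (phi_cont : continuous phi) (phi_ndecr : {homo phi : a b / a <= b}).
Hypotheses (c0 : 0 < c) (d0 : 0 < delta) (d1 : delta <= 1) (tau0 : 0 < tau).
Hypotheses (hB : forall a, `|a| <= M -> `|phi a| <= B) (hBc : `|phi c| <= B).
Variables (v : XT -> R) (u0 w : 'rV[R]_N -> R).
Hypothesis EV : evolution nu phi tau M v u0 w.
Variables (e k1 k2 : nat).
Local Notation resolves k :=
  (\int[m]_x `|lam * (J (rho k) x - rho k x) - J (gen nu (rho k)) x| <= eta).
Hypotheses (Je : resolves e) (J1 : resolves k1) (J2 : resolves k2).
Local Notation A0 := (2 * B / (delta * c)).
Variables (beta dp : R) (n : nat).
Hypotheses (beta0 : 0 < beta) (dp0 : 0 < dp) (n0 : (0 < n)%N).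
Local Notation h := (tau / n%:R).
Hypothesis cfl : 2 * (h * A0 * lam) <= 1.

Let Mr := @rho_mollifier R N.
Let rL k := mo_L1 Mr k.
Let mr k : measurable_fun setT (@rho R N k). Proof. by case: (rL k) => -[]. Qed.
Let mg k : measurable_fun setT (gen nu (rho k)). Proof. by case: (gL k) => -[]. Qed.
Let mv : measurable_fun setT v := ev_meas EV.
Let vM : forall p, `|v p| <= M := ev_bound EV.
Let M0 : 0 <= M. Proof. exact: le_trans (vM (0, 0)). Qed.
Let B0 : 0 <= B. Proof. exact: le_trans hBc. Qed.
Let h0 : 0 < h. Proof. by rewrite divr_gt0// ltr0n. Qed.
Let nh : n%:R * h = tau. Proof. by field; rewrite pnatr_eq0 -lt0n. Qed.
Let A00 : 0 <= A0. Proof. by rewrite divr_ge0 ?mulr_ge0 ?(ltW c0) ?(ltW d0). Qed.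

Let phv p := phi (v p).
Let psv p := phi (v p) - phi c.
Let av p := slope phi c delta (v p).
(** By continuity of [phi] it vanishes for small |v|; being bounded, it is dominated by a multiple
    of |v|, hence integrable, which [phi (v) - phi 0] need not be. *)
Definition excess p := phi (v p) - phi 0 - clamp dp (phi (v p) - phi 0).

Let mphv : measurable_fun setT phv.
Proof. by apply: measurableT_comp => //; exact: continuous_measurable_fun. Qed.
Let phvB p : `|phv p| <= B. Proof. exact: hB. Qed.
Let mpsv : measurable_fun setT psv.
Proof. by apply: measurable_funB => //; exact: measurable_cst. Qed.
Let psvB p : `|psv p| <= 2 * B.
Proof. by rewrite (le_trans (ler_normB _ _))// mulr_natl mulr2n lerD//; exact: hB. Qed.
Let mav : measurable_fun setT av.
Proof.
apply: measurableT_comp => //; apply: continuous_measurable_fun; exact: slope_continuous.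
Qed.
Let av0 p : 0 <= av p. Proof. exact: slope_ge0. Qed.
Let avA p : av p <= A0. Proof. exact: slope_le (hB) (hBc) _ (vM p). Qed.
Let avAn p : `|av p| <= A0. Proof. by rewrite ger0_norm. Qed.
Let mfv : measurable_fun setT (fun p => phi (v p) - phi 0).
Proof. by apply: measurable_funB => //; exact: measurable_cst. Qed.
Let p0B : `|phi 0| <= B. Proof. by apply: hB; rewrite normr0. Qed.
Let fvB p : `|phi (v p) - phi 0| <= 2 * B.
Proof. by rewrite (le_trans (ler_normB _ _))// mulr_natl mulr2n lerD//; exact: phvB. Qed.
Let mclampf : measurable_fun setT (fun p => clamp dp (phi (v p) - phi 0)).
Proof. exact: measurable_clamp. Qed.
Let clampfB p : `|clamp dp (phi (v p) - phi 0)| <= dp. Proof. exact: clamp_le (ltW dp0). Qed.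

Lemma excess_meas : measurable_fun setT excess.
Proof. exact: measurable_funB. Qed.
Lemma excess_bound p : `|excess p| <= 4 * B.
Proof.
rewrite (le_trans (ler_normB _ _))// (_ : 4 * B = 2 * B + 2 * B); last by ring.
by rewrite lerD// (le_trans (clamp_norm _ (ltW dp0))).
Qed.

Let mcv (k : 'rV[R]_N -> R) b := @measurable_cvl_xt R N k b.
Let g := gen nu (rho e).

Let cgB p : `|cvl g (fun y => phv (y, p.2)) p.1| <= B * gmass nu e.
Proof. exact: (cvl_bound (gL e) p.1 (slice_bmf p.2 mphv phvB) (fun y => phvB (y, p.2))). Qed.
Let mcg : measurable_fun [set: XT] (fun p => cvl g (fun y => phv (y, p.2)) p.1).
Proof. exact: (mcv (mg e) mphv). Qed.
Let cpB p : `|cvl (rho e) (fun y => psv (y, p.2)) p.1| <= 2 * B.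
Proof. exact: (moll_bound Mr e (slice_bmf p.2 mpsv psvB) (fun y => psvB (y, p.2))). Qed.
Let mcp : measurable_fun [set: XT] (fun p => cvl (rho e) (fun y => psv (y, p.2)) p.1).
Proof. exact: (mcv (mr e) mpsv). Qed.

Let P t := mild nu phi v u0 e t.

Let P_bmf t : 0 <= t -> bmf (P t).
Proof.
move=> t0; apply: bmfD; first by apply: cvl_bmf => //; exact: L1b_bmf (ev_u0 EV).
exact: (itv_bmf mcg cgB t0).
Qed.

Let P_step t1 t2 x : 0 <= t1 -> t1 <= t2 ->
  P t2 x - P t1 x = \int[leb]_(s in `]t1, t2[) cvl g (fun y => phv (y, s)) x.
Proof.
move=> t10 t12; rewrite /P /mild opprD addrACA subrr add0r.
rewrite (Rint_itv_split t10 t12 (slice_time x mcg) (fun t => cgB (x, t))).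
by rewrite addrC addKr.
Qed.

Let P_lip t1 t2 x : 0 <= t1 -> t1 <= t2 -> `|P t2 x - P t1 x| <= B * gmass nu e * (t2 - t1).
Proof.
move=> t10 t12; rewrite P_step//; apply: Rint_itv_le => //.
- exact: (slice_time x mcg).
- by move=> t _; exact: cgB (x, t).
- by rewrite mulr_ge0 ?gmass_ge0.
Qed.

(** The scheme is indexed by all naturals, but the equation ends at tau: the clock stops there, and
    [W], [ab] and [F] vanish from step n on. *)
Let clk k := (minn k n)%:R * h.
Let clk0 k : 0 <= clk k. Proof. by rewrite mulr_ge0// ltW. Qed.
Let clkE k : (k < n)%N -> clk k = k%:R * h. Proof. by move=> kn; rewrite /clk (minn_idPl (ltnW kn)). Qed.
Let clkS k : (k < n)%N -> clk k.+1 = k.+1%:R * h. Proof. by move=> kn; rewrite /clk (minn_idPl kn). Qed.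
Let khS k : k%:R * h <= k.+1%:R * h. Proof. by rewrite ler_pM2r// ler_nat. Qed.
Let khD k : k.+1%:R * h - k%:R * h = h. Proof. by rewrite -mulrBl -natrB// subSnn mul1r. Qed.

Local Notation slab k := (`]k%:R * h, k.+1%:R * h[%classic).

Let mslab k : measurable (slab k : set (measurableTypeR R)). Proof. exact: measurable_itv. Qed.

(** [W] and [ab] integrate or average over the slab that follows time k h. Subtracting [phi c] in
    [W] does not affect J W - W, as J preserves constants, and makes [W] comparable with [ab] times
    U - c. *)
Let U k x := J (P (clk k)) x.
Let W k x := if (k < n)%N then \int[leb]_(s in slab k) cvl (rho e) (fun y => psv (y, s)) x else 0.
Let ab k x := if (k < n)%N then h^-1 * \int[leb]_(s in slab k) av (x, s) else 0.
Let r k x := U k.+1 x - U k x - lam * (J (W k) x - W k x).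

(** The error terms of [slope_key] at one point: regularisation of the slope, smoothing of v,
    mollification of the excess. *)
Definition density p := B / beta * delta * `|v p|
  + M * A0 / beta * `|J (cvl (rho e) (fun y => v (y, p.2))) p.1 - v p|
  + lam * `|cvl (rho e) (fun y => excess (y, p.2)) p.1 - excess p|.

Let F k x := if (k < n)%N then \int[leb]_(s in slab k) density (x, s) else 0.

Let JRvM p : `|J (cvl (rho e) (fun y => v (y, p.2))) p.1| <= M.
Proof.
apply: (mk_bound MJ) => y; exact: (moll_bound Mr e (slice_bmf p.2 mv vM) (fun y => vM (y, p.2))).
Qed.
Let mJRv : measurable_fun [set: XT] (fun p => J (cvl (rho e) (fun y => v (y, p.2))) p.1).
Proof. exact: (measurable_finshift_xt (b := fun p => cvl (rho e) (fun y => v (y, p.2)) p.1) FJ (mcv (mr e) mv)). Qed.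
Let mRx : measurable_fun [set: XT] (fun p => cvl (rho e) (fun y => excess (y, p.2)) p.1).
Proof. exact: (mcv (mr e) excess_meas). Qed.
Let RxB p : `|cvl (rho e) (fun y => excess (y, p.2)) p.1| <= 4 * B.
Proof. exact: (moll_bound Mr e (slice_bmf p.2 excess_meas excess_bound) (fun y => excess_bound (y, p.2))). Qed.

Let MA0 : 0 <= M * A0 / beta. Proof. exact: divr_ge0 (mulr_ge0 M0 A00) (ltW beta0). Qed.
Let Bd0 : 0 <= B / beta * delta. Proof. exact: mulr_ge0 (divr_ge0 B0 (ltW beta0)) (ltW d0). Qed.

Let d1m : measurable_fun [set: XT] (fun p => `|v p|). Proof. exact: measurableT_comp. Qed.
Let d2m : measurable_fun [set: XT] (fun p => `|J (cvl (rho e) (fun y => v (y, p.2))) p.1 - v p|).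
Proof. by apply: measurableT_comp => //; exact: (measurable_funB mJRv mv). Qed.
Let d3m : measurable_fun [set: XT] (fun p => `|cvl (rho e) (fun y => excess (y, p.2)) p.1 - excess p|).
Proof. by apply: measurableT_comp => //; exact: (measurable_funB mRx excess_meas). Qed.

Lemma density_meas : measurable_fun setT density.
Proof.
apply: measurable_funD; [apply: measurable_funD|];
  by apply: measurable_funM => //; exact: measurable_cst.
Qed.

Lemma density_ge0 p : 0 <= density p.
Proof. by apply: addr_ge0; [apply: addr_ge0|]; apply: mulr_ge0 => //; exact: ltW. Qed.

Lemma density_bound : exists K, forall p, density p <= K.
Proof.
exists (B / beta * delta * M + M * A0 / beta * (M + M) + lam * (4 * B + 4 * B)) => p.
rewrite !lerD// ler_wpM2l ?(ltW lam0)//.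
  by rewrite (le_trans (ler_normB _ _))// lerD.
by rewrite (le_trans (ler_normB _ _))// lerD//; exact: excess_bound.
Qed.

Let mab k : measurable_fun setT (ab k).
Proof.
rewrite /ab; case: (k < n)%N; last exact: measurable_cst.
apply: measurable_funM; [exact: measurable_cst|exact: (measurable_Rint_itv _ _ mav)].
Qed.

Let iav k x : leb.-integrable (slab k) (EFin \o (fun s => av (x, s))).
Proof. exact: integrable_itv (slice_time x mav) (fun t => avAn (x, t)). Qed.

Let abA k x : 0 <= ab k x <= A0.
Proof.
rewrite /ab; case: ifP => _; last by rewrite lexx A00.
have I0 : 0 <= \int[leb]_(s in slab k) av (x, s) by exact: Rintegral_ge0.
rewrite mulr_ge0 ?invr_ge0 ?(ltW h0)//= mulrC ler_pdivrMr//.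
rewrite -[X in _ <= _ * X](khD k); apply: le_trans (ler_norm _) _; apply: Rint_itv_le => //.
exact: slice_time.
Qed.

Let bU k : bmf (U k). Proof. by apply: (mk_bmf MJ); exact: P_bmf. Qed.

Let bW k : bmf (W k).
Proof.
rewrite /W; case: (k < n)%N; last exact: bmf_cst.
exact: (itv_bmf mcp cpB (khS k)).
Qed.

Let br k : bmf (r k).
Proof.
apply: bmfB; first exact: bmfB.
by apply: bmfZ; apply: bmfB => //; exact: (mk_bmf MJ).
Qed.

Let US k x : U k.+1 x - U k x = lam * (J (W k) x - W k x) + r k x.
Proof. by rewrite /r addrCA subrr addr0. Qed.

(** The increment of U is J of the time integral of L rho * phi (v). As J passes under the
    convolution and the integral, r is the integral over a slab of length h of [phi (v)] convolved
    with J L rho - lam (J rho - rho), a kernel of L1 norm at most eta. *)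
Let rE k x : `|r k x| <= h * (B * eta).
Proof.
have [kn|nk] := ltnP k n; last first.
  rewrite /r /U /clk (minn_idPr nk) (minn_idPr (leqW nk)) subrr sub0r normrN.
  have -> : W k = fun=> 0 by apply/funext => y; rewrite /W ltnNge nk.
  by rewrite (mk_cst MJ) subrr mulr0 normr0 !mulr_ge0// ltW.
pose q s y := cvl (fun t => J (gen nu (rho e)) t - lam * (J (rho e) t - rho e t)) (fun y => phv (y, s)) y.
have LJg : L1b m (J g) by have [] := mk_int MJ (gL e).
have LJr : L1b m (J (rho e)) by have [] := mk_int MJ (rL e).
have Lq : L1b m (fun t => J g t - lam * (J (rho e) t - rho e t)).
  by apply: L1bB => //; apply: L1bZ; exact: L1bB.
have bph s := slice_bmf s mphv phvB.
have bps s := slice_bmf s mpsv psvB.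
have mJcg : measurable_fun [set: XT] (fun p => J (cvl g (fun y => phv (y, p.2))) p.1).
  exact: (measurable_finshift_xt FJ mcg).
have mJcp : measurable_fun [set: XT] (fun p => J (cvl (rho e) (fun y => psv (y, p.2))) p.1).
  exact: (measurable_finshift_xt FJ mcp).
have JcgB p : `|J (cvl g (fun y => phv (y, p.2))) p.1| <= B * gmass nu e.
  by apply: (mk_bound MJ) => y; exact: cgB (y, p.2).
have JcpB p : `|J (cvl (rho e) (fun y => psv (y, p.2))) p.1| <= 2 * B.
  by apply: (mk_bound MJ) => y; exact: cpB (y, p.2).
have qE s : q s x = J (cvl g (fun y => phv (y, s))) x
    - lam * (J (cvl (rho e) (fun y => psv (y, s))) x - cvl (rho e) (fun y => psv (y, s)) x).
  have -> : J (cvl (rho e) (fun y => psv (y, s))) x - cvl (rho e) (fun y => psv (y, s)) x =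
      J (cvl (rho e) (fun y => phv (y, s))) x - cvl (rho e) (fun y => phv (y, s)) x.
    have -> : cvl (rho e) (fun y => psv (y, s)) = fun y => cvl (rho e) (fun y => phv (y, s)) y - phi c.
      apply/funext => y; rewrite /psv (cvlB (rL e) y (bph s) (bmf_cst _ (phi c))).
      by rewrite (moll_cst Mr).
    by rewrite (mkB MJ) (mk_cst MJ); ring.
  rewrite (moll_flux MJ FJ)// (finshift_cvl (gL e) x FJ (bph s)) -(cvl_kZ lam x (L1bB LJr (rL e)) (bph s)).
  by rewrite -(cvl_kB x LJg (L1bZ lam (L1bB LJr (rL e))) (bph s)).
have E : r k x = \int[leb]_(s in slab k) q s x.
  under [RHS]eq_Rintegral do rewrite qE.
  have S1 := integrable_itv (k%:R * h) (k.+1%:R * h) (slice_time x mJcg) (fun t => JcgB (x, t)).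
  have S2 := integrable_itv (k%:R * h) (k.+1%:R * h) (slice_time x mJcp) (fun t => JcpB (x, t)).
  have S3 := integrable_itv (k%:R * h) (k.+1%:R * h) (slice_time x mcp) (fun t => cpB (x, t)).
  have mS4 : measurable_fun [set: measurableTypeR R] (fun s => J (cvl (rho e) (fun y => psv (y, s))) x - cvl (rho e) (fun y => psv (y, s)) x).
    by apply: measurable_funB; [exact: (slice_time x mJcp)|exact: (slice_time x mcp)].
  have S4B s : `|J (cvl (rho e) (fun y => psv (y, s))) x - cvl (rho e) (fun y => psv (y, s)) x| <= 4 * B.
    rewrite (le_trans (ler_normB _ _))// (_ : 4 * B = 2 * B + 2 * B); last by ring.
    by apply: lerD; [exact: JcpB (x, s)|exact: cpB (x, s)].
  have S4 := integrable_itv (k%:R * h) (k.+1%:R * h) mS4 S4B.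
  have mS5 : measurable_fun [set: measurableTypeR R] (fun s => lam * (J (cvl (rho e) (fun y => psv (y, s))) x - cvl (rho e) (fun y => psv (y, s)) x)).
    by apply: measurable_funM => //; exact: measurable_cst.
  have S5B s : `|lam * (J (cvl (rho e) (fun y => psv (y, s))) x - cvl (rho e) (fun y => psv (y, s)) x)| <= lam * (4 * B).
    by rewrite normrM (gtr0_norm lam0) ler_wpM2l ?(ltW lam0).
  have S5 := integrable_itv (k%:R * h) (k.+1%:R * h) mS5 S5B.
  rewrite (RintegralB (mslab k) S1 S5) (RintegralZl lam (mslab k) S4).
  rewrite (RintegralB (mslab k) S2 S3) /r; congr (_ - lam * (_ - _)).
  - rewrite /U (clkE kn) (clkS kn).
    have -> : J (P (k.+1%:R * h)) x - J (P (k%:R * h)) x =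
        J (fun y => P (k.+1%:R * h) y - P (k%:R * h) y) x by rewrite (mkB MJ).
    have -> : (fun y => P (k.+1%:R * h) y - P (k%:R * h) y) =
       (fun y => \int[leb]_(s in slab k) cvl g (fun y => phv (y, s)) y).
      by apply/funext => y; rewrite P_step// mulr_ge0// ltW.
    exact: (finshift_itv _ _ _ FJ mcg cgB).
  - have -> : W k = (fun y => \int[leb]_(s in slab k) cvl (rho e) (fun y => psv (y, s)) y).
      by apply/funext => y; rewrite /W kn.
    exact: (finshift_itv _ _ _ FJ mcp cpB).
  - by rewrite /W kn.
have qB s : `|q s x| <= B * eta.
  apply: le_trans (cvl_bound Lq x (bph s) (fun y => phvB (y, s))) _.
  have Je' : \int[m]_t `|J g t - lam * (J (rho e) t - rho e t)| <= eta by rewrite Rint_normC; exact: Je.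
  exact: (ler_wpM2l B0 Je').
have mq : measurable_fun [set: measurableTypeR R] (fun s => q s x).
  have := @measurable_cvl_xt R N _ _ (bmf_meas (L1b_bmf Lq)) mphv.
  exact: (slice_time x).
have -> : h * (B * eta) = B * eta * (k.+1%:R * h - k%:R * h) by rewrite khD mulrC.
rewrite E; apply: Rint_itv_le => //; exact: mulr_ge0.
Qed.


Local Notation kp := (A0 * (B * gmass nu e * h) + 2 * dp).

Let G0 : 0 <= B * gmass nu e * h.
Proof. exact: mulr_ge0 (mulr_ge0 B0 (gmass_ge0 _ _)) (ltW h0). Qed.

Let kp0 : 0 <= kp.
Proof. exact: addr_ge0 (mulr_ge0 A00 G0) (mulr_ge0 (ler0n _ 2) (ltW dp0)). Qed.

(** The mollified solution is Lipschitz in time with constant B times [gmass nu e], and J is a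
    sup-norm contraction. *)
Let U_near k s x : (k < n)%N -> k%:R * h < s -> s < k.+1%:R * h ->
  `|U k x - J (cvl (rho e) (fun y => v (y, s))) x| <= B * gmass nu e * h.
Proof.
move=> kn ks sk.
have kh0 : 0 <= k%:R * h by rewrite mulr_ge0// ltW.
have st : 0 < s < tau.
  by rewrite (le_lt_trans kh0 ks) (lt_le_trans sk)// -[leRHS]nh ler_pM2r// ler_nat.
have -> : cvl (rho e) (fun y => v (y, s)) = P s by apply/funext => y; exact: (ev_mid EV).
rewrite /U (clkE kn).
have -> : J (P (k%:R * h)) x - J (P s) x = J (fun y => P (k%:R * h) y - P s y) x by rewrite (mkB MJ).
apply: (mk_bound MJ) => y; rewrite distrC.
apply: le_trans (P_lip y kh0 (ltW ks)) _.
apply: ler_wpM2l; first exact: mulr_ge0 B0 (gmass_ge0 _ _).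
by rewrite -[leRHS](khD k) lerB// ltW.
Qed.

(** Up to a constant, [phi (v) - phi c] is the excess plus a function of size at most dp, which
    mollification changes by at most 2 dp. *)
Let split_psi p :
  `|psv p - cvl (rho e) (fun y => psv (y, p.2)) p.1
    - (excess p - cvl (rho e) (fun y => excess (y, p.2)) p.1)| <= 2 * dp.
Proof.
pose cf q := clamp dp (phi (v q) - phi 0).
have b1 := slice_bmf p.2 mclampf clampfB.
have b2 := slice_bmf p.2 excess_meas excess_bound.
have -> : cvl (rho e) (fun y => psv (y, p.2)) p.1 =
   cvl (rho e) (fun y => cf (y, p.2)) p.1 + (phi 0 - phi c) + cvl (rho e) (fun y => excess (y, p.2)) p.1.
  have -> : (fun y => psv (y, p.2)) = (fun y => cf (y, p.2) + (phi 0 - phi c) + excess (y, p.2)).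
    by apply/funext => y; rewrite /psv /cf /excess; ring.
  have b3 : bmf (fun y => cf (y, p.2) + (phi 0 - phi c)) by apply: bmfD => //; exact: bmf_cst.
  rewrite (cvlD (rL e) p.1 b3 b2) (cvlD (rL e) p.1 b1 (bmf_cst _ (phi 0 - phi c))).
  by rewrite (moll_cst Mr).
have -> : psv p = cf p + (phi 0 - phi c) + excess p by rewrite /psv /cf /excess; ring.
set x1 := cvl _ _ _; set x2 := cvl _ _ _.
have -> : cf p + (phi 0 - phi c) + excess p - (x1 + (phi 0 - phi c) + x2) - (excess p - x2) = cf p - x1 by ring.
rewrite (le_trans (ler_normB _ _))// mulr_natl mulr2n lerD//; first exact: clampfB.
exact: (moll_bound Mr e b1 (fun y => clampfB (y, p.2))).
Qed.

(** [slope_key] integrated over the slab, on which y and U k are constant. *)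
Let key k x y : `|y| <= lam ->
  - y * W k x + h * ab k x * (U k x - c) * y <=
  beta * (h * (ab k x * y ^+ 2)) + F k x + h * kp * `|y|.
Proof.
move=> yl; rewrite /W /ab /F; case: ifPn => kn; last first.
  by rewrite !(mulr0, mul0r) !add0r mulr_ge0// mulr_ge0// ltW.
have [K hK] := density_bound.
have dK p : `|density p| <= K by rewrite ger0_norm// density_ge0.
have I1 := iav k x.
have I2 : leb.-integrable (slab k) (EFin \o (fun s => cvl (rho e) (fun y => psv (y, s)) x)).
  exact: integrable_itv (slice_time x mcp) (fun t => cpB (x, t)).
have I3 : leb.-integrable (slab k) (EFin \o (fun s => density (x, s))).
  exact: integrable_itv (slice_time x density_meas) (fun t => dK (x, t)).
have mc1 : measurable_fun [set: measurableTypeR R] (fun=> kp * `|y|) by exact: measurable_cst.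
have I4 := integrable_itv (k%:R * h) (k.+1%:R * h) mc1 (fun t => lexx _).
have mul_int (a C : R) (f : measurableTypeR R -> R) : measurable_fun setT f -> (forall t, `|f t| <= C) ->
    leb.-integrable (slab k) (EFin \o (fun s => a * f s)).
  move=> mf fC; apply: (integrable_itv (C := `|a| * C)).
    by apply: measurable_funM => //; exact: measurable_cst.
  by move=> t; rewrite normrM ler_wpM2l.
have I5 := mul_int (y * (U k x - c)) _ _ (slice_time x mav) (fun t => avAn (x, t)).
have I6 := mul_int (- y) _ _ (slice_time x mcp) (fun t => cpB (x, t)).
have I7 := mul_int (beta * y ^+ 2) _ _ (slice_time x mav) (fun t => avAn (x, t)).
have hne : h != 0 by rewrite gt_eqF.
have L : - y * (\int[leb]_(s in slab k) cvl (rho e) (fun y => psv (y, s)) x) +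
    h * (h^-1 * \int[leb]_(s in slab k) av (x, s)) * (U k x - c) * y =
    \int[leb]_(s in slab k) ((y * (U k x - c)) * av (x, s) + (- y) * cvl (rho e) (fun y => psv (y, s)) x).
  rewrite (RintegralD (mslab k) I5 I6) (RintegralZl _ (mslab k) I1) (RintegralZl _ (mslab k) I2).
  rewrite mulVKf// addrC; congr (_ + _); rewrite -mulrA mulrC; congr (_ * _); exact: mulrC.
have Rr : beta * (h * (h^-1 * (\int[leb]_(s in slab k) av (x, s)) * y ^+ 2)) + \int[leb]_(s in slab k) density (x, s) + h * kp * `|y| =
    \int[leb]_(s in slab k) (((beta * y ^+ 2) * av (x, s) + density (x, s)) + kp * `|y|).
  have I73 : leb.-integrable (slab k) (EFin \o (fun s => (beta * y ^+ 2) * av (x, s) + density (x, s))).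
    by have := integrableD (mslab k) I7 I3.
  rewrite (RintegralD (mslab k) I73 I4) (RintegralD (mslab k) I7 I3) (RintegralZl _ (mslab k) I1).
  rewrite (Rintegral_cst _ (mslab k)).
  have -> : fine (leb (slab k)) = h.
    rewrite lebesgue_measure_itv /= lte_fin ltr_pM2r// ltr_nat ltnSn -EFinB /=; exact: khD.
  congr (_ + _ + _); last by rewrite -mulrA mulrC.
  rewrite -[h^-1 * _ * _]mulrA mulVKf// -mulrA; congr (_ * _); exact: mulrC.
rewrite L Rr; apply: le_Rintegral => //.
- by have := integrableD (mslab k) I5 I6.
- have I73 : leb.-integrable (slab k) (EFin \o (fun s => (beta * y ^+ 2) * av (x, s) + density (x, s))).
    by have := integrableD (mslab k) I7 I3.
  by have := integrableD (mslab k) I73 I4.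
move=> s; rewrite /= in_itv /= => /andP[ks sk].
have := slope_key phi_ndecr c0 d0 d1 hB hBc beta0 (vM (x, s)) (avA (x, s)) (JRvM (x, s))
  (U_near x kn ks sk) yl (split_psi (x, s)).
rewrite [X in lam * X]distrC => H.
have -> : y * (U k x - c) * av (x, s) + - y * cvl (rho e) (fun y0 => psv (y0, s)) x =
  y * (slope phi c delta (v (x, s)) * (U k x - c) - cvl (rho e) (fun y0 => psv (y0, s)) x).
  by rewrite /av; ring.
apply: le_trans H _; rewrite /density /av /= le_eqVlt; apply/orP; left; apply/eqP; ring.
Qed.

Variables (L o1 o2 o3 : R).
Hypothesis eta1 : 0 < eta.
Local Notation xt := (lebesgue_xt R N).
Hypotheses (V1 : (\int[xt]_p `|v p|%:E <= L%:E)%E)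
  (V2 : (\int[xt]_p `|cvl (rho e) (fun y => v (y, p.2)) p.1 - v p|%:E <= o1%:E)%E)
  (V3 : (\int[xt]_p `|cvl (rho k2) (fun y => v (y, p.2)) p.1 - v p|%:E <= o2%:E)%E)
  (V4 : (\int[xt]_p `|cvl (rho e) (fun y => excess (y, p.2)) p.1 - excess p|%:E <= o3%:E)%E).

Local Notation coef := (lam^-1 * (gmass nu k2 + eta)).
Local Notation om := (B / beta * delta * L + M * A0 / beta * (o1 + 2 * o2 + coef * L) + lam * o3).

Let coef0 : 0 < coef.
Proof. by rewrite mulr_gt0 ?invr_gt0// ltr_wpDl ?gmass_ge0. Qed.

Let mRk k : measurable_fun [set: XT] (fun p => `|cvl (rho k) (fun y => v (y, p.2)) p.1 - v p|).
Proof.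
by apply: measurableT_comp => //; exact: (measurable_funB (mcv (mr k) mv) mv).
Qed.

Let majorant p := 1 * (1 * `|cvl (rho e) (fun y => v (y, p.2)) p.1 - v p|
  + 2 * `|cvl (rho k2) (fun y => v (y, p.2)) p.1 - v p|) + coef * `|v p|.

Let mm1 : measurable_fun [set: XT] (fun p => 1 * `|cvl (rho e) (fun y => v (y, p.2)) p.1 - v p|
  + 2 * `|cvl (rho k2) (fun y => v (y, p.2)) p.1 - v p|).
Proof. by apply: measurable_funD; apply: measurable_funM => //; exact: measurable_cst. Qed.

Let m10 p : 0 <= 1 * `|cvl (rho e) (fun y => v (y, p.2)) p.1 - v p|
  + 2 * `|cvl (rho k2) (fun y => v (y, p.2)) p.1 - v p|.
Proof. by rewrite addr_ge0 ?mulr_ge0. Qed.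

Let mmaj : measurable_fun setT majorant.
Proof. by apply: measurable_funD; apply: measurable_funM => //; exact: measurable_cst. Qed.

Let majorant_slice s : (\int[m]_x `|J (cvl (rho e) (fun y => v (y, s))) x - v (x, s)|%:E <=
  \int[m]_x (majorant (x, s))%:E)%E.
Proof.
have bs := slice_bmf s mv vM.
have mvs : measurable_fun setT (fun x => `|v (x, s)|) by apply: measurableT_comp => //; case: bs.
have [fin|inf] := ltP (\int[m]_x `|v (x, s)|%:E)%E +oo%E.
  have Ls : L1b m (fun y => v (y, s)).
    by split=> //; apply/integrableP; split=> //; apply/measurable_EFinP; case: bs.
  have [Le _] := moll_L1 Mr e Ls; have [Lk _] := moll_L1 Mr k2 Ls.
  have LJ : L1b m (J (cvl (rho e) (fun y => v (y, s)))) by have [] := mk_int MJ Le.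
  have De := L1b_norm (L1bB Le Ls); have Dk := L1b_norm (L1bB Lk Ls).
  have LM : L1b m (fun x => majorant (x, s)).
    exact: (L1bD (L1bZ 1 (L1bD (L1bZ 1 De) (L1bZ 2 Dk))) (L1bZ coef (L1b_norm Ls))).
  have LMn := L1bE LM.
  rewrite (L1bE (L1bB LJ Ls)).
  have -> : (\int[m]_x (majorant (x, s))%:E = (\int[m]_x majorant (x, s))%:E)%E.
    by rewrite /Rintegral fineK//; apply: integrable_fin_num => //; exact: L1b_int LM.
  rewrite lee_fin; apply: le_trans (resolvent_moll_L1 gL MJ FJ lam0 J2 e Ls) _.
  have -> : \int[m]_x majorant (x, s) =
     1 * (1 * \int[m]_x `|cvl (rho e) (fun y => v (y, s)) x - v (x, s)|
      + 2 * \int[m]_x `|cvl (rho k2) (fun y => v (y, s)) x - v (x, s)|) + coef * \int[m]_x `|v (x, s)|.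
    rewrite -(RintZ 1 De) -(RintZ 2 Dk) -(RintD (L1bZ 1 De) (L1bZ 2 Dk)).
    rewrite -(RintZ 1 (L1bD (L1bZ 1 De) (L1bZ 2 Dk))) -(RintZ coef (L1b_norm Ls)).
    by rewrite -(RintD (L1bZ 1 (L1bD (L1bZ 1 De) (L1bZ 2 Dk))) (L1bZ coef (L1b_norm Ls))).
  by rewrite !mul1r.
(* On a slice of infinite L1 norm the right side is infinite, because [coef] is positive. *)
apply: (@le_trans _ _ (coef%:E * \int[m]_x `|v (x, s)|%:E)%E).
  have -> : (\int[m]_x `|v (x, s)|%:E = +oo)%E by apply/eqP; rewrite eq_le leey.
  by rewrite gt0_muley ?lte_fin// leey.
rewrite -ge0_integralZl//; last 2 first.
- exact/measurable_EFinP.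
- by rewrite lee_fin ltW.
apply: ge0_le_integral => //.
- by move=> x _; rewrite -EFinM lee_fin mulr_ge0// ltW.
- by apply: measurable_funeM; exact/measurable_EFinP.
- by apply/measurable_EFinP; exact: (measurableT_comp mmaj (measurable_pair2 _)).
- by move=> x _; rewrite -EFinM lee_fin /majorant lerDr mulr_ge0.
Qed.

Lemma density_int : (\int[leb]_s \int[m]_x (density (x, s))%:E <= om%:E)%E.
Proof.
rewrite -(xt_iterated density_meas density_ge0).
have Smaj : (\int[xt]_p `|J (cvl (rho e) (fun y => v (y, p.2))) p.1 - v p|%:E
    <= (o1 + 2 * o2 + coef * L)%:E)%E.
  apply: (@le_trans _ _ (\int[xt]_p (majorant p)%:E)%E).
    apply: (xt_slices d2m mmaj) => //.
    by move=> p; rewrite addr_ge0 ?mul1r// mulr_ge0// ltW.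
  have := xt_le (mRk e) (mRk k2) (fun=> normr_ge0 _) (fun=> normr_ge0 _) ler01 (ler0n R 2) V2 V3.
  move=> S; have := xt_le mm1 d1m m10 (fun=> normr_ge0 _) ler01 (ltW coef0) S V1.
  by rewrite !mul1r.
have S := xt_le d1m d2m (fun=> normr_ge0 _) (fun=> normr_ge0 _) Bd0 MA0 V1 Smaj.
have m12 : measurable_fun [set: XT] (fun p => B / beta * delta * `|v p|
  + M * A0 / beta * `|J (cvl (rho e) (fun y => v (y, p.2))) p.1 - v p|).
  by apply: measurable_funD; apply: measurable_funM => //; exact: measurable_cst.
have g12 p : 0 <= B / beta * delta * `|v p|
  + M * A0 / beta * `|J (cvl (rho e) (fun y => v (y, p.2))) p.1 - v p|.
  by apply: addr_ge0; exact: mulr_ge0.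
have := xt_le m12 d3m g12 (fun=> normr_ge0 _) ler01 (ltW lam0) S V4.
rewrite mul1r; apply: le_trans; rewrite le_eqVlt; apply/orP; left; apply/eqP.
by apply: eq_integral => p _; rewrite mul1r.
Qed.

Let LF k : L1b m (F k).
Proof.
have [K hK] := density_bound.
rewrite /F; case: (k < n)%N.
  by have [] := slab_L1b density_meas density_ge0 hK density_int (khS k).
apply: (L1b_le (bmf_cst _ 0) (indic_L1b (@obox_fin R N 0)).1) => x.
by rewrite normr0.
Qed.

(** [discrete_core] started at the mollified indicator of E. The index k1 belongs to the indicator,
    k2 to the auxiliary mollifier of [resolvent_moll_L1], and e to the equation; the last term
    collects the errors made in each step, with the growth of the mass of z. *)
Lemma core_estimate E : fin_meas E ->
  \int[m]_x (w x * \1_E x) - c * fine (m E) <=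
  \int[m]_x Num.max 0 (u0 x - c)
  + M * (lam^-1 * (gmass nu k1 + eta) * fine (m E) +
    \int[m]_x `|cvl (rho e) (cvl (rho k1) \1_E) x - cvl (rho k1) \1_E x|
    + \int[m]_x `|cvl (rho k1) \1_E x - \1_E x|)
  + beta * ((gmass nu k1 + eta) * fine (m E)) + om
  + tau * (2 * lam * kp + B * eta) * (1 + h * A0 * lam) ^+ n * fine (m E).
Proof.
move=> fE; have [LE _] := indic_L1b fE.
have [Lz _] := moll_L1 Mr k1 LE.
have bE := L1b_bmf LE.
have E01 y : 0 <= (\1_E y : R) <= 1 by rewrite indicE; case: (_ \in _); rewrite ?ler01 ?lexx.
have z01 x : 0 <= cvl (rho k1) \1_E x <= 1.
  apply/andP; split; first by apply: (moll_ge0 Mr) => // y; case/andP: (E01 y).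
  rewrite -[leRHS](moll_cst Mr k1 1 x).
  by apply: (moll_le Mr k1 bE (bmf_cst _ 1)) => y; case/andP: (E01 y).
have Be0 : 0 <= B * eta by rewrite mulr_ge0.
have [z0 [Lz0 z001 H]] := discrete_core MJ lam0 A00 h0 cfl kp0 Be0 (ltW beta0) mab abA bU bW br rE LF US key n Lz z01.
have iz : \int[m]_x cvl (rho k1) \1_E x = fine (m E).
  by rewrite (moll_int Mr)// Rint_indic.
have Un : U n = J (cvl (rho e) w).
  rewrite /U /clk minnn nh; congr J; apply/funext => x; exact: esym (ev_end EV e x).
have U0 : U 0%N = J (cvl (rho e) u0).
  rewrite /U /clk min0n mul0r; congr J; apply/funext => x.
  by rewrite /P /mild set_itv_ge ?Rintegral_set0 ?addr0// bnd_simp ltxx.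
have bw : bmf w by split; [exact: (ev_w EV)|exists M; exact: (ev_wM EV)].
have [K hK] := density_bound.
have S := slab_sum density_meas density_ge0 hK (ltW h0) density_int n.
have SF : \sum_(k < n) \int[m]_x F k x <= om.
  apply: le_trans S; rewrite le_eqVlt; apply/orP; left; apply/eqP.
  by apply: eq_bigr => k _; rewrite /F ltn_ord.
have en := moll_energy gL MJ FJ lam0 J1 fE.
have pr := resolvent_pairing gL MJ FJ lam0 J1 e fE bw (ev_wM EV).
have i0 := initial_pairing MJ e (ev_u0 EV) c0 Lz0 z001.
have LJw : bmf (J (cvl (rho e) w)) by apply: (mk_bmf MJ); exact: cvl_bmf.
have lhs : \int[m]_x ((U n x - c) * cvl (rho k1) \1_E x) =
   \int[m]_x (J (cvl (rho e) w) x * cvl (rho k1) \1_E x) - c * fine (m E).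
  rewrite -iz -(RintZ c Lz) -(RintB (L1bM LJw Lz) (L1bZ c Lz)) Un.
  by apply: eq_Rint => x; rewrite mulrBl.
rewrite lhs U0 iz nh in H.
have en' := ler_wpM2l (ltW beta0) en.
exact: chain_bounds H pr i0 SF en'.
Qed.

End core.

(** * The choice of the parameters *)

(** Division by K + 1 covers K = 0; x <= 1 is recorded because delta and eta must not exceed 1. *)
Lemma small_factor (R : realFieldType) (K e : R) : 0 <= K -> 0 < e ->
  exists x, [/\ 0 < x, x <= 1 & K * x <= e].
Proof.
move=> K0 e0; have K1 : 0 < K + 1 by rewrite ltr_wpDl.
exists (Num.min 1 (e / (K + 1))); split.
- by rewrite lt_min ltr01 divr_gt0.
- by rewrite ge_min lexx.
apply: (@le_trans _ _ (K * (e / (K + 1)))).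
  by rewrite ler_wpM2l// ge_min lexx orbT.
by rewrite mulrCA ler_piMr ?(ltW e0)// ler_pdivrMr// mul1r lerDl.
Qed.

(** Bookkeeping: twelve sources of error, each allowed e. Replacing eta by 1 next to G1 and G2 lets
    lam be chosen before eta. *)
Lemma budget (R : realFieldType) (M li G1 eta a r1 r2 beta B delta L A0 G2 o1 o2 lam o3 tau Ge h dp Q Qx e : R) :
  0 <= M -> 0 <= li -> 0 <= G1 -> 0 <= eta -> eta <= 1 -> 0 <= a -> 0 <= beta -> 0 <= M * A0 / beta ->
  0 <= G2 -> 0 <= L -> 0 <= tau -> 0 <= 2 * lam * (A0 * (B * Ge * h) + 2 * dp) + B * eta -> Q <= Qx ->
  M * r2 <= e -> M * r1 <= e -> M * (G1 + 1) * a * li <= e -> (G1 + 1) * a * beta <= e ->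
  B / beta * L * delta <= e -> M * A0 / beta * o1 <= e -> M * A0 / beta * 2 * o2 <= e ->
  M * A0 / beta * (G2 + 1) * L * li <= e -> lam * o3 <= e ->
  tau * (4 * lam) * Qx * a * dp <= e -> tau * B * Qx * a * eta <= e ->
  tau * (2 * lam * A0 * B * Ge) * Qx * a * h <= e ->
  M * (li * (G1 + eta) * a + r1 + r2) + beta * ((G1 + eta) * a)
  + (B / beta * delta * L + M * A0 / beta * (o1 + 2 * o2 + li * (G2 + eta) * L) + lam * o3)
  + tau * (2 * lam * (A0 * (B * Ge * h) + 2 * dp) + B * eta) * Q * a <= 12 * e.
Proof.
move=> M0 li0 G10 eta0 eta1 a0 beta0; set Z := M * A0 / beta; move=> Z0 G20 L0 tau0 S0 QQ.
move=> H1 H2 H3 H4 H5 H6 H7 H8 H9 H10 H11 H12.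
have E1 : G1 + eta <= G1 + 1 by rewrite lerD2l.
have E2 : G2 + eta <= G2 + 1 by rewrite lerD2l.
have K1 : M * (li * (G1 + eta) * a) <= e.
  apply: le_trans H3; rewrite (_ : M * (G1 + 1) * a * li = M * (li * (G1 + 1) * a)); last by ring.
  by rewrite ler_wpM2l// ler_wpM2r// ler_wpM2l.
have K2 : beta * ((G1 + eta) * a) <= e.
  by apply: le_trans H4; rewrite mulrC ler_wpM2r// ler_wpM2r.
have K3 : Z * (li * (G2 + eta) * L) <= e.
  apply: le_trans H8; rewrite (_ : Z * (G2 + 1) * L * li = Z * (li * (G2 + 1) * L)); last by ring.
  by rewrite ler_wpM2l// ler_wpM2r// ler_wpM2l.
set S := 2 * lam * _ + _ in S0 *.
have K4 : tau * S * Q * a <= 3 * e.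
  apply: (@le_trans _ _ (tau * S * Qx * a)).
    by rewrite ler_wpM2r// ler_wpM2l// mulr_ge0.
  rewrite (_ : tau * S * Qx * a = tau * (2 * lam * A0 * B * Ge) * Qx * a * h
     + tau * (4 * lam) * Qx * a * dp + tau * B * Qx * a * eta); last by rewrite /S; ring.
  lra.
have -> : B / beta * delta * L = B / beta * L * delta by ring.
move: K1 K2 K3 K4 H1 H2 H5 H6 H7 H9.
move: (li * (G1 + eta) * a) (beta * _) (li * _ * L) (tau * S * Q * a) (B / beta * L * delta) (lam * o3).
move=> t1 t2 t3 t4 t5 t6 K1 K2 K3 K4 H1 H2 H5 H6 H7 H9.
have -> : M * (t1 + r1 + r2) = M * t1 + M * r1 + M * r2 by ring.
have -> : Z * (o1 + 2 * o2 + t3) = Z * o1 + Z * 2 * o2 + Z * t3 by ring.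
lra.
Qed.

Section dominated.
Context {R : realType} {N : nat}.
Local Notation m := (lebesgue_rV R N).
Local Notation leb := (@lebesgue_measure R).
Local Notation XT := ('rV[R]_N * measurableTypeR R)%type.
Local Notation xt := (lebesgue_xt R N).
Let Mr := @rho_mollifier R N.

(** At almost every time the slice is integrable and its mollification converges in L1; twice the L1
    norm of the slice is the majorant for dominated convergence in time. *)
Lemma xt_moll_cvg (b : XT -> R) C : measurable_fun setT b -> (forall p, `|b p| <= C) ->
  xt.-integrable setT (EFin \o b) -> forall e : R, 0 < e -> exists n0, forall n, (n0 <= n)%N ->
  (\int[xt]_p `|cvl (rho n) (fun y => b (y, p.2)) p.1 - b p|%:E <= e%:E)%E.
Proof.
move=> mb bC ib e e0.
pose D n (p : XT) := `|cvl (rho n) (fun y => b (y, p.2)) p.1 - b p|.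
have mD n : measurable_fun setT (D n).
  have mr : measurable_fun setT (@rho R N n) by case: (mo_L1 Mr n) => -[].
  by apply: measurableT_comp => //; exact: (measurable_funB (measurable_cvl_xt mr mb) mb).
have mn : measurable_fun [set: XT] (fun p => `|b p|) by exact: measurableT_comp.
have mG (f : XT -> R) : measurable_fun [set: XT] f -> (forall p, 0 <= f p) ->
    measurable_fun [set: measurableTypeR R] (fun s => \int[m]_x (f (x, s) : R)%:E)%E.
  move=> mf f0; apply: (@measurable_fun_fubini_tonelli_G _ _ _ _ R m (fun p => (f p)%:E)).
    exact/measurable_EFinP.
  by move=> p; rewrite lee_fin.
pose G n s := (\int[m]_x (D n (x, s))%:E)%E.
pose g s := (\int[m]_x `|b (x, s)|%:E)%E.
have Ig : (\int[leb]_s g s < +oo)%E.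
  rewrite /g -(xt_iterated mn (fun=> normr_ge0 _)).
  by case/integrableP: ib.
have g0 s : (0 <= g s)%E by apply: integral_ge0 => x _; rewrite lee_fin.
have ig : leb.-integrable setT g.
  apply/integrableP; split; first exact: (mG _ mn (fun=> normr_ge0 _)).
  by rewrite (eq_integral g)// => s _; rewrite gee0_abs.
have G0 n s : (0 <= G n s)%E by apply: integral_ge0 => x _; rewrite lee_fin /D normr_ge0.
have slice s : (g s < +oo)%E -> L1b m (fun y => b (y, s)).
  move=> gs; have bs := slice_bmf s mb bC; split=> //; apply/integrableP; split=> //.
  by apply/measurable_EFinP; case: bs.
have GE n s : (g s < +oo)%E -> G n s = (\int[m]_x `|cvl (rho n) (fun y => b (y, s)) x - b (x, s)|)%:E.
  move=> /slice Ls; have [Ln _] := moll_L1 Mr n Ls.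
  exact: L1bE (L1bB Ln Ls).
have Gg n s : (G n s <= 2%:E * g s)%E.
  have [gs|] := ltP (g s) +oo%E; last first.
    rewrite leye_eq => /eqP ->; rewrite gt0_muley ?leey// lte_fin; exact: ltr0n.
  rewrite GE//; have Ls := slice _ gs; have [Ln le] := moll_L1 Mr n Ls.
  rewrite /g (L1bE Ls) -EFinM lee_fin.
  have := Rint_normD Ln (L1bN Ls) => h; apply: le_trans h _.
  rewrite mulr_natl mulr2n lerD// le_eqVlt; apply/orP; left; apply/eqP.
  by apply: eq_Rint => x; rewrite normrN.
have fin : \forall s \ae leb, (g s < +oo)%E.
  have := integrable_ae measurableT ig; apply: filterS => s /(_ I) h.
  by rewrite ltey_eq h.
have cv : \forall s \ae leb, setT s -> (G ^~ s) @ \oo --> (0 : \bar R)%E.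
  apply: filterS fin => s gs _; have Ls := slice _ gs.
  rewrite (_ : G ^~ s = EFin \o (fun n => \int[m]_x `|cvl (rho n) (fun y => b (y, s)) x - b (x, s)|)); last first.
    by apply/funext => n; rewrite GE.
  apply: cvg_EFin; first by apply: nearW.
  apply/cvgrPdist_le => g1 g10; have [n0 hn] := moll_cvg_L1 Mr Ls g10.
  exists n0 => // n /= nn; rewrite sub0r normrN /= ger0_norm ?Rint_ge0//; exact: hn.
have mGn n : measurable_fun setT (G n) by exact: (mG _ (mD n) (fun=> normr_ge0 _)).
have m0 : measurable_fun [set: measurableTypeR R] (cst (0 : \bar R)%E) by exact: measurable_cst.
have ig2 : leb.-integrable setT (fun s => 2%:E * g s)%E by exact: integrableZl.
have dm : \forall s \ae leb, forall n, setT s -> (`|G n s| <= 2%:E * g s)%E.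
  by apply: aeW => s n _; rewrite gee0_abs.
have [_ _] := dominated_convergence measurableT mGn m0 cv ig2 dm.
rewrite integral0 => dc.
have O : nbhs (0 : \bar R)%E [set y | (y < e%:E)%E].
  by apply: open_nbhs_nbhs; split; [exact: open_ereal_lt_ereal|rewrite /= lte_fin].
have [n0 _ hn] := dc _ O; exists n0 => n nn.
by rewrite (xt_iterated (mD n) (fun=> normr_ge0 _)); apply: ltW; exact: hn.
Qed.

End dominated.

Section half_estimate.
Context {R : realType} {N : nat}.
Local Notation m := (lebesgue_rV R N).
Local Notation XT := ('rV[R]_N * measurableTypeR R)%type.
Local Notation xt := (lebesgue_xt R N).
Variable nu : {sigma_finite_measure set 'rV[R]_N -> \bar R}.
Hypothesis ilw : nu.-integrable setT (EFin \o @lw R N).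
Hypothesis ntail : forall r : R, 0 < r -> (nu (~` cube r) < +oo)%E.
Hypothesis gL : forall k, L1b m (gen nu (rho k)).

Lemma kernel_const_le (f : 'rV[R]_N -> R) (C D : R) : C <= D -> kernel_const f C -> kernel_const f D.
Proof.
move=> CD [[h1 h2 h3 h4] [h5 h6]].
have mn (z : 'rV[R]_N) : 0 <= Num.min 1 (`|z| ^+ 2) :> R by rewrite le_min ler01 sqr_ge0.
split; first split.
- by move=> x; exact: le_trans CD.
- exact: le_trans CD.
- by move=> x y z; apply: le_trans (h3 _ _ _) _; rewrite ler_wpM2r.
- by move=> y z; apply: le_trans (h4 _ _) _; rewrite ler_wpM2r.
split; first by move=> x z; apply: le_trans (h5 _ _) _; exact: ler_wpM2r (mn z) _ _ CD.
by move=> z; apply: le_trans (h6 _) _; exact: ler_wpM2r (mn z) _ _ CD.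
Qed.

Lemma half_estimate (phi : R -> R) (c M tau : R) (v : XT -> R) (u0 w : 'rV[R]_N -> R)
    (E : set 'rV[R]_N) :
  continuous phi -> {homo phi : a b / a <= b} -> 0 < c -> 0 < tau ->
  evolution nu phi tau M v u0 w -> fin_meas E ->
  \int[m]_x (w x * \1_E x) - c * fine (m E) <= \int[m]_x Num.max 0 (u0 x - c).
Proof.
move=> phi_cont phi_ndecr c0 tau0 EV fE.
have mv := ev_meas EV; have vM := ev_bound EV.
have M0 : 0 <= M by exact: le_trans (vM (0, 0)).
have Mc0 : 0 <= Num.max M c by rewrite le_max M0.
have [B B0 hBM] := phi_bound phi_cont Mc0.
have hB a : `|a| <= M -> `|phi a| <= B by move=> aM; apply: hBM; rewrite le_max aM.
have hBc : `|phi c| <= B by apply: hBM; rewrite (gtr0_norm c0) le_max lexx orbT.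
apply/ler_addgt0Pr => e00 e000; pose e := e00 / 12.
have e0 : 0 < e by rewrite divr_gt0.
have -> : e00 = 12 * e by rewrite /e mulrC divfK.
have Mr := @rho_mollifier R N.
have [LE _] := indic_L1b fE.
pose a := fine (m E); have a0 : 0 <= a by exact: fine_ge0.
pose L := fine (\int[xt]_p `|v p|%:E)%E.
have /integrableP[_ Lfin] := ev_int EV.
have V1 : (\int[xt]_p `|v p|%:E <= L%:E)%E.
  rewrite /L fineK// ge0_fin_numE//; apply: integral_ge0 => p _; rewrite lee_fin; exact: normr_ge0.
have L0 : 0 <= L by apply: fine_ge0; apply: integral_ge0 => p _; rewrite lee_fin; exact: normr_ge0.
have [x1 [x10 _ Mx1]] := small_factor M0 e0.
(* [k1] fixes the bound on the energy of the terminal z, before lam is known. *)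
have [k1 hk1] := moll_cvg_L1 Mr LE x10.
have r2 := hk1 k1 (leqnn _).
have [Lz _] := moll_L1 Mr k1 LE.
have G10 := gmass_ge0 nu k1.
have Gp : 0 <= gmass nu k1 + 1 by rewrite addr_ge0.
have [beta [beta0 _ Hbeta]] := small_factor (mulr_ge0 Gp a0) e0.
have Bb0 : 0 <= B / beta * L by rewrite mulr_ge0 ?divr_ge0// ltW.
have [delta [d0 d1 Hdelta]] := small_factor Bb0 e0.
pose A0 := 2 * B / (delta * c).
have A00 : 0 <= A0 := divr_ge0 (mulr_ge0 (ler0n _ 2) B0) (mulr_ge0 (ltW d0) (ltW c0)).
pose Z := M * A0 / beta.
have Z0 : 0 <= Z by exact: divr_ge0 (mulr_ge0 M0 A00) (ltW beta0).
have [q2 [q20 _ Ho2]] := small_factor (mulr_ge0 Z0 (ler0n _ 2)) e0.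
have [k2 hk2] := xt_moll_cvg mv vM (ev_int EV) q20.
have V3 := hk2 k2 (leqnn _).
have G20 := gmass_ge0 nu k2.
have Gp2 : 0 <= gmass nu k2 + 1 by rewrite addr_ge0.
have K5a : 0 <= M * (gmass nu k1 + 1) * a := mulr_ge0 (mulr_ge0 M0 Gp) a0.
have K5b : 0 <= Z * (gmass nu k2 + 1) * L := mulr_ge0 (mulr_ge0 Z0 Gp2) L0.
(* [ll] is 1/lam. It has to absorb two errors, with factors coming from k1 and from k2, hence the
   sum. *)
have [ll [ll0 _ Hli]] := small_factor (addr_ge0 K5a K5b) e0.
have Hz3 : M * (gmass nu k1 + 1) * a * ll <= e.
  by apply: le_trans Hli; apply: ler_wpM2r; [exact: ltW|rewrite lerDl; exact: K5b].
have Hz8 : Z * (gmass nu k2 + 1) * L * ll <= e.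
  by apply: le_trans Hli; apply: ler_wpM2r; [exact: ltW|rewrite lerDr; exact: K5a].
pose lam := ll^-1.
have lam0 : 0 < lam by rewrite invr_gt0.
have lamV : lam^-1 = ll by rewrite /lam invrK.
(* Bounds the growth of the mass of z for every number of steps, so that dp, eta and the step size
   can be chosen before n. *)
pose Qx := expR (A0 * lam * tau); have Qx0 : 0 <= Qx by exact: expR_ge0.
have K6 : 0 <= tau * (4 * lam) * Qx * a.
  exact: mulr_ge0 (mulr_ge0 (mulr_ge0 (ltW tau0) (mulr_ge0 (ler0n _ 4) (ltW lam0))) Qx0) a0.
have [dp [dp0 _ Hdp]] := small_factor K6 e0.
have [q1 [q10 _ Ho1]] := small_factor Z0 e0.
have [q3 [q30 _ Ho3]] := small_factor (ltW lam0) e0.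
have [n1 hn1] := moll_cvg_L1 Mr Lz x10.
have [n2 hn2] := xt_moll_cvg mv vM (ev_int EV) q10.
pose f2 := excess phi v dp.
have mf2 : measurable_fun setT f2 := excess_meas phi_cont EV dp.
have bf2 p : `|f2 p| <= 4 * B by exact: (excess_bound hB EV dp0).
have if2 : xt.-integrable setT (EFin \o f2).
  (* The excess vanishes where |v| < kap; elsewhere |v| / kap >= 1 turns its bound 4 B into a
     multiple of |v|. *)
  have [kap kap0 hkap] : exists2 kap, 0 < kap & forall s, `|s| < kap -> `|phi s - phi 0| <= dp.
    have /cvgrPdist_le/(_ _ dp0) /nbhs_ballP[kap /= kap0 h] := phi_cont 0.
    exists kap => // s sk; rewrite distrC; apply: h.
    by rewrite /ball /= sub0r normrN.
  have f2v p : `|f2 p| <= 4 * B / kap * `|v p|.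
    have [vk|vk] := ltP `|v p| kap.
      rewrite /f2 /excess clamp_id ?subrr ?normr0; last exact: hkap.
      by rewrite !mulr_ge0// ?invr_ge0 ltW.
    apply: le_trans (bf2 p) _; rewrite -mulrA ler_peMr ?mulr_ge0//.
    by rewrite ler_pdivlMl// mulr1.
  have i1 : xt.-integrable setT (fun p => (4 * B / kap)%:E * (EFin \o v) p)%E.
    by apply: integrableZl => //; exact: ev_int EV.
  apply: (le_integrable measurableT _ _ i1); first exact/measurable_EFinP.
  move=> p _; rewrite /= lee_fin (le_trans (f2v p))// normrM ger0_norm//.
  by rewrite !mulr_ge0// invr_ge0 ltW.
have [n3 hn3] := xt_moll_cvg mf2 bf2 if2 q30.
pose k := maxn n1 (maxn n2 n3).
have r1 := hn1 k (leq_maxl _ _).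
have V2 := hn2 k (leq_trans (leq_maxl n2 n3) (leq_maxr _ _)).
have V4 := hn3 k (leq_trans (leq_maxr n2 n3) (leq_maxr _ _)).
have K7 : 0 <= tau * B * Qx * a := mulr_ge0 (mulr_ge0 (mulr_ge0 (ltW tau0) B0) Qx0) a0.
have [eta [eta0 eta1 Heta]] := small_factor K7 e0.
have [Ce Ce0 KCe] := @rho_kernel R N k.
have [C1 C10 KC1] := @rho_kernel R N k1.
have [C2 C20 KC2] := @rho_kernel R N k2.
(* A common constant for the three mollifiers, so that one J resolves all of them. *)
have C0 : 0 <= Ce + C1 + C2 by rewrite !addr_ge0.
have [J [MJ FJ HJ]] := resolvent_approx ilw ntail lam0 eta0 C0.
have lCe : Ce <= Ce + C1 + C2 by rewrite -addrA lerDl addr_ge0.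
have lC1 : C1 <= Ce + C1 + C2 by rewrite addrAC lerDr addr_ge0.
have lC2 : C2 <= Ce + C1 + C2 by rewrite lerDr addr_ge0.
have Je := HJ _ (mo_L1 Mr k) (kernel_const_le lCe KCe).
have J1 := HJ _ (mo_L1 Mr k1) (kernel_const_le lC1 KC1).
have J2 := HJ _ (mo_L1 Mr k2) (kernel_const_le lC2 KC2).
have Ge0 := gmass_ge0 nu k.
have K9 : 0 <= tau * (2 * lam * A0 * B * gmass nu k) * Qx * a.
  have p1 : 0 <= 2 * lam * A0 * B * gmass nu k.
    exact: mulr_ge0 (mulr_ge0 (mulr_ge0 (mulr_ge0 (ler0n _ 2) (ltW lam0)) A00) B0) Ge0.
  exact: mulr_ge0 (mulr_ge0 (mulr_ge0 (ltW tau0) p1) Qx0) a0.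
have K10 : 0 <= 2 * (A0 * lam) := mulr_ge0 (ler0n _ 2) (mulr_ge0 A00 (ltW lam0)).
have [h1 [h10 _ Hh1]] := small_factor K9 e0.
have [h2 [h20 _ Hh2]] := small_factor K10 (ltr01 : 0 < 1 :> R).
(* [h1] controls the error of the time discretisation, [h2] is the CFL condition. *)
pose hm := Num.min h1 h2; have hm0 : 0 < hm by rewrite lt_min h10.
pose n := (Num.truncn (tau / hm)).+1.
have n0 : (0 < n)%N by [].
have nR : 0 < n%:R :> R by rewrite ltr0n.
have hle : tau / n%:R <= hm.
  rewrite ler_pdivrMr// mulrC -ler_pdivrMr//; apply: ltW; exact: truncnS_gt.
have h0 : 0 < tau / n%:R by rewrite divr_gt0.
have hle1 : tau / n%:R <= h1 by rewrite (le_trans hle)// ge_min lexx.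
have hle2 : tau / n%:R <= h2 by rewrite (le_trans hle)// ge_min lexx orbT.
have cfl : 2 * (tau / n%:R * A0 * lam) <= 1.
  apply: le_trans Hh2; rewrite (_ : 2 * (tau / n%:R * A0 * lam) = 2 * (A0 * lam) * (tau / n%:R)); last by ring.
  exact: ler_wpM2l K10 _ _ hle2.
have QQ : (1 + tau / n%:R * A0 * lam) ^+ n <= Qx.
  have -> : Qx = expR (tau / n%:R * A0 * lam) ^+ n.
    by rewrite -expRM_natl /Qx; congr expR; field; rewrite gt_eqF.
  have p0 : 0 <= tau / n%:R * A0 * lam := mulr_ge0 (mulr_ge0 (ltW h0) A00) (ltW lam0).
  by apply: lerXn2r; rewrite ?nnegrE ?addr_ge0 ?expR_ge0 ?expR_ge1Dx.
have CE := core_estimate gL MJ FJ lam0 (ltW eta0) phi_cont phi_ndecr c0 d0 d1 tau0 hB hBc EV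
  Je J1 J2 beta0 dp0 n0 cfl eta0 V1 V2 V3 V4 fE.
apply: le_trans CE _; rewrite -!addrA lerD2l !addrA lamV.
have S0 : 0 <= 2 * lam * (A0 * (B * gmass nu k * (tau / n%:R)) + 2 * dp) + B * eta.
  have p1 : 0 <= A0 * (B * gmass nu k * (tau / n%:R)) := mulr_ge0 A00 (mulr_ge0 (mulr_ge0 B0 Ge0) (ltW h0)).
  have p2 : 0 <= 2 * dp := mulr_ge0 (ler0n _ 2) (ltW dp0).
  exact: addr_ge0 (mulr_ge0 (mulr_ge0 (ler0n _ 2) (ltW lam0)) (addr_ge0 p1 p2)) (mulr_ge0 B0 (ltW eta0)).
have Hz12 := le_trans (ler_wpM2l K9 hle1) Hh1.
have Hr1 := le_trans (ler_wpM2l M0 r1) Mx1.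
have Hr2 := le_trans (ler_wpM2l M0 r2) Mx1.
have := budget M0 (ltW ll0) G10 (ltW eta0) eta1 a0 (ltW beta0) Z0 G20 L0 (ltW tau0) S0 QQ
  Hr2 Hr1 Hz3 Hbeta Hdelta Ho1 Ho2 Hz8 Ho3 Hdp Heta Hz12.
by rewrite !addrA.
Qed.

End half_estimate.

(** * Reflection, exhaustion by boxes, and superposition of hinges *)

Section final.
Context {R : realType} {N : nat}.
Local Notation m := (lebesgue_rV R N).
Local Notation leb := (@lebesgue_measure R).
Local Notation XT := ('rV[R]_N * measurableTypeR R)%type.

Lemma cvlN k (f : 'rV[R]_N -> R) x : L1b m k -> bmf f -> cvl k (fun y => - f y) x = - cvl k f x.
Proof.
move=> Lk bf; have := cvlZ Lk (-1) x bf; rewrite mulN1r => <-.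
by congr cvl; apply/funext => y; rewrite mulN1r.
Qed.

Lemma evolution_opp (nu : {sigma_finite_measure set 'rV[R]_N -> \bar R}) (phi : R -> R) tau M v u0 w :
  (forall k, L1b m (gen nu (rho k))) -> continuous phi -> evolution nu phi tau M v u0 w ->
  evolution nu (fun s => - phi (- s)) tau M (fun p => - v p) (fun x => - u0 x) (fun x => - w x).
Proof.
move=> gL phi_cont EV; have mv := ev_meas EV; have vM := ev_bound EV.
have rL := mo_L1 (@rho_mollifier R N).
have M0 : 0 <= M by exact: le_trans (vM (0, 0)).
have [B B0 hB] := phi_bound phi_cont M0.
have mphv : measurable_fun setT (fun p => phi (v p)).
  by apply: measurableT_comp => //; exact: continuous_measurable_fun.
have phvB p : `|phi (v p)| <= B by exact: hB.
have mk k : measurable_fun setT (gen nu (rho k)) by case: (gL k) => -[].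
have E n t x : mild nu (fun s => - phi (- s)) (fun p => - v p) (fun x => - u0 x) n t x =
    - mild nu phi v u0 n t x.
  rewrite /mild opprD cvlN//; last exact: L1b_bmf (ev_u0 EV).
  congr (_ + _).
  have bd s : `|cvl (gen nu (rho n)) (fun y => phi (v (y, s))) x| <= B * gmass nu n.
    exact: (cvl_bound (gL n) x (slice_bmf s mphv phvB) (fun y => phvB (y, s))).
  have ms := slice_time x (measurable_cvl_xt (mk n) mphv).
  rewrite -mulN1r -RintegralZl//; last exact: integrable_itv ms bd.
  apply: eq_Rintegral => s _; rewrite mulN1r -(cvlN _ (gL n) (slice_bmf s mphv phvB)).
  by congr cvl; apply/funext => y; rewrite opprK.
have bw : bmf w by split; [exact: (ev_w EV)|exists M; exact: (ev_wM EV)].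
split.
- exact: measurableT_comp.
- by move=> p; rewrite normrN.
- rewrite (_ : _ \o _ = (fun p => - (EFin \o v) p)%E)//; apply: integrableN; exact: ev_int EV.
- exact: L1bN (ev_u0 EV).
- by apply: measurableT_comp => //; exact: (ev_w EV).
- by move=> x; rewrite normrN; exact: (ev_wM EV).
- by move=> n t x tt; rewrite E -(ev_mid EV n x tt) -(cvlN _ (rL n) (slice_bmf t mv vM)).
- by move=> n x; rewrite E -(ev_end EV) cvlN.
Qed.

Lemma box_integral (f : 'rV[R]_N -> R) K : measurable_fun setT f -> (forall x, 0 <= f x) ->
  (forall r : nat, \int[m]_(x in obox r%:R) (f x)%:E <= K)%E -> (\int[m]_x (f x)%:E <= K)%E.
Proof.
move=> mf f0 H.
have mo r : measurable (@obox R N r) by case: (@obox_fin R N r).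
pose g (n : nat) x := (((fun x => (f x)%:E) \_ (obox n%:R)) x : \bar R).
have mg n : measurable_fun setT (g n).
  by apply/(measurable_restrictT _ (mo _)); apply: measurable_funTS; exact/measurable_EFinP.
have g0 n x : setT x -> (0 <= g n x)%E.
  by move=> _; rewrite /g patchE; case: ifP => // _; rewrite lee_fin.
have ndg x : setT x -> nondecreasing_seq (g ^~ x).
  move=> _ a b ab; rewrite /g !patchE; case: ifPn => [|_]; last by case: ifP => // _; rewrite lee_fin.
  rewrite inE /obox /= => xa; rewrite mem_set// /obox /= (lt_le_trans xa)// ler_nat//.
have -> : (\int[m]_x (f x)%:E = \int[m]_x limn (g ^~ x))%E.
  apply: eq_integral => x _; apply/esym/cvg_lim => //; apply: cvg_near_cst.
  exists (Num.truncn `|x|).+1 => // n /= hn.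
  rewrite /g patchE mem_set// /obox /=; apply: lt_le_trans (truncnS_gt _) _.
  by rewrite ler_nat.
rewrite monotone_convergence//; apply: lime_le.
  apply: ereal_nondecreasing_is_cvgn => a b ab; apply: ge0_le_integral => //.
  - by move=> x _; exact: g0.
  - by move=> x _; exact: ndg.
by apply: nearW => n; rewrite /g -integral_mkcond; exact: H.
Qed.

(** The power lies above its tangent at y. It is Young's inequality for x and y^(p-1) with exponents
    p and p/(p-1), which covers y = 0 and needs no derivative. *)
Lemma tangent_powR (p x y : R) : 1 < p -> 0 <= x -> 0 <= y ->
  y `^ p + p * y `^ (p - 1) * (x - y) <= x `^ p.
Proof.
move=> p1 x0 y0; have p0 : 0 < p by exact: lt_trans p1.
have pm : 0 < p - 1 by rewrite subr_gt0.
have yp : y `^ p = y * y `^ (p - 1).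
  have [->|yn] := eqVneq y 0; first by rewrite mul0r powR0// gt_eqF.
  by rewrite -{2}(powRr1 y0) -powRD ?yn ?implybT// addrC subrK.
have q0 : 0 < p / (p - 1) by rewrite divr_gt0.
have pq : p^-1 + (p / (p - 1))^-1 = 1 by field; rewrite !gt_eqF.
have := conjugate_powR x0 (powR_ge0 y (p - 1)) p0 q0 pq.
rewrite -powRrM (_ : (p - 1) * (p / (p - 1)) = p); last by field; rewrite gt_eqF.
rewrite yp; set t := y `^ (p - 1); set s := x `^ p => h.
have : p * (x * t) <= p * (s / p + y * t / (p / (p - 1))) by rewrite ler_wpM2l// ltW.
rewrite (_ : p * (s / p + y * t / (p / (p - 1))) = s + y * t * (p - 1)); last by field; rewrite !gt_eqF.
lra.
Qed.

Section hinges.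
Variables (p om : R).
Hypotheses (p1 : 1 < p) (om0 : 0 < om).

Let p0 : 0 < p. Proof. exact: lt_trans p1. Qed.
Let pm : 0 < p - 1. Proof. by rewrite subr_gt0. Qed.

(** The point where the derivative p s^(p-1) of s^p takes the value i om. *)
Definition node (i : nat) := (i%:R * om / p) `^ (p - 1)^-1.
(** For i <= n its slope from node i to the next node, where one exists in the sum, is i om: a
    piecewise linear minorant of s^p made of the positive parts to which level estimates apply. *)
Definition hinges n s := \sum_(i < n) om * Num.max 0 (s - node i.+1).

Lemma node_ge0 i : 0 <= node i. Proof. exact: powR_ge0. Qed.

Lemma node_slope i : p * node i `^ (p - 1) = i%:R * om.
Proof.
rewrite /node -powRrM mulVf ?gt_eqF// powRr1; first by field; rewrite gt_eqF.
by rewrite divr_ge0 ?mulr_ge0// ltW.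
Qed.

Lemma node_gt0 i : 0 < node i.+1.
Proof. by apply: powR_gt0; rewrite divr_gt0 ?mulr_gt0// ltr0n. Qed.

Lemma node_le i : node i <= node i.+1.
Proof.
apply: ge0_ler_powR; rewrite ?invr_ge0 ?(ltW pm) ?nnegrE ?divr_ge0 ?mulr_ge0 ?(ltW om0) ?(ltW p0)//.
by rewrite ler_pM2r ?invr_gt0// ler_pM2r// ler_nat.
Qed.

Lemma hinges_line n s t : node n <= t -> t <= s -> hinges n s = hinges n t + n%:R * om * (s - t).
Proof.
elim: n => [|n IH] nt ts; first by rewrite /hinges !big_ord0 !mul0r addr0.
have nn : node n <= t by exact: le_trans (node_le n) nt.
rewrite /hinges !big_ord_recr /= -!/(hinges n _) IH//.
rewrite !max_r ?subr_ge0//; last exact: le_trans ts.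
by rewrite -[n.+1]addn1 natrD; ring.
Qed.

(** Between consecutive nodes the derivative of s^p runs from k om to (k + 1) om, so the gap grows
    by at most om times the distance covered, in total at most om s. *)
Lemma hinges_bounds n s : 0 <= s -> s <= node n.+1 ->
  hinges n s <= s `^ p /\ s `^ p <= hinges n s + om * s.
Proof.
have step (c t S : R) k : 0 <= c -> c <= t -> t <= node k.+1 -> p * c `^ (p - 1) = k%:R * om ->
    S <= c `^ p -> c `^ p <= S + om * c ->
    S + k%:R * om * (t - c) <= t `^ p /\ t `^ p <= S + k%:R * om * (t - c) + om * t.
  move=> c0 ct tk slope S1 S2; have t0 := le_trans c0 ct; split.
    apply: le_trans (tangent_powR p1 t0 c0); rewrite slope lerD2r//.
  have := tangent_powR p1 c0 t0.
  have : p * t `^ (p - 1) * (t - c) <= k.+1%:R * om * (t - c).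
    rewrite ler_wpM2r ?subr_ge0// -node_slope ler_wpM2l ?(ltW p0)//.
    by apply: ge0_ler_powR; rewrite ?nnegrE ?node_ge0 ?(ltW pm).
  rewrite -[k.+1]addn1 natrD.
  have -> : p * t `^ (p - 1) * (c - t) = - (p * t `^ (p - 1) * (t - c)) by ring.
  rewrite (_ : (k%:R + 1) * om * (t - c) = k%:R * om * (t - c) + om * t - om * c); last by ring.
  lra.
elim: n s => [|n IH] s s0 sn.
  have := step 0 s 0 0%N (lexx _) s0 sn.
  rewrite /hinges big_ord0 !mul0r mulr0 add0r powR0 ?gt_eqF// powR0 ?gt_eqF// mulr0.
  exact.
have [sc|/ltW cs] := leP s (node n.+1).
  have [h1 h2] := IH _ s0 sc; rewrite /hinges big_ord_recr /= -/(hinges n s) max_l ?subr_le0//.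
  by rewrite mulr0 addr0.
have [h1 h2] := IH _ (node_ge0 n.+1) (lexx _).
have E : hinges n.+1 s = hinges n (node n.+1) + n.+1%:R * om * (s - node n.+1).
  rewrite (hinges_line (lexx (node n.+1)) cs) /hinges big_ord_recr /= subrr max_l// mulr0 addr0//.
by rewrite E; apply: step => //; [exact: node_ge0|exact: node_slope].
Qed.

Lemma hinges_reach M : exists n, M <= node n.+1.
Proof.
pose n := Num.truncn (p * (Num.max 0 M) `^ (p - 1) / om); exists n.
apply: (@le_trans _ _ (Num.max 0 M)); first by rewrite le_max lexx orbT.
have M0 : 0 <= Num.max 0 M by rewrite le_max lexx.
rewrite -[leLHS](powRr1 M0) -[X in _ `^ X](@mulfV _ (p - 1)) ?gt_eqF// powRrM.
apply: ge0_ler_powR; rewrite ?invr_ge0 ?(ltW pm) ?nnegrE ?powR_ge0 ?divr_ge0 ?mulr_ge0 ?(ltW om0) ?(ltW p0)//.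
rewrite ler_pdivlMr// mulrC -ler_pdivrMr//; apply: ltW; exact: truncnS_gt.
Qed.

End hinges.
End final.

(** * From level estimates to norms *)

Section real_integrands.
Context d (X : measurableType d) (R : realType) (m : {measure set X -> \bar R}).
Implicit Types f g : X -> R.

Lemma le_EFin_integral f g : measurable_fun setT f -> measurable_fun setT g ->
  (forall x, 0 <= f x) -> (forall x, f x <= g x) -> (\int[m]_x (f x)%:E <= \int[m]_x (g x)%:E)%E.
Proof.
move=> mf mg f0 fg; apply: ge0_le_integral => //; try exact/measurable_EFinP.
all: by move=> x _; rewrite lee_fin.
Qed.

Lemma EFin_integralD f g : measurable_fun setT f -> measurable_fun setT g ->
  (forall x, 0 <= f x) -> (forall x, 0 <= g x) ->
  (\int[m]_x (f x + g x)%:E = \int[m]_x (f x)%:E + \int[m]_x (g x)%:E)%E.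
Proof.
move=> mf mg f0 g0; under eq_integral do rewrite EFinD.
rewrite ge0_integralD//; try exact/measurable_EFinP.
all: by move=> x _; rewrite lee_fin.
Qed.

Lemma EFin_integralZ a f : measurable_fun setT f -> (forall x, 0 <= f x) -> 0 <= a ->
  (\int[m]_x (a * f x)%:E = a%:E * \int[m]_x (f x)%:E)%E.
Proof.
move=> mf f0 a0; under eq_integral do rewrite EFinM.
rewrite ge0_integralZl//; try exact/measurable_EFinP.
all: by move=> *; rewrite lee_fin.
Qed.

Lemma EFin_integral_ae f g : measurable_fun setT f -> measurable_fun setT g ->
  (forall x, 0 <= f x) -> (forall x, 0 <= g x) -> (\forall x \ae m, f x = g x) ->
  (\int[m]_x (f x)%:E = \int[m]_x (g x)%:E)%E.
Proof.
move=> mf mg f0 g0 fg; apply: ge0_ae_eq_integral => //; try exact/measurable_EFinP.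
all: try by move=> x _; rewrite lee_fin.
by apply: filterS fg => x -> _.
Qed.

End real_integrands.

Section levels.
Context {R : realType} {N : nat}.
Local Notation m := (lebesgue_rV R N).
Local Notation XT := ('rV[R]_N * measurableTypeR R)%type.
Variable nu : {sigma_finite_measure set 'rV[R]_N -> \bar R}.
Hypothesis ilw : nu.-integrable setT (EFin \o @lw R N).
Hypothesis ntail : forall r : R, 0 < r -> (nu (~` cube r) < +oo)%E.
Hypothesis gL : forall k, L1b m (gen nu (rho k)).

Let meas_pos (f : 'rV[R]_N -> R) c : measurable_fun setT f ->
  measurable_fun setT (fun x => Num.max 0 (f x - c)).
Proof.
move=> mf; apply: measurable_maxr; first exact: measurable_cst.
by apply: measurable_funB => //; exact: measurable_cst.
Qed.

(** Inside a box, (w - c)^+ is w - c times the indicator of the part of the box where w > c. This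
    set has finite measure, so [half_estimate] applies; the boxes then exhaust the space. *)
Lemma level_one_sided (phi : R -> R) (c M tau : R) (v : XT -> R) (u0 w : 'rV[R]_N -> R) :
  continuous phi -> {homo phi : a b / a <= b} -> 0 < c -> 0 < tau ->
  evolution nu phi tau M v u0 w ->
  (\int[m]_x (Num.max 0 (w x - c))%:E <= \int[m]_x (Num.max 0 (u0 x - c))%:E)%E.
Proof.
move=> phi_cont phi_ndecr c0 tau0 EV; have mw := ev_w EV; have L0 := ev_u0 EV.
have Lp : L1b m (fun x => Num.max 0 (u0 x - c)).
  have h x : `|Num.max 0 (u0 x - c)| <= `|u0 x|.
    rewrite ger0_norm ?le_max ?lexx// ge_max normr_ge0/=.
    by rewrite (le_trans _ (ler_norm _))// lerBlDr lerDl ltW.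
  apply: (L1b_le _ L0 h); split; first by apply: meas_pos; case: L0 => -[].
  by have [[_ [C fC]] _] := L0; exists C => x; exact: le_trans (h x) (fC x).
have -> : (\int[m]_x (Num.max 0 (u0 x - c))%:E = (\int[m]_x Num.max 0 (u0 x - c))%:E)%E.
  rewrite /Rintegral fineK//; apply: integrable_fin_num => //; exact: L1b_int Lp.
apply: box_integral.
- exact: meas_pos.
- by move=> x; rewrite le_max lexx.
move=> r; pose P := [set x | c < w x].
have mP : measurable P.
  rewrite -[P]setTI (_ : P = w @^-1` `]c, +oo[%classic); first exact: mw.
  by apply/seteqP; split=> x; rewrite /P /= in_itv /= andbT.
have fE : fin_meas (P `&` obox r%:R) by exact: fin_measI.
have [LE _] := indic_L1b fE.
have bw : bmf w by split=> //; exists M; exact: (ev_wM EV).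
have H := half_estimate ilw ntail gL phi_cont phi_ndecr c0 tau0 EV fE.
have mo : measurable (@obox R N r%:R) by case: (@obox_fin R N r%:R).
have E x : ((fun x => (Num.max 0 (w x - c))%:E) \_ (obox r%:R)) x =
   (w x * \1_(P `&` obox r%:R) x - c * \1_(P `&` obox r%:R) x)%:E.
  rewrite patchE -mulrBl; case: ifPn => [|] ox.
    have [cx|cx] := ltP c (w x).
      rewrite indicE mem_set; last by split=> //; move: ox; rewrite inE.
      by rewrite mulr1 max_r// subr_ge0 ltW.
    rewrite indicE memNset; last by case; rewrite /P /= ltNge cx.
    by rewrite mulr0 max_l// subr_le0.
  rewrite indicE memNset ?mulr0// => -[_ h]; by move/negP: ox; apply; rewrite inE.
rewrite integral_mkcond (eq_integral _ _ (fun x _ => E x)).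
have L1 := L1bM bw LE; have L2 := L1bZ c LE.
have -> : (\int[m]_x (w x * \1_(P `&` obox r%:R) x - c * \1_(P `&` obox r%:R) x)%:E =
   (\int[m]_x (w x * \1_(P `&` obox r%:R) x - c * \1_(P `&` obox r%:R) x))%:E)%E.
  rewrite /Rintegral fineK//; apply: integrable_fin_num => //; exact: L1b_int (L1bB L1 L2).
by rewrite lee_fin (RintB L1 L2) (RintZ c LE) (Rint_indic fE).
Qed.

Variables (phi : R -> R) (M tau : R) (v : XT -> R) (u0 w : 'rV[R]_N -> R).
Hypotheses (phi_cont : continuous phi) (phi_ndecr : {homo phi : a b / a <= b}).
Hypotheses (tau0 : 0 < tau) (EV : evolution nu phi tau M v u0 w).

Let mw : measurable_fun setT w := ev_w EV.
Let mu0 : measurable_fun setT u0. Proof. by case: (ev_u0 EV) => -[]. Qed.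
Let mabs (f : 'rV[R]_N -> R) : measurable_fun setT f -> measurable_fun setT (fun x => `|f x|).
Proof. by move=> mf; apply: measurableT_comp. Qed.

(** For c > 0 at most one of the two terms on the right is nonzero. *)
Lemma pos_abs (c s : R) : 0 < c ->
  Num.max 0 (`|s| - c) = Num.max 0 (s - c) + Num.max 0 (- s - c).
Proof.
move=> c0; have [s0|s0] := leP 0 s.
  have -> : Num.max 0 (- s - c) = 0 by rewrite max_l//; lra.
  by rewrite ger0_norm// addr0.
have -> : Num.max 0 (s - c) = 0 by rewrite max_l//; lra.
by rewrite ltr0_norm// add0r.
Qed.

Lemma level_sets c : 0 < c ->
  (\int[m]_x (Num.max 0 (`|w x| - c))%:E <= \int[m]_x (Num.max 0 (`|u0 x| - c))%:E)%E.
Proof.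
move=> c0.
have S (f : 'rV[R]_N -> R) : measurable_fun setT f -> (\int[m]_x (Num.max 0 (`|f x| - c))%:E =
   \int[m]_x (Num.max 0 (f x - c))%:E + \int[m]_x (Num.max 0 (- f x - c))%:E)%E.
  move=> mf; under eq_integral do rewrite pos_abs// EFinD.
  have mNf : measurable_fun setT (fun x => - f x) by exact: measurableT_comp.
  rewrite ge0_integralD//.
  - by move=> x _; rewrite lee_fin le_max lexx.
  - by apply/measurable_EFinP; exact: meas_pos.
  - by move=> x _; rewrite lee_fin le_max lexx.
  - by apply/measurable_EFinP; exact: meas_pos.
rewrite !S//; apply: leeD; first exact: level_one_sided c0 tau0 EV.
have EVo := evolution_opp gL phi_cont EV.
apply: (level_one_sided _ _ c0 tau0 EVo).
- move=> s; apply: cvgN; apply: continuous_comp; [exact: opp_continuous|exact: phi_cont].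
- by move=> a b ab; rewrite lerN2; apply: phi_ndecr; rewrite lerN2.
Qed.

Let u0_fin : (\int[m]_x `|u0 x|%:E)%E = (\int[m]_x `|u0 x|)%:E.
Proof. exact: L1bE (ev_u0 EV). Qed.

(** The limit c to 0: inside a box |w| exceeds (|w| - c)^+ by at most c, which costs c times a
    finite measure. *)
Lemma contraction_L1 : (\int[m]_x `|w x|%:E <= \int[m]_x `|u0 x|%:E)%E.
Proof.
apply: box_integral; [exact: mabs|by []|move=> r].
have [mo fo] := @obox_fin R N r%:R.
apply/lee_addgt0Pr => e e0.
have [c [c0 _ hc]] := small_factor (fine_ge0 (measure_ge0 m (obox r%:R))) e0.
apply: (@le_trans _ _ (\int[m]_(x in obox r%:R) ((Num.max 0 (`|w x| - c))%:E + c%:E))%E).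
  apply: ge0_le_integral => //.
  - by apply/measurable_EFinP; apply: measurable_funTS; exact: mabs.
  - apply: emeasurable_funD; last exact: measurable_cst.
    by apply/measurable_EFinP; apply: measurable_funTS; apply: meas_pos; exact: mabs.
  - by move=> x _; rewrite -EFinD lee_fin -lerBlDr le_max lexx orbT.
have mc : measurable_fun (obox r%:R) (fun x => (Num.max 0 (`|w x| - c))%:E).
  by apply/measurable_EFinP; apply: measurable_funTS; apply: meas_pos; exact: mabs.
have pc x : (0 <= (Num.max 0 (`|w x| - c))%:E)%E by rewrite lee_fin le_max lexx.
have cc : (0 <= c%:E)%E by rewrite lee_fin ltW.
rewrite (ge0_integralD _ mo (fun x _ => pc x) mc (fun x _ => cc) (measurable_cst _)).
apply: leeD.
  apply: (@le_trans _ _ (\int[m]_x (Num.max 0 (`|w x| - c))%:E)%E).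
    apply: ge0_subset_integral => //.
    by apply/measurable_EFinP; apply: meas_pos; exact: mabs.
  apply: le_trans (level_sets c0) _; apply: le_EFin_integral.
  - by apply: meas_pos; exact: mabs.
  - exact: mabs.
  - by move=> x; rewrite le_max lexx.
  - by move=> x; rewrite ge_max normr_ge0 lerBlDr lerDl ltW.
rewrite integral_cst// -[X in (c%:E * X)%E]fineK ?ge0_fin_numE//.
by rewrite -EFinM lee_fin mulrC.
Qed.

(** |w|^p is at most its hinges plus om |w|. The hinges are compared by [level_sets] and those of
    |u0| lie below |u0|^p; the remainder is at most om times the L1 norm of u0 by
    [contraction_L1]. *)
Lemma contraction_Lp p : 1 <= p ->
  (\int[m]_x (`|w x| `^ p)%:E <= \int[m]_x (`|u0 x| `^ p)%:E)%E.
Proof.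
rewrite le_eqVlt => /predU1P[<-|p1].
  under eq_integral do rewrite powRr1//; under [leRHS]eq_integral do rewrite powRr1//.
  exact: contraction_L1.
have [B0 hB0] : exists B0, forall x, `|u0 x| <= B0 by have [[_ ?] _] := ev_u0 EV.
apply/lee_addgt0Pr => e e0.
have [om [om0 _ hom]] := small_factor (Rint_ge0 m (fun x => normr_ge0 (u0 x))) e0.
have [n hn] := hinges_reach p1 om0 (Num.max M B0).
have wn x : `|w x| <= node p om n.+1.
  by apply: le_trans hn; rewrite le_max (ev_wM EV).
have un x : `|u0 x| <= node p om n.+1.
  by apply: le_trans hn; rewrite le_max hB0 orbT.
have H0 s : 0 <= hinges p om n s.
  by apply: sumr_ge0 => i _; rewrite mulr_ge0 ?(ltW om0)// le_max lexx.
have mp (f : 'rV[R]_N -> R) : measurable_fun setT f -> measurable_fun setT (fun x => `|f x| `^ p).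
  by move=> mf; apply: (measurableT_comp (measurable_powR p)); exact: mabs.
have mH (f : 'rV[R]_N -> R) : measurable_fun setT f -> measurable_fun setT (fun x => hinges p om n `|f x|).
  move=> mf; apply: measurable_sumr => i; apply: measurable_funM; first exact: measurable_cst.
  by apply: meas_pos; exact: mabs.
have mo (f : 'rV[R]_N -> R) : measurable_fun setT f -> measurable_fun setT (fun x => om * `|f x|).
  by move=> mf; apply: measurable_funM; [exact: measurable_cst|exact: mabs].
have o_ge0 (f : 'rV[R]_N -> R) x : 0 <= om * `|f x| by rewrite mulr_ge0// ltW.
apply: (@le_trans _ _ (\int[m]_x (hinges p om n `|w x| + om * `|w x|)%:E)%E).
  apply: le_EFin_integral; [exact: mp|by apply: measurable_funD; [exact: mH|exact: mo]| |].
  - by move=> x; exact: powR_ge0.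
  - by move=> x; have [] := hinges_bounds p1 om0 (normr_ge0 (w x)) (wn x).
rewrite (EFin_integralD _ (mH _ mw) (mo _ mw) (fun x => H0 _) (o_ge0 w)).
have HE (f : 'rV[R]_N -> R) : measurable_fun setT f -> (\int[m]_x (hinges p om n `|f x|)%:E =
    \sum_(i < n) om%:E * \int[m]_x (Num.max 0 (`|f x| - node p om i.+1))%:E)%E.
  move=> mf; have mi c : measurable_fun setT (fun x => Num.max 0 (`|f x| - c)) by apply: meas_pos; exact: mabs.
  have pi c x : 0 <= Num.max 0 (`|f x| - c) by rewrite le_max lexx.
  elim: (n) => [|j IH].
    by rewrite big_ord0; under eq_integral do rewrite /hinges big_ord0; rewrite integral0.
  rewrite big_ord_recr /= -IH -(EFin_integralZ _ (mi _) (pi _) (ltW om0)).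
  have mom c : measurable_fun setT (fun x => om * Num.max 0 (`|f x| - c)).
    by apply: measurable_funM; [exact: measurable_cst|exact: mi].
  have pom c x : 0 <= om * Num.max 0 (`|f x| - c) by rewrite mulr_ge0 ?(ltW om0).
  rewrite -EFin_integralD//.
  - by apply: eq_integral => x _; rewrite /hinges big_ord_recr.
  - by apply: measurable_sumr => i; exact: mom.
  - by move=> x; apply: sumr_ge0 => i _; exact: pom.
apply: leeD.
  apply: (@le_trans _ _ (\int[m]_x (hinges p om n `|u0 x|)%:E)%E).
    rewrite !HE//; apply: lee_sum => i _; apply: lee_wpmul2l; first by rewrite lee_fin ltW.
    by apply: level_sets; exact: node_gt0.
  apply: le_EFin_integral; [exact: mH|exact: mp|by move=> x; exact: H0|].
  by move=> x; have [] := hinges_bounds p1 om0 (normr_ge0 (u0 x)) (un x).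
rewrite (EFin_integralZ _ (mabs mw) (fun x => normr_ge0 _) (ltW om0)).
apply: (@le_trans _ _ (om%:E * \int[m]_x `|u0 x|%:E)%E).
  by apply: lee_wpmul2l; [rewrite lee_fin ltW|exact: contraction_L1].
by rewrite u0_fin -EFinM lee_fin mulrC.
Qed.

(** The integral of (|u0| - c)^+ vanishes, hence so does that of (|w| - c)^+. *)
Lemma contraction_ae c : 0 < c -> (\forall x \ae m, `|u0 x| <= c) -> \forall x \ae m, `|w x| <= c.
Proof.
move=> c0 uc.
have mp (f : 'rV[R]_N -> R) : measurable_fun setT f -> measurable_fun setT (fun x => (Num.max 0 (`|f x| - c))%:E).
  by move=> mf; apply/measurable_EFinP; apply: meas_pos; exact: mabs.
have I0 : (\int[m]_x (Num.max 0 (`|u0 x| - c))%:E = 0)%E.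
  rewrite -[RHS](integral0 m setT); apply: EFin_integral_ae.
  - by apply: meas_pos; exact: mabs.
  - exact: measurable_cst.
  - by move=> x; rewrite le_max lexx.
  - by [].
  - by apply: filterS uc => x h; rewrite max_l// subr_le0.
have := level_sets c0; rewrite I0 => h.
have I1 : (\int[m]_x `|(Num.max 0 (`|w x| - c))%:E| = 0)%E.
  apply/eqP; rewrite eq_le integral_ge0// andbT; apply: le_trans h.
  rewrite le_eqVlt; apply/orP; left; apply/eqP; apply: eq_integral => x _.
  by rewrite gee0_abs// lee_fin le_max lexx.
have := (ae_eq_integral_abs m measurableT (mp _ mw)).1 I1.
apply: filterS => x /(_ I) /= [] h1; rewrite -subr_le0 -h1 le_max lexx orbT//.
Qed.

Lemma contraction_Loo : ('N[m]_+oo[EFin \o w] <= 'N[m]_+oo[EFin \o u0])%E.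
Proof.
rewrite !unlock /=; case: ifPn => // m0.
have ge := @ess_sup_ge _ _ _ m (abse \o (EFin \o u0)).
set K := ess_sup m (abse \o (EFin \o u0)) in ge *.
have K0 : (0 <= K)%E by apply: ess_sup_gee => //; apply: aeW => x /=; rewrite lee_fin normr_ge0.
case KE : K => [k| |]; last 2 first.
- by rewrite leey.
- by move: K0; rewrite KE.
(* Levels must be positive while the essential supremum may be 0, hence the margin e. *)
apply/lee_addgt0Pr => e e0; rewrite -EFinD.
have k0 : 0 <= k by move: K0; rewrite KE lee_fin.
apply/ess_supP.
have := @contraction_ae (k + e) (ltr_wpDl k0 e0) _; have [|H] := pselect (\forall x \ae m, `|u0 x| <= k + e); last first.
  exfalso; apply: H; apply: filterS ge => x; rewrite KE /= lee_fin => /le_trans; apply.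
  by rewrite lerDl ltW.
by move=> uc /(_ uc); apply: filterS => x h /=; rewrite lee_fin.
Qed.

End levels.

Theorem theorem2p21 (R : realType) (N : nat) (T : R) (phi : R -> R)
    (mu : {measure set 'rV[R]_N -> \bar R})
    (u0 : 'rV[R]_N -> R) (u : 'rV[R]_N -> R -> R)
    (N_gt0 : (0 < N)%N) (T_gt0 : 0 < T)
    (phi_cont : continuous phi) (phi_ndecr : {homo phi : a b / a <= b})
    (mu_radon : radon_punctured mu) (mu_even : even_punctured mu)
    (mu_levy : levy_integrable mu)
    (u0_L1 : u0 \in Lfun (lebesgue_rV R N) 1%E)
    (u0_Loo : u0 \in Lfun (lebesgue_rV R N) +oo%E)
    (u_L1 : (fun y => u y.1 y.2) \_ (QT T) \in Lfun (lebesgue_xt R N) 1%E)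
    (u_Loo : (fun y => u y.1 y.2) \_ (QT T) \in Lfun (lebesgue_xt R N) +oo%E)
    (u_cont : continuous_L1loc T u)
    (u_sol : distributional_solution phi mu T u0 u)
    (tau : R) (tau_gt0 : 0 < tau) (tau_leT : tau <= T) :
  (forall p : R, 1 <= p ->
    (\int[lebesgue_rV R N]_x (`|u x tau| `^ p)%:E
       <= \int[lebesgue_rV R N]_x (`|u0 x| `^ p)%:E)%E) /\
  ('N[lebesgue_rV R N]_+oo[EFin \o (u ^~ tau)]
     <= 'N[lebesgue_rV R N]_+oo[EFin \o u0])%E.
Proof.
have [nu nuE] := punctured_measure mu_levy.
have [M1 M10 hM1] := Lfun_bounded u_Loo.
have [M2 M20 hM2] := Lfun_bounded u0_Loo.
pose M := Num.max M1 M2; have M0 : 0 <= M by rewrite le_max M10.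
have wM : \forall p \ae lebesgue_xt R N, `|((fun y => u y.1 y.2) \_ (QT T)) p| <= M.
  by apply: filterS hM1 => p h; rewrite le_max h.
have uM : \forall x \ae lebesgue_rV R N, `|u0 x| <= M.
  by apply: filterS hM2 => p h; rewrite le_max h orbT.
have t0T : 0 <= tau <= T by rewrite ltW.
have EV : evolution nu phi tau M (clip_xt T u M) (clip_0 u0 M) (clip_at u M tau).
  by apply: (clip_evolution T_gt0 phi_cont mu_even mu_levy) => //; rewrite tau_gt0.
(* The estimates hold for the truncations; agreement almost everywhere carries integrals and
   essential suprema over to the given functions. *)
have ua : \forall x \ae lebesgue_rV R N, u x tau = clip_at u M tau x.
  exact: (clip_at_ae T_gt0 u_L1 u_cont M0 wM t0T).
have u0a : \forall x \ae lebesgue_rV R N, u0 x = clip_0 u0 M x.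
  by apply: filterS uM => x h; rewrite /clip_0 clamp_id.
have ilw := integrable_lw mu_levy nuE.
have gL := gen_rho_L1b mu_levy nuE.
have ntail := @nu_tail R N mu mu_levy nu nuE.
have mu1 : measurable_fun setT (u ^~ tau) by have [+ _] := u_cont.1 tau t0T.
have mu2 := Lfun_meas u0_L1.
have mp (f : 'rV[R]_N -> R) p : measurable_fun setT f ->
    measurable_fun setT (fun x => `|f x| `^ p).
  move=> mf; apply: (measurableT_comp (measurable_powR p)).
  exact: measurableT_comp.
split=> [p p1|].
  have := contraction_Lp ilw ntail gL phi_cont phi_ndecr tau_gt0 EV p1.
  have -> : (\int[lebesgue_rV R N]_x (`|clip_at u M tau x| `^ p)%:E = \int[lebesgue_rV R N]_x (`|u x tau| `^ p)%:E)%E.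
    apply: EFin_integral_ae; [by apply: mp; exact: ev_w EV|exact: mp| | |].
    - by move=> x; exact: powR_ge0.
    - by move=> x; exact: powR_ge0.
    - by apply: filterS ua => x ->.
  move/le_trans; apply; rewrite le_eqVlt; apply/orP; left; apply/eqP.
  apply: EFin_integral_ae; [by apply: mp; case: (ev_u0 EV) => -[]|exact: mp| | |].
  - by move=> x; exact: powR_ge0.
  - by move=> x; exact: powR_ge0.
  - by apply: filterS u0a => x ->.
have := contraction_Loo ilw ntail gL phi_cont phi_ndecr tau_gt0 EV.
rewrite !unlock /=; case: ifPn => // m0.
have e1 : ess_sup (lebesgue_rV R N) (abse \o (EFin \o (u ^~ tau))) =
   ess_sup (lebesgue_rV R N) (abse \o (EFin \o clip_at u M tau)).
  by apply: eq_ess_sup; apply: filterS ua => x /= ->.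
have e2 : ess_sup (lebesgue_rV R N) (abse \o (EFin \o u0)) =
   ess_sup (lebesgue_rV R N) (abse \o (EFin \o clip_0 u0 M)).
  by apply: eq_ess_sup; apply: filterS u0a => x /= ->.
by rewrite e1 e2.
Qed.
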